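(* Let $q$ be a primitive integral isotropic ternary quadratic form with $\Delta=\Delta(q)>0$, let $w:\mathbb{R}^3\to\mathbb{R}$ be infinitely differentiable with $w(\mathbf{x})=0$ whenever $\|\mathbf{x}\|>1$, and let $\mathbf{z}_0$ be a nonzero integer zero of $q$ with $\|\mathbf{z}_0\|$ minimal. Then for all real $B\ge2$, $$N(B,w;q)=\tfrac12\sigma_\infty(q;w)\mathfrak{S}(q)B\Big\{1+O_w\Big(\psi(B)\Big(\frac{\|q\|^2}{\|\mathbf{z}_0\|B}\Big)^{1/4}\Big)\Big\}+O_w(\tau(\Delta)),$$ where $\psi(B)=4^{\omega(\Delta)}\rho\,\frac{\sigma_\infty(q;w_0)}{\sigma_\infty(q;w)}\log B$ and the implied constants depend only on $w$.
   Context: For $q(\mathbf{x})=\sum_{1\le i\le j\le3}q_{ij}x_ix_j$ (integral: $q_{ij}\in\mathbb{Z}$; primitive: $\gcd(q_{ij})=1$; isotropic: has a nonzero integer zero), $Q=\begin{pmatrix}2q_{11}&q_{12}&q_{13}\\ q_{12}&2q_{22}&q_{23}\\ q_{13}&q_{23}&2q_{33}\end{pmatrix}$, $\Delta(q)=\tfrac12\det Q$, $\|q\|$ the Frobenius norm of $Q$, $\rho=\|q\|^3/\Delta$; $\|\cdot\|$ on vectors is Euclidean. $N(B,w;q)=\sum w(B^{-1}\mathbf{x})$ over primitive $\mathbf{x}\in\mathbb{Z}^3$ (entries with gcd 1) with $q(\mathbf{x})=0$. $w_0(\mathbf{x})=\exp\{-1/(1-\|\mathbf{x}\|^2)\}$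 for $\|\mathbf{x}\|<1$, $0$ otherwise. $K_T(t)=T\max\{1-T|t|,0\}$ and $\sigma_\infty(q;w)=\lim_{T\to\infty}\int_{\mathbb{R}^3}w(\mathbf{y})K_T(q(\mathbf{y}))d\mathbf{y}$. $\mathfrak{S}(q)=\prod_p\sigma_p(q)$ is the product of the $p$-adic densities of primitive zeros, $\sigma_p(q)=\lim_{r\to\infty}p^{-2r}\#\{\mathbf{x}\bmod p^r: p\nmid\mathbf{x},\ q(\mathbf{x})\equiv0\bmod p^r\}$. $\tau$ is the divisor function and $\omega(n)$ the number of distinct prime factors of $n$. When $\sigma_\infty(q;w)=0$ the product $\sigma_\infty(q;w)\psi(B)$ is read as $4^{\omega(\Delta)}\rho\,\sigma_\infty(q;w_0)\log B$. *)

(* Defs.v *)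
From HB Require Import structures.
From mathcomp Require Import all_boot all_order all_algebra.
From mathcomp Require Import all_classical all_reals all_analysis.
From mathcomp Require Import ring.
Set Implicit Arguments.
Unset Strict Implicit.
Unset Printing Implicit Defensive.
Import Order.TTheory GRing.Theory Num.Theory.
Import numFieldNormedType.Exports.
Local Open Scope classical_set_scope.
Local Open Scope ring_scope.

(* The q_ij x_i x_j with i <= j: off-diagonal coefficients are not doubled. *)
Record ternary_form := TernaryForm {
  q11 : int; q12 : int; q13 : int; q22 : int; q23 : int; q33 : int }.

Definition qeval (S : comNzRingType) (q : ternary_form) (v : S * S * S) : S :=
  let: (x, y, z) := v in
  (q11 q)%:~R * x ^+ 2 + (q12 q)%:~R * x * y + (q13 q)%:~R * x * z
  + (q22 q)%:~R * y ^+ 2 + (q23 q)%:~R * y * z + (q33 q)%:~R * z ^+ 2.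

Definition primitive_form (q : ternary_form) : bool :=
  \big[gcdz/0]_(c <- [:: q11 q; q12 q; q13 q; q22 q; q23 q; q33 q]) c == 1.

Definition isotropic (q : ternary_form) : Prop :=
  exists z : int * int * int, z != 0 /\ qeval q z = 0.

Definition form_mx (q : ternary_form) : 'M[int]_3 :=
  \matrix_(i, j) nth 0 (nth [::]
    [:: [:: 2 * q11 q; q12 q; q13 q];
        [:: q12 q; 2 * q22 q; q23 q];
        [:: q13 q; q23 q; 2 * q33 q]] i) j.

(* The division is exact, see [disc_detE]. *)
Definition disc (q : ternary_form) : int := (\det (form_mx q) %/ 2)%Z.

Lemma disc_detE (q : ternary_form) : 2 * disc q = \det (form_mx q).
Proof.
rewrite /disc; suff -> : \det (form_mx q) =
  (4 * q11 q * q22 q * q33 q + q12 q * q13 q * q23 q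
   - q11 q * q23 q ^+ 2 - q22 q * q13 q ^+ 2 - q33 q * q12 q ^+ 2) * 2.
  by rewrite mulzK // mulrC.
rewrite (expand_det_row _ ord0) !big_ord_recl big_ord0 /cofactor.
rewrite !(expand_det_row _ ord0) !big_ord_recl !big_ord0 /cofactor.
rewrite !det_mx11 !mxE /=.
ring.
Qed.

Definition tau (n : nat) : nat := size (divisors n).
Definition omega (n : nat) : nat := size (primes n).

Definition primitive_vec (v : int * int * int) : bool :=
  let: (x, y, z) := v in gcdz (gcdz x y) z == 1.

Definition local_count (q : ternary_form) (p r : nat) : nat :=
  #|[pred v : 'I_(p ^ r) * 'I_(p ^ r) * 'I_(p ^ r) |
     let: (x, y, z) := v in
     ~~ [&& (p %| x)%N, (p %| y)%N & (p %| z)%N]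
     && ((p ^ r)%:Z %| qeval q ((x : nat)%:Z, (y : nat)%:Z, (z : nat)%:Z))%Z]|.

Section Real.
Variable R : realType.

Definition vec3R (v : int * int * int) : R * R * R :=
  (v.1.1%:~R, v.1.2%:~R, v.2%:~R).

(* The library norm on a product is the sup norm. *)
Definition norm2 (v : R * R * R) : R :=
  Num.sqrt (v.1.1 ^+ 2 + v.1.2 ^+ 2 + v.2 ^+ 2).

Definition form_norm (q : ternary_form) : R :=
  Num.sqrt (\sum_(i < 3) \sum_(j < 3) (form_mx q i j)%:~R ^+ 2).

Definition rho (q : ternary_form) : R := form_norm q ^+ 3 / (disc q)%:~R.

Definition minimal_zero (q : ternary_form) (z : int * int * int) : Prop :=
  [/\ z != 0, qeval q z = 0 &
   forall z' : int * int * int, z' != 0 -> qeval q z' = 0 ->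
     norm2 (vec3R z) <= norm2 (vec3R z')].

(* [differentiable] is Frechet differentiability; for all n, this is C^infinity. *)
Fixpoint n_differentiable (n : nat) (f : R * R * R -> R) : Prop :=
  if n is n'.+1 then
    (forall x, differentiable f x) /\
    forall v : R * R * R, n_differentiable n' ('D_v f)
  else True.

Definition smooth (f : R * R * R -> R) : Prop :=
  forall n, n_differentiable n f.

Definition w0 (x : R * R * R) : R :=
  if norm2 x < 1 then expR (- (1 - norm2 x ^+ 2)^-1) else 0.

(* Finitely supported as soon as [w] has bounded support and [B > 0]. *)
Definition zero_count (B : R) (w : R * R * R -> R) (q : ternary_form) : R :=
  \sum_(x \in [set x : int * int * int | primitive_vec x /\ qeval q x = 0])
    w (B^-1 *: vec3R x).

Definition kernelK (T t : R) : R := T * Num.max (1 - T * `|t|) 0.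

Definition lebesgue3 :=
  ((@lebesgue_measure R \x @lebesgue_measure R) \x @lebesgue_measure R)%E.

Definition sigma_infty (q : ternary_form) (w : R * R * R -> R) : R :=
  lim ((\int[lebesgue3]_y (w y * kernelK T (qeval q y))) @[T --> +oo]).

Definition sigma_p (q : ternary_form) (p : nat) : R :=
  limn (fun r : nat => (local_count q p r)%:R / (p ^ (2 * r))%:R : R).

Definition singular_series (q : ternary_form) : R :=
  limn (fun n : nat => \prod_(0 <= p < n | prime p) sigma_p q p).

Definition psi (q : ternary_form) (w : R * R * R -> R) (B : R) : R :=
  4 ^+ omega `|disc q|%N * rho q * (sigma_infty q w0 / sigma_infty q w) * ln B.

(* The product [sigma_infty q w * psi q w B], with its conventional value when
   [sigma_infty q w = 0]. *)
Definition sigma_psi (q : ternary_form) (w : R * R * R -> R) (B : R) : R :=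
  if sigma_infty q w == 0
  then 4 ^+ omega `|disc q|%N * rho q * sigma_infty q w0 * ln B
  else sigma_infty q w * psi q w B.

End Real.

(* Main.v *)
(* An isotropic form q can be brought, by an integral substitution M, into c (x1 x2 - n x3^2) in such
   a way that M is a bijection between the primitive zeros; all local densities and the density at
   infinity are then computed for x1 x2 = n x3^2, whose primitive zeros are +- (d u^2, (n / d) v^2, u v)
   with d | n and coprimality conditions on u and v. Pairing M (d u^2, (n / d) v^2, u v) with an
   eigenvector of Q for its positive eigenvalue gives a binary form h comparable with the norm of the
   zero; hence h is at least of the order of |z0| on nonzero integer points. Summing the weight over a
   lattice, after a Gauss reduction of h, costs an error inversely proportional to the square root of
   the minimum of h, because the weight has bounded variation along every line. The coprimality
   conditions are removed by a sieve, prime by prime; the sum over d of the resulting errors is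
   multiplicative and is compared with 4^omega times the product of the local densities. *)
Require Import Defs.
From HB Require Import structures.
From mathcomp Require Import all_boot all_order all_algebra.
From mathcomp Require Import ring lra zify.
From mathcomp Require Import all_classical all_reals all_analysis measurable_realfun.
Set Implicit Arguments.
Unset Strict Implicit.
Unset Printing Implicit Defensive.
Import Order.TTheory GRing.Theory Num.Theory.
Import numFieldNormedType.Exports.
Local Open Scope classical_set_scope.
Local Open Scope ring_scope.

(** * Integrals over the plane and over space *)

(** The error has to be uniform in [q], which enters the lattice sums only through the binary form
    [h]: its discriminant [D] is at most the square of [form_norm q], and its minimum is at least
    the norm of [z0] divided by [K], where [K^2 = 1 + rho / 2]. The variation bound is uniform
    because a quadratic polynomial clipped to [-1, 1] is monotone on two half-lines, whatever its
    coefficients; a Lipschitz weight inherits this. Smoothness of [w] serves to give the Lipschitz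
    bound, which passes to the positive and negative parts, so that all estimates concern
    nonnegative weights. The density of [w0] measures the error because the mass of [w0] on the cone
    is at least a constant times [1 / (K sqrt D)], the area of an ellipse, also where the density of
    [w] vanishes. When the fourth-root factor exceeds 1, no asymptotics are needed: the zeros are
    bounded by counting coprime points, which produces the isolated [tau], and the main term by an
    area. The reduction of [q] is not an integral equivalence: it lowers the discriminant by
    dividing out powers of primes after diagonal substitutions. *)

Section AffineSubstitution.
Variable R : realType.
Local Notation MR := (measurableTypeR R).
Local Notation leb := (@lebesgue_measure R).
Local Open Scope ereal_scope.

Let aff (a b : R) : MR -> MR := fun x => (a * x + b)%R.

Let measurable_aff a b : measurable_fun setT (aff a b).
Proof.
by apply: measurable_realfun.measurable_funD => //; apply: measurable_funM.
Qed.

(** Scaled by [|a|], the pushforward agrees with Lebesgue measure on half-open intervals, hence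
    everywhere by uniqueness. For negative [a] the preimage of []u, v]] is closed on the left
    instead. *)
Lemma lebesgue_measure_affine (a b : R) (A : set MR) : a != 0%R -> measurable A ->
  pushforward leb (aff a b) A = (`|a|^-1)%:E * leb A.
Proof.
move=> a0 mA.
pose nu0 : {measure set MR -> \bar R} := pushforward leb (aff a b).
pose nu := nu0 (@measurable_aff a b).
pose mu : {measure set MR -> \bar R} := mscale (NngNum (normr_ge0 a)) nu.
suff H : mu A = leb A.
  rewrite -H /mu /= /mscale /= /nu /nu0 /= muleA -EFinM mulVf ?mul1e ?normr_eq0 //.
apply/esym/lebesgue_measure_unique => //= _ [[u v]] _ <-.
rewrite /mscale/= /nu /nu0 /= /pushforward.
have [a_gt|a_lt] := ltrP 0 a.
- have -> : aff a b @^-1` `]u, v] = `]((u - b) / a)%R, ((v - b) / a)%R]%classic.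
    rewrite /aff; apply/seteqP; split=> x /=; rewrite !in_itv /=.
      by rewrite ltr_pdivrMr // ler_pdivlMr // ltrBlDr lerBrDr [(x * a)%R]mulrC.
    by rewrite ltr_pdivrMr // ler_pdivlMr // ltrBlDr lerBrDr [(x * a)%R]mulrC.
  rewrite !lebesgue_measure_itv /= !lte_fin ltr_pM2r ?invr_gt0 // ltrD2r.
  case: ifP => _; rewrite ?mule0 // !EFinN -!EFinD -EFinM gtr0_norm //.
  by congr EFin; field.
- have {}a_lt : (a < 0)%R by rewrite lt_neqAle a0.
  have -> : aff a b @^-1` `]u, v] = `[((v - b) / a)%R, ((u - b) / a)%R[%classic.
    rewrite /aff; apply/seteqP; split=> x /=; rewrite !in_itv /=.
      by rewrite ler_ndivrMr // ltr_ndivlMr // ltrBlDr lerBrDr [(x * a)%R]mulrC andbC.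
    by rewrite ler_ndivrMr // ltr_ndivlMr // ltrBlDr lerBrDr [(x * a)%R]mulrC andbC.
  rewrite !lebesgue_measure_itv /= !lte_fin ltr_nM2r ?invr_lt0 // ltrD2r.
  case: ifP => _; rewrite ?mule0 // !EFinN -!EFinD -EFinM ltr0_norm //.
  by congr EFin; field.
Qed.

Lemma ge0_integral_affine (a b : R) (f : R -> \bar R) : a != 0%R ->
  measurable_fun [set: MR] f -> (forall x, 0 <= f x) ->
  \int[leb]_x f (a * x + b)%R = (`|a|^-1)%:E * \int[leb]_x f x.
Proof.
move=> a0 mf f0.
transitivity (\int[pushforward leb (aff a b)]_x f x).
  by rewrite (ge0_integral_pushforward (@measurable_aff a b)).
have a1 : (0 <= `|a|^-1)%R by rewrite invr_ge0.
transitivity (\int[mscale (NngNum a1) leb]_x f x).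
  by apply: eq_measure_integral => A mA _; exact: lebesgue_measure_affine.
by rewrite ge0_integral_mscale.
Qed.

End AffineSubstitution.

Section Lebesgue3.
Variable R : realType.
Local Notation MR := (measurableTypeR R).
Local Notation leb := (@lebesgue_measure R).
Local Open Scope ereal_scope.

Lemma ge0_fubini_leb (f : MR * MR -> \bar R) :
  measurable_fun [set: MR * MR] f -> (forall x, 0 <= f x) ->
  \int[leb]_x \int[leb]_y f (x, y) = \int[leb]_y \int[leb]_x f (x, y).
Proof. by move=> mf f0; rewrite fubini_tonelli. Qed.

(** Makes the product of two Lebesgue measures available as the first factor in Tonelli's theorem,
    since [lebesgue3] is nested to the left. *)
Lemma sigma_finite_leb2 : sigma_finite [set: MR * MR] (leb \x leb)%E.
Proof.
have /sigma_finiteP[F [TF ndF Foo]] := sigma_finiteT leb.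
exists (fun n => F n `*` F n).
  rewrite -setXTT TF predeqE => -[x y]; split.
    move=> [/= [n _ Fnx] [k _ Gky]]; exists (maxn n k) => //; split.
      by move: x Fnx; exact/subsetPset/ndF/leq_maxl.
    by move: y Gky; exact/subsetPset/ndF/leq_maxr.
  by move=> [n _ []/= ? ?]; split; exists n.
move=> k; have [? ?] := Foo k; split; first exact: measurableX.
by rewrite product_measure1E// lte_mul_pinfty// ge0_fin_numE.
Qed.

Lemma ge0_integral_lebesgue3 (f : MR * MR * MR -> \bar R) :
  measurable_fun [set: MR * MR * MR] f -> (forall x, 0 <= f x) ->
  \int[@lebesgue3 R]_x f x =
  \int[leb]_x \int[leb]_y \int[leb]_z f (x, y, z).
Proof.
move=> mf f0.
pose m12 : {sigma_finite_measure set (MR * MR)%type -> \bar R} :=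
  HB.pack (leb \x leb)%E (Measure_isSigmaFinite.Build _ _ _ _ sigma_finite_leb2).
rewrite (_ : @lebesgue3 R = (m12 \x leb)%E) // fubini_tonelli1 //= fubini_tonelli1 //=.
  exact: measurable_fun_fubini_tonelli_F.
by move=> x; apply: integral_ge0.
Qed.

Lemma measurable_section23 (f : MR * MR * MR -> \bar R) (x : R) :
  measurable_fun [set: MR * MR * MR] f -> measurable_fun [set: MR * MR] (fun yz : MR * MR => f (x, yz.1, yz.2)).
Proof.
move=> mf; apply: measurableT_comp => //.
by apply: measurable_fun_pair => //; apply: measurable_fun_pair.
Qed.

Lemma ge0_fubini_leb12 (f : MR * MR * MR -> \bar R) :
  measurable_fun [set: MR * MR * MR] f -> (forall x, 0 <= f x) ->
  \int[leb]_x \int[leb]_y \int[leb]_z f (x, y, z) =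
  \int[leb]_y \int[leb]_x \int[leb]_z f (x, y, z).
Proof.
move=> mf f0.
apply: (@ge0_fubini_leb (fun xy => \int[leb]_z f (xy, z))).
  exact: measurable_fun_fubini_tonelli_F.
by move=> x; apply: integral_ge0.
Qed.

Lemma ge0_fubini_leb23 (f : MR * MR * MR -> \bar R) :
  measurable_fun [set: MR * MR * MR] f -> (forall x, 0 <= f x) ->
  \int[leb]_x \int[leb]_y \int[leb]_z f (x, y, z) =
  \int[leb]_x \int[leb]_z \int[leb]_y f (x, y, z).
Proof.
move=> mf f0; apply: eq_integral => x _.
apply: (@ge0_fubini_leb (fun yz => f (x, yz.1, yz.2))) => //.
exact: measurable_section23.
Qed.

(** Every preimage is a union of boxes indexed by the countable set of integer triples. *)
Lemma measurable_int_step (F : int * int * int -> R) (k : R) :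
  measurable_fun [set: MR * MR * MR] (fun v : MR * MR * MR =>
    F (Num.floor (k * v.1.1)%R, Num.floor (k * v.1.2)%R, Num.floor (k * v.2)%R)).
Proof.
move=> _ A mA; rewrite setTI.
pose fl (x : MR) := Num.floor (k * x)%R.
have mfl (i : int) : measurable (fl @^-1` [set i]).
  have -> : fl @^-1` [set i] = (fun x : MR => (k * x)%R) @^-1` `[i%:~R, (i + 1)%:~R[.
    apply/seteqP; split=> x /=; rewrite /fl in_itv /=.
      by move=> <-; rewrite ge_floor /= lt_succ_floor.
    by move=> H; apply/floor_def.
  rewrite -[X in measurable X]setTI.
  exact: (@measurable_realfun.measurable_funM _ _ _ setT (cst k) id).
pose box (u : int * int * int) : set (MR * MR * MR) :=
  if F u \in A then (fl @^-1` [set u.1.1] `*` (fl @^-1` [set u.1.2])) `*` (fl @^-1` [set u.2])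
  else set0.
rewrite (_ : _ @^-1` A = \bigcup_u box u).
  apply: countable_bigcupT_measurable => [|u]; first exact: countableP.
  by rewrite /box; case: ifP => // _; do 2 apply: measurableX => //.
apply/seteqP; split=> [v /= Av|v /= [[[a b] c] _]].
  by exists (fl v.1.1, fl v.1.2, fl v.2) => //; rewrite /box mem_set.
rewrite /box; case: ifPn => //= /set_mem Au; rewrite /fl => -[[E1 E2] E3].
by rewrite /preimage /= E1 E2 E3.
Qed.

(** Measurability refers to the product sigma-algebra; it follows by writing [f] as a pointwise
    limit of functions constant on small cubes, each coordinate being rounded down to a multiple of
    [1 / (n + 1)]. *)
Lemma measurable_continuous3 (f : R * R * R -> R) :
  continuous f -> measurable_fun [set: MR * MR * MR] (f : MR * MR * MR -> R).
Proof.
move=> cf.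
pose g (n : nat) (x : R) : R := ((Num.floor (n.+1%:R * x))%:~R / n.+1%:R)%R.
have cg x : g n x @[n --> \oo] --> x.
  apply: (@squeeze_cvgr _ _ _ _ (fun n : nat => x - harmonic n)%R (fun=> x)).
  - near=> n; rewrite /g ler_pdivlMr ?ltr0n // ler_pdivrMr ?ltr0n //.
    rewrite mulrBl /harmonic mulVf ?pnatr_eq0 // mulrC; apply/andP; split.
      by rewrite lerBlDr ltW // -[1%R]/(1%:~R)%R -intrD lt_succ_floor.
    exact: ge_floor.
  - rewrite -[X in _ --> X]subr0; apply: cvgB; first exact: cvg_cst.
    exact: cvg_harmonic.
  - exact: cvg_cst.
apply: (@measurable_fun_cvg _ _ _ _ (fun n v => f (g n v.1.1, g n v.1.2, g n v.2))).
  move=> n.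
  exact: (@measurable_int_step (fun u => f (u.1.1%:~R / n.+1%:R,
    u.1.2%:~R / n.+1%:R, u.2%:~R / n.+1%:R)%R)).
move=> [[x y] z] _; apply: cvg_comp; last exact: cf.
apply: (@cvg_pair _ _ _ _ (nbhs (x, y)) (nbhs z)); last exact: cg.
by apply: (@cvg_pair _ _ _ _ (nbhs x) (nbhs y)); exact: cg.
Unshelve. all: by end_near. Qed.

End Lebesgue3.

(** * Integral ternary forms and their zeros *)

(** Nine named entries instead of an indexed matrix: matrix identities then unfold to polynomial
    identities that [ring] closes. *)
Record mat3 (S : Type) := Mat3 {
  m11 : S; m12 : S; m13 : S; m21 : S; m22 : S; m23 : S; m31 : S; m32 : S; m33 : S }.

Section Mat3.
Variable S : comNzRingType.
Implicit Types (M N : mat3 S) (v : S * S * S).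

Definition mat3_app M v : S * S * S :=
  let: (x, y, z) := v in
  (m11 M * x + m12 M * y + m13 M * z,
   m21 M * x + m22 M * y + m23 M * z,
   m31 M * x + m32 M * y + m33 M * z).

Definition mat3_mul M N : mat3 S := Mat3
  (m11 M * m11 N + m12 M * m21 N + m13 M * m31 N)
  (m11 M * m12 N + m12 M * m22 N + m13 M * m32 N)
  (m11 M * m13 N + m12 M * m23 N + m13 M * m33 N)
  (m21 M * m11 N + m22 M * m21 N + m23 M * m31 N)
  (m21 M * m12 N + m22 M * m22 N + m23 M * m32 N)
  (m21 M * m13 N + m22 M * m23 N + m23 M * m33 N)
  (m31 M * m11 N + m32 M * m21 N + m33 M * m31 N)
  (m31 M * m12 N + m32 M * m22 N + m33 M * m32 N)
  (m31 M * m13 N + m32 M * m23 N + m33 M * m33 N).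

Definition mat3_det M : S :=
  m11 M * (m22 M * m33 M - m23 M * m32 M)
  - m12 M * (m21 M * m33 M - m23 M * m31 M)
  + m13 M * (m21 M * m32 M - m22 M * m31 M).

Definition mat3_adj M : mat3 S := Mat3
  (m22 M * m33 M - m23 M * m32 M) (m13 M * m32 M - m12 M * m33 M)
  (m12 M * m23 M - m13 M * m22 M)
  (m23 M * m31 M - m21 M * m33 M) (m11 M * m33 M - m13 M * m31 M)
  (m13 M * m21 M - m11 M * m23 M)
  (m21 M * m32 M - m22 M * m31 M) (m12 M * m31 M - m11 M * m32 M)
  (m11 M * m22 M - m12 M * m21 M).

Definition mat3_diag (a b c : S) : mat3 S := Mat3 a 0 0 0 b 0 0 0 c.

Lemma mat3_appM M N v : mat3_app (mat3_mul M N) v = mat3_app M (mat3_app N v).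
Proof. by case: v => [[x y] z]; rewrite /mat3_app /=; congr (_, _, _); ring. Qed.

Lemma mat3_detM M N : mat3_det (mat3_mul M N) = mat3_det M * mat3_det N.
Proof. by rewrite /mat3_det /=; ring. Qed.

Lemma mat3_app_adj M x y z :
  mat3_app (mat3_adj M) (mat3_app M (x, y, z)) =
  (mat3_det M * x, mat3_det M * y, mat3_det M * z).
Proof. by rewrite /mat3_det /mat3_app /=; congr (_, _, _); ring. Qed.

End Mat3.

Definition mat3_int (S : comNzRingType) (M : mat3 int) : mat3 S :=
  Mat3 (m11 M)%:~R (m12 M)%:~R (m13 M)%:~R (m21 M)%:~R (m22 M)%:~R (m23 M)%:~R
    (m31 M)%:~R (m32 M)%:~R (m33 M)%:~R.

Lemma mat3_intM (S : comNzRingType) M N :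
  mat3_int S (mat3_mul M N) = mat3_mul (mat3_int S M) (mat3_int S N).
Proof. by rewrite /mat3_int /mat3_mul /= !(intrD, intrM). Qed.

Lemma mat3_int_det (S : comNzRingType) M :
  mat3_det (mat3_int S M) = (mat3_det M)%:~R.
Proof. by rewrite /mat3_det /=; ring. Qed.

Lemma mat3_int_id (M : mat3 int) : mat3_int int M = M.
Proof. by case: M => *; rewrite /mat3_int /= !intz. Qed.

Lemma vec3R_app (R : realType) M v :
  vec3R R (mat3_app M v) = mat3_app (mat3_int R M) (vec3R R v).
Proof. by case: v => [[x y] z]; rewrite /vec3R /= !(intrD, intrM). Qed.

Definition form_scale (c : int) (q : ternary_form) : ternary_form :=
  TernaryForm (c * q11 q) (c * q12 q) (c * q13 q) (c * q22 q) (c * q23 q) (c * q33 q).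

(** [Q] is the form at one column of [M], and [P] its polar form at two columns. *)
Definition form_pull (M : mat3 int) (q : ternary_form) : ternary_form :=
  let Q x y z := q11 q * x ^+ 2 + q12 q * x * y + q13 q * x * z
    + q22 q * y ^+ 2 + q23 q * y * z + q33 q * z ^+ 2 in
  let P x y z x' y' z' :=
    2 * q11 q * x * x' + q12 q * (x * y' + x' * y) + q13 q * (x * z' + x' * z)
    + 2 * q22 q * y * y' + q23 q * (y * z' + y' * z) + 2 * q33 q * z * z' in
  TernaryForm (Q (m11 M) (m21 M) (m31 M))
    (P (m11 M) (m21 M) (m31 M) (m12 M) (m22 M) (m32 M))
    (P (m11 M) (m21 M) (m31 M) (m13 M) (m23 M) (m33 M))
    (Q (m12 M) (m22 M) (m32 M))
    (P (m12 M) (m22 M) (m32 M) (m13 M) (m23 M) (m33 M))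
    (Q (m13 M) (m23 M) (m33 M)).

Lemma qeval_pull (S : comNzRingType) M q (v : S * S * S) :
  qeval (form_pull M q) v = qeval q (mat3_app (mat3_int S M) v).
Proof.
case: v => [[x y] z]; rewrite /qeval /=.
by rewrite !(intrD, intrM, rmorphXn) /=; ring.
Qed.

Lemma qeval_scale (S : comNzRingType) c q (v : S * S * S) :
  qeval (form_scale c q) v = c%:~R * qeval q v.
Proof. by case: v => [[x y] z]; rewrite /qeval /= !intrM; ring. Qed.

Lemma qeval_int_pull M q v : qeval (form_pull M q) v = qeval q (mat3_app M v) :> int.
Proof. by rewrite qeval_pull mat3_int_id. Qed.

Lemma form_pullM M N q : form_pull (mat3_mul M N) q = form_pull N (form_pull M q).
Proof. by rewrite /form_pull /=; congr TernaryForm; ring. Qed.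

Lemma form_pull_scale M c q : form_pull M (form_scale c q) = form_scale c (form_pull M q).
Proof. by rewrite /form_pull /form_scale /=; congr TernaryForm; ring. Qed.

Lemma form_scaleM c d q : form_scale (c * d) q = form_scale c (form_scale d q).
Proof. by rewrite /form_scale /= !mulrA. Qed.

Lemma form_scale1 q : form_scale 1 q = q.
Proof. by case: q => *; rewrite /form_scale /= !mul1r. Qed.

Lemma disc_explicit q : disc q =
  4 * q11 q * q22 q * q33 q + q12 q * q13 q * q23 q
   - q11 q * q23 q ^+ 2 - q22 q * q13 q ^+ 2 - q33 q * q12 q ^+ 2.
Proof.
apply: (@mulfI _ 2) => //; rewrite disc_detE.
rewrite (expand_det_row _ ord0) !big_ord_recl big_ord0 /cofactor.
rewrite !(expand_det_row _ ord0) !big_ord_recl !big_ord0 /cofactor.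
by rewrite !det_mx11 !mxE /=; ring.
Qed.

Lemma disc_pull M q : disc (form_pull M q) = mat3_det M ^+ 2 * disc q.
Proof. by rewrite !disc_explicit /mat3_det /=; ring. Qed.

Lemma disc_scale c q : disc (form_scale c q) = c ^+ 3 * disc q.
Proof. by rewrite !disc_explicit /=; ring. Qed.

(** * Primitive vectors and counting in residue boxes *)

Section PrimitiveVectors.
Implicit Types (P : int * int * int -> bool) (v : int * int * int).

Definition pdvd3 (d : int) v : bool := [&& (d %| v.1.1)%Z, (d %| v.1.2)%Z & (d %| v.2)%Z].

Lemma pdvd3_app (d : int) M v : pdvd3 d v -> pdvd3 d (mat3_app M v).
Proof.
by case: v => [[x y] z] /and3P[/= dx dy dz]; apply/and3P; split=> /=;
  by rewrite !rpredD ?dvdz_mull.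
Qed.

Lemma pdvd3_app_det (p : nat) M v : prime p -> ~~ (p %| `|mat3_det M|)%N ->
  pdvd3 p%:Z (mat3_app M v) -> pdvd3 p%:Z v.
Proof.
move=> pp pM; case: v => [[x y] z] /(pdvd3_app (mat3_adj M)).
rewrite mat3_app_adj => /and3P[/= ]; rewrite !dvdzE !abszM !Euclid_dvdM // !(negPf pM) /=.
by rewrite /pdvd3 /= !dvdzE /= => -> -> ->.
Qed.

Lemma primitive_vecP v :
  reflect (forall p : nat, prime p -> ~~ pdvd3 p%:Z v) (primitive_vec v).
Proof.
case: v => [[x y] z] /=; apply: (iffP eqP) => [g1 p pp|H].
  apply/negP => /and3P[/= px py pz].
  have : (p%:Z %| gcdz (gcdz x y) z)%Z by rewrite !dvdz_gcd px py pz.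
  by rewrite g1 dvdzE /= dvdn1 => /eqP p1; rewrite p1 in pp.
set g := gcdz _ _ in H *.
have g_ge0 : g = `|g|%N by rewrite /g /gcdz.
have [g0|g_gt] := posnP `|g|%N.
  have := H 2%N isT; have : (2 %| g)%Z by rewrite g_ge0 g0.
  by rewrite /g !dvdz_gcd /pdvd3 /= => /andP[/andP[-> ->] ->].
rewrite g_ge0; congr Posz; apply/eqP; rewrite eqn_leq g_gt andbT leqNgt.
apply/negP => g_gt1; have := H _ (pdiv_prime g_gt1).
have : ((pdiv `|g|)%:Z %| g)%Z by rewrite dvdzE pdiv_dvd.
by rewrite /g !dvdz_gcd /pdvd3 /= => /andP[/andP[-> ->] ->].
Qed.

Definition periodic3 (L : nat) P :=
  forall x y z x' y' z', (x = x' %[mod L])%Z -> (y = y' %[mod L])%Z ->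
    (z = z' %[mod L])%Z -> P (x, y, z) = P (x', y', z').

Lemma dvdz_modr (d L : nat) (x y : int) : (d %| L)%N ->
  (x = y %[mod L])%Z -> (d%:Z %| x)%Z = (d%:Z %| y)%Z.
Proof.
move=> dL /eqP; rewrite eqz_mod_dvd => Lxy.
have dxy : (d%:Z %| x - y)%Z by apply: dvdz_trans Lxy.
by rewrite -[x](subrK y) rpredDl.
Qed.

Lemma periodic3_pdvd (d L : nat) : (d %| L)%N -> periodic3 L (pdvd3 d%:Z).
Proof.
by move=> dL x y z x' y' z' hx hy hz; rewrite /pdvd3 /=
  (dvdz_modr dL hx) (dvdz_modr dL hy) (dvdz_modr dL hz).
Qed.

Lemma eqz_mod_sub (L : nat) (x y : int) :
  (x = y %[mod L])%Z <-> exists k, x = y + k * L%:Z.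
Proof.
split=> [/eqP|[k ->]]; last by rewrite addrC modzMDl.
by rewrite eqz_mod_dvd => /dvdzP[k kE]; exists k; rewrite -kE; ring.
Qed.

Lemma periodic3_qeval (d : nat) q : periodic3 d (fun v => (d%:Z %| qeval q v)%Z).
Proof.
move=> x y z x' y' z' /eqz_mod_sub[i ->] /eqz_mod_sub[j ->] /eqz_mod_sub[k ->].
rewrite (@dvdz_modr d d _ (qeval q (x', y', z'))) //; apply/eqz_mod_sub.
rewrite /qeval !intz.
exists (q11 q * (2 * x' * i + i ^+ 2 * d) + q12 q * (x' * j + i * y' + i * j * d)
 + q13 q * (x' * k + i * z' + i * k * d) + q22 q * (2 * y' * j + j ^+ 2 * d)
 + q23 q * (y' * k + j * z' + j * k * d) + q33 q * (2 * z' * k + k ^+ 2 * d)).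
ring.
Qed.

(** The sides may differ, since the diagonal substitutions of the reduction shrink the coordinates
    by different powers of a prime. *)
Definition cnt3 (a b c : nat) P : nat :=
  \sum_(i < a) \sum_(j < b) \sum_(k < c) P (i%:Z, j%:Z, k%:Z).

Lemma eq_cnt3 a b c P P' : P =1 P' -> cnt3 a b c P = cnt3 a b c P'.
Proof. by move=> PP'; do 3 apply: eq_bigr => ? _; rewrite PP'. Qed.

Lemma sum_periodic (f : nat -> nat) (L a : nat) :
  (forall i, f (i + L)%N = f i) ->
  (\sum_(i < L * a) f i = a * \sum_(i < L) f i)%N.
Proof.
move=> fL; elim: a => [|a IH]; first by rewrite muln0 big_ord0.
rewrite mulnS big_split_ord /= mulSn; congr addn; rewrite -IH.
by apply: eq_bigr => i _; rewrite addnC fL.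
Qed.

Lemma cnt3_mul L a b c P : periodic3 L P ->
  (cnt3 (L * a) (L * b) (L * c) P = a * b * c * cnt3 L L L P)%N.
Proof.
move=> HP; rewrite /cnt3.
have HL (i : nat) : ((i + L)%N%:Z = i%:Z %[mod L])%Z.
  by apply/eqz_mod_sub; exists 1; rewrite PoszD mul1r.
rewrite (@sum_periodic (fun i => \sum_(j < L * b) \sum_(k < L * c) P (i%:Z, j%:Z, k%:Z))%N).
  rewrite -!mulnA; congr muln; rewrite !big_distrr /=; apply: eq_bigr => i _.
  rewrite (@sum_periodic (fun j => \sum_(k < L * c) P (i%:Z, j%:Z, k%:Z))%N).
    congr muln; rewrite !big_distrr /=; apply: eq_bigr => j _.
    rewrite (@sum_periodic (fun k => nat_of_bool (P (i%:Z, j%:Z, k%:Z)))) //.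
    by move=> k; congr nat_of_bool; apply: HP.
  by move=> j; apply: eq_bigr => k _; congr nat_of_bool; apply: HP.
by move=> i; do 2 apply: eq_bigr => ? _; congr nat_of_bool; apply: HP.
Qed.

Lemma sum_dvd (f : nat -> nat) (s N : nat) : (0 < s)%N ->
  (\sum_(i < s * N) (s %| i) * f i = \sum_(i < N) f (s * i))%N.
Proof.
move=> s0; elim: N => [|N IH]; first by rewrite muln0 !big_ord0.
rewrite mulnSr big_split_ord /= IH big_ord_recr /=; congr addn.
case: s s0 {IH} => // s _; rewrite big_ord_recl /= addn0 dvdn_mulr // mul1n.
rewrite big1 ?addn0 // => i _.
by rewrite dvdn_addr ?dvdn_mulr // /bump leq0n gtnNdvd //= ?ltnS.
Qed.

Lemma cnt3_scale (s t u : nat) a b c P : (0 < s)%N -> (0 < t)%N -> (0 < u)%N ->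
  (forall v, P v -> [&& (s%:Z %| v.1.1)%Z, (t%:Z %| v.1.2)%Z & (u%:Z %| v.2)%Z]) ->
  cnt3 (s * a) (t * b) (u * c) P =
  cnt3 a b c (fun v => P (mat3_app (mat3_diag s%:Z t%:Z u%:Z) v)).
Proof.
move=> s0 t0 u0 HP; rewrite /cnt3.
transitivity (\sum_(i < s * a) (s %| i) * \sum_(j < t * b) (t %| j) *
    \sum_(k < u * c) (u %| k) * P (i%:Z, j%:Z, k%:Z))%N.
  apply: eq_bigr => i _; rewrite big_distrr; apply: eq_bigr => j _ /=.
  rewrite mulnA big_distrr; apply: eq_bigr => k _ /=.
  case E: (P _); rewrite ?muln0 //.
  by have := HP _ E; rewrite /= !dvdzE /= => /and3P[-> -> ->].
rewrite (sum_dvd (fun i => \sum_(j < t * b) (t %| j) *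
    \sum_(k < u * c) (u %| k) * P (i%:Z, j%:Z, k%:Z))%N _ s0).
apply: eq_bigr => i _.
rewrite (sum_dvd (fun j => \sum_(k < u * c) (u %| k) * P ((s * i)%N%:Z, j%:Z, k%:Z))%N _ t0).
apply: eq_bigr => j _.
rewrite (sum_dvd (fun k => nat_of_bool (P ((s * i)%N%:Z, (t * j)%N%:Z, k%:Z))) _ u0).
apply: eq_bigr => k _; congr nat_of_bool; congr P; rewrite /=.
by rewrite !mul0r !addr0 !add0r !PoszM.
Qed.

Lemma cnt3E L P : cnt3 L L L P =
  #|[pred v : 'I_L * 'I_L * 'I_L | P (v.1.1%:Z, v.1.2%:Z, v.2%:Z)]|.
Proof.
rewrite -sum1_card big_mkcond /= /cnt3 pair_big pair_big /=.
by apply: eq_bigr => -[[i j] k] _ /=; rewrite inE /=; case: (P _).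
Qed.

(** A matrix whose determinant is prime to [L] permutes the residue classes: multiplying by the
    adjugate recovers each coordinate up to the invertible factor [det M]. *)
Lemma cnt3_app (L : nat) P M : (0 < L)%N -> periodic3 L P ->
  coprime L `|mat3_det M| -> cnt3 L L L (fun v => P (mat3_app M v)) = cnt3 L L L P.
Proof.
case: L => // L _ HP cop.
pose o (x : int) : 'I_L.+1 := inord `|(x %% L.+1%:Z)%Z|%N.
have oE (x : int) : ((o x)%:Z = x %[mod L.+1])%Z.
  have lt0 : (0 <= (x %% L.+1%:Z)%Z) by apply: modz_ge0.
  rewrite inordK ?gez0_abs ?modz_mod //.
  by rewrite -ltz_nat gez0_abs // ltz_pmod.
have oI (i j : 'I_L.+1) : (i%:Z = j%:Z %[mod L.+1])%Z -> i = j.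
  by rewrite !modz_nat => -[]; rewrite !modn_small // => /ord_inj.
pose iv (v : 'I_L.+1 * 'I_L.+1 * 'I_L.+1) := (v.1.1%:Z, v.1.2%:Z, v.2%:Z).
pose f (v : 'I_L.+1 * 'I_L.+1 * 'I_L.+1) :=
  let w := mat3_app M (iv v) in (o w.1.1, o w.1.2, o w.2).
have f_inj : injective f.
  move=> [[a b] c] [[a' b'] c'] [] /(congr1 (fun x : 'I_L.+1 => (x%:Z %% L.+1)%Z)).
  rewrite !oE => /eqz_mod_sub[i iE].
  move=> /(congr1 (fun x : 'I_L.+1 => (x%:Z %% L.+1)%Z)); rewrite !oE => /eqz_mod_sub[j jE].
  move=> /(congr1 (fun x : 'I_L.+1 => (x%:Z %% L.+1)%Z)); rewrite !oE => /eqz_mod_sub[k kE].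
  rewrite /= in iE jE kE.
  have cancel (x y : 'I_L.+1) l :
      mat3_det M * x%:Z = mat3_det M * y%:Z + l * L.+1%:Z -> x = y.
    move=> E; apply: oI; apply/eqP; rewrite eqz_mod_dvd.
    have : (L.+1%:Z %| mat3_det M * (x%:Z - y%:Z))%Z.
      by rewrite mulrBr E addrAC subrr add0r dvdz_mull.
    by rewrite Gauss_dvdzr // coprimezE.
  pose A := mat3_adj M.
  congr (_, _, _).
  - apply: (cancel _ _ (m11 A * i + m12 A * j + m13 A * k)).
    transitivity (m11 A * (m11 M * a%:Z + m12 M * b%:Z + m13 M * c%:Z)
      + m12 A * (m21 M * a%:Z + m22 M * b%:Z + m23 M * c%:Z)
      + m13 A * (m31 M * a%:Z + m32 M * b%:Z + m33 M * c%:Z)).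
      by rewrite /A /mat3_det /=; ring.
    by rewrite iE jE kE /A /mat3_det /=; ring.
  - apply: (cancel _ _ (m21 A * i + m22 A * j + m23 A * k)).
    transitivity (m21 A * (m11 M * a%:Z + m12 M * b%:Z + m13 M * c%:Z)
      + m22 A * (m21 M * a%:Z + m22 M * b%:Z + m23 M * c%:Z)
      + m23 A * (m31 M * a%:Z + m32 M * b%:Z + m33 M * c%:Z)).
      by rewrite /A /mat3_det /=; ring.
    by rewrite iE jE kE /A /mat3_det /=; ring.
  - apply: (cancel _ _ (m31 A * i + m32 A * j + m33 A * k)).
    transitivity (m31 A * (m11 M * a%:Z + m12 M * b%:Z + m13 M * c%:Z)
      + m32 A * (m21 M * a%:Z + m22 M * b%:Z + m23 M * c%:Z)
      + m33 A * (m31 M * a%:Z + m32 M * b%:Z + m33 M * c%:Z)).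
      by rewrite /A /mat3_det /=; ring.
    by rewrite iE jE kE /A /mat3_det /=; ring.
rewrite !cnt3E -!sum1_card [RHS](reindex_inj f_inj) /=.
apply: eq_bigl => -[[a b] c]; rewrite !inE /= /f /iv /=.
by apply: HP; rewrite oE.
Qed.

End PrimitiveVectors.

(** * Linear changes of variables in space integrals *)

Section LinearSubstitution.
Variable R : realType.
Local Notation MR := (measurableTypeR R).
Local Notation leb := (@lebesgue_measure R).
Local Open Scope ereal_scope.

(** A predicate on [M] rather than a theorem on all invertible matrices: it is stable under
    products, and the reduction only composes shears, two-by-two blocks and diagonal matrices. *)
Definition linear_subst (M : mat3 R) : Prop :=
  forall f : MR * MR * MR -> \bar R,
    measurable_fun [set: MR * MR * MR] f -> (forall x, 0 <= f x) ->
    \int[@lebesgue3 R]_x f x =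
    (`|mat3_det M|)%:E * \int[@lebesgue3 R]_x f (mat3_app M x).

Lemma measurable_mat3_app (M : mat3 R) :
  measurable_fun [set: MR * MR * MR] (mat3_app M : _ -> MR * MR * MR).
Proof.
have H (a b c : R) : measurable_fun [set: MR * MR * MR]
    (fun x : MR * MR * MR => (a * x.1.1 + b * x.1.2 + c * x.2)%R : MR).
  apply: measurable_funD; last by apply: measurable_funM.
  by apply: measurable_funD; apply: measurable_funM => //; apply: measurableT_comp.
rewrite (_ : mat3_app M = fun x => (m11 M * x.1.1 + m12 M * x.1.2 + m13 M * x.2,
   m21 M * x.1.1 + m22 M * x.1.2 + m23 M * x.2,
   m31 M * x.1.1 + m32 M * x.1.2 + m33 M * x.2)%R).
  by do 2 (apply: measurable_fun_pair; last exact: H); exact: H.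
by apply/funext => -[[x y] z].
Qed.

Lemma measurable_comp_app (M : mat3 R) (f : MR * MR * MR -> \bar R) :
  measurable_fun [set: MR * MR * MR] f ->
  measurable_fun [set: MR * MR * MR] (fun x => f (mat3_app M x)).
Proof. by move=> mf; exact: (measurableT_comp mf (measurable_mat3_app M)). Qed.

Lemma linear_substM (M N : mat3 R) :
  linear_subst M -> linear_subst N -> linear_subst (mat3_mul M N).
Proof.
move=> HM HN f mf f0; rewrite HM // HN //; last first.
  exact: measurable_comp_app.
rewrite muleA -EFinM mat3_detM normrM; congr (_ * _).
by apply: eq_integral => x _; rewrite mat3_appM.
Qed.

(** Only the innermost variable changes, so this is one affine substitution under two integral
    signs. Conjugation by swaps moves it to the other rows. *)
Lemma linear_subst_row3 (a b k : R) : k != 0%R ->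
  linear_subst (Mat3 1 0 0 0 1 0 a b k)%R.
Proof.
move=> k0 f mf f0; rewrite ge0_integral_lebesgue3 // ge0_integral_lebesgue3 //; last first.
  exact: measurable_comp_app.
have m2 : measurable_fun [set: MR * MR] (fun x : MR * MR => \int[leb]_z f (x, z)).
  exact: measurable_fun_fubini_tonelli_F.
have m1 x : measurable_fun [set: MR] (fun y : MR => \int[leb]_z f (x, y, z)).
  exact: (measurableT_comp m2).
have m0 x y : measurable_fun [set: MR] (fun z : MR => f (x, y, z)).
  exact: (measurableT_comp mf).
have E x y : \int[leb]_z f (mat3_app (Mat3 1 0 0 0 1 0 a b k) (x, y, z))%R =
    (`|k|^-1)%:E * \int[leb]_z f (x, y, z).
  rewrite -(@ge0_integral_affine _ k (a * x + b * y)%R) //.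
  apply: eq_integral => z _; congr f; rewrite /mat3_app /=.
  by congr (_, _, _); ring.
have k1 : 0 <= (`|k|^-1)%:E by rewrite lee_fin invr_ge0.
have E2 x : \int[leb]_y \int[leb]_z f (mat3_app (Mat3 1 0 0 0 1 0 a b k) (x, y, z))%R =
    (`|k|^-1)%:E * \int[leb]_y \int[leb]_z f (x, y, z).
  under eq_integral => y _ do rewrite E.
  by rewrite ge0_integralZl // => y _; apply: integral_ge0.
under [X in _ = _ * X]eq_integral => x _ do rewrite E2.
rewrite ge0_integralZl //; last 2 first.
- apply: (@measurable_fun_fubini_tonelli_F _ _ MR MR R leb (fun xy : MR * MR => \int[leb]_z f (xy, z))) => //.
  by move=> x; apply: integral_ge0.
- by move=> x _; apply: integral_ge0 => y _; apply: integral_ge0.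
rewrite muleA -EFinM /mat3_det /= (_ : _ * _ = 1)%R ?mul1e //.
rewrite (_ : (_ - _ + _)%R = k); first by rewrite mulfV ?normr_eq0.
by ring.
Qed.

Lemma linear_subst_swap12 : linear_subst (Mat3 0 1 0 1 0 0 0 0 1)%R.
Proof.
move=> f mf f0; rewrite ge0_integral_lebesgue3 // ge0_integral_lebesgue3 //; last first.
  exact: measurable_comp_app.
rewrite /mat3_det /= (_ : `|_| = 1)%R ?mul1e; last first.
  by rewrite (_ : (_ - _ + _)%R = -1)%R ?normrN1 //; ring.
apply: (etrans (ge0_fubini_leb12 mf f0)).
apply: eq_integral => y _; apply: eq_integral => x _; apply: eq_integral => z _.
by congr f; congr (_, _, _); ring.
Qed.

Lemma linear_subst_swap23 : linear_subst (Mat3 1 0 0 0 0 1 0 1 0)%R.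
Proof.
move=> f mf f0; rewrite ge0_integral_lebesgue3 // ge0_integral_lebesgue3 //; last first.
  exact: measurable_comp_app.
rewrite /mat3_det /= (_ : `|_| = 1)%R ?mul1e; last first.
  by rewrite (_ : (_ - _ + _)%R = -1)%R ?normrN1 //; ring.
apply: (etrans (ge0_fubini_leb23 mf f0)).
apply: eq_integral => y _; apply: eq_integral => x _; apply: eq_integral => z _.
by congr f; congr (_, _, _); ring.
Qed.

Lemma linear_subst_row2 (a k b : R) : k != 0%R ->
  linear_subst (Mat3 1 0 0 a k b 0 0 1)%R.
Proof.
move=> k0; have := linear_substM linear_subst_swap23
  (linear_substM (linear_subst_row3 a b k0) linear_subst_swap23).
by congr linear_subst; rewrite /mat3_mul /=; congr Mat3; ring.
Qed.

Lemma linear_subst_row1 (k a b : R) : k != 0%R ->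
  linear_subst (Mat3 k a b 0 1 0 0 0 1)%R.
Proof.
move=> k0; have := linear_substM linear_subst_swap12
  (linear_substM (linear_subst_row2 a b k0) linear_subst_swap12).
by congr linear_subst; rewrite /mat3_mul /=; congr Mat3; ring.
Qed.

(** For nonzero [d] the block is a product of two row operations. Otherwise [c] is nonzero, and
    exchanging the last two columns leads back to that case. *)
Lemma linear_subst_block23 (a b c d : R) : (a * d - b * c != 0)%R ->
  linear_subst (Mat3 1 0 0 0 a b 0 c d)%R.
Proof.
have main (a' b' c' d' : R) : (a' * d' - b' * c' != 0)%R -> d' != 0%R ->
    linear_subst (Mat3 1 0 0 0 a' b' 0 c' d')%R.
  move=> D0 d0; have E0 : ((a' * d' - b' * c') / d' != 0)%R by rewrite mulf_neq0 ?invr_eq0.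
  have := linear_substM (linear_subst_row2 0 (b' / d') E0) (linear_subst_row3 0 c' d0).
  by congr linear_subst; rewrite /mat3_mul /=; congr Mat3; field.
move=> D0; have [d0|d0] := eqVneq d 0%R; last exact: main.
have c0 : c != 0%R by apply: contraNneq D0 => c0; rewrite c0 d0 !mulr0 subr0.
have D1 : (b * c - a * d != 0)%R by rewrite -opprB oppr_eq0.
have := linear_substM (main _ _ _ _ D1 c0) linear_subst_swap23.
by congr linear_subst; rewrite /mat3_mul /=; congr Mat3; ring.
Qed.

Lemma linear_subst_block12 (a b c d : R) : (a * d - b * c != 0)%R ->
  linear_subst (Mat3 a b 0 c d 0 0 0 1)%R.
Proof.
move=> D0; pose T := linear_substM linear_subst_swap12 linear_subst_swap23.
have := linear_substM (linear_substM linear_subst_swap23 linear_subst_swap12)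
  (linear_substM (linear_subst_block23 D0) T).
by congr linear_subst; rewrite /mat3_mul /=; congr Mat3; ring.
Qed.

Lemma linear_subst_diag (a b c : R) : a != 0%R -> b != 0%R -> c != 0%R ->
  linear_subst (mat3_diag a b c).
Proof.
move=> a0 b0 c0; have := linear_substM (linear_subst_row1 0 0 a0)
  (linear_substM (linear_subst_row2 0 0 b0) (linear_subst_row3 0 0 c0)).
by congr linear_subst; rewrite /mat3_mul /mat3_diag /=; congr Mat3; ring.
Qed.

End LinearSubstitution.

Lemma local_countE q (p r : nat) : prime p ->
  local_count q p r = cnt3 (p ^ r) (p ^ r) (p ^ r)
    (fun v => ~~ pdvd3 p%:Z v && ((p ^ r)%:Z %| qeval q v)%Z).
Proof.
move=> pp; rewrite cnt3E /local_count; apply: eq_card => -[[x y] z].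
by rewrite !inE /= /pdvd3 /= !dvdzE.
Qed.

Lemma periodic3_local (p r : nat) q : (0 < r)%N ->
  periodic3 (p ^ r) (fun v => ~~ pdvd3 p%:Z v && ((p ^ r)%:Z %| qeval q v)%Z).
Proof.
move=> r0 x y z x' y' z' hx hy hz.
by rewrite (periodic3_pdvd (dvdn_exp r0 (dvdnn p)) hx hy hz) (periodic3_qeval q hx hy hz).
Qed.

Lemma mat3_app_adjr (M : mat3 int) x y z :
  mat3_app M (mat3_app (mat3_adj M) (x, y, z)) =
  (mat3_det M * x, mat3_det M * y, mat3_det M * z).
Proof. by rewrite /mat3_det /mat3_app /=; congr (_, _, _); ring. Qed.

(** * Substitutions that preserve primitive zeros and transform densities *)

Section ZeroEquiv.
Variable R : realType.

(** All that the counting problem has to know about a substitution with [q o M = c q1]; injectivity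
    of [M] is implied by the nonzero determinant. Divided by powers of [p], [ze_local] says that the
    density of [q] at [p] is [p^(v_p c - v_p (det M))] times that of [q1]; it is restricted to
    [2 <= r] because the primitivity of [M v] at [p] is read off from [p^2] dividing [q1 v]. The
    divisibility [ze_det_dvd] makes the discriminant decrease. *)
Record zero_equiv (q q1 : ternary_form) (M : mat3 int) (c : nat) : Prop := ZeroEquiv {
  ze_c_gt0 : (0 < c)%N;
  ze_det_gt0 : (0 < `|mat3_det M|)%N;
  ze_det_dvd : (`|mat3_det M| %| c)%N;
  ze_pull : form_pull M q = form_scale c%:Z q1;
  ze_into : forall v, primitive_vec v -> qeval q1 v = 0 -> primitive_vec (mat3_app M v);
  ze_onto : forall v, primitive_vec v -> qeval q v = 0 ->
    exists2 u, primitive_vec u /\ qeval q1 u = 0 & v = mat3_app M u;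
  ze_local : forall p r : nat, prime p -> (2 <= r)%N ->
    (p ^ logn p `|mat3_det M| * local_count q p (r + logn p c) =
     p ^ (3 * logn p c) * local_count q1 p r)%N;
  ze_subst : linear_subst (mat3_int R M) }.

Lemma zero_equivM q q1 q2 M N c d :
  zero_equiv q q1 M c -> zero_equiv q1 q2 N d -> zero_equiv q q2 (mat3_mul M N) (c * d).
Proof.
move=> [c0 M0 Mc qM Mi Mo Ml Ms] [d0 N0 Nd qN Ni No Nl Ns]; split.
- by rewrite muln_gt0 c0.
- by rewrite mat3_detM abszM muln_gt0 M0.
- by rewrite mat3_detM abszM dvdn_mul.
- by rewrite form_pullM qM form_pull_scale qN PoszM form_scaleM.
- move=> v pv q0; rewrite mat3_appM; apply: Mi; first exact: Ni.
  have := qeval_int_pull N q1 v; rewrite qN qeval_scale q0 mulr0.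
  by move=> <-.
- move=> v pv /(Mo _ pv)[u [pu /(No _ pu)[t tP uE]] vE].
  by exists t => //; rewrite vE uE mat3_appM.
- move=> p r pp r2; rewrite mat3_detM abszM !lognM // mulnDr !expnD.
  have := Ml p (r + logn p d)%N pp (leq_trans r2 (leq_addr _ _)).
  have := Nl p r pp r2; rewrite (addnC (logn p c)) addnA => E2 E1.
  rewrite mulnAC E1 -mulnA (mulnC _ (p ^ logn p `|mat3_det N|)%N) E2 mulnA.
  by rewrite !mulSn !mul0n !expnD.
- by rewrite mat3_intM; exact: linear_substM.
Qed.

Lemma zero_equiv_unimodular q M : `|mat3_det M|%N = 1%N ->
  linear_subst (mat3_int R M) -> zero_equiv q (form_pull M q) M 1.
Proof.
move=> M1 Ms; split; rewrite ?M1 ?form_scale1 //.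
- move=> v /primitive_vecP pv _; apply/primitive_vecP => p pp.
  apply: contra (pv p pp); apply: pdvd3_app_det => //; rewrite M1.
  by rewrite dvdn1; case: eqP pp => // ->.
- move=> [[x y] z] pv q0.
  have DD : mat3_det M * mat3_det M = 1.
    by case: (mat3_det M) M1 => -[|[|?]].
  pose u := mat3_app (mat3_adj M) (mat3_det M * x, mat3_det M * y, mat3_det M * z).
  have vE : (x, y, z) = mat3_app M u.
    by rewrite /u mat3_app_adjr !mulrA DD !mul1r.
  exists u => //; split; last by rewrite qeval_int_pull -vE.
  apply/primitive_vecP => p pp; apply/negP => /(pdvd3_app M).
  by rewrite -vE; apply/negP; move/primitive_vecP: pv => /(_ p pp).
- move=> p r pp r2; rewrite logn1 muln0 !mul1n addn0 !local_countE //.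
  rewrite -(@cnt3_app _ _ M) ?expn_gt0 ?prime_gt0 //; first last.
  + by rewrite M1 coprimen1.
  + by apply: periodic3_local; apply: leq_trans r2.
  apply: eq_cnt3 => v; rewrite qeval_int_pull; congr (~~ _ && _).
  apply/idP/idP; last exact: pdvd3_app.
  by apply: pdvd3_app_det => //; rewrite M1 dvdn1; case: eqP pp => // ->.
Qed.

(** At primes other than [p] the diagonal matrix is invertible. At [p], the first divisibility
    hypothesis puts every solution for [q] modulo [p^(r + a)] in the image of [M]; dividing the
    coordinates by [p^e1], [p^e2], [p^e3] leaves boxes made of full periods modulo [p^r] for [q1],
    and the second hypothesis identifies the primitivity conditions. *)
Lemma zero_equiv_scale q q1 (p e1 e2 e3 a : nat) :
  prime p -> (0 < a)%N -> (e1 + e2 + e3 <= a)%N ->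
  form_pull (mat3_diag (p ^ e1)%:Z (p ^ e2)%:Z (p ^ e3)%:Z) q = form_scale (p ^ a)%:Z q1 ->
  (forall v, ~~ pdvd3 p%:Z v -> (p%:Z %| qeval q v)%Z ->
     [&& ((p ^ e1)%:Z %| v.1.1)%Z, ((p ^ e2)%:Z %| v.1.2)%Z & ((p ^ e3)%:Z %| v.2)%Z]) ->
  (forall v, ~~ pdvd3 p%:Z v -> (p%:Z ^+ 2 %| qeval q1 v)%Z ->
     ~~ pdvd3 p%:Z (mat3_app (mat3_diag (p ^ e1)%:Z (p ^ e2)%:Z (p ^ e3)%:Z) v)) ->
  zero_equiv q q1 (mat3_diag (p ^ e1)%:Z (p ^ e2)%:Z (p ^ e3)%:Z) (p ^ a).
Proof.
move=> pp a0 ea qM H1 H2; set M := mat3_diag _ _ _ in qM H2 *.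
have p0 : (0 < p)%N := prime_gt0 pp.
have detM : `|mat3_det M|%N = (p ^ (e1 + e2 + e3))%N.
  rewrite /mat3_det /= !(mulr0, mul0r, subr0, addr0) !expnD -!PoszM absz_nat.
  by rewrite mulnA.
have qMv v : qeval q (mat3_app M v) = (p ^ a)%:Z * qeval q1 v.
  by rewrite -qeval_int_pull qM qeval_scale intz.
have pa0 : (p ^ a)%:Z != 0 by rewrite eqz_nat -lt0n expn_gt0 p0.
have dvdM l v : pdvd3 l v -> pdvd3 l (mat3_app M v) by exact: pdvd3_app.
split.
- by rewrite expn_gt0 p0.
- by rewrite detM expn_gt0 p0.
- by rewrite detM dvdn_exp2l.
- exact: qM.
- move=> v /primitive_vecP pv q0; apply/primitive_vecP => l pl.
  have [->|lp] := eqVneq l p; first by apply: H2; rewrite ?pv // q0 dvdz0.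
  apply: contra (pv l pl); apply: pdvd3_app_det => //.
  by rewrite detM; apply: contra lp; rewrite Euclid_dvdX // => /andP[]; rewrite dvdn_prime2.
- move=> [[x y] z] /primitive_vecP pv q0.
  have /and3P[/= /dvdzP[x' xE] /dvdzP[y' yE] /dvdzP[z' zE]] := H1 _ (pv p pp) (eq_ind_r (fun t => (_ %| t)%Z) (dvdz0 _) q0).
  have vE : (x, y, z) = mat3_app M (x', y', z').
    by rewrite /M /mat3_app /= xE yE zE; congr (_, _, _); ring.
  exists (x', y', z') => //; split.
    apply/primitive_vecP => l pl; apply/negP => /dvdM.
    by rewrite -vE; apply/negP/pv.
  by apply: (mulfI pa0); rewrite -qMv -vE mulr0.
- move=> l r pl r2; rewrite detM !lognX.
  have [lp|lp] := eqVneq l p; last first.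
    rewrite !logn_prime // (negPf lp) /= !muln0 !mul1n addn0.
    rewrite !local_countE // -(@cnt3_app _ _ M) ?expn_gt0 ?prime_gt0 //; first last.
    + rewrite detM coprimeXl // coprimeXr // prime_coprime // dvdn_prime2 //.
    + by apply: periodic3_local; apply: leq_trans r2.
    apply: eq_cnt3 => v; rewrite qMv; congr (~~ _ && _).
      apply/idP/idP; last exact: pdvd3_app.
      apply: pdvd3_app_det => //.
      by rewrite detM; apply: contra lp; rewrite Euclid_dvdX // => /andP[]; rewrite dvdn_prime2.
    rewrite Gauss_dvdzr // coprimezE !absz_nat.
    by rewrite coprimeXl // coprimeXr // prime_coprime // dvdn_prime2.
  subst l; rewrite logn_prime // eqxx !muln1 !local_countE //.
  have [u1 u2 u3] : [/\ (r + a = e1 + (r + (a - e1)))%N, (r + a = e2 + (r + (a - e2)))%N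
      & (r + a = e3 + (r + (a - e3)))%N] by split; lia.
  have -> : cnt3 (p ^ (r + a)) (p ^ (r + a)) (p ^ (r + a))
      (fun v => ~~ pdvd3 p v && ((p ^ (r + a))%N %| qeval q v)%Z) =
      cnt3 (p ^ e1 * p ^ (r + (a - e1))) (p ^ e2 * p ^ (r + (a - e2))) (p ^ e3 * p ^ (r + (a - e3)))
      (fun v => ~~ pdvd3 p v && ((p ^ (r + a))%N %| qeval q v)%Z).
    by rewrite -!expnD -u1 -u2 -u3.
  rewrite cnt3_scale ?expn_gt0 ?p0 //; last first.
    move=> v /andP[pv qv]; apply: H1 => //; apply: dvdz_trans qv.
    by rewrite dvdzE !absz_nat dvdn_exp // addn_gt0 a0 orbT.
  rewrite (@eq_cnt3 _ _ _ _ (fun v => ~~ pdvd3 p v && ((p ^ r)%N %| qeval q1 v)%Z)).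
    rewrite !(expnD p r) cnt3_mul; last by apply: periodic3_local; apply: leq_trans r2.
    rewrite mulnA -!expnD; congr (p ^ _ * _)%N; lia.
  move=> v; rewrite -/M qMv addnC expnD PoszM dvdz_mul2l //.
  case qv: (_ %| qeval q1 v)%Z; rewrite ?andbF // !andbT; apply/idP/idP.
    by apply: contra; exact: dvdM.
  move=> pv; apply: H2 => //; apply: dvdz_trans qv.
  by rewrite -[(_ ^+ 2)]/((p ^ 2)%:Z) dvdzE !absz_nat dvdn_exp2l.
- have := linear_subst_diag (a := ((p ^ e1)%:Z%:~R : R)) (b := (p ^ e2)%:Z%:~R) (c := (p ^ e3)%:Z%:~R).
  rewrite !intr_eq0 !eqz_nat -!lt0n !expn_gt0 p0 => /(_ isT isT isT).
  by rewrite /M /mat3_int /mat3_diag /= mulr0z.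
Qed.

End ZeroEquiv.

(** * Reduction to the form x1 x2 - n x3^2 *)

Definition pdvd6 (d : int) (q : ternary_form) : bool :=
  [&& (d %| q11 q)%Z, (d %| q12 q)%Z, (d %| q13 q)%Z, (d %| q22 q)%Z, (d %| q23 q)%Z
    & (d %| q33 q)%Z].

Lemma dvdz_biggcd (d : int) (s : seq int) :
  (d %| \big[gcdz/0]_(c <- s) c)%Z = all (fun c => (d %| c)%Z) s.
Proof.
elim: s => [|c s IH]; first by rewrite big_nil dvdz0.
by rewrite big_cons dvdz_gcd IH.
Qed.

Lemma primitive_formP q :
  reflect (forall p : nat, prime p -> ~~ pdvd6 p%:Z q) (primitive_form q).
Proof.
rewrite /primitive_form.
set s := [:: _; _; _; _; _; _].
have H d : pdvd6 d q = (d %| \big[gcdz/0]_(c <- s) c)%Z.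
  by rewrite dvdz_biggcd /pdvd6 /= andbT.
have g0 : (0 <= \big[gcdz/0]_(c <- s) c)%R by rewrite /s big_cons /gcdz.
apply: (iffP eqP) => [g1 p pp|K].
  by rewrite H g1 dvdzE /= dvdn1; case: eqP pp => // ->.
have E := gez0_abs g0; set g := (\big[_/_]_(_ <- _) _) in H g0 E *.
have [g0'|g_gt] := posnP `|g|%N.
  by have := K 2%N isT; rewrite H -E g0' dvdz0.
rewrite -E; congr Posz; apply/eqP; rewrite eqn_leq g_gt andbT leqNgt.
apply/negP => g_gt1; have := K _ (pdiv_prime g_gt1).
by rewrite H dvdzE pdiv_dvd.
Qed.

Lemma pdvd6_pull d M q : pdvd6 d q -> pdvd6 d (form_pull M q).
Proof.
case: q => a1 a2 a3 a4 a5 a6 /and5P[/=].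
move=> /dvdzP[b1 ->] /dvdzP[b2 ->] /dvdzP[b3 ->] /dvdzP[b4 ->] /andP[/dvdzP[b5 ->] /dvdzP[b6 ->]].
rewrite (_ : TernaryForm _ _ _ _ _ _ = form_scale d (TernaryForm b1 b2 b3 b4 b5 b6)).
  by rewrite form_pull_scale /pdvd6 /= !dvdz_mulr.
by rewrite /form_scale /= ![d * _]mulrC.
Qed.

Lemma primitive_pull M q : `|mat3_det M|%N = 1%N ->
  primitive_form q -> primitive_form (form_pull M q).
Proof.
move=> M1 /primitive_formP pq; apply/primitive_formP => p pp.
apply: contra (pq p pp) => /(pdvd6_pull (mat3_adj M)).
have DD : mat3_det M ^+ 2 = 1 by case: (mat3_det M) M1 => -[|[|?]].
rewrite -form_pullM (_ : form_pull _ q = form_scale (mat3_det M ^+ 2) q).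
  by rewrite DD form_scale1.
by rewrite /form_pull /form_scale /mat3_det /=; congr TernaryForm; ring.
Qed.

Lemma Euclid_dvdzM (p : nat) (a b : int) : prime p ->
  (p%:Z %| a * b)%Z = (p%:Z %| a)%Z || (p%:Z %| b)%Z.
Proof. by move=> pp; rewrite !dvdzE abszM Euclid_dvdM. Qed.

(** A form vanishing at [(1, 0, 0)], the linear form that multiplies [x] having been turned into a
    multiple of [y]. The reduction aims at [g = 1] and [c = d = 0], that is, at [x y - n z^2]. *)
Definition nf_form (g c d e : int) : ternary_form := TernaryForm 0 g 0 c d e.

Lemma qeval_nf g c d e (x y z : int) :
  qeval (nf_form g c d e) (x, y, z) = g * x * y + c * y ^+ 2 + d * y * z + e * z ^+ 2.
Proof. by rewrite /qeval /= !intz; ring. Qed.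

Lemma disc_nf g c d e : disc (nf_form g c d e) = - (g ^+ 2 * e).
Proof. by rewrite disc_explicit /=; ring. Qed.

Lemma primitive_nfP g c d e :
  reflect (forall p : nat, prime p ->
      ~~ [&& (p%:Z %| g)%Z, (p%:Z %| c)%Z, (p%:Z %| d)%Z & (p%:Z %| e)%Z])
    (primitive_form (nf_form g c d e)).
Proof.
by apply: (iffP (primitive_formP _)) => H p pp; have := H p pp;
  rewrite /pdvd6 /= dvdz0.
Qed.

Lemma isotropic_nf g c d e : isotropic (nf_form g c d e).
Proof. by exists (1, 0, 0); split => //; rewrite qeval_nf; ring. Qed.

(** * Unimodular normalisation at a given zero *)

Section Reduction.
Variable R : realType.

Definition unimodular_subst (M : mat3 int) : Prop :=
  `|mat3_det M|%N = 1%N /\ linear_subst (mat3_int R M).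

Lemma unimodular_substM M N :
  unimodular_subst M -> unimodular_subst N -> unimodular_subst (mat3_mul M N).
Proof.
move=> [M1 Ms] [N1 Ns]; split; first by rewrite mat3_detM abszM M1 N1.
by rewrite mat3_intM; exact: linear_substM.
Qed.

Lemma unimodular_block23 (a b c d : int) : `|(a * d - b * c)%R|%N = 1%N ->
  unimodular_subst (Mat3 1 0 0 0 a b 0 c d).
Proof.
move=> D; split; first by rewrite -D /mat3_det /=; congr absz; ring.
have := @linear_subst_block23 R a%:~R b%:~R c%:~R d%:~R.
rewrite -!intrM -intrB intr_eq0 -absz_eq0 D => /(_ isT).
by rewrite /mat3_int /= mulr0z.
Qed.

Lemma unimodular_block12 (a b c d : int) : `|(a * d - b * c)%R|%N = 1%N ->
  unimodular_subst (Mat3 a b 0 c d 0 0 0 1).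
Proof.
move=> D; split; first by rewrite -D /mat3_det /=; congr absz; ring.
have := @linear_subst_block12 R a%:~R b%:~R c%:~R d%:~R.
rewrite -!intrM -intrB intr_eq0 -absz_eq0 D => /(_ isT).
by rewrite /mat3_int /= mulr0z.
Qed.

Lemma unimodular_row1 (a b : int) : unimodular_subst (Mat3 1 a b 0 1 0 0 0 1).
Proof.
split; first by rewrite /mat3_det /= (_ : _ - _ + _ = 1) //; ring.
have := @linear_subst_row1 R 1 a%:~R b%:~R (oner_neq0 R).
by rewrite /mat3_int /= mulr0z.
Qed.

Lemma bezout_block (y z : int) : exists a b c d : int,
  [/\ `|(a * d - b * c)%R|%N = 1%N, y = a * gcdz y z & z = c * gcdz y z].
Proof.
have [g0|g0] := eqVneq (gcdz y z) 0.
  move/eqP: (g0); rewrite gcdz_eq0 => /andP[/eqP-> /eqP->].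
  by exists 1, 0, 0, 1; rewrite /gcdz /= !mulr0.
have /dvdzP[a yE] := dvdz_gcdl y z; have /dvdzP[c zE] := dvdz_gcdr y z.
have [u [v uvE]] := Bezoutz y z.
exists a, (- v), c, u; split=> //; rewrite (_ : _ - _ = 1) //.
set g := gcdz y z in g0 yE zE uvE *.
apply: (mulIf g0); transitivity (u * (a * g) + v * (c * g)); first by ring.
by rewrite -yE -zE mul1r.
Qed.

(** Two Bezout blocks: one collects the last two coordinates into their gcd, the other combines this
    gcd with the first coordinate. *)
Lemma unimodular_first_column v : primitive_vec v ->
  exists2 U, unimodular_subst U & mat3_app U (1, 0, 0) = v.
Proof.
case: v => [[x y] z] /eqP; rewrite -gcdzA => xyz1.
have [a [b [c [d [D yE zE]]]]] := bezout_block y z.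
have [a' [b' [c' [d' [D' xE hE]]]]] := bezout_block x (gcdz y z).
rewrite xyz1 !mulr1 in xE hE.
exists (mat3_mul (Mat3 1 0 0 0 a b 0 c d) (Mat3 a' b' 0 c' d' 0 0 0 1)).
  by apply: unimodular_substM; [apply: unimodular_block23|apply: unimodular_block12].
rewrite mat3_appM /mat3_app /=; congr (_, _, _); first by rewrite xE; ring.
  by rewrite [in RHS]yE hE; ring.
by rewrite [in RHS]zE hE; ring.
Qed.

Definition polar (q : ternary_form) (u v : int * int * int) : int :=
  let: (x, y, z) := u in let: (x', y', z') := v in
  2 * q11 q * x * x' + q12 q * (x * y' + x' * y) + q13 q * (x * z' + x' * z)
    + 2 * q22 q * y * y' + q23 q * (y * z' + y' * z) + 2 * q33 q * z * z'.

Lemma polar_pull M q u v :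
  polar (form_pull M q) u v = polar q (mat3_app M u) (mat3_app M v).
Proof. by case: u => [[x y] z]; case: v => [[x' y'] z']; rewrite /polar /=; ring. Qed.

(** Move [v] to [(1, 0, 0)] and let [g] be the gcd of the two remaining coefficients in its row.
    Then [g] generates the values of the polar form at [v]; this last clause is what later bounds
    the new [g] when the zero is changed. *)
Lemma nf_of_zero q v : primitive_vec v -> qeval q v = 0 -> disc q != 0 ->
  exists M g c d e, [/\ unimodular_subst M, form_pull M q = nf_form g c d e, 0 < g
    & forall u, (g %| polar q v u)%Z].
Proof.
move=> pv q0 D0; have [U Uu Uv] := unimodular_first_column pv.
have U1 : `|mat3_det U|%N = 1%N := proj1 Uu.
set q' := form_pull U q.
have q11' : q11 q' = 0.
  have := qeval_int_pull U q (1, 0, 0); rewrite Uv q0 -/q' /qeval !intz => <-.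
  by ring.
have q'E : form_pull U q = q' by [].
clearbody q'.
have [a [b [c [d [D g2 g3]]]]] := bezout_block (q12 q') (q13 q').
set g := gcdz _ _ in g2 g3.
(* If [g] were zero, [x] would not occur in the form and the discriminant would vanish. *)
have g0 : g != 0.
  apply: contraNneq D0 => g0; have := disc_pull U q; rewrite q'E disc_explicit.
  rewrite q11' g2 g3 g0 (_ : _ - _ - _ - _ = 0) => [/esym/eqP|]; last by ring.
  by rewrite mulf_eq0 expf_eq0 /= => /orP[/eqP U0|//]; move: U1; rewrite U0.
have g_gt0 : 0 < g by rewrite lt_def g0 /g /gcdz.
(* [s] is a sign; inserting it into [N] makes the new coefficient [g] and not [- g]. *)
pose s := a * d - b * c.
have s1 : s * s = 1 by rewrite /s; case: (a * d - b * c) D => -[|[|?]].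
pose N := Mat3 1 0 0 0 (s * d) (- c) 0 (- (s * b)) a.
have Nu : unimodular_subst N.
  apply: unimodular_block23.
  have -> : s * d * a - - c * - (s * b) = s * s by rewrite /s; ring.
  by rewrite s1.
have MM := unimodular_substM Uu Nu.
exists (mat3_mul U N), g, (q22 (form_pull N q')), (q23 (form_pull N q')), (q33 (form_pull N q')).
have nfE : form_pull (mat3_mul U N) q = nf_form g (q22 (form_pull N q')) (q23 (form_pull N q')) (q33 (form_pull N q')).
  rewrite form_pullM q'E /nf_form; rewrite {1}/form_pull /=; congr TernaryForm.
  - by rewrite q11'; ring.
  - by transitivity (s * s * g); [rewrite q11' g2 g3 /s; ring | rewrite s1 mul1r].
  - by rewrite q11' g2 g3; ring.
split=> // -[[x y] z].
have := mat3_app_adjr (mat3_mul U N) x y z; have [detM _] := MM.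
set D' := mat3_det _ in detM *; set w := mat3_app (mat3_adj _) _ => wE.
have : polar (form_pull (mat3_mul U N) q) (1, 0, 0) w = D' * polar q v (x, y, z).
  rewrite polar_pull wE mat3_appM (_ : mat3_app N (1, 0, 0) = (1, 0, 0)).
    by rewrite Uv; case: (v) => [[? ?] ?]; rewrite /polar; ring.
  by rewrite /mat3_app /=; congr (_, _, _); ring.
rewrite nfE; case: w {wE} => [[w1 w2] w3] E.
have : (g %| D' * polar q v (x, y, z))%Z.
  by rewrite -E /polar /= (_ : _ + _ = w2 * g) ?dvdz_mull //; ring.
by rewrite !dvdzE abszM detM mul1n.
Qed.

Definition reducible (q : ternary_form) : Prop :=
  exists n M c, (0 < n)%N /\ zero_equiv R q (nf_form 1 0 0 (- n%:Z)) M c.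

Lemma reducible_equiv q q1 M c : zero_equiv R q q1 M c -> reducible q1 -> reducible q.
Proof.
move=> qq1 [n [N [d [n0 H]]]]; exists n, (mat3_mul M N), (c * d)%N; split => //.
exact: zero_equivM H.
Qed.

Lemma reducible_unimodular q M : unimodular_subst M -> reducible (form_pull M q) -> reducible q.
Proof. by move=> [M1 Ms]; apply: reducible_equiv; exact: zero_equiv_unimodular. Qed.

(** From [det(M)^2 disc q = c^3 disc q1] and [|det M| <= c] follows [c disc q1 <= disc q]. *)
Lemma zero_equiv_disc q q1 M c : zero_equiv R q q1 M c -> (1 < c)%N ->
  0 < disc q -> 0 < disc q1 < disc q.
Proof.
move=> H c1 D0; have c0 := ze_c_gt0 H.
have := congr1 disc (ze_pull H); rewrite disc_pull disc_scale.
have := ze_det_gt0 H; have := dvdn_leq c0 (ze_det_dvd H).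
have -> : mat3_det M ^+ 2 = (`|mat3_det M|%N)%:Z ^+ 2.
  by rewrite abszE real_normK ?num_real.
set m := `|_|%N => mc m0 E.
have D1 : 0 < disc q1.
  have : 0 < c%:Z ^+ 3 * disc q1 by rewrite -E mulr_gt0 ?exprn_gt0.
  by rewrite pmulr_rgt0 // exprn_gt0.
rewrite D1 /=.
have : c%:Z ^+ 2 * (c%:Z * disc q1) <= c%:Z ^+ 2 * disc q.
  rewrite mulrA -exprSr -E ler_pM2r // lerXn2r ?nnegrE // lez_nat //.
rewrite ler_pM2l ?exprn_gt0 // => H2; apply: lt_le_trans H2.
by rewrite ltr_pMl // ltz_nat.
Qed.

End Reduction.

(** * Descent of the discriminant at a prime dividing [g] *)

Section ReductionCases.
Variable R : realType.
Variable q : ternary_form.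
Hypothesis disc_gt0 : 0 < disc q.
Hypothesis IH : forall q1, primitive_form q1 -> isotropic q1 -> 0 < disc q1 < disc q ->
  reducible R q1.

Let reducible_scale (p a e1 e2 e3 : nat) g c d e :
  prime p -> (0 < a)%N -> (e1 + e2 + e3 <= a)%N ->
  primitive_form (nf_form g c d e) ->
  form_pull (mat3_diag (p ^ e1)%:Z (p ^ e2)%:Z (p ^ e3)%:Z) q =
    form_scale (p ^ a)%:Z (nf_form g c d e) ->
  (forall v, ~~ pdvd3 p%:Z v -> (p%:Z %| qeval q v)%Z ->
     [&& ((p ^ e1)%:Z %| v.1.1)%Z, ((p ^ e2)%:Z %| v.1.2)%Z & ((p ^ e3)%:Z %| v.2)%Z]) ->
  (forall v, ~~ pdvd3 p%:Z v -> (p%:Z ^+ 2 %| qeval (nf_form g c d e) v)%Z ->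
     ~~ pdvd3 p%:Z (mat3_app (mat3_diag (p ^ e1)%:Z (p ^ e2)%:Z (p ^ e3)%:Z) v)) ->
  reducible R q.
Proof.
move=> pp a0 ea pq1 qE H1 H2.
have ZE := zero_equiv_scale R pp a0 ea qE H1 H2.
apply: (reducible_equiv ZE); apply: IH => //; first exact: isotropic_nf.
apply: (zero_equiv_disc ZE) => //.
by rewrite -(exp1n a) ltn_exp2r // prime_gt1.
Qed.

Let other_prime (p l : nat) (x : int) : prime p -> prime l -> l != p ->
  (l%:Z %| p%:Z * x)%Z = (l%:Z %| x)%Z.
Proof.
by move=> pp pl lp; rewrite Euclid_dvdzM // [X in X || _]dvdzE /= dvdn_prime2 // (negPf lp).
Qed.

(** Modulo [p] the form is [c y^2] with [c] a unit, so zeros have [p | y]. After [y := p y] the form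
    is divisible by [p], and by [p^2] exactly when [p | e]; in either case the quotient is primitive
    with smaller discriminant. *)
Lemma reduce_middle (p : nat) g c d e : prime p ->
  q = nf_form (p%:Z * g) c (p%:Z * d) (p%:Z * e) -> primitive_form q ->
  reducible R q.
Proof.
move=> pp qE prim_q; have p0 : p%:Z != 0 by rewrite eqz_nat -lt0n prime_gt0.
have pc : ~~ (p%:Z %| c)%Z.
  by move: prim_q; rewrite qE => /primitive_nfP/(_ p pp); rewrite !dvdz_mulr ?dvdzz //= andbT.
have HH v : ~~ pdvd3 p%:Z v -> (p%:Z %| qeval q v)%Z ->
     [&& ((p ^ 0)%:Z %| v.1.1)%Z, ((p ^ 1)%:Z %| v.1.2)%Z & ((p ^ 0)%:Z %| v.2)%Z].
  case: v => [[x y] z] _; rewrite qE qeval_nf /= !expn0 !expn1 !dvd1z andbT /=.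
  rewrite (_ : _ + _ = p%:Z * (g * x * y + d * y * z + e * z ^+ 2) + c * (y * y)); last by ring.
  rewrite rpredDl; last by rewrite dvdz_mulr ?dvdzz.
  by rewrite Euclid_dvdzM // (negPf pc) Euclid_dvdzM // orbb.
have [/dvdzP[e' eE]|pe] := boolP (p%:Z %| e)%Z.
  apply: (@reducible_scale p 2 0 1 0 g c d e') => //.
  - apply/primitive_nfP => l pl; move/primitive_formP: prim_q => /(_ l pl).
    apply: contra => /and4P[lg lc ld le].
    by rewrite qE eE /pdvd6 /= dvdz0 lc (dvdz_mull _ lg) (dvdz_mull _ ld) (dvdz_mull _ (dvdz_mulr _ le)).
  - rewrite qE eE /form_pull /form_scale /= !expn0 !expn1 -mulnn PoszM.
    by congr TernaryForm; ring.
  - move=> [[x y] z] pv; rewrite qeval_nf.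
    apply: contraL => /and3P[/= ].
    rewrite !expn0 expn1 !(mul0r, mul1r, addr0, add0r) => px _ pz.
    have py : ~~ (p%:Z %| y)%Z by apply: contra pv => py; apply/and3P.
    apply/negP => /(dvdz_trans (dvdz_mulr p%:Z (dvdzz p%:Z))).
    case/dvdzP: px => x' ->; case/dvdzP: pz => z' ->.
    rewrite (_ : _ + _ = p%:Z * (g * x' * y + d * y * z' + e' * z' ^+ 2 * p%:Z) + c * (y * y)); last by ring.
    rewrite rpredDl; last by rewrite dvdz_mulr ?dvdzz.
    by rewrite Euclid_dvdzM // (negPf pc) Euclid_dvdzM // (negPf py).
apply: (@reducible_scale p 1 0 1 0 (p%:Z * g) (p%:Z * c) (p%:Z * d) e) => //.
- apply/primitive_nfP => l pl; move/primitive_formP: prim_q => /(_ l pl).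
  apply: contra => /and4P[lg lc ld le].
  rewrite qE /pdvd6 /= dvdz0 lg ld dvdz_mull //= andbT.
  by rewrite -(other_prime _ pp pl) //; apply: contraNneq pe => <-.
- by rewrite qE /form_pull /form_scale /= !expn0 !expn1; congr TernaryForm; ring.
- move=> [[x y] z] pv; rewrite qeval_nf.
  apply: contraL => /and3P[/= ].
  rewrite !expn0 expn1 !(mul0r, mul1r, addr0, add0r) => px _ pz.
  have py : ~~ (p%:Z %| y)%Z by apply: contra pv => py; apply/and3P.
  case/dvdzP: px => x' ->; case/dvdzP: pz => z' ->.
  rewrite (_ : _ + _ = p%:Z ^+ 2 * (g * x' * y + d * y * z' + e * z' ^+ 2) + p%:Z * (c * (y * y))); last by ring.
  rewrite rpredDl; last by rewrite dvdz_mulr ?dvdzz.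
  rewrite expr2 dvdz_mul2l //.
  by rewrite Euclid_dvdzM // (negPf pc) Euclid_dvdzM // (negPf py).
Qed.

(** The analogue for a form congruent to [e z^2]: after [z := p z] the form is divided by [p^2] if
    [p] divides both [g] and [c], and by [p] otherwise. *)
Lemma reduce_last (p : nat) g c d e : prime p ->
  q = nf_form (p%:Z * g) (p%:Z * c) (p%:Z * d) e -> primitive_form q ->
  reducible R q.
Proof.
move=> pp qE prim_q; have p0 : p%:Z != 0 by rewrite eqz_nat -lt0n prime_gt0.
have pe : ~~ (p%:Z %| e)%Z.
  by move: prim_q; rewrite qE => /primitive_nfP/(_ p pp); rewrite !dvdz_mulr ?dvdzz.
have HH v : ~~ pdvd3 p%:Z v -> (p%:Z %| qeval q v)%Z ->
     [&& ((p ^ 0)%:Z %| v.1.1)%Z, ((p ^ 0)%:Z %| v.1.2)%Z & ((p ^ 1)%:Z %| v.2)%Z].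
  case: v => [[x y] z] _; rewrite qE qeval_nf /= !expn0 !expn1 !dvd1z /=.
  rewrite (_ : _ + _ = p%:Z * (g * x * y + c * y ^+ 2 + d * y * z) + e * (z * z)); last by ring.
  rewrite rpredDl; last by rewrite dvdz_mulr ?dvdzz.
  by rewrite Euclid_dvdzM // (negPf pe) Euclid_dvdzM // orbb.
have [/andP[/dvdzP[g' gE] /dvdzP[c' cE]]|pgc] := boolP ((p%:Z %| g)%Z && (p%:Z %| c)%Z).
  apply: (@reducible_scale p 2 0 0 1 g' c' d e) => //.
  - apply/primitive_nfP => l pl; move/primitive_formP: prim_q => /(_ l pl).
    apply: contra => /and4P[lg lc ld le].
    by rewrite qE gE cE /pdvd6 /= dvdz0 le (dvdz_mull _ ld) (dvdz_mull _ (dvdz_mulr _ lg)) (dvdz_mull _ (dvdz_mulr _ lc)).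
  - rewrite qE gE cE /form_pull /form_scale /= !expn0 !expn1 -mulnn PoszM.
    by congr TernaryForm; ring.
  - move=> [[x y] z] pv; rewrite qeval_nf.
    apply: contraL => /and3P[/= ].
    rewrite !expn0 expn1 !(mul0r, mul1r, addr0, add0r) => px py _.
    have pz : ~~ (p%:Z %| z)%Z by apply: contra pv => pz; apply/and3P.
    apply/negP => /(dvdz_trans (dvdz_mulr p%:Z (dvdzz p%:Z))).
    case/dvdzP: px => x' ->; case/dvdzP: py => y' ->.
    rewrite (_ : _ + _ = p%:Z * (g' * x' * y' * p%:Z + c' * y' ^+ 2 * p%:Z + d * y' * z) + e * (z * z)); last by ring.
    rewrite rpredDl; last by rewrite dvdz_mulr ?dvdzz.
    by rewrite Euclid_dvdzM // (negPf pe) Euclid_dvdzM // (negPf pz).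
apply: (@reducible_scale p 1 0 0 1 g c (p%:Z * d) (p%:Z * e)) => //.
- apply/primitive_nfP => l pl; move/primitive_formP: prim_q => /(_ l pl).
  apply: contra => /and4P[lg lc ld le].
  rewrite qE /pdvd6 /= dvdz0 ld !dvdz_mull //=.
  by rewrite -(other_prime _ pp pl) //; apply: contraNneq pgc => <-; rewrite lg lc.
- by rewrite qE /form_pull /form_scale /= !expn0 !expn1; congr TernaryForm; ring.
- move=> [[x y] z] pv; rewrite qeval_nf.
  apply: contraL => /and3P[/= ].
  rewrite !expn0 expn1 !(mul0r, mul1r, addr0, add0r) => px py _.
  have pz : ~~ (p%:Z %| z)%Z by apply: contra pv => pz; apply/and3P.
  case/dvdzP: px => x' ->; case/dvdzP: py => y' ->.
  rewrite (_ : _ + _ = p%:Z ^+ 2 * (g * x' * y' + c * y' ^+ 2 + d * y' * z) + p%:Z * (e * (z * z))); last by ring.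
  rewrite rpredDl; last by rewrite dvdz_mulr ?dvdzz.
  rewrite expr2 dvdz_mul2l //.
  by rewrite Euclid_dvdzM // (negPf pe) Euclid_dvdzM // (negPf pz).
Qed.

(** When the binary part has no nontrivial zero modulo [p], zeros have [p | y] and [p | z]; scaling
    both makes the whole form divisible by [p^2]. *)
Lemma reduce_anisotropic (p : nat) g c d e : prime p ->
  q = nf_form (p%:Z * g) c d e -> primitive_form q ->
  (forall y z : int, (p%:Z %| c * y ^+ 2 + d * y * z + e * z ^+ 2)%Z ->
    (p%:Z %| y)%Z && (p%:Z %| z)%Z) ->
  reducible R q.
Proof.
move=> pp qE prim_q an; have p0 : p%:Z != 0 by rewrite eqz_nat -lt0n prime_gt0.
have HH g' x y z : (p%:Z %| qeval (nf_form (p%:Z * g') c d e) (x, y, z))%Z ->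
    (p%:Z %| y)%Z && (p%:Z %| z)%Z.
  rewrite qeval_nf.
  rewrite (_ : _ + _ = p%:Z * (g' * x * y) + (c * y ^+ 2 + d * y * z + e * z ^+ 2)); last by ring.
  by rewrite rpredDl ?dvdz_mulr ?dvdzz // => /an.
apply: (@reducible_scale p 2 0 1 1 g c d e) => //.
- apply/primitive_nfP => l pl; move/primitive_formP: prim_q => /(_ l pl).
  apply: contra => /and4P[lg lc ld le].
  by rewrite qE /pdvd6 /= dvdz0 lc ld le dvdz_mull.
- rewrite qE /form_pull /form_scale /= !expn0 !expn1 -mulnn PoszM.
  by congr TernaryForm; ring.
- by move=> [[x y] z] _; rewrite qE => /HH; rewrite /= !expn0 !expn1 dvd1z.
- move=> [[x y] z] pv; rewrite qeval_nf; apply: contraL => /and3P[/= ].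
  rewrite !expn0 expn1 !(mul0r, mul1r, addr0, add0r) => px _ _.
  apply/negP => /(dvdz_trans (dvdz_mulr p%:Z (dvdzz p%:Z))).
  case/dvdzP: (px) => x' xE; rewrite [in X in X -> _]xE.
  rewrite (_ : _ + _ = p%:Z * (g * x' * y) + (c * y ^+ 2 + d * y * z + e * z ^+ 2)); last by ring.
  rewrite rpredDl ?dvdz_mulr ?dvdzz // => /an/andP[py pz].
  by move/negP: pv; apply; apply/and3P.
Qed.

End ReductionCases.

Section ReductionTheorem.
Variable R : realType.

Lemma inverse_mod (p : nat) (a b : int) : prime p -> ~~ (p%:Z %| a)%Z ->
  exists t : int, (p%:Z %| b + a * t)%Z.
Proof.
move=> pp pa; have [u [v uv]] := Bezoutz a p%:Z.
have g1 : gcdz a p%:Z = 1.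
  by apply/eqP; rewrite -[_ == 1]/(coprimez _ _) coprimez_sym coprimezE prime_coprime.
exists (- (b * u)); rewrite (_ : _ + _ = b * v * p%:Z) ?dvdz_mull ?dvdzz //.
by rewrite -[X in X + _]mulr1 -g1 -uv; ring.
Qed.

(** For fixed discriminant the induction is on [g]. Let [p] divide [g]. If [c + d t + e t^2] has a
    simple root modulo [p], another zero of the form yields an equivalent one with smaller [g].
    Otherwise the binary part modulo [p] is a multiple of [y^2], or of the square of a linear form
    movable to [z], or anisotropic, and the discriminant can be lowered. *)
Lemma reducible_nf (D : int) :
  (forall q1, primitive_form q1 -> isotropic q1 -> 0 < disc q1 < D -> reducible R q1) ->
  forall (G : nat) g c d e, 0 < g -> g <= G%:Z -> primitive_form (nf_form g c d e) ->
    0 < disc (nf_form g c d e) -> disc (nf_form g c d e) = D -> reducible R (nf_form g c d e).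
Proof.
move=> IH; elim=> [|G IHG] g c d e g0 gG pq D0 DE; first by move: (lt_le_trans g0 gG).
have [g1|g1] := eqVneq g 1.
  (* For [g = 1] the terms [c y^2] and [d y z] are absorbed by replacing [x] with
     [x - c y - d z]. *)
  have e0 : e < 0 by move: D0; rewrite disc_nf g1 expr1n mul1r oppr_gt0.
  apply: (reducible_unimodular (unimodular_row1 R (- c) (- d))).
  exists `|e|%N, (mat3_diag 1 1 1), (1 * 1)%N; rewrite absz_gt0 lt_eqF //; split => //.
  rewrite abszE ltr0_norm // opprK.
  have U1 : unimodular_subst R (mat3_diag 1 1 1) by have := unimodular_row1 R 0 0.
  have := zero_equiv_unimodular (nf_form 1 0 0 e) U1.1 U1.2.
  have -> : form_pull (Mat3 1 (- c) (- d) 0 1 0 0 0 1) (nf_form g c d e) = nf_form 1 0 0 e.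
    by rewrite g1 /form_pull /nf_form /=; congr TernaryForm; ring.
  have -> // : form_pull (mat3_diag 1 1 1) (nf_form 1 0 0 e) = nf_form 1 0 0 e.
  by rewrite /form_pull /nf_form /=; congr TernaryForm; ring.
have g_gt1 : (1 < `|g|)%N by rewrite -ltz_nat abszE gtr0_norm // lt_neqAle eq_sym g1.
have pp := pdiv_prime g_gt1; set p := pdiv _ in pp.
have pg : (p%:Z %| g)%Z by rewrite dvdzE pdiv_dvd.
have IHq : forall q1, primitive_form q1 -> isotropic q1 ->
    0 < disc q1 < disc (nf_form g c d e) -> reducible R q1 by rewrite DE.
have [smooth|nosmooth] := pselect (exists t : int,
    (p%:Z %| c + d * t + e * t ^+ 2)%Z /\ ~~ (p%:Z %| d + 2 * e * t)%Z).
  have [t [pF pdF]] := smooth.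
  set F := c + d * t + e * t ^+ 2 in pF.
  set l := gcdz F g.
  have l0 : 0 < l by rewrite lt_def /l gcdz_eq0 (gt_eqF g0) andbF.
  have /dvdzP[F' FE] : (l %| F)%Z := dvdz_gcdl _ _.
  have /dvdzP[g' gE] : (l %| g)%Z := dvdz_gcdr _ _.
  have cop : coprimez F' g'.
    have [u [v uv]] := Bezoutz F g.
    apply/coprimezP; exists (u, v); apply: (mulIf (lt0r_neq0 l0)) => /=.
    rewrite mul1r; transitivity (u * (F' * l) + v * (g' * l)); first by ring.
    by rewrite -FE -gE.
  (* The point [(- F, g, g t)] is a zero for every [t]; division by [l = gcd(F, g)] makes it
     primitive. *)
  pose v : int * int * int := (- F', g', g' * t).
  have pv : primitive_vec v.
    apply/primitive_vecP => r pr; apply/negP => /and3P[/= ]; rewrite rpredN => rF rg _.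
    have : (r%:Z %| gcdz F' g')%Z by rewrite dvdz_gcd rF rg.
    by move: cop; rewrite /coprimez => /eqP->; rewrite dvdzE /= dvdn1; case: eqP pr => // ->.
  have qv : qeval (nf_form g c d e) v = 0.
    rewrite qeval_nf; transitivity (g' ^+ 2 * F - F' * (g * g')); first by rewrite /F; ring.
    by rewrite FE gE; ring.
  have [M [h [c' [d' [e' [Mu ME h0 hdvd]]]]]] := nf_of_zero R pv qv (lt0r_neq0 D0).
  apply: (reducible_unimodular Mu); rewrite ME.
  have [M1 _] := Mu.
  have DM : disc (nf_form h c' d' e') = D.
    rewrite -ME disc_pull DE (_ : mat3_det M ^+ 2 = 1) ?mul1r //.
    by case: (mat3_det M) M1 => -[|[|?]].
  apply: IHG => //; last 2 first.
  - by rewrite -ME; apply: primitive_pull.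
  - by rewrite DM -DE.
  suff hg : h < g by rewrite -ltzD1 -PoszD addn1; exact: lt_le_trans hg gG.
  (* The polar form at [v] takes the values [g' g], [g' (c - e t^2)] and [g' (d + 2 e t)] on the
     basis, so [h] divides [g' E] and [h l] divides [g E]. Here [E] divides [l], but [p] divides [l]
     and not [E], the root being simple; hence [E < l] and [h < g]. *)
  pose E := gcdz g (gcdz (c - e * t ^+ 2) (d + 2 * e * t)).
  have El : (E %| l)%Z.
    have EF : (E %| F)%Z.
      rewrite (_ : F = (c - e * t ^+ 2) + (d + 2 * e * t) * t); last by rewrite /F; ring.
      rewrite rpredD //; first exact: dvdz_trans (dvdz_gcdr _ _) (dvdz_gcdl _ _).
      by rewrite dvdz_mulr // (dvdz_trans (dvdz_gcdr _ _) (dvdz_gcdr _ _)).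
    by rewrite dvdz_gcd EF dvdz_gcdl.
  have E0 : 0 < E by rewrite lt_def /E gcdz_eq0 (gt_eqF g0).
  have pl : (p%:Z %| l)%Z by rewrite dvdz_gcd pF pg.
  have pE : ~~ (p%:Z %| E)%Z.
    by apply: contra pdF => pE; apply: dvdz_trans pE (dvdz_trans (dvdz_gcdr _ _) (dvdz_gcdr _ _)).
  have El' : E < l.
    rewrite lt_neqAle; apply/andP; split; first by apply: contraNneq pE => ->.
    have /dvdn_leq : (`|E| %| `|l|)%N := El.
    by rewrite absz_gt0 gt_eqF // -lez_nat !abszE !gtr0_norm // => ->.
  have hl : (h * l %| g * E)%Z.
    have key x : (h %| g' * x)%Z -> (h * l %| g * x)%Z.
      by rewrite gE => hx; rewrite mulrAC dvdz_mul ?dvdzz.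
    have [u [u' uE]] := Bezoutz g (gcdz (c - e * t ^+ 2) (d + 2 * e * t)).
    have [s [s' sE]] := Bezoutz (c - e * t ^+ 2) (d + 2 * e * t).
    rewrite /E -uE -sE mulrDr rpredD //.
      rewrite mulrCA dvdz_mull // key //.
      have := hdvd (0, 1, 0); rewrite /polar /=.
      have := hdvd (1, 0, 0); rewrite /polar /=.
      by move=> + _; congr (_ %| _)%Z; ring.
    rewrite mulrCA dvdz_mull // mulrDr rpredD // mulrCA dvdz_mull // key //.
      have := hdvd (0, 1, 0); rewrite /polar /= => H.
      rewrite (_ : g' * _ = - F' * g + 2 * c * g' + d * (g' * t)).
        by move: H; congr (_ %| _)%Z; ring.
      have -> : - F' * g = - (F * g') by rewrite FE gE; ring.
      by rewrite /F; ring.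
    by have := hdvd (0, 0, 1); rewrite /polar /=; congr (_ %| _)%Z; ring.
  have : h * l <= g * E.
    have /dvdn_leq : (`|(h * l)%R| %| `|(g * E)%R|)%N := hl.
    rewrite absz_gt0 mulf_neq0 ?gt_eqF // => /(_ isT).
    by rewrite -lez_nat !abszE !gtr0_norm ?mulr_gt0.
  have : g * E < g * l by rewrite ltr_pM2l.
  by move=> H1 H2; have := le_lt_trans H2 H1; rewrite ltr_pM2r.
have dblroot t : (p%:Z %| c + d * t + e * t ^+ 2)%Z -> (p%:Z %| d + 2 * e * t)%Z.
  by move=> pF; apply/negPn/negP => pdF; apply: nosmooth; exists t.
case/dvdzP: (pg) => g' gE; rewrite mulrC in gE.
have [pe|pe] := boolP (p%:Z %| e)%Z.
  have pd : (p%:Z %| d)%Z.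
    (* With [p | e] and [d] a unit, the linear congruence [c + d t = 0] would provide a simple
       root. *)
    apply/negPn/negP => pd; have [t pt] := inverse_mod c pp pd.
    move/negP: (pd); apply.
    have p1 : (p%:Z %| c + d * t + e * t ^+ 2)%Z by rewrite rpredD // dvdz_mulr.
    have p2 : (p%:Z %| 2 * e * t)%Z by rewrite dvdz_mulr // dvdz_mull.
    by have := dblroot t p1; rewrite rpredDr.
  case/dvdzP: (pe) => e' eE; case/dvdzP: (pd) => d' dE; rewrite mulrC in eE; rewrite mulrC in dE.
  apply: (reduce_middle D0 IHq pp (g := g') (c := c) (d := d') (e := e')) => //.
  by rewrite gE eE dE.
have [[t pt]|noroot] := pselect (exists t : int, (p%:Z %| c + d * t + e * t ^+ 2)%Z).
  have pdt := dblroot t pt.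
  have Mu : unimodular_subst R (Mat3 1 0 0 0 1 0 0 t 1).
    by apply: unimodular_block23; rewrite mulr1 mul0r subr0.
  apply: (reducible_unimodular Mu).
  have pullE : form_pull (Mat3 1 0 0 0 1 0 0 t 1) (nf_form g c d e) =
      nf_form g (c + d * t + e * t ^+ 2) (d + 2 * e * t) e.
    by rewrite /form_pull /nf_form /=; congr TernaryForm; ring.
  have DD : disc (nf_form g (c + d * t + e * t ^+ 2) (d + 2 * e * t) e) = disc (nf_form g c d e).
    by rewrite !disc_nf.
  have ppull : primitive_form (nf_form g (c + d * t + e * t ^+ 2) (d + 2 * e * t) e).
    by rewrite -pullE; apply: primitive_pull => //; exact: Mu.1.
  rewrite pullE.
  case/dvdzP: pt => c' cE; case/dvdzP: pdt => d' dE; rewrite [RHS]mulrC in cE; rewrite [RHS]mulrC in dE.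
  rewrite -DD in D0; apply: (reduce_last D0 _ pp (g := g') (c := c') (d := d') (e := e)) => //.
    by rewrite DD.
  by rewrite -gE -cE -dE.
rewrite gE in pq D0 IHq *.
apply: (reduce_anisotropic D0 IHq pp (erefl _) pq) => y z yz.
have py : (p%:Z %| y)%Z.
  (* If [y] were a unit modulo [p], then [t = z / y] would be a root. *)
  apply/negPn/negP => py; apply: noroot; have [t /dvdzP[k kE]] := inverse_mod (- z) pp py.
  exists t; have zE : z = y * t - k * p%:Z by rewrite -kE; ring.
  have : (p%:Z %| y ^+ 2 * (c + d * t + e * t ^+ 2))%Z.
    move: yz; rewrite zE (_ : _ + _ = y ^+ 2 * (c + d * t + e * t ^+ 2)
      + (- (d * y * k) - 2 * e * y * t * k + e * k ^+ 2 * p%:Z) * p%:Z); last by ring.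
    by rewrite rpredDr // dvdz_mull ?dvdzz.
  by rewrite Euclid_dvdzM // expr2 Euclid_dvdzM // (negPf py).
rewrite py /=; case/dvdzP: py yz => y' ->.
rewrite (_ : _ + _ = (c * y' ^+ 2 * p%:Z + d * y' * z) * p%:Z + e * (z * z)); last by ring.
rewrite rpredDl; last by rewrite dvdz_mull ?dvdzz.
by rewrite Euclid_dvdzM // (negPf pe) Euclid_dvdzM // orbb.
Qed.

(** Outer induction on a bound for the discriminant; a nonzero zero is first divided by the gcd of
    its coordinates. *)
Theorem isotropic_reducible q : primitive_form q -> isotropic q -> 0 < disc q -> reducible R q.
Proof.
move=> pq iq D0; have [n DE] : exists n : nat, disc q <= n%:Z.
  by exists `|disc q|%N; rewrite abszE ler_norm.
elim: n q DE pq iq D0 => [|n IH] q Dn pq iq D0; first by move: (lt_le_trans D0 Dn).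
case: iq => -[[x y] z] [v0 qv].
pose l := gcdz (gcdz x y) z.
have l0 : l != 0.
  apply: contra v0; rewrite gcdz_eq0 gcdz_eq0 => /andP[/andP[/eqP-> /eqP->] /eqP->].
  by [].
have /dvdzP[x' xE] : (l %| x)%Z by apply: dvdz_trans (dvdz_gcdl _ _) (dvdz_gcdl _ _).
have /dvdzP[y' yE] : (l %| y)%Z by apply: dvdz_trans (dvdz_gcdl _ _) (dvdz_gcdr _ _).
have /dvdzP[z' zE] : (l %| z)%Z by apply: dvdz_gcdr.
have pv : primitive_vec (x', y', z').
  apply/eqP; apply: (mulIf l0); rewrite mul1r.
  have lN : (`|l|%N)%:Z = l by rewrite /l /gcdz.
  by rewrite -{1}lN mulz_gcdl -{1}lN mulz_gcdl -xE -yE -zE.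
have qv' : qeval q (x', y', z') = 0.
  apply: (mulfI (expf_neq0 2 l0)); rewrite mulr0 -qv xE yE zE /qeval !intz; ring.
have [M [g [c [d [e [Mu ME g0 _]]]]]] := nf_of_zero R pv qv' (lt0r_neq0 D0).
apply: (reducible_unimodular Mu); rewrite ME.
have [M1 _] := Mu.
have DM : disc (nf_form g c d e) = disc q.
  rewrite -ME disc_pull (_ : mat3_det M ^+ 2 = 1) ?mul1r //.
  by case: (mat3_det M) M1 => -[|[|?]].
apply: (@reducible_nf (disc q) _ `|g|%N) => //.
- move=> q1 pq1 iq1 /andP[D1 D2]; apply: IH => //.
  by rewrite -ltzD1 -PoszD addn1; exact: lt_le_trans D2 Dn.
- by rewrite abszE ler_norm.
- by rewrite -ME; apply: primitive_pull.
- by rewrite DM.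
Qed.

End ReductionTheorem.

(** * Local densities *)

Lemma cnt3_split Q a b c P :
  cnt3 a b c P = (cnt3 a b c (fun v => Q v && P v) + cnt3 a b c (fun v => ~~ Q v && P v))%N.
Proof.
rewrite /cnt3 -big_split; apply: eq_bigr => i _; rewrite -big_split; apply: eq_bigr => j _.
rewrite -big_split; apply: eq_bigr => k _ /=; case: (Q _); case: (P _) => //.
Qed.

Lemma cnt3_eq0 a b c P : (forall v, ~~ P v) -> cnt3 a b c P = 0%N.
Proof.
by move=> P0; rewrite /cnt3 big1 // => i _; rewrite big1 // => j _; rewrite big1 // => k _;
  rewrite (negPf (P0 _)).
Qed.

Lemma sum_linear_congruence (L : nat) (x m : int) : (0 < L)%N -> coprimez x L%:Z ->
  (\sum_(j < L) (L%:Z %| (x * j%:Z - m)%R)%Z = 1)%N.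
Proof.
case: L => // L _ cop.
pose f (j : 'I_L.+1) : 'I_L.+1 := inord `|((x * j%:Z - m) %% L.+1%:Z)%Z|%N.
have fE j : (f j)%:Z = ((x * j%:Z - m) %% L.+1%:Z)%Z.
  have lt0 : (0 <= ((x * j%:Z - m) %% L.+1%:Z)%Z) by apply: modz_ge0.
  by rewrite inordK ?gez0_abs // -ltz_nat gez0_abs // ltz_pmod.
have f_inj : injective f.
  move=> i j /(congr1 (fun t : 'I_L.+1 => t%:Z)); rewrite !fE => /eqP.
  rewrite eqz_mod_dvd (_ : _ - _ - _ = x * (i%:Z - j%:Z)); last by ring.
  rewrite Gauss_dvdzr 1?coprimez_sym // -eqz_mod_dvd => /eqP.
  by rewrite !modz_nat => -[]; rewrite !modn_small // => /ord_inj.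
rewrite (eq_bigr (fun j => nat_of_bool (f j == ord0))); last first.
  move=> j _; congr nat_of_bool; rewrite -val_eqE /= -eqz_nat fE.
  by apply/idP/eqP => /dvdz_mod0P.
rewrite -(reindex_inj f_inj (P := xpredT) (F := fun j => nat_of_bool (j == ord0))) /=.
by rewrite (bigD1 ord0) //= big1 // => j /negPf->.
Qed.

Lemma sum_units (p r : nat) : prime p -> (0 < r)%N ->
  (\sum_(i < p ^ r) ~~ (p%:Z %| i%:Z)%Z = p ^ r.-1 * p.-1)%N.
Proof.
move=> pp; case: r => // r _; rewrite expnS /=.
apply: (@addnI (\sum_(i < p * p ^ r) (p %| i) * 1)%N).
rewrite [in RHS](@sum_dvd (fun=> 1%N)) ?prime_gt0 // -big_split /= (eq_bigr (fun=> 1%N)); last first.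
  by move=> i _; rewrite dvdzE /=; case: (_ %| _)%N.
rewrite !sum_nat_const !card_ord !muln1 -{2}[(p ^ r)%N]muln1 -mulnDr mulnC.
by rewrite add1n prednK // prime_gt0.
Qed.

Section LocalCountNF.
Variables (p : nat) (n : nat).
Hypothesis pp : prime p.
Let p0 : (0 < p)%N := prime_gt0 pp.
Let phi (r : nat) : nat := (p ^ r.-1 * p.-1)%N.
Implicit Types (m r : nat) (Z : int -> bool) (v : int * int * int).

Let sol m r v : bool := ((p ^ r)%:Z %| v.1.1 * v.1.2 - m%:Z * v.2 ^+ 2)%Z.
Let px v := (p%:Z %| v.1.1)%Z.
Let py v := (p%:Z %| v.1.2)%Z.
Let pz v := (p%:Z %| v.2)%Z.

(** A unit [x] and an arbitrary [z] determine [y], whence one solution for each pair. *)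
Let cnt_unit_x m r Z : (0 < r)%N ->
  cnt3 (p ^ r) (p ^ r) (p ^ r) (fun v => [&& ~~ px v, Z v.2 & sol m r v]) =
  (phi r * \sum_(k < p ^ r) Z k%:Z)%N.
Proof.
move=> r0; rewrite /phi -(sum_units pp r0) big_distrl /cnt3 /=; apply: eq_bigr => i _.
rewrite exchange_big big_distrr /=; apply: eq_bigr => k _; rewrite /px /sol /=.
have [pi|pi] := boolP (p%:Z %| i%:Z)%Z; first by rewrite big1.
case: (Z _); last by rewrite big1.
rewrite sum_linear_congruence ?expn_gt0 ?p0 // coprimez_sym coprimezE coprimeXl //.
by rewrite prime_coprime.
Qed.

Let cnt_unit_y m r Z : (0 < r)%N ->
  cnt3 (p ^ r) (p ^ r) (p ^ r) (fun v => [&& ~~ py v, Z v.2 & sol m r v]) =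
  (phi r * \sum_(k < p ^ r) Z k%:Z)%N.
Proof.
move=> r0; rewrite -(cnt_unit_x m Z r0) /cnt3 exchange_big /=.
do 3 apply: eq_bigr => ? _; congr nat_of_bool.
by rewrite /px /py /sol /= [X in (_ %| X - _)%Z]mulrC.
Qed.

Let p_dvd_sol m r v : (0 < r)%N -> sol m r v ->
  (p%:Z %| v.1.1 * v.1.2)%Z = (p%:Z %| m%:Z * v.2 ^+ 2)%Z.
Proof.
move=> r0 H; rewrite -[v.1.1 * v.1.2](subrK (m%:Z * v.2 ^+ 2)) rpredDl //.
by apply: dvdz_trans H; rewrite dvdzE /= dvdn_exp.
Qed.

Let cnt_split_xy r (P : int * int * int -> bool) :
  cnt3 (p ^ r) (p ^ r) (p ^ r) P =
  (cnt3 (p ^ r) (p ^ r) (p ^ r) (fun v => ~~ px v && P v) +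
   (cnt3 (p ^ r) (p ^ r) (p ^ r) (fun v => ~~ py v && (px v && P v)) +
   cnt3 (p ^ r) (p ^ r) (p ^ r) (fun v => py v && (px v && P v))))%N.
Proof.
by rewrite (cnt3_split px) addnC; congr addn; rewrite (cnt3_split py) addnC.
Qed.

(** Induction on the valuation of [m] in steps of two. Solutions with [x] a unit, and those with [y]
    a unit and [p | x], give [phi^2] each, the second class being empty if [p] does not divide [m].
    If [p] divides both, then [p^2 | m], and [x / p], [y / p] solve the problem for [m / p^2] modulo
    [p^(r - 2)]. *)
Let cnt_unit_z m r : (0 < m)%N -> (logn p m < r)%N ->
  cnt3 (p ^ r) (p ^ r) (p ^ r) (fun v => ~~ pz v && sol m r v) =
  ((logn p m).+1 * phi r ^ 2)%N.
Proof.
have [k] := ubnP (logn p m); elim: k m r => // k IH m r km m0 mr.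
have r0 : (0 < r)%N by apply: leq_ltn_trans mr.
have Zs := sum_units pp r0.
rewrite cnt_split_xy.
rewrite (cnt_unit_x m (fun z => ~~ (p%:Z %| z)%Z) r0) Zs.
have [m_p|m_p] := boolP (p %| m)%N; last first.
  have -> : logn p m = 0%N by apply/eqP; rewrite -leqn0 leqNgt logn_gt0 mem_primes pp m0.
  rewrite !cnt3_eq0 ?addn0 ?mul1n //= => v; apply/negP.
    case/and4P=> vy vx vz /(p_dvd_sol r0); rewrite dvdz_mulr // => /esym.
    by rewrite Euclid_dvdzM // dvdzE /= (negPf m_p) /= expr2 Euclid_dvdzM // orbb -/(pz v) (negPf vz).
  case/and4P=> vy vx vz /(p_dvd_sol r0); rewrite dvdz_mulr // => /esym.
  by rewrite Euclid_dvdzM // dvdzE /= (negPf m_p) /= expr2 Euclid_dvdzM // orbb -/(pz v) (negPf vz).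
rewrite (@eq_cnt3 _ _ _ (fun v => ~~ py v && _) (fun v => [&& ~~ py v, ~~ pz v & sol m r v])); last first.
  move=> v /=; have [//|vy /=] := boolP (py v).
  have [|vz /=] := boolP (pz v); first by rewrite andbF.
  have [vs|] := boolP (sol m r v); last by rewrite andbF.
  have := p_dvd_sol r0 vs; rewrite [RHS]dvdz_mulr //.
  by rewrite Euclid_dvdzM // [X in _ || X](negPf vy) orbF /px => ->.
rewrite (cnt_unit_y m (fun z => ~~ (p%:Z %| z)%Z) r0) Zs.
have kpos : (0 < logn p m)%N by rewrite logn_gt0 mem_primes pp m0.
have [k1|k1] := eqVneq (logn p m) 1%N.
  rewrite cnt3_eq0 ?addn0 ?k1 /phi; last first.
    move=> [[x y] z] /=; apply/negP; case/and4P => /dvdzP[y' yE] /dvdzP[x' xE] vz vs.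
    have : (p%:Z ^+ 2 %| m%:Z * z ^+ 2)%Z.
      have : (p%:Z ^+ 2 %| x * y - m%:Z * z ^+ 2)%Z.
        apply: dvdz_trans vs; rewrite -[_ ^+ 2]/((p ^ 2)%N%:Z) dvdzE /= dvdn_exp2l //.
        by rewrite -k1.
      rewrite /= in xE yE; rewrite xE yE (_ : _ - _ = p%:Z ^+ 2 * (x' * y') - m%:Z * z ^+ 2); last by ring.
      by rewrite rpredBl // dvdz_mulr.
    rewrite dvdzE abszM !abszX /= Gauss_dvdl; last first.
      by rewrite coprimeXl // coprimeXr // prime_coprime //; move: vz; rewrite /pz dvdzE.
    by rewrite pfactor_dvdn // k1.
  by ring.
have k2 : (2 <= logn p m)%N by rewrite ltn_neqAle eq_sym k1.
have /dvdnP[m' mE] : (p ^ 2 %| m)%N by rewrite pfactor_dvdn.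
have m'0 : (0 < m')%N by move: m0; rewrite mE muln_gt0 => /andP[].
have lm : logn p m = (logn p m').+2.
  by rewrite mE lognM ?expn_gt0 ?p0 // pfactorK // addn2.
have [s rE] : exists s, r = s.+2 by case: (r) mr => [|[|s]]; rewrite ?lm // => _; exists s.
have s0 : (logn p m' < s)%N by move: mr; rewrite lm rE !ltnS.
have spos : (0 < s)%N by apply: leq_ltn_trans s0.
have := IH m' s _ m'0 s0; rewrite -ltnS => /(_ _); rewrite (leq_trans _ km) ?lm // => /(_ isT) E.
have -> : cnt3 (p ^ r) (p ^ r) (p ^ r) (fun v => py v && (px v && (~~ pz v && sol m r v))) =
    cnt3 (p * p ^ s.+1) (p * p ^ s.+1) (1 * p ^ r) (fun v => py v && (px v && (~~ pz v && sol m r v))).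
  by rewrite mul1n -!expnS -rE.
rewrite cnt3_scale //; last by move=> v /and4P[vy vx _ _]; rewrite dvd1z andbT; apply/andP.
rewrite (@eq_cnt3 _ _ _ _ (fun v => ~~ pz v && sol m' s v)); last first.
  move=> [[x y] z]; rewrite /px /py /pz /sol /= !mul0r !addr0 !add0r !mul1r !dvdz_mulr //=.
  congr (_ && _); rewrite mE rE PoszM (_ : _ - _ = (p ^ 2)%:Z * (x * y - m'%:Z * z ^+ 2)).
    have -> : (p ^ s.+2)%N%:Z = (p ^ 2)%N%:Z * (p ^ s)%N%:Z by rewrite -PoszM -expnD.
    by rewrite dvdz_mul2l // eqz_nat -lt0n expn_gt0 p0.
  by rewrite -mulnn !PoszM; ring.
have per : periodic3 (p ^ s) (fun v => ~~ pz v && sol m' s v).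
  move=> x y z x' y' z' hx hy hz; rewrite /pz /sol /=.
  rewrite (@dvdz_modr p (p ^ s) z z') ?dvdn_exp //; congr (_ && _).
  have := periodic3_qeval (nf_form 1 0 0 (- m'%:Z)) hx hy hz; rewrite !qeval_nf.
  by rewrite !mul0r !addr0 !mul1r !mulNr.
have h1 : (p ^ s.+1 = p ^ s * p)%N by rewrite expnSr.
have h2 : (p ^ s.+2 = p ^ s * p ^ 2)%N by rewrite -expnD addn2.
(* The box is [p], [p] and [p^2] periods long, and this factor [p^4] turns [phi(s)^2] into
   [phi(r)^2]. *)
rewrite rE [in cnt3 _ _ _ _]h2 [in cnt3 _ _ _ _]h1 cnt3_mul //.
rewrite E ?lm /phi /=; case: (s) spos => // s' _ /=; rewrite !expnS; ring.
Qed.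

Let local_count_sol r : local_count (nf_form 1 0 0 (- n%:Z)) p r =
  cnt3 (p ^ r) (p ^ r) (p ^ r) (fun v => ~~ pdvd3 p%:Z v && sol n r v).
Proof.
rewrite local_countE //; apply: eq_cnt3 => -[[x y] z]; rewrite qeval_nf /sol /=.
by rewrite !mul0r !addr0 !mul1r !mulNr.
Qed.

Let cnt_dvd_all r : (0 < r)%N ->
  cnt3 (p ^ r) (p ^ r) (p ^ r) (fun v => ~~ px v && (~~ pdvd3 p%:Z v && sol n r v)) =
  (phi r * p ^ r)%N.
Proof.
move=> r0; rewrite (@eq_cnt3 _ _ _ _ (fun v => [&& ~~ px v, true & sol n r v])).
  rewrite (cnt_unit_x n xpredT r0); congr muln.
  by rewrite sum_nat_const card_ord muln1.
by move=> [[x y] z]; rewrite /pdvd3 /px /=; case: (_ %| x)%Z.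
Qed.

Lemma local_count_nf0 r : (0 < n)%N -> ~~ (p %| n)%N -> (0 < r)%N ->
  (local_count (nf_form 1 0 0 (- n%:Z)) p r = p ^ r.-1 * p.-1 * (p ^ r.-1 * p.+1))%N.
Proof.
move=> n0 pn r0; rewrite local_count_sol cnt_split_xy cnt_dvd_all //.
have E v : sol n r v -> (p%:Z %| v.1.1 * v.1.2)%Z = pz v.
  move/(p_dvd_sol r0)=> ->; rewrite Euclid_dvdzM // dvdzE /= (negPf pn) /=.
  by rewrite expr2 Euclid_dvdzM // orbb.
rewrite [X in (_ + (_ + X))%N]cnt3_eq0 ?addn0; last first.
  move=> v; apply/negP => /and4P[vy vx vd /E]; rewrite dvdz_mulr // => /esym vz.
  by move/negP: vd; apply; apply/and3P.
rewrite (@eq_cnt3 _ _ _ _ (fun v => [&& ~~ py v, p%:Z %| v.2 & sol n r v]%Z)); last first.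
  move=> v; have [//|vy /=] := boolP (py v); have [vs|] := boolP (sol n r v); last by rewrite !andbF.
  have := E v vs; rewrite Euclid_dvdzM // [X in _ || X](negPf vy) orbF /px => ->.
  by rewrite /pdvd3 -/(py v) (negPf vy) andbF !andbT.
rewrite (cnt_unit_y n (fun z => (p%:Z %| z)%Z) r0).
have -> : (\sum_(k < p ^ r) (p%:Z %| k%:Z)%Z = p ^ r.-1)%N.
  case: r r0 {E} => // r _; rewrite expnS /=.
  rewrite (eq_bigr (fun k : 'I_ _ => (p %| k) * 1)%N); last by move=> k _; rewrite muln1 dvdzE.
  by rewrite (@sum_dvd (fun=> 1%N)) // sum_nat_const card_ord muln1.
have H : (p ^ r + p ^ r.-1 = p ^ r.-1 * p.+1)%N.
  by case: (r) r0 => // s _ /=; rewrite expnS mulnS addnC mulnC.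
by rewrite -mulnDr H.
Qed.

(** The solutions with [x] a unit, and those with [y] a unit, number [phi(r) p^r] each, [z] being
    free. If [p] divides both, primitivity makes [z] a unit, and their number is left over in
    [cnt_unit_z] after removing the two classes with a unit among [x] and [y]. *)
Lemma local_count_nf r : (0 < n)%N -> (p %| n)%N -> (logn p n < r)%N ->
  (local_count (nf_form 1 0 0 (- n%:Z)) p r =
   2 * (p ^ r.-1 * p.-1) * p ^ r + (logn p n).-1 * (p ^ r.-1 * p.-1) ^ 2)%N.
Proof.
move=> n0 pn nr; have r0 : (0 < r)%N by apply: leq_ltn_trans nr.
have kpos : (0 < logn p n)%N by rewrite logn_gt0 mem_primes pp n0.
have Zs := sum_units pp r0.
have E v : sol n r v -> (p%:Z %| v.1.1 * v.1.2)%Z.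
  by move/(p_dvd_sol r0)=> ->; rewrite dvdz_mulr.
have U Z : cnt3 (p ^ r) (p ^ r) (p ^ r) (fun v => ~~ py v && (px v && (Z v.2 && sol n r v))) =
    (phi r * \sum_(k < p ^ r) Z k%:Z)%N.
  rewrite -(cnt_unit_y n Z r0); apply: eq_cnt3 => v.
  have [//|vy /=] := boolP (py v); have [vs|] := boolP (sol n r v); last by rewrite !andbF.
  by have := E v vs; rewrite Euclid_dvdzM // [X in _ || X](negPf vy) orbF /px => ->.
have := cnt_unit_z n0 nr; rewrite cnt_split_xy.
rewrite (cnt_unit_x n (fun z => ~~ (p%:Z %| z)%Z) r0) Zs.
rewrite (U (fun z => ~~ (p%:Z %| z)%Z)) Zs.
set W := cnt3 _ _ _ _ => WE.
rewrite local_count_sol cnt_split_xy cnt_dvd_all //.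
rewrite (@eq_cnt3 _ _ _ (fun v => py v && _) (fun v => py v && (px v && (~~ pz v && sol n r v)))); last first.
  by move=> v; rewrite /px /py /pz /pdvd3; do 2 case: (_ %| _)%Z => //.
rewrite -/W (@eq_cnt3 _ _ _ _ (fun v => ~~ py v && (px v && (true && sol n r v)))); last first.
  by move=> v; rewrite /px /py /pz /pdvd3; do 2 case: (_ %| _)%Z => //.
rewrite (U xpredT) (_ : (\sum_(k < p ^ r) true)%N = (p ^ r)%N); last first.
  by rewrite sum_nat_const card_ord muln1.
clearbody W; move: WE; rewrite /phi; case: (logn p n) kpos => // k _ /=.
set A := (p ^ r.-1 * p.-1)%N; set B := (p ^ r)%N => WE.
have -> : W = (k * A ^ 2)%N.
  have : (A * A + (A * A + W) = A * A + (A * A + k * A ^ 2))%N by rewrite WE; ring.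
  by move/addnI/addnI.
ring.
Qed.

End LocalCountNF.

(** * The singular series as a product over primes *)

Section SingularSeries.
Variable R : realType.

(** For [p | n] the two terms [1 - 1/p] belong to the divisors [d] of [n] of valuation 0 and
    [v_p n], the squares to the intermediate valuations; this is how the sum over [d] reproduces the
    density. *)
Definition local_dens (n p : nat) : R :=
  if (p %| n)%N then
    2 * (1 - p%:R^-1) + (logn p n).-1%:R * (1 - p%:R^-1) ^+ 2
  else 1 - p%:R^-1 ^+ 2.

Lemma local_count_dens (n p r : nat) : prime p -> (0 < n)%N -> (logn p n < r)%N ->
  (local_count (nf_form 1 0 0 (- n%:Z)) p r)%:R = local_dens n p * p%:R ^+ (2 * r) :> R.
Proof.
move=> pp n0 nr; have r0 : (0 < r)%N by apply: leq_ltn_trans nr.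
have pR : p%:R != 0 :> R by rewrite pnatr_eq0 -lt0n prime_gt0.
have pE : p.-1%:R = p%:R - 1 :> R.
  by rewrite -[in RHS](prednK (prime_gt0 pp)) -natr1 addrK.
rewrite /local_dens; case: ifPn => pn.
  rewrite local_count_nf // !(natrD, natrM, natrX) pE.
  case: r r0 {nr} => // r _ /=; rewrite mulnS exprD (mulnC 2 r) exprM !exprS expr0.
  by field.
rewrite local_count_nf0 // !(natrM, natrX) pE -natr1.
case: r r0 {nr} => // r _ /=; rewrite mulnS exprD (mulnC 2 r) exprM !exprS expr0.
by field.
Qed.

(** The normalised counts are constant once [r] exceeds a bound in [v_p n] and [v_p c], so the limit
    is that constant. *)
Lemma sigma_p_zero_equiv q n M c (p : nat) : prime p -> (0 < n)%N ->
  zero_equiv R q (nf_form 1 0 0 (- n%:Z)) M c ->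
  sigma_p R q p =
    p%:R ^+ logn p c / p%:R ^+ logn p `|mat3_det M|%N * local_dens n p.
Proof.
move=> pp n0 H; apply: cvg_lim => //; apply: cvg_near_cst.
have pR : p%:R != 0 :> R by rewrite pnatr_eq0 -lt0n prime_gt0.
exists ((logn p n + 2) + logn p c)%N => //= r rr.
have := ze_local H pp (r := (r - logn p c)%N); rewrite subnK; last first.
  by apply: leq_trans rr; rewrite leq_addl.
have n2 : (logn p n + 2 <= r - logn p c)%N by rewrite leq_subRL ?(leq_trans _ rr) ?leq_addl // addnC.
rewrite (leq_trans _ n2) ?leq_addl // => /(_ isT)/(congr1 (fun t : nat => t%:R : R)).
rewrite !natrM !natrX local_count_dens //; last by apply: leq_trans n2; rewrite addn2.
have rE : r = (r - logn p c + logn p c)%N.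
  by rewrite subnK // (leq_trans _ rr) // leq_addl.
set X := local_dens n p; set a := logn p c; set b := logn p `|_|%N => E.
have -> : (local_count q p r)%:R = p%:R ^+ (3 * a) * (X * p%:R ^+ (2 * (r - a))) / p%:R ^+ b.
  by rewrite -E mulrC mulKf // expf_neq0.
rewrite ?natrX [in p%:R ^+ (2 * r)]rE -/a mulnDr exprD.
rewrite (_ : (3 * a = a + 2 * a)%N) ?exprD; last by lia.
by field; rewrite !expf_neq0.
Qed.

Lemma prod_logn (c N : nat) : (0 < c)%N -> (c < N)%N ->
  \prod_(0 <= p < N | prime p) p%:R ^+ logn p c = c%:R :> R.
Proof.
move=> c0 cN; rewrite -[in RHS](partnT c0) /partn natr_prod.
rewrite (big_cat_nat (n := c.+1)) //= [X in _ * X]big_nat_cond [X in _ * X]big1 ?mulr1; last first.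
  move=> p /andP[/andP[cp _] pp].
  by rewrite (_ : logn p c = 0%N) ?expr0 //; apply/eqP; rewrite -leqn0 leqNgt logn_gt0 mem_primes pp c0 gtnNdvd.
rewrite big_mkcond [RHS]big_mkcond; apply: eq_bigr => p _ /=.
by rewrite natrX; case: ifPn => // np; rewrite lognE (negPf np).
Qed.

Definition dens_prod (n N : nat) : R := \prod_(0 <= p < N | prime p) local_dens n p.

Lemma local_dens_gt0 n p : prime p -> 0 < local_dens n p.
Proof.
move=> pp; have p1 : p%:R^-1 < 1 :> R by rewrite invf_lt1 ?ltr1n ?ltr0n ?prime_gt1 ?prime_gt0.
have p0 : 0 <= p%:R^-1 :> R by rewrite invr_ge0.
rewrite /local_dens; case: ifP => _.
  by rewrite ltr_wpDr ?mulr_ge0 ?exprn_ge0 ?subr_ge0 ?(ltW p1) ?ler0n // mulr_gt0 // subr_gt0.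
by rewrite subr_gt0 expr_lt1.
Qed.

Lemma dens_prod_gt0 n N : 0 < dens_prod n N.
Proof. by apply: prodr_gt0 => p pp; exact: local_dens_gt0. Qed.

(** Beyond [n] the factors are [1 - p^-2]. Extended to all integers from [N] on, their product
    telescopes to [(1 - 1/N)(1 + 1/(k - 1))], which is at least 1/2. *)
Lemma dens_prod_tail n N N' : (0 < n)%N -> (n < N)%N -> (1 < N)%N -> (N <= N')%N ->
  2^-1 * dens_prod n N <= dens_prod n N' <= dens_prod n N.
Proof.
move=> n0 nN N1 NN; have D0 := ltW (dens_prod_gt0 n N).
rewrite /dens_prod (big_cat_nat (n := N) (p := N')) //= -/(dens_prod n N).
rewrite [2^-1 * _]mulrC ler_pM2l ?dens_prod_gt0 // ger_pMr ?dens_prod_gt0 //.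
have tele k : (N <= k)%N ->
    \prod_(N <= i < k) (1 - i%:R^-1 ^+ 2) = (1 - N%:R^-1) * (1 + k.-1%:R^-1) :> R.
  elim: k => [|k IH]; first by rewrite leqn0 => /eqP N0; move: N1; rewrite N0.
  rewrite leq_eqVlt => /orP[/eqP<-|Nk].
    rewrite big_geq //; case: N N1 {nN NN D0 IH} => // m m0 /=.
    have m1 : m%:R != 0 :> R by rewrite pnatr_eq0 -lt0n.
    by field; rewrite ?m1 ?nat1r ?natr1 ?pnatr_eq0.
  rewrite big_nat_recr //= IH //; case: k Nk {IH} => [|k] Nk /=.
    by case: (N) N1 Nk => [|[|?]].
  have k0 : k%:R != 0 :> R by rewrite pnatr_eq0 -lt0n; move: (leq_trans N1 Nk); rewrite !ltnS.
  have NR : N%:R != 0 :> R by rewrite pnatr_eq0 -lt0n ltnW.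
  by rewrite -natr1; field; rewrite ?k0 ?NR ?nat1r ?natr1 ?pnatr_eq0.
have lo i : (N <= i)%N -> 0 <= 1 - i%:R^-1 ^+ 2 :> R /\ 1 - i%:R^-1 ^+ 2 <= 1 :> R.
  move=> Ni; have i0 : (0 < i)%N by apply: leq_trans Ni; exact: ltnW.
  have : i%:R^-1 <= 1 :> R by rewrite invf_le1 ?ler1n ?ltr0n.
  move=> H; split; first by rewrite subr_ge0 expr_le1 // invr_ge0 ler0n.
  by rewrite lerBlDr lerDl exprn_ge0 // invr_ge0 ler0n.
have -> : \prod_(N <= i < N' | prime i) local_dens n i =
    \prod_(N <= i < N') (if prime i then 1 - i%:R^-1 ^+ 2 else 1).
  rewrite big_mkcond; apply: eq_big_nat => i /andP[Ni _]; case: ifP => // _.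
  by rewrite /local_dens gtnNdvd // (leq_trans nN).
apply/andP; split; last first.
  rewrite big_nat_cond; apply: prodr_ile1 => i /andP[/andP[Ni _] _].
  by case: ifP => _; rewrite ?ler01 ?lexx //; have [-> ->] := lo i Ni.
apply: (@le_trans _ _ (\prod_(N <= i < N') (1 - i%:R^-1 ^+ 2))).
  have N0 : (0 < N)%N by exact: ltnW.
  rewrite tele //; have N2 : 2^-1 <= 1 - N%:R^-1 :> R.
    rewrite lerBrDr -lerBrDl (_ : 1 - 2^-1 = 2^-1 :> R); last by field.
    by rewrite lef_pV2 ?posrE ?ltr0n ?ler_nat.
  apply: le_trans N2 _; rewrite ler_peMr //; last by rewrite lerDl invr_ge0.
  by rewrite subr_ge0 invf_le1 ?ler1n ?ltr0n.
rewrite big_seq_cond [X in _ <= X]big_seq_cond; apply: ler_prod => i; rewrite mem_index_iota => /andP[/andP[Ni _] _].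
have [h1 h2] := lo i Ni; rewrite h1 /=; case: ifP => _ //; exact: lexx.
Qed.

Lemma is_cvg_dens_prod n : (0 < n)%N -> cvgn (dens_prod n).
Proof.
move=> n0; have : cvgn (fun i => dens_prod n (i + n.+2)).
  apply: nonincreasing_is_cvgn.
    move=> i j ij; suff /andP[] : 2^-1 * dens_prod n (i + n.+2) <=
      dens_prod n (j + n.+2) <= dens_prod n (i + n.+2) by [].
    apply: dens_prod_tail => //.
    - by rewrite addnS ltnS addnS leqW // leq_addl.
    - by rewrite !addnS.
    - by rewrite leq_add2r.
  by exists 0 => _ [i _ <-]; apply/ltW/dens_prod_gt0.
move=> H; apply/cvg_ex; exists (limn (fun i => dens_prod n (i + n.+2))).
by rewrite -(cvg_shiftn n.+2); exact: H.
Qed.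

Definition dens_series (n : nat) : R := limn (dens_prod n).

Lemma dens_series_bounds n N : (0 < n)%N -> (n < N)%N -> (1 < N)%N ->
  2^-1 * dens_prod n N <= dens_series n <= dens_prod n N.
Proof.
move=> n0 nN N1; apply/andP; split.
  apply: limr_ge; first exact: is_cvg_dens_prod.
  by exists N => // k /= Nk; have /andP[] := dens_prod_tail n0 nN N1 Nk.
apply: limr_le; first exact: is_cvg_dens_prod.
by exists N => // k /= Nk; have /andP[] := dens_prod_tail n0 nN N1 Nk.
Qed.

Lemma dens_series_gt0 n : (0 < n)%N -> 0 < dens_series n.
Proof.
move=> n0; have /andP[+ _] := @dens_series_bounds n n.+2 n0 (leqnSn n.+1) isT.
by apply: lt_le_trans; rewrite mulr_gt0 ?invr_gt0 ?dens_prod_gt0.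
Qed.

(** The factors [p^(v_p c - v_p (det M))] multiply to [c / |det M|], the inverse of the factor in
    [sigma_infty_cvg]; the two cancel in the main term. *)
Lemma singular_series_zero_equiv q n M c : (0 < n)%N ->
  zero_equiv R q (nf_form 1 0 0 (- n%:Z)) M c ->
  singular_series R q = c%:R / `|mat3_det M|%N%:R * dens_series n.
Proof.
move=> n0 H; apply: cvg_lim => //.
have : (fun N => c%:R / `|mat3_det M|%N%:R * dens_prod n N) @ \oo --> c%:R / `|mat3_det M|%N%:R * dens_series n.
  by apply: cvgMl_tmp; exact: is_cvg_dens_prod.
apply: cvg_trans; apply: near_eq_cvg.
exists (c + `|mat3_det M|).+1 => //= N NN.
rewrite /dens_prod -(@prod_logn c N) ?(ze_c_gt0 H) //; last by apply: leq_trans NN; rewrite ltnS leq_addr.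
rewrite -(@prod_logn `|mat3_det M|%N N) ?(ze_det_gt0 H) //; last by apply: leq_trans NN; rewrite ltnS leq_addl.
rewrite -prodf_div -big_split /=; apply: eq_bigr => p pp.
by rewrite (sigma_p_zero_equiv pp n0 H).
Qed.

End SingularSeries.

(** * The density at infinity *)

Section RealIntegrals.
Variable R : realType.
Local Notation MR := (measurableTypeR R).
Local Notation leb := (@lebesgue_measure R).
Local Open Scope ereal_scope.

(** The coordinates used on the cone degenerate at 0, where convergence is not claimed; a single
    point is negligible. *)
Lemma dominated_cvg_neq0 (f_ : nat -> MR -> \bar R) (f : MR -> \bar R) (g : MR -> R) :
  (forall n, measurable_fun [set: MR] (f_ n)) -> measurable_fun [set: MR] f ->
  leb.-integrable [set: MR] (EFin \o g) ->
  (forall n x, 0 <= f_ n x) -> (forall n x, f_ n x <= (g x)%:E) ->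
  (forall x, x != 0%R -> f_ ^~ x @ \oo --> f x) ->
  \int[leb]_x f_ n x @[n --> \oo] --> \int[leb]_x f x.
Proof.
move=> mf_ mf ig f0 fg ff.
pose D : set MR := [set: MR] `\ 0%R.
have mD : measurable D by apply: measurableD.
have HD (h : MR -> \bar R) : measurable_fun [set: MR] h ->
    \int[leb]_x h x = \int[leb]_(x in D) h x.
  by move=> mh; rewrite integral_setD1 //; exact: measurable_funTS.
rewrite HD //; under eq_fun do rewrite HD //.
apply: (@dominated_cvg _ _ _ leb D mD _ _ (EFin \o g)).
- by move=> n; exact: measurable_funTS.
- by move=> x [_ /eqP x0]; exact: ff.
- by [].
- by apply: integrableS ig.
- by move=> n x _; rewrite gee0_abs.
Qed.

Lemma integral_symmetric_itv (r : R) : (0 <= r)%R ->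
  leb `[(- r)%R, r]%classic = (2 * r)%:E.
Proof.
move=> r0; rewrite lebesgue_measure_itv /= lte_fin.
move: r0; rewrite le_eqVlt => /orP[/eqP<-|r_gt]; first by rewrite oppr0 ltxx mulr0.
rewrite (lt_trans _ r_gt) ?oppr_lt0 //=; congr EFin; ring.
Qed.

Definition box1 (r x : R) : R := (`|x| <= r)%R%:R.

Lemma box1_indic r : box1 r = \1_(`[(- r)%R, r]%classic).
Proof.
by apply/funext => x; rewrite /box1 indicE mem_setE in_itv /= -ler_norml.
Qed.

Lemma measurable_box1 r : measurable_fun [set: MR] (box1 r).
Proof. by rewrite box1_indic; exact: measurable_indic. Qed.

Lemma box1_ge0 r x : (0 <= box1 r x)%R.
Proof. by rewrite /box1 ler0n. Qed.

Lemma integral_box1 (c r : R) : (0 <= c)%R -> (0 <= r)%R ->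
  \int[leb]_x (c * box1 r x)%:E = (c * (2 * r))%:E.
Proof.
move=> c0 r0; under eq_integral do rewrite EFinM.
rewrite ge0_integralZl //; last 2 first.
- by apply/measurable_EFinP; exact: measurable_box1.
- by move=> x _; rewrite lee_fin box1_ge0.
transitivity (c%:E * (2 * r)%:E); last by rewrite -EFinM.
by congr (_ * _); rewrite box1_indic integral_indic // setIT; exact: integral_symmetric_itv.
Qed.

Lemma integrable_box1 (c r : R) : leb.-integrable [set: MR] (EFin \o (fun x => c * box1 r x)%R).
Proof.
rewrite (_ : EFin \o _ = (fun x => c%:E * (\1_(`[(- r)%R, r]%classic) x)%:E)).
  by apply: integrableZl => //; exact: integrable_indic_itv.
by apply/funext => x; rewrite /= box1_indic EFinM.
Qed.

Lemma integrable_oneDsqrV (c : R) : (0 <= c)%R ->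
  leb.-integrable [set: MR] (EFin \o (fun x => c / (1 + x ^+ 2))%R).
Proof.
move=> c0; rewrite (_ : EFin \o _ = (fun x => c%:E * ((oneDsqr x)^-1)%R%:E)); last first.
  by apply/funext => x; rewrite /= EFinM.
have mV : measurable_fun [set: MR] (fun x : MR => ((oneDsqr x)^-1)%R%:E).
  apply/measurable_EFinP; apply: (continuous_measurable_fun (f := fun x : R => (oneDsqr x)^-1%R)).
  move=> x; apply: cvgV; last exact: continuous_oneDsqr.
  by rewrite gt_eqF // (lt_le_trans ltr01) ?oneDsqr_ge1.
apply: integrableZl => //; apply/integrableP; split => //.
under eq_integral do rewrite gee0_abs ?lee_fin ?invr_ge0 ?(le_trans ler01) ?oneDsqr_ge1 //.
rewrite ge0_symfun_integralT.
- by rewrite -set_itvcy integral0y_oneDsqr -EFinM ltry.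
- by move=> x; rewrite /= invr_ge0 (le_trans ler01) ?oneDsqr_ge1.
- exact: continuous_oneDsqrV.
- by move=> x; rewrite /= /oneDsqr sqrrN.
Qed.

Definition tent (s : R) : R := Num.max (1 - `|s|)%R 0%R.

Lemma tent_ge0 s : (0 <= tent s)%R.
Proof. by rewrite /tent le_max lexx orbT. Qed.

Lemma tent_le s : (tent s <= box1 1 s)%R.
Proof.
rewrite /tent /box1 ge_max ler0n andbT; case: (leP `|s|%R 1%R) => [_|s1] /=.
  by rewrite lerBlDr lerDl.
by rewrite subr_le0 ltW.
Qed.

Lemma continuous_tent : continuous tent.
Proof.
move=> x; apply: (@continuous_max _ R (fun s => 1 - `|s|)%R (cst 0%R) x); last exact: cst_continuous.
by apply: cvgB; [exact: cvg_cst | exact: norm_continuous].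
Qed.

Lemma measurable_tent : measurable_fun [set: MR] tent.
Proof. exact: continuous_measurable_fun continuous_tent. Qed.

Lemma integral_tent : \int[leb]_s (tent s)%:E = 1.
Proof.
rewrite ge0_symfun_integralT; last 3 first.
- exact: tent_ge0.
- exact: continuous_tent.
- by move=> x; rewrite /tent /= normrN.
rewrite (_ : [set x : R | (0 <= x)%R] = `[0%R, +oo[%classic); last by rewrite set_itvcy.
rewrite (_ : \int[leb]_(x in _) _ = \int[leb]_(x in `[0%R, 1%R]) (1 - x)%:E).
  pose F (x : R) : R := (x - x ^+ 2 / 2)%R.
  have dF (x : R) : is_derive x (1%R : R) F (1 - x)%R.
    by apply: is_derive_eq; rewrite /GRing.scale /=; field.
  rewrite (@continuous_FTC2 _ (fun x => 1 - x)%R F) //.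
  - by rewrite -EFinB -EFinM /F; congr EFin; field.
  - apply: continuous_subspaceT => x.
    by apply: cvgB; [exact: cvg_cst | exact: cvg_id].
  - split; first by move=> x _; exact: (@ex_derive _ _ _ _ _ _ _ (dF x)).
      apply: cvg_at_right_filter; apply: differentiable_continuous.
      by apply/derivable1_diffP; exact: (@ex_derive _ _ _ _ _ _ _ (dF 0%R)).
    apply: cvg_at_left_filter; apply: differentiable_continuous.
    by apply/derivable1_diffP; exact: (@ex_derive _ _ _ _ _ _ _ (dF 1%R)).
  - by move=> x _; rewrite derive1E (@derive_val _ _ _ _ _ _ _ (dF x)).
rewrite integral_mkcond [RHS]integral_mkcond; apply: eq_integral => x _.
rewrite /patch !mem_setE !in_itv /= andbT /tent.
case: (leP 0%R x) => //= x0; rewrite ger0_norm //.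
by case: (leP x 1%R) => x1; [rewrite max_l // subr_ge0|rewrite max_r // subr_le0 ltW].
Qed.

End RealIntegrals.

(** * The density at infinity of the model form *)

Section RealDensity.
Variable R : realType.
Local Notation MR := (measurableTypeR R).
Local Notation leb := (@lebesgue_measure R).
Variables (W : R * R * R -> R) (C r nn : R).
Hypothesis Wc : continuous W.
Hypothesis W0 : forall x, 0 <= W x.
Hypothesis WC : forall x, W x <= C.
Hypothesis r0 : 0 < r.
Hypothesis W_supp : forall x y z, W (x, y, z) != 0 -> [/\ `|x| <= r, `|y| <= r & `|z| <= r].
Hypothesis nn1 : 1 <= nn.

Let C0 : 0 <= C := le_trans (W0 0) (WC 0).
Let nn0 : 0 < nn := lt_le_trans ltr01 nn1.

Lemma kernelK_tent (T t : R) : 0 < T -> kernelK T t = T * tent (T * t).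
Proof. by move=> T0; rewrite /kernelK /tent normrM gtr0_norm. Qed.

(** The integrand in coordinates adapted to the cone: at [(x, nn x y^2 + s, x y)] the form
    [x1 x2 - nn x3^2] equals [x s], and the Jacobian is [|x|]. *)
Definition fib_core (T : R) (y x s : R) : R :=
  W (x, nn * x * y ^+ 2 + s, x * y) * (`|x| * kernelK T (x * s)).

Definition fib_int (T : R) (y x : R) : \bar R := (\int[leb]_s (fib_core T y x s)%:E)%E.

Lemma kernelK_ge0 (T t : R) : 0 < T -> 0 <= kernelK T t.
Proof. by move=> T0; rewrite kernelK_tent // mulr_ge0 ?tent_ge0 // ltW. Qed.

Lemma fib_core_ge0 T y x s : 0 < T -> 0 <= fib_core T y x s.
Proof. by move=> T0; rewrite /fib_core mulr_ge0 // mulr_ge0 // kernelK_ge0. Qed.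

Lemma measurable_kernelK (T : R) : 0 < T -> measurable_fun [set: MR] (kernelK T : MR -> R).
Proof.
move=> T0; rewrite (_ : kernelK T = fun t => T * tent (T * t)); last first.
  by apply/funext => t; rewrite kernelK_tent.
apply: measurable_funM => //; apply: (measurableT_comp (@measurable_tent R)).
exact: measurable_funM.
Qed.

Lemma measurable_W : measurable_fun [set: MR * MR * MR] (W : MR * MR * MR -> R).
Proof. exact: measurable_continuous3. Qed.

Lemma measurable_abs : measurable_fun [set: MR] (fun x : MR => `|x| : R).
Proof. exact: (continuous_measurable_fun (@norm_continuous R R)). Qed.

Lemma measurable_fib_core (T : R) : 0 < T ->
  measurable_fun [set: MR * MR * MR] (fun v => (fib_core T v.1.1 v.1.2 v.2)%:E).
Proof.
move=> T0; apply/measurable_EFinP; rewrite /fib_core.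
have m1 : measurable_fun [set: MR * MR * MR] (fun v : MR * MR * MR => v.1.1) by apply: measurableT_comp.
have m2 : measurable_fun [set: MR * MR * MR] (fun v : MR * MR * MR => v.1.2) by apply: measurableT_comp.
apply: measurable_funM.
  apply: (measurableT_comp measurable_W).
  apply: measurable_fun_pair; last exact: measurable_funM.
  apply: measurable_fun_pair => //; apply: measurable_funD => //.
  by apply: measurable_funM; [exact: measurable_funM | exact: measurable_funX].
apply: measurable_funM; first exact: (measurableT_comp measurable_abs m2).
by apply: (measurableT_comp (measurable_kernelK T0)); exact: measurable_funM.
Qed.

Lemma measurable_fib_int (T : R) : 0 < T ->
  measurable_fun [set: MR * MR] (fun v : MR * MR => fib_int T v.1 v.2).
Proof.
move=> T0; apply: (@measurable_fun_fubini_tonelli_F _ _ (MR * MR)%type MR R leb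
  (fun v => (fib_core T v.1.1 v.1.2 v.2)%:E)).
  exact: measurable_fib_core.
by move=> v; rewrite lee_fin fib_core_ge0.
Qed.

Lemma fib_int_ge0 T y x : 0 < T -> (0 <= fib_int T y x)%E.
Proof. by move=> T0; apply: integral_ge0 => s _; rewrite lee_fin fib_core_ge0. Qed.

Lemma fib_int0 T y : fib_int T y 0 = 0%E.
Proof.
by rewrite /fib_int; apply: integral0_eq => s _; rewrite /fib_core normr0 (mul0r (kernelK _ _)) mulr0.
Qed.

Lemma measurable_slice2 (x y z a : R) :
  measurable_fun [set: MR] (fun s : MR => W (x, y + s / a, z)).
Proof.
apply: (measurableT_comp measurable_W); apply: measurable_fun_pair => //.
by apply: measurable_fun_pair => //; apply: measurable_funD => //; exact: measurable_funM.
Qed.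

(** Rescaling [s] by [T x] absorbs the Jacobian and turns the kernel into a fixed tent, so the limit
    in [T] acts on the weight alone. *)
Lemma fib_int_subst (T y x : R) : 0 < T -> x != 0 ->
  fib_int T y x =
  (\int[leb]_s (W (x, nn * x * y ^+ 2 + s / (T * x), x * y) * tent s)%:E)%E.
Proof.
move=> T0 x0; have Tx : T * x != 0 by rewrite mulf_neq0 // gt_eqF.
have a0 : (T * x)^-1 != 0 by rewrite invr_eq0.
have mf : measurable_fun [set: MR] (fun s : MR => (fib_core T y x s)%:E).
  exact: (measurable_fun_pair2 (f := fun v : MR * MR * MR => (fib_core T v.1.1 v.1.2 v.2)%:E) (y, x) (measurable_fib_core T0)).
have := @ge0_integral_affine R _ 0 (fun s => (fib_core T y x s)%:E) a0 mf.
move=> /(_ (fun s => _)) H; have {}H := H (fun s => fib_core_ge0 y x s T0).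
have na : 0 <= `|(T * x)^-1| by [].
rewrite /fib_int (_ : (\int[leb]_s _)%E = (`|(T * x)^-1|%:E * \int[leb]_s (fib_core T y x ((T * x)^-1 * s + 0))%:E)%E); last first.
  by rewrite H muleA -EFinM mulfV ?mul1e // normr_eq0.
rewrite -ge0_integralZl //; last 2 first.
- apply: (measurableT_comp mf); apply: measurable_funD => //; exact: measurable_funM.
- by move=> s _; rewrite lee_fin fib_core_ge0.
apply: eq_integral => s _; rewrite -EFinM; congr EFin.
rewrite /fib_core kernelK_tent // addr0 [_^-1 * s]mulrC.
rewrite (_ : T * (x * (s / (T * x))) = s); last by field; rewrite x0 gt_eqF.
rewrite normfV normrM (gtr0_norm T0); field.
by rewrite normr_eq0 x0 gt_eqF.
Qed.

Lemma W_continuous2 (x y z : R) (h : nat -> R) :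
  h n @[n --> \oo] --> 0 -> W (x, y + h n, z) @[n --> \oo] --> W (x, y, z).
Proof.
move=> h0; apply: (@cvg_comp _ _ _ (fun n => (x, y + h n, z)) W _ (nbhs (x, y, z))); last exact: Wc.
apply: (@cvg_pair _ _ _ _ (nbhs (x, y)) (nbhs z)); last exact: cvg_cst.
apply: (@cvg_pair _ _ _ _ (nbhs x) (nbhs y)); first exact: cvg_cst.
have H := cvgD (cvg_cst y : (fun=> y) @ \oo --> y) h0; rewrite addr0 in H.
exact: H.
Qed.

Lemma fib_int_cvg (T : nat -> R) (y x : R) : (forall k, 0 < T k) ->
  T k @[k --> \oo] --> +oo -> x != 0 ->
  fib_int (T k) y x @[k --> \oo] --> (W (x, nn * x * y ^+ 2, x * y))%:E.
Proof.
move=> T0 Too x0; under eq_fun do rewrite fib_int_subst //.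
set w := W _.
have -> : w%:E = (\int[leb]_s (w * tent s)%:E)%E.
  under eq_integral do rewrite EFinM.
  rewrite ge0_integralZl //; last 3 first.
  - by apply/measurable_EFinP; exact: measurable_tent.
  - by move=> s _; rewrite lee_fin tent_ge0.
  - by rewrite lee_fin W0.
  by rewrite integral_tent mule1.
apply: (@dominated_cvg_neq0 _ _ _ (fun s => C * box1 1 s)).
- move=> k; apply/measurable_EFinP; apply: measurable_funM; last exact: measurable_tent.
  exact: measurable_slice2.
- by apply/measurable_EFinP; apply: measurable_funM => //; exact: measurable_tent.
- exact: integrable_box1.
- by move=> k s; rewrite lee_fin mulr_ge0 ?tent_ge0.
- by move=> k s; rewrite lee_fin ler_pM ?tent_ge0 ?tent_le.
move=> s _; apply: cvg_EFin; first by near=> k.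
apply: cvgMr_tmp; apply: W_continuous2.
rewrite (_ : (fun n => _) = fun k => s / x * (T k)^-1); last first.
  by apply/funext => k; rewrite invfM mulrA mulrAC.
rewrite -[X in _ --> X](mulr0 (s / x)); apply: cvgMl_tmp.
by apply/gtr0_cvgV0 => //; exact: nearW.
Unshelve. all: by end_near. Qed.

Lemma fib_int_le1 (T y x : R) : 0 < T -> (fib_int T y x <= (2 * C * box1 r x)%:E)%E.
Proof.
move=> T0; have [->|x0] := eqVneq x 0.
  by rewrite fib_int0 lee_fin !mulr_ge0 ?box1_ge0.
rewrite fib_int_subst //.
have -> : (2 * C * box1 r x)%:E = (\int[leb]_s (C * box1 r x * box1 1 s)%:E)%E.
  by rewrite integral_box1 ?mulr_ge0 ?box1_ge0 //; congr EFin; ring.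
apply: ge0_le_integral => //.
- by move=> s _; rewrite lee_fin mulr_ge0 ?tent_ge0.
- apply/measurable_EFinP; apply: measurable_funM; last exact: measurable_tent.
  exact: measurable_slice2.
- by apply/measurable_EFinP; apply: measurable_funM => //; exact: measurable_box1.
move=> s _; rewrite lee_fin ler_pM ?tent_ge0 ?tent_le //.
set w := W _; have [->|/W_supp[xr _ _]] := eqVneq w 0; first by rewrite mulr_ge0 ?box1_ge0.
by rewrite /box1 xr mulr1 WC.
Qed.

Lemma fib_int_le2 (T y x X1 X2 : R) : 1 <= T -> y != 0 ->
  X1 = 2 * r / (nn * y ^+ 2) -> X2 = Num.sqrt (2 / (nn * T * y ^+ 2)) ->
  (fib_int T y x <= (2 * C * box1 X1 x + 2 * C * r * T * X2 * box1 X2 x)%:E)%E.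
Proof.
move=> T1 y0 X1E X2E; have T0 : 0 < T by apply: lt_le_trans T1.
have X20 : 0 <= X2 by rewrite X2E sqrtr_ge0.
have y2 : 0 < y ^+ 2 by rewrite exprn_even_gt0.
have B0 : 0 <= 2 * C * r * T * X2 * box1 X2 x by rewrite !mulr_ge0 ?box1_ge0 // ltW.
have A0 : 0 <= 2 * C * box1 X1 x by rewrite !mulr_ge0 ?box1_ge0.
have [x0|x0] := eqVneq x 0; first by rewrite {1}x0 fib_int0 lee_fin addr_ge0.
have xpos : 0 < `|x| by rewrite normr_gt0.
have [x1|x1] := leP `|x| X1.
  apply: (le_trans (fib_int_le1 y x T0)); rewrite lee_fin ler_wpDr //.
  rewrite ler_wpM2l ?mulr_ge0 // /box1 x1 /=.
  by case: (`|x| <= r); rewrite ?lexx ?ler01.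
rewrite fib_int_subst //.
have [x2|x2] := leP `|x| X2.
  apply: (@le_trans _ _ (\int[leb]_s (C * box1 r ((T * x)^-1 * s + nn * x * y ^+ 2))%:E)%E).
    apply: ge0_le_integral => //.
    - by move=> s _; rewrite lee_fin mulr_ge0 ?tent_ge0.
    - apply/measurable_EFinP; apply: measurable_funM; last exact: measurable_tent.
      exact: measurable_slice2.
    - apply/measurable_EFinP; apply: measurable_funM => //.
      apply: (measurableT_comp (@measurable_box1 R r)); apply: measurable_funD => //.
    move=> s _; rewrite lee_fin -[leRHS]mulr1.
    have t1 : tent s <= 1.
      by apply: le_trans (tent_le s) _; rewrite /box1; case: (`|s| <= 1); rewrite ?lexx ?ler01.
    rewrite ler_pM ?tent_ge0 //.
    set w := W _; have [->|/W_supp[_ xr _]] := eqVneq w 0; first by rewrite mulr_ge0 ?box1_ge0.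
    by rewrite /box1 addrC [_^-1 * s]mulrC xr mulr1 WC.
  rewrite (ge0_integral_affine _ (f := fun t => (C * box1 r t)%:E)); last 3 first.
  - by rewrite invr_eq0 mulf_neq0 // gt_eqF.
  - by apply/measurable_EFinP; apply: measurable_funM => //; exact: measurable_box1.
  - by move=> t; rewrite lee_fin mulr_ge0 ?box1_ge0.
  rewrite integral_box1 // ?(ltW r0) // -EFinM lee_fin ler_wpDl //.
  rewrite /box1 x2 mulr1 normfV invrK normrM gtr0_norm //.
  rewrite (_ : T * `|x| * (C * (2 * r)) = 2 * C * r * T * `|x|); last by ring.
  by rewrite ler_wpM2l // !mulr_ge0 // ltW.
rewrite (_ : (\int[leb]_s _)%E = 0%E) ?lee_fin ?addr_ge0 //.
apply: integral0_eq => s _; congr EFin.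
set w := W _; have [->|/W_supp[_ xr _]] := eqVneq w 0; first by rewrite mul0r.
suff -> : tent s = 0 by rewrite mulr0.
have [s1|s1] := leP 1 `|s|; first by rewrite /tent max_r // subr_le0.
exfalso; move: xr; apply/negP; rewrite -ltNge.
have e1 : `|nn * x * y ^+ 2| = nn * `|x| * y ^+ 2.
  by rewrite normrM (gtr0_norm y2) normrM (gtr0_norm nn0).
have e2 : `|s / (T * x)| <= (T * `|x|)^-1.
  by rewrite normrM normfV normrM (gtr0_norm T0) ler_piMl ?invr_ge0 ?mulr_ge0 // ltW.
have h1 : 2 * r < nn * `|x| * y ^+ 2.
  rewrite (_ : nn * `|x| * y ^+ 2 = `|x| * (nn * y ^+ 2)); last by ring.
  by move: x1; rewrite X1E ltr_pdivrMr // mulr_gt0.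
have h2 : (T * `|x|)^-1 < nn * `|x| * y ^+ 2 / 2.
  have : X2 ^+ 2 < `|x| ^+ 2 by rewrite ltrXn2r // nnegrE.
  rewrite X2E sqr_sqrtr; last first.
    by apply: divr_ge0 => //; apply/ltW/mulr_gt0 => //; exact: mulr_gt0.
  rewrite ltr_pdivrMr; last by apply: mulr_gt0 => //; exact: mulr_gt0.
  move=> h.
  rewrite -div1r ltr_pdivrMr; last exact: mulr_gt0.
  rewrite mulrAC ltr_pdivlMr // mul1r.
  by apply: (lt_le_trans h); rewrite le_eqVlt; apply/orP; left; apply/eqP; ring.
have := lerB_normD (nn * x * y ^+ 2) (s / (T * x)).
rewrite e1 => H; apply: lt_le_trans H.
set A := nn * `|x| * y ^+ 2 in h1 h2 *; set B := `|s / (T * x)| in e2 *.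
set D := (T * `|x|)^-1 in e2 h2; lra.
Qed.

Definition fib_lim (y x : R) : R := W (x, nn * x * y ^+ 2, x * y).

Lemma measurable_fib_lim :
  measurable_fun [set: MR * MR] (fun v : MR * MR => (fib_lim v.1 v.2)%:E).
Proof.
apply/measurable_EFinP; apply: (measurableT_comp measurable_W).
apply: measurable_fun_pair; last by apply: measurable_funM.
apply: measurable_fun_pair => //; apply: measurable_funM; first exact: measurable_funM.
exact: measurable_funX.
Qed.

(** The total mass of the weight on the cone: the limit of the thickened integrals as [T] tends to
    infinity. *)
Definition tot_int : \bar R := (\int[leb]_y \int[leb]_x (fib_lim y x)%:E)%E.

Lemma fibre_cvg (T : nat -> R) (y : R) : (forall k, 0 < T k) -> T k @[k --> \oo] --> +oo ->
  (\int[leb]_x fib_int (T k) y x)%E @[k --> \oo] --> (\int[leb]_x (fib_lim y x)%:E)%E.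
Proof.
move=> T0 Too; apply: (@dominated_cvg_neq0 _ _ _ (fun x => 2 * C * box1 r x)).
- move=> k; exact: (measurable_fun_pair2 (f := fun v : MR * MR => fib_int (T k) v.1 v.2) y (measurable_fib_int (T0 k))).
- exact: (measurable_fun_pair2 (f := fun v : MR * MR => (fib_lim v.1 v.2)%:E) y measurable_fib_lim).
- exact: integrable_box1.
- by move=> k x; exact: fib_int_ge0.
- by move=> k x; exact: fib_int_le1.
- by move=> x x0; exact: fib_int_cvg.
Qed.

(** An integrable majorant in [y], uniform in [T]: bounded fibres for [|y| <= 1], decay like
    [1 / y^2] beyond. *)
Lemma fibre_le (T y : R) : 1 <= T ->
  (\int[leb]_x fib_int T y x <= (32 * C * r / (1 + y ^+ 2))%:E)%E.
Proof.
move=> T1; have T0 : 0 < T by apply: lt_le_trans T1.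
have mF : measurable_fun [set: MR] (fib_int T y).
  exact: (measurable_fun_pair2 (f := fun v : MR * MR => fib_int T v.1 v.2) y (measurable_fib_int T0)).
have d0 : 0 < 1 + y ^+ 2 by rewrite ltr_pwDl ?sqr_ge0.
have Cr0 : 0 <= C * r by rewrite mulr_ge0 // ltW.
have b1 : (\int[leb]_x fib_int T y x <= (4 * C * r)%:E)%E.
  have -> : (4 * C * r)%:E = (\int[leb]_x (2 * C * box1 r x)%:E)%E.
    by rewrite integral_box1 ?mulr_ge0 // ?(ltW r0) //; congr EFin; ring.
  apply: ge0_le_integral => //.
  - by move=> x _; exact: fib_int_ge0.
  - by apply/measurable_EFinP; apply: measurable_funM => //; exact: measurable_box1.
  - by move=> x _; exact: fib_int_le1.
have [y1|y1] := leP (y ^+ 2) 1.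
  apply: (le_trans b1); rewrite lee_fin ler_pdivlMr //; nra.
have y0 : y != 0 by apply: contraTneq y1 => ->; rewrite expr0n /= -leNgt.
set X1 := 2 * r / (nn * y ^+ 2); set X2 := Num.sqrt (2 / (nn * T * y ^+ 2)).
have y2 : 0 < y ^+ 2 by apply: lt_trans y1.
have X10 : 0 <= X1 by rewrite /X1; apply: divr_ge0; apply: mulr_ge0 => //; exact: ltW.
have X20 : 0 <= X2 := sqrtr_ge0 _.
have X22 : X2 ^+ 2 = 2 / (nn * T * y ^+ 2).
  rewrite /X2 sqr_sqrtr //; apply: divr_ge0 => //; apply: mulr_ge0; last exact: ltW.
  by apply: mulr_ge0; exact: ltW.
have c1 : 0 <= 2 * C by rewrite mulr_ge0.
have c2 : 0 <= 2 * C * r * T * X2 by rewrite !mulr_ge0 // ltW.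
apply: (@le_trans _ _ (\int[leb]_x ((2 * C * box1 X1 x)%:E + (2 * C * r * T * X2 * box1 X2 x)%:E))%E).
  apply: ge0_le_integral => //.
  - by move=> x _; exact: fib_int_ge0.
  - by apply: emeasurable_funD; apply/measurable_EFinP; apply: measurable_funM => //; exact: measurable_box1.
  - by move=> x _; rewrite -EFinD; exact: fib_int_le2.
rewrite ge0_integralD //; last 4 first.
- by move=> x _; rewrite lee_fin mulr_ge0 ?box1_ge0.
- by apply/measurable_EFinP; apply: measurable_funM => //; exact: measurable_box1.
- by move=> x _; rewrite lee_fin mulr_ge0 ?box1_ge0.
- by apply/measurable_EFinP; apply: measurable_funM => //; exact: measurable_box1.
rewrite !integral_box1 // -EFinD lee_fin.
(* [T X2^2 = 2 / (nn y^2)], so that [T] cancels. *)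
have -> : 2 * C * (2 * X1) + 2 * C * r * T * X2 * (2 * X2) = 16 * (C * r) / (nn * y ^+ 2).
  rewrite (_ : 2 * C * r * T * X2 * (2 * X2) = 4 * C * r * T * X2 ^+ 2); last by ring.
  by rewrite X22 /X1; field; rewrite ?y0 ?(gt_eqF nn0) ?(gt_eqF T0).
have nn_y : y ^+ 2 <= nn * y ^+ 2 by rewrite ler_peMl // ltW.
rewrite -subr_ge0 (_ : _ - _ =
  C * r * (32 * (nn * y ^+ 2) - 16 * (1 + y ^+ 2)) / ((1 + y ^+ 2) * (nn * y ^+ 2))).
  apply: divr_ge0; last by apply/ltW/mulr_gt0 => //; exact: mulr_gt0.
  by apply: mulr_ge0 => //; lra.
by field; rewrite ?y0 ?(gt_eqF nn0) ?(gt_eqF d0).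
Qed.

Lemma fibre_lim_le (y : R) :
  (\int[leb]_x (fib_lim y x)%:E <= (32 * C * r / (1 + y ^+ 2))%:E)%E.
Proof.
have T0 k : 0 < k.+1%:R :> R by rewrite ltr0n.
have Too : k.+1%:R @[k --> \oo] --> (+oo : set_system R).
  by apply/cvgryPge => A; near=> k; apply: le_trans (_ : k%:R <= _); [near: k; exact: nbhs_infty_ger|rewrite ler_nat].
have := @fibre_cvg (fun k => k.+1%:R) y T0 Too.
move/(@cvg_lim _) => <- //; apply: lime_le; last by apply: nearW => k; apply: fibre_le; rewrite ler1n.
by apply/cvg_ex; eexists; exact: (@fibre_cvg (fun k => k.+1%:R) y T0 Too).
Unshelve. all: by end_near. Qed.

Lemma fib_int_tot_cvg (T : nat -> R) : (forall k, 1 <= T k) -> T k @[k --> \oo] --> +oo ->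
  (\int[leb]_y \int[leb]_x fib_int (T k) y x)%E @[k --> \oo] --> tot_int.
Proof.
move=> T1 Too; have T0 k : 0 < T k by apply: lt_le_trans (T1 k).
apply: (@dominated_cvg_neq0 _ _ _ (fun y => 32 * C * r / (1 + y ^+ 2))).
- move=> k; apply: (@measurable_fun_fubini_tonelli_F _ _ MR MR R leb
    (fun v => fib_int (T k) v.1 v.2)); first exact: measurable_fib_int.
  by move=> v; exact: fib_int_ge0.
- apply: (@measurable_fun_fubini_tonelli_F _ _ MR MR R leb
    (fun v => (fib_lim v.1 v.2)%:E)); first exact: measurable_fib_lim.
  by move=> v; rewrite lee_fin W0.
- by apply: integrable_oneDsqrV; rewrite !mulr_ge0 // ltW.
- by move=> k y; apply: integral_ge0 => x _; exact: fib_int_ge0.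
- by move=> k y; exact: fibre_le.
- by move=> y _; exact: fibre_cvg.
Qed.

Lemma tot_int_fin : tot_int \is a fin_num.
Proof.
rewrite ge0_fin_numE; last by apply: integral_ge0 => y _; apply: integral_ge0 => x _; rewrite lee_fin W0.
have C32 : 0 <= 32 * C * r by rewrite !mulr_ge0 // ltW.
have /integrableP[mI] := integrable_oneDsqrV C32.
apply: le_lt_trans; apply: ge0_le_integral => //.
- by move=> y _; apply: integral_ge0 => x _; rewrite lee_fin W0.
- apply: (@measurable_fun_fubini_tonelli_F _ _ MR MR R leb
    (fun v => (fib_lim v.1 v.2)%:E)); first exact: measurable_fib_lim.
  by move=> v; rewrite lee_fin W0.
- exact: measurableT_comp.
- move=> y _; rewrite gee0_abs; first exact: fibre_lim_le.
  by rewrite lee_fin divr_ge0 // addr_ge0 // sqr_ge0.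
Qed.

End RealDensity.

(** * Passage to cone coordinates under the integral *)

Section SigmaInfty.
Variable R : realType.
Local Notation MR := (measurableTypeR R).
Local Notation leb := (@lebesgue_measure R).

Definition bump_like (W : R * R * R -> R) (C r : R) : Prop :=
  [/\ continuous W, forall x, 0 <= W x, forall x, W x <= C, 0 < r &
   forall x y z, W (x, y, z) != 0 -> [/\ `|x| <= r, `|y| <= r & `|z| <= r]].

Lemma measurable_qeval q :
  measurable_fun [set: MR * MR * MR] (fun v : MR * MR * MR => qeval q (v : R * R * R) : MR).
Proof.
have m1 : measurable_fun [set: MR * MR * MR] (fun v : MR * MR * MR => v.1.1) by apply: measurableT_comp.
have m2 : measurable_fun [set: MR * MR * MR] (fun v : MR * MR * MR => v.1.2) by apply: measurableT_comp.
have m3 : measurable_fun [set: MR * MR * MR] (fun v : MR * MR * MR => v.2) by exact: measurable_snd.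
rewrite (_ : (fun v => _) = fun v : MR * MR * MR =>
  ((q11 q)%:~R * v.1.1 ^+ 2 + (q12 q)%:~R * v.1.1 * v.1.2 + (q13 q)%:~R * v.1.1 * v.2
  + (q22 q)%:~R * v.1.2 ^+ 2 + (q23 q)%:~R * v.1.2 * v.2 + (q33 q)%:~R * v.2 ^+ 2)); last first.
  by apply/funext => -[[x y] z].
have mM (a : R) (f g : MR * MR * MR -> MR) : measurable_fun [set: MR * MR * MR] f ->
  measurable_fun [set: MR * MR * MR] g -> measurable_fun [set: MR * MR * MR] (fun v => a * f v * g v).
  by move=> mf mg; apply: measurable_funM => //; exact: measurable_funM.
have mX (a : R) (f : MR * MR * MR -> MR) : measurable_fun [set: MR * MR * MR] f ->
  measurable_fun [set: MR * MR * MR] (fun v => a * f v ^+ 2).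
  by move=> mf; apply: measurable_funM => //; exact: measurable_funX.
apply: measurable_funD; last exact: mX.
apply: measurable_funD; last exact: mM.
apply: measurable_funD; last exact: mX.
apply: measurable_funD; last exact: mM.
by apply: measurable_funD; [exact: mX | exact: mM].
Qed.

Lemma measurable_kernelK_qeval T q : 0 < T ->
  measurable_fun [set: MR * MR * MR] (fun v : MR * MR * MR => kernelK T (qeval q (v : R * R * R)) : R).
Proof. by move=> T0; exact: (measurableT_comp (measurable_kernelK T0) (measurable_qeval q)). Qed.

Variables (W : R * R * R -> R) (C r : R).
Hypothesis HW : bump_like W C r.
Variable n : nat.
Hypothesis n0 : (0 < n)%N.

Let nn1 : 1 <= n%:R :> R. Proof. by rewrite ler1n. Qed.
Let Wc : continuous W := let: And5 h _ _ _ _ := HW in h.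
Let W0 : forall x, 0 <= W x := let: And5 _ h _ _ _ := HW in h.
Let WC : forall x, W x <= C := let: And5 _ _ h _ _ := HW in h.
Let r0 : 0 < r := let: And5 _ _ _ h _ := HW in h.
Let Ws : forall x y z, W (x, y, z) != 0 -> [/\ `|x| <= r, `|y| <= r & `|z| <= r] :=
  let: And5 _ _ _ _ h := HW in h.

Let core (T : R) (v : MR * MR * MR) : R := W v * kernelK T (qeval (nf_form 1 0 0 (- n%:Z)) (v : R * R * R)).

Let measurable_core T : 0 < T -> measurable_fun [set: MR * MR * MR] (fun v => (core T v)%:E).
Proof.
move=> T0; apply/measurable_EFinP; apply: measurable_funM.
  exact: (measurable_W Wc).
exact: measurable_kernelK_qeval.
Qed.

Let core_ge0 T v : 0 < T -> 0 <= core T v.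
Proof. by move=> T0; rewrite mulr_ge0 // kernelK_ge0. Qed.

Let coreE T (x y z : R) : core T (x, y, z) = W (x, y, z) * kernelK T (x * y - n%:R * z ^+ 2).
Proof.
rewrite /core /qeval /=; congr (_ * kernelK _ _).
by rewrite !mulr0z mulr1z rmorphN /= -pmulrn; ring.
Qed.

(** For each nonzero [x], the third coordinate is replaced by [x y] and the second is shifted by
    [n x y^2]; the plane [x = 0] is removed as a null set. *)
Lemma integral_core_fib (T : R) : 0 < T ->
  (\int[@lebesgue3 R]_v (W v * kernelK T (qeval (nf_form 1 0 0 (- n%:Z)) (v : R * R * R)))%:E =
   \int[leb]_y \int[leb]_x fib_int W n%:R T y x)%E.
Proof.
move=> T0; rewrite ge0_integral_lebesgue3; last 2 first.
- exact: measurable_core.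
- by move=> v; rewrite lee_fin core_ge0.
have core0 v : (0 <= (core T v)%:E)%E by rewrite lee_fin core_ge0.
apply: (etrans (ge0_fubini_leb23 (measurable_core T0) core0)).
pose G (v : MR * MR) : \bar R := (\int[leb]_y (core T (v.1, y, v.2))%:E)%E.
have mG : measurable_fun [set: MR * MR] G.
  apply: (@measurable_fun_fubini_tonelli_F _ _ (MR * MR)%type MR R leb
    (fun v => (core T (v.1.1, v.2, v.1.2))%:E)).
    apply: (measurableT_comp (measurable_core T0)).
    apply: measurable_fun_pair; last by apply: measurableT_comp.
    by apply: measurable_fun_pair; [apply: measurableT_comp | exact: measurable_snd].
  by move=> v; rewrite lee_fin core_ge0.
have G0 v : (0 <= G v)%E by apply: integral_ge0 => y _; rewrite lee_fin core_ge0.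
have mGx x : measurable_fun [set: MR] (fun z : MR => G (x, z)).
  exact: (measurable_fun_pair2 x mG).
have mF : measurable_fun [set: MR * MR] (fun v : MR * MR => fib_int W n%:R T v.1 v.2).
  by apply: measurable_fib_int.
have F0 y x : (0 <= fib_int W n%:R T y x)%E by apply: fib_int_ge0.
have F0' (v : MR * MR) : (0 <= fib_int W n%:R T v.1 v.2)%E by exact: F0.
apply: (etrans _ (esym (ge0_fubini_leb mF F0'))).
have mS (x y : R) : measurable_fun [set: MR] (fun s : MR => (core T (x, s, y))%:E).
  apply: (measurableT_comp (measurable_core T0)).
  by apply: measurable_fun_pair => //; apply: measurable_fun_pair.
pose D : set MR := [set: MR] `\ 0%R.
have HD (h : MR -> \bar R) : measurable_fun [set: MR] h ->
    (\int[leb]_x h x = \int[leb]_(x in D) h x)%E.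
  move=> mh; rewrite integral_setD1 //; first exact: measurableD.
  exact: measurable_funTS.
rewrite HD; last exact: (@measurable_fun_fubini_tonelli_F _ _ MR MR R leb G).
rewrite [RHS]HD; last first.
  apply: (@measurable_fun_fubini_tonelli_G _ _ MR MR R leb
    (fun v => fib_int W n%:R T v.1 v.2)) => //.
apply: eq_integral => x; rewrite inE => -[_ /eqP x0].
have H := ge0_integral_affine 0 x0 (mGx x) (fun z => G0 (x, z)).
have nx : `|x| != 0 by rewrite normr_eq0.
transitivity (`|x|%:E * \int[leb]_z G (x, (x * z + 0)%R))%E.
  by rewrite H muleA -EFinM mulfV // mul1e.
rewrite -ge0_integralZl //; last first.
  apply: (measurableT_comp (mGx x)); apply: measurable_funD => //.
apply: eq_integral => y _; rewrite addr0 /G /=.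
rewrite -ge0_integralZl //.
have m2 : measurable_fun [set: MR] (fun s : MR => (`|x|%:E * (core T (x, s, x * y))%:E)%E).
  by apply: emeasurable_funM.
have h2 s : (0 <= `|x|%:E * (core T (x, s, (x * y)%R))%:E)%E.
  by rewrite mule_ge0 ?lee_fin ?core_ge0.
have := ge0_integral_affine (n%:R * x * y ^+ 2) (oner_neq0 R) m2 h2.
rewrite normr1 invr1 mul1e => <-.
apply: eq_integral => s _; rewrite coreE /fib_core -EFinM; congr EFin.
rewrite mul1r addrC (_ : x * (n%:R * x * y ^+ 2 + s) - n%:R * (x * y) ^+ 2 = x * s); last by ring.
by ring.
Qed.

Lemma integral_core_cvg :
  (fine (\int[@lebesgue3 R]_v (W v * kernelK T (qeval (nf_form 1 0 0 (- n%:Z)) (v : R * R * R)))%:E)%E)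
   @[T --> +oo] --> fine (tot_int W n%:R).
Proof.
apply/cvg_pinftyP => u uoo.
(* The majorants hold for [T >= 1], which a sequence tending to infinity satisfies eventually. *)
pose u' k := Num.max (u k) 1.
have uu' : \forall k \near \oo, u k = u' k.
  by move/cvgryPge : uoo => /(_ 1); apply: filterS => k uk; rewrite /u' max_l.
have u1 k : 1 <= u' k by rewrite le_max lexx orbT.
have u'oo : u' k @[k --> \oo] --> +oo.
  apply/cvgryPge => A; move/cvgryPge : uoo => /(_ A); apply: filterS => k Ak.
  by rewrite le_max Ak.
have H := fib_int_tot_cvg Wc W0 WC r0 Ws nn1 u1 u'oo.
have H' : fine (\int[leb]_y \int[leb]_x fib_int W n%:R (u' k) y x)%E @[k --> \oo] --> fine (tot_int W n%:R).
  by apply: fine_cvg; rewrite fineK //; exact: (tot_int_fin Wc W0 WC r0 Ws nn1).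
apply: cvg_trans H'; apply: near_eq_cvg; apply: filterS uu' => k ->.
by rewrite integral_core_fib // (lt_le_trans ltr01).
Qed.

End SigmaInfty.

Section SigmaInftyEquiv.
Variable R : realType.
Local Notation MR := (measurableTypeR R).

Lemma mat3_app_continuous (M : mat3 R) : continuous (mat3_app M).
Proof.
have H (a b c : R) : continuous (fun x : R * R * R => a * x.1.1 + b * x.1.2 + c * x.2).
  move=> x; apply: cvgD; last first.
    by apply: cvgMl_tmp; exact: cvg_snd.
  apply: cvgD; apply: cvgMl_tmp; apply: cvg_comp (@cvg_fst _ _ _ _ _) _ => //.
    exact: cvg_fst.
  exact: cvg_snd.
rewrite (_ : mat3_app M = fun x => (m11 M * x.1.1 + m12 M * x.1.2 + m13 M * x.2,
   m21 M * x.1.1 + m22 M * x.1.2 + m23 M * x.2,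
   m31 M * x.1.1 + m32 M * x.1.2 + m33 M * x.2)); last by apply/funext => -[[x y] z].
move=> x.
apply: (@cvg_pair _ _ _ _ (nbhs (m11 M * x.1.1 + m12 M * x.1.2 + m13 M * x.2,
   m21 M * x.1.1 + m22 M * x.1.2 + m23 M * x.2)) (nbhs (m31 M * x.1.1 + m32 M * x.1.2 + m33 M * x.2))); last exact: H.
apply: (@cvg_pair _ _ _ _ (nbhs (m11 M * x.1.1 + m12 M * x.1.2 + m13 M * x.2))
   (nbhs (m21 M * x.1.1 + m22 M * x.1.2 + m23 M * x.2))); exact: H.
Qed.

(** The substitution [M] contributes [|det M|] and replaces the form by [c] times the model; since
    [K_T(c t) = K_(c T)(t) / c], the limit is unchanged apart from the factor [1 / c]. *)
Lemma sigma_infty_cvg q n M c (w : R * R * R -> R) (C r C' r' : R) : (0 < n)%N ->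
  zero_equiv R q (nf_form 1 0 0 (- n%:Z)) M c ->
  bump_like w C r -> bump_like (fun x => w (mat3_app (mat3_int R M) x)) C' r' ->
  (\int[@lebesgue3 R]_y (w y * kernelK T (qeval q y))) @[T --> +oo] -->
  `|mat3_det M|%N%:R / c%:R * fine (tot_int (fun x => w (mat3_app (mat3_int R M) x)) n%:R).
Proof.
move=> n0 H Hw HW.
set W := fun x => _ in HW *; have c0 : 0 < c%:R :> R by rewrite ltr0n (ze_c_gt0 H).
have cvgI := @integral_core_cvg R W C' r' HW n n0.
set I := fun T : R => fine _ in cvgI.
have cT : c%:R * T @[T --> +oo] --> (+oo : set_system R).
  apply/cvgryPge => A; move: (@nbhs_pinfty_ge R (A / c%:R) (num_real _)).
  by apply: filterS => T; rewrite ler_pdivrMr // mulrC.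
have E : \forall T \near +oo, `|mat3_det M|%N%:R / c%:R * I (c%:R * T) =
    \int[@lebesgue3 R]_y (w y * kernelK T (qeval q y)).
  near=> T; have T0 : 0 < T by near: T; exact: nbhs_pinfty_gt.
  have cT0 : 0 < c%:R * T by rewrite mulr_gt0.
  rewrite /Rintegral (ze_subst H) /I; last 2 first.
  - apply/measurable_EFinP; apply: measurable_funM.
      by apply: measurable_W; case: Hw.
    exact: measurable_kernelK_qeval.
  - by move=> v; rewrite lee_fin mulr_ge0 ?kernelK_ge0 //; case: Hw.
  have -> : `|mat3_det (mat3_int R M)| = `|mat3_det M|%N%:R.
    by rewrite mat3_int_det -intr_norm -abszE.
  have fineZ (a : R) (x : \bar R) : 0 < a -> fine (a%:E * x)%E = a * fine x.
    by case: x => [x| |] a0 //=; rewrite ?gt0_muley ?gt0_muleNy ?lte_fin //= mulr0.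
  have KE v : kernelK T (qeval q (mat3_app (mat3_int R M) v)) =
      c%:R^-1 * kernelK (c%:R * T) (qeval (nf_form 1 0 0 (- n%:Z)) v).
    rewrite -qeval_pull (ze_pull H) qeval_scale -pmulrn !kernelK_tent //.
    set X := qeval _ v; rewrite (_ : c%:R * T * X = T * (c%:R * X)); last by ring.
    by field; rewrite gt_eqF.
  under [X in _ = fine (_ * X)]eq_integral do rewrite KE mulrCA EFinM.
  rewrite ge0_integralZl //; last 2 first.
  - apply/measurable_EFinP; apply: measurable_funM.
      by apply: measurable_W; case: HW.
    exact: measurable_kernelK_qeval.
  - have W0 : forall v, 0 <= W v by case: HW.
    by move=> v _; rewrite lee_fin; apply: mulr_ge0; [exact: W0 | exact: kernelK_ge0].
  rewrite muleA -EFinM fineZ // divr_gt0 // ltr0n; exact: ze_det_gt0 H.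
apply: cvg_trans; first exact: (near_eq_cvg E).
by apply: cvgMl_tmp; apply: cvg_comp cT _; exact: cvgI.
Unshelve. all: by end_near. Qed.

End SigmaInftyEquiv.

(** * The mass on the cone in the coordinates of each divisor *)

Section ConeIntegral.
Variable R : realType.
Local Notation MR := (measurableTypeR R).
Local Notation leb := (@lebesgue_measure R).

Lemma integral_itv_cutoff (f : R -> R) (b : R) : 0 <= b -> (forall x, b < x -> f x = 0) ->
  (\int[leb]_(x in `[0%R, +oo[) (f x)%:E = \int[leb]_(x in `[0%R, b]) (f x)%:E)%E.
Proof.
move=> b0 fb; rewrite integral_mkcond [RHS]integral_mkcond; apply: eq_integral => x _.
rewrite /patch !mem_setE !in_itv /= andbT.
by case: (leP 0 x) => //= x0; case: (leP x b) => // xb; rewrite fb.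
Qed.

(** The substitution [x = d u^2]; the two signs of [u] supply the factor 2 of its derivative. *)
Lemma integral_quadratic_subst (d r : R) (G : R -> R) : 0 < d -> 0 < r ->
  continuous G -> (forall x, 0 <= G x) -> (forall x, r < x -> G x = 0) ->
  (\int[leb]_u (d * `|u| * G (d * u ^+ 2))%:E = \int[leb]_(x in `[0%R, +oo[) (G x)%:E)%E.
Proof.
(* Chosen so that [d b^2 >= r], hence both integrals may be cut off: [(1 + t)^2 >= t] with
   [t = r / d]. *)
move=> d0 r0 cG G0 Gr; pose b := 1 + r / d.
have b0 : 0 < b by rewrite addr_gt0 // divr_gt0.
have Fb : r <= d * b ^+ 2.
  have rd : 0 < r / d by rewrite divr_gt0.
  have : r / d <= b ^+ 2 by rewrite /b; nra.
  by rewrite ler_pdivrMr // mulrC.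
pose F (u : R) : R := d * u ^+ 2.
have dF (u : R) : is_derive u (1 : R) F (2 * d * u).
  by apply: is_derive_eq; rewrite /GRing.scale /=; ring.
have F'E : derive1 F = fun u => 2 * d * u.
  by apply/funext => u; rewrite derive1E (@derive_val _ _ _ _ _ _ _ (dF u)).
have cF : continuous F.
  by move=> u; apply: differentiable_continuous; apply/derivable1_diffP; exact: (@ex_derive _ _ _ _ _ _ _ (dF u)).
have cF' : continuous (derive1 F).
  by rewrite F'E => u; apply: cvgMl_tmp; exact: cvg_id.
have c_abs : continuous (fun u : R => d * `|u| * G (d * u ^+ 2)).
  move=> u; apply: cvgM; last first.
    by apply: (@cvg_comp _ _ _ F G (nbhs u) (nbhs (F u))); [exact: cF | exact: cG].
  by apply: cvgMl_tmp; exact: norm_continuous.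
have big u : b < u -> r < d * u ^+ 2.
  move=> bu; apply: le_lt_trans Fb _; rewrite ltr_pM2l // !expr2.
  by apply: ltr_pM => //; exact: ltW.
rewrite ge0_symfun_integralT //; last 2 first.
- by move=> u; rewrite !mulr_ge0 // ltW.
- by move=> u; rewrite /= normrN sqrrN.
rewrite (_ : [set x : R | 0 <= x] = `[0%R, +oo[%classic); last by rewrite set_itvcy.
rewrite (@integral_itv_cutoff _ b) ?(ltW b0) //; last first.
  by move=> u bu; rewrite Gr ?mulr0 // big.
rewrite (@integral_itv_cutoff G (F b)); last 2 first.
- by rewrite /F mulr_ge0 ?sqr_ge0 // ltW.
- by move=> x Fx; rewrite Gr // (le_lt_trans Fb).
have F0 : F 0 = 0 by rewrite /F expr0n mulr0.
rewrite -[in RHS]F0 integration_by_substitution_increasing; last 7 first.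
- exact: ltW.
- move=> x y; rewrite !in_itv /= => /andP[x0 _] /andP[y0 _] xy.
  by rewrite /F ltr_pM2l // ltrXn2r // nnegrE.
- by move=> x _; exact: cF'.
- by apply/cvg_ex; exists (derive1 F 0); apply: cvg_at_right_filter; exact: cF'.
- by apply/cvg_ex; exists (derive1 F b); apply: cvg_at_left_filter; exact: cF'.
- split; first by move=> x _; exact: (@ex_derive _ _ _ _ _ _ _ (dF x)).
    by apply: cvg_at_right_filter; exact: cF.
  by apply: cvg_at_left_filter; exact: cF.
- exact: continuous_subspaceT.
have m1 : measurable_fun (`[0, b] : set MR) (fun u : R => (d * `|u| * G (d * u ^+ 2))%:E).
  by apply/measurable_EFinP; apply: measurable_funTS; exact: continuous_measurable_fun.
rewrite -ge0_integralZl //.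
- apply: eq_integral => u; rewrite inE /= in_itv /= => /andP[u0 _].
  rewrite -EFinM ger0_norm //; congr EFin.
  rewrite -[RHS]/(G (d * u ^+ 2) * derive1 F u) F'E; ring.
- by move=> u _; rewrite lee_fin !mulr_ge0 // ltW.
Qed.

Definition cone_pt (d e : R) (u v : R) : R * R * R := (d * u ^+ 2, e * v ^+ 2, u * v).

Definition cone_int (W : R * R * R -> R) (d e : R) : \bar R :=
  (\int[leb]_u \int[leb]_v (W (cone_pt d e u v))%:E)%E.

Lemma measurable_cone (W : R * R * R -> R) (d e : R) : continuous W ->
  measurable_fun [set: MR * MR] (fun t : MR * MR => (W (cone_pt d e t.1 t.2))%:E).
Proof.
move=> cW; apply/measurable_EFinP; apply: (measurableT_comp (measurable_W cW)).
apply: measurable_fun_pair; last by apply: measurable_funM.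
by apply: measurable_fun_pair; apply: measurable_funM => //; exact: measurable_funX.
Qed.

(** With [v = d u y] and then [x = d u^2], the point [(d u^2, e v^2, u v)] becomes
    [(x, d e x y^2, x y)]. *)
Lemma cone_int_fibre (W : R * R * R -> R) (C r d e : R) : bump_like W C r -> 0 < d ->
  cone_int W d e =
  (\int[leb]_y \int[leb]_(x in `[0%R, +oo[) (W (x, d * e * x * y ^+ 2, x * y))%:E)%E.
Proof.
move=> [cW W0 WC r0 Ws] d0.
have mW := measurable_cone d e cW.
pose h (t : MR * MR) : \bar R := (d * `|t.1| * W (d * t.1 ^+ 2, d * e * (d * t.1 ^+ 2) * t.2 ^+ 2, d * t.1 ^+ 2 * t.2))%:E.
have mh : measurable_fun [set: MR * MR] h.
  apply/measurable_EFinP; apply: measurable_funM.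
    by apply: measurable_funM => //; apply: (measurableT_comp (@measurable_abs R)).
  have m2 : measurable_fun [set: MR * MR] (fun t : MR * MR => d * t.1 ^+ 2 : MR).
    by apply: measurable_funM => //; exact: measurable_funX.
  apply: (measurableT_comp (measurable_W cW)).
  apply: measurable_fun_pair; last exact: measurable_funM.
  apply: measurable_fun_pair => //; apply: measurable_funM; last exact: measurable_funX.
  exact: measurable_funM.
have h0 t : (0 <= h t)%E by rewrite lee_fin !mulr_ge0 // ltW.
transitivity (\int[leb]_u \int[leb]_y h (u, y))%E.
  pose D : set MR := [set: MR] `\ 0%R.
  have HD (k : MR -> \bar R) : measurable_fun [set: MR] k ->
      (\int[leb]_x k x = \int[leb]_(x in D) k x)%E.
    move=> mk; rewrite integral_setD1 //; first exact: measurableD.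
    exact: measurable_funTS.
  rewrite /cone_int HD; last first.
    apply: (@measurable_fun_fubini_tonelli_F _ _ MR MR R leb
      (fun t => (W (cone_pt d e t.1 t.2))%:E)) => //.
    by move=> t; rewrite lee_fin.
  rewrite [RHS]HD; last exact: (@measurable_fun_fubini_tonelli_F _ _ MR MR R leb h).
  apply: eq_integral => u; rewrite inE => -[_ /eqP u0].
  have a0 : d * u != 0 by rewrite mulf_neq0 // gt_eqF.
  have mu := measurable_fun_pair2 (f := fun t : MR * MR => (W (cone_pt d e t.1 t.2))%:E) u mW.
  have u_ge0 v : (0 <= (W (cone_pt d e u v))%:E)%E by rewrite lee_fin.
  have H := ge0_integral_affine 0 a0 mu u_ge0.
  transitivity (`|d * u|%:E * \int[leb]_y (W (cone_pt d e u (d * u * y + 0)%R))%:E)%E.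
    by rewrite H muleA -EFinM mulfV ?mul1e // normr_eq0.
  rewrite -ge0_integralZl //.
  - apply: eq_integral => y _; rewrite addr0 /h -EFinM normrM (gtr0_norm d0) /cone_pt.
    by congr ((_ * _ * W (_, _, _))%:E) => /=; ring.
  - apply: (measurableT_comp mu); apply: measurable_funD => //.
apply: (etrans (ge0_fubini_leb mh h0)).
apply: eq_integral => y _.
pose G (x : R) := W (x, d * e * x * y ^+ 2, x * y).
rewrite -(@integral_quadratic_subst d r G) //.
- move=> x; apply: (@cvg_comp _ _ _ (fun x => (x, d * e * x * y ^+ 2, x * y)) W _ (nbhs (x, d * e * x * y ^+ 2, x * y))); last exact: cW.
  apply: (@cvg_pair _ _ _ _ (nbhs (x, d * e * x * y ^+ 2)) (nbhs (x * y))).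
    apply: (@cvg_pair _ _ _ _ (nbhs x) (nbhs (d * e * x * y ^+ 2))) => //.
    by apply: cvgMr_tmp; apply: cvgMl_tmp; exact: cvg_id.
  by apply: cvgMr_tmp; exact: cvg_id.
- by move=> x; exact: W0.
- move=> x rx; apply/eqP; apply: contraTT rx => /Ws[xr _ _].
  by rewrite -leNgt (le_trans (ler_norm x)).
Qed.

Lemma measurable_half_fibre (W : R * R * R -> R) (c : R) :
  continuous W -> (forall x, 0 <= W x) ->
  measurable_fun [set: MR]
    (fun y : MR => \int[leb]_(x in `[0%R, +oo[) (fib_lim W c y x)%:E)%E.
Proof.
move=> cW W0.
rewrite (_ : (fun y => _) = (fun y : MR =>
    \int[leb]_x (fib_lim W c y x * \1_(`[0%R, +oo[%classic) x)%:E)%E).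
  have m1 : measurable_fun [set: MR] (\1_(`[0%R, +oo[%classic) : MR -> R).
    by apply: measurable_indic.
  apply: (@measurable_fun_fubini_tonelli_F _ _ MR MR R leb
    (fun v => (fib_lim W c v.1 v.2 * \1_(`[0%R, +oo[%classic) v.2)%:E)).
    apply/measurable_EFinP; apply: measurable_funM.
      by apply/measurable_EFinP; exact: (measurable_fib_lim c cW).
    exact: (measurableT_comp m1 measurable_snd).
  by move=> v; rewrite lee_fin; apply: mulr_ge0; [exact: W0 | rewrite indicE].
apply/funext => y; rewrite integral_mkcond; apply: eq_integral => x _.
by rewrite /patch indicE; case: ifPn => _; rewrite ?mulr1 ?mulr0.
Qed.

(** The half with [x] positive is the integral of [W], the other half that of its reflection. Only
    [d e] matters, so every factorisation of [n] carries the same mass. *)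
Lemma tot_int_cone (W : R * R * R -> R) (C r d e : R) :
  bump_like W C r -> bump_like (fun x => W (- x)) C r -> 0 < d ->
  tot_int W (d * e) = (cone_int W d e + cone_int (fun x => W (- x)%R) d e)%E.
Proof.
move=> HW HW' d0; rewrite (cone_int_fibre e HW d0) (cone_int_fibre e HW' d0).
have [cW W0 _ _ _] := HW; have [cW' W0' _ _ _] := HW'.
have mF := measurable_fib_lim (d * e) cW.
have mFy y := measurable_fun_pair2 (f := fun v : MR * MR => (fib_lim W (d * e) v.1 v.2)%:E) y mF.
rewrite -ge0_integralD //; last 4 first.
- by move=> y _; apply: integral_ge0 => x _; rewrite lee_fin W0.
- exact: measurable_half_fibre.
- by move=> y _; apply: integral_ge0 => x _; rewrite lee_fin W0.
- exact: (measurable_half_fibre (d * e) cW' W0').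
apply: eq_integral => y _.
have -> : (\int[leb]_(x in `[0%R, +oo[) (W (- (x, d * e * x * y ^+ 2, x * y))%R)%:E)%E =
    (\int[leb]_(x in `]-oo, 0%R]) (fib_lim W (d * e) y x)%:E)%E.
  rewrite ge0_integration_by_substitution0 /=; last 2 first.
  - apply: (measurable_fun_pair2 (f := fun v : MR * MR => (fib_lim (fun x => W (- x)%R) (d * e) v.1 v.2)%:E) y).
    exact: (measurable_fib_lim (d * e) cW').
  - by move=> x; rewrite lee_fin W0.
  apply: eq_integral => x _; congr (W _)%:E; rewrite /fib_lim.
  by congr (_, _, _) => /=; ring.
rewrite -(@integral_itv_bndo_bndc _ _ 0%R); last by apply: measurable_funTS; exact: mFy.
rewrite addeC -ge0_integral_setU //=.
- congr (integral _ _ _); apply/esym/seteqP; split => x //= _.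
  by rewrite !in_itv /= andbT; case: (ltP x 0) => h; [left|right].
- by apply: measurable_funTS; exact: mFy.
- by move=> x _; rewrite lee_fin W0.
- by apply/disj_setPS => x [] /=; rewrite !in_itv /= andbT => x0 /(lt_le_trans x0); rewrite ltxx.
Qed.

End ConeIntegral.

(** * A quadratic form controlling the norm of zeros *)

Section Eigendirection.
Variable R : realType.
Implicit Types (x y z s : R * R * R).

Definition dot3 x y : R := x.1.1 * y.1.1 + x.1.2 * y.1.2 + x.2 * y.2.

Lemma dot3_ge0 x : 0 <= dot3 x x.
Proof. by rewrite /dot3 -!expr2 !addr_ge0 ?sqr_ge0. Qed.

Lemma dot3_eq0 x : dot3 x x = 0 -> x = (0, 0, 0).
Proof.
case: x => [[a b] c]; rewrite /dot3 /= => E.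
have a0 : a = 0 by nra.
have b0 : b = 0 by nra.
have c0 : c = 0 by nra.
by rewrite a0 b0 c0.
Qed.

Lemma norm2_dot3 x : norm2 x ^+ 2 = dot3 x x.
Proof.
rewrite /norm2 sqr_sqrtr; first by rewrite /dot3 -!expr2.
by rewrite !addr_ge0 ?sqr_ge0.
Qed.

Lemma dot3_cauchy x y : dot3 x y ^+ 2 <= dot3 x x * dot3 y y.
Proof.
case: x => [[a b] c]; case: y => [[a' b'] c']; rewrite /dot3 /= -subr_ge0.
have -> : (a * a + b * b + c * c) * (a' * a' + b' * b' + c' * c') - (a * a' + b * b' + c * c') ^+ 2
  = (a * b' - b * a') ^+ 2 + (a * c' - c * a') ^+ 2 + (b * c' - c * b') ^+ 2 by ring.
by rewrite !addr_ge0 ?sqr_ge0.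
Qed.

Lemma norm2_dot3_le x y : `|dot3 x y| <= norm2 x * norm2 y.
Proof.
have n0 (t : R * R * R) : 0 <= norm2 t by rewrite sqrtr_ge0.
rewrite -(@ler_pXn2r _ 2) ?nnegrE ?mulr_ge0 // real_normK ?num_real //.
by rewrite exprMn !norm2_dot3 dot3_cauchy.
Qed.

Variable q : ternary_form.
Local Notation S := (fun t : int => (t%:~R : R)).

Definition form_mat : mat3 R :=
  Mat3 (2 * S (q11 q)) (S (q12 q)) (S (q13 q)) (S (q12 q)) (2 * S (q22 q)) (S (q23 q))
    (S (q13 q)) (S (q23 q)) (2 * S (q33 q)).

Local Notation Q := (mat3_app form_mat).
Local Notation F := (form_norm R q).

Lemma form_norm_sqr : F ^+ 2 =
  (2 * S (q11 q)) ^+ 2 + (2 * S (q22 q)) ^+ 2 + (2 * S (q33 q)) ^+ 2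
  + 2 * (S (q12 q) ^+ 2 + S (q13 q) ^+ 2 + S (q23 q) ^+ 2).
Proof.
rewrite /form_norm sqr_sqrtr; last by do 2 apply: sumr_ge0 => ? _; rewrite sqr_ge0.
rewrite !big_ord_recl !big_ord0 !mxE /= !intrM.
by ring.
Qed.

Lemma form_norm_ge0 : 0 <= F. Proof. exact: sqrtr_ge0. Qed.

Lemma form_mat_sym x y : dot3 x (Q y) = dot3 (Q x) y.
Proof. by case: x => [[a b] c]; case: y => [[a' b'] c']; rewrite /dot3 /=; ring. Qed.

Lemma qeval_form_mat x : 2 * qeval q x = dot3 x (Q x).
Proof. by case: x => [[a b] c]; rewrite /dot3 /qeval /=; ring. Qed.

Lemma form_mat_det : mat3_det form_mat = 2 * S (disc q).
Proof. by rewrite disc_explicit /mat3_det /=; ring. Qed.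

Lemma form_mat_bound x : `|dot3 x (Q x)| <= F * dot3 x x.
Proof.
have F0 := form_norm_ge0.
have QQ : dot3 (Q x) (Q x) <= F ^+ 2 * dot3 x x.
  case: x => [[a b] c].
  have c1 := dot3_cauchy (2 * S (q11 q), S (q12 q), S (q13 q)) (a, b, c).
  have c2 := dot3_cauchy (S (q12 q), 2 * S (q22 q), S (q23 q)) (a, b, c).
  have c3 := dot3_cauchy (S (q13 q), S (q23 q), 2 * S (q33 q)) (a, b, c).
  rewrite form_norm_sqr; move: c1 c2 c3; rewrite /dot3 /=.
  set A := 2 * S (q11 q); set B := 2 * S (q22 q); set C := 2 * S (q33 q).
  set D := S (q12 q); set E := S (q13 q); set G := S (q23 q); set X := a * a + b * b + c * c.
  lra.
rewrite -(@ler_pXn2r _ 2) ?nnegrE ?mulr_ge0 ?dot3_ge0 // real_normK ?num_real //.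
apply: le_trans (dot3_cauchy _ _) _.
rewrite (_ : (F * dot3 x x) ^+ 2 = dot3 x x * (F ^+ 2 * dot3 x x)); last by ring.
by rewrite ler_wpM2l // dot3_ge0.
Qed.

Hypothesis disc_gt0 : 0 < disc q.
Let D0 : 0 < S (disc q). Proof. by rewrite ltr0z. Qed.

(** [p] is the polynomial [det (Q - X)]. Its value at 0 is [2 disc q], which is positive, and it is
    nonpositive far out, so it has a positive root; a null vector at that root is normalised. *)
Lemma eigenvector_exists : exists s l, [/\ 0 < l, dot3 s s = 1 & Q s = (l * s.1.1, l * s.1.2, l * s.2)].
Proof.
set a := 2 * S (q11 q); set b := S (q12 q); set c := S (q13 q).
set d := 2 * S (q22 q); set e := S (q23 q); set f := 2 * S (q33 q).
pose p : {poly R} := - 'X^3 + (a + d + f) *: 'X^2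
  - (a * d - b ^+ 2 + a * f - c ^+ 2 + d * f - e ^+ 2) *: 'X + (2 * S (disc q))%:P.
have pE (x : R) : p.[x] = - x ^+ 3 + (a + d + f) * x ^+ 2
  - (a * d - b ^+ 2 + a * f - c ^+ 2 + d * f - e ^+ 2) * x + 2 * S (disc q).
  by rewrite /p !hornerE.
set m2 := (a * d - _ + _ - _ + _ - _) in pE.
(* [L] majorises the sum of the lower coefficients, so that [L^3 = L L^2] dominates the lower
   terms. *)
pose L := 1 + `|a + d + f| + `|m2| + 2 * S (disc q).
have L1 : 1 <= L by rewrite /L -!addrA lerDl !addr_ge0 // mulr_ge0 // ltW.
have pL : p.[L] <= 0.
  rewrite pE; have := ler_norm (a + d + f); have := ler_norm (- m2); rewrite normrN.
  have D0' := D0; set X := S (disc q) in L L1 D0' *.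
  have LE : L = 1 + `|a + d + f| + `|m2| + 2 * X by [].
  have u0 : 0 <= `|a + d + f| := normr_ge0 _; have v0 : 0 <= `|m2| := normr_ge0 _.
  move: LE u0 v0; set u := `|a + d + f|; set v := `|m2| => LE u0 v0 h1 h2.
  clearbody u v X L.
  have t1 : (a + d + f) * L ^+ 2 <= u * L ^+ 2 by rewrite ler_wpM2r ?sqr_ge0.
  have t2 : - m2 * L <= v * L ^+ 2.
    apply: (@le_trans _ _ (v * L)); first by rewrite ler_wpM2r // (le_trans ler01).
    by rewrite ler_wpM2l // expr2 ler_peMl // (le_trans ler01).
  have t3 : 2 * X <= 2 * X * L ^+ 2.
    by rewrite ler_peMr ?mulr_ge0 ?(ltW D0') // -(expr1n _ 2) lerXn2r ?nnegrE ?(le_trans ler01).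
  have t4 : L ^+ 3 = L * L ^+ 2 by ring.
  rewrite t4 [in X in - X]LE; nra.
have p0 : 0 <= p.[0].
  by rewrite pE !(expr0n, mulr0, oppr0, subr0, add0r) mulr_ge0 // ltW.
have L0 : 0 <= L by apply: le_trans L1.
have [|l l_in /rootP pl] := @poly_ivt R (- p) 0 L L0; first by rewrite !hornerN oppr_le0 oppr_ge0 p0 pL.
have {}pl : p.[l] = 0 by move: pl; rewrite hornerN => /eqP; rewrite oppr_eq0 => /eqP.
have l0 : 0 < l.
  move: l_in => /andP[+ _]; rewrite le_eqVlt => /orP[/eqP l0|//].
  by move: pl; rewrite -l0 pE !(expr0n, mulr0, oppr0, subr0, add0r) => /eqP; rewrite mulf_eq0 pnatr_eq0 /= gt_eqF.
pose A : 'M[R]_3 := \matrix_(i, j) nth 0 (nth [::]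
    [:: [:: a - l; b; c]; [:: b; d - l; e]; [:: c; e; f - l]] i) j.
have detA : \det A = 0.
  rewrite (expand_det_row _ ord0) !big_ord_recl big_ord0 /cofactor.
  rewrite !(expand_det_row _ ord0) !big_ord_recl !big_ord0 /cofactor.
  rewrite !det_mx11 !mxE /=.
  transitivity p.[l]; last by [].
  rewrite pE -form_mat_det /mat3_det /form_mat /= /m2 /a /b /c /d /e /f.
  by ring.
have /det0P[v v0 vA] : \det A == 0 by apply/eqP.
pose x := v ord0 ord0; pose y := v ord0 (lift ord0 ord0); pose z := v ord0 (lift ord0 (lift ord0 ord0)).
have row j : x * A ord0 j + y * A (lift ord0 ord0) j + z * A (lift ord0 (lift ord0 ord0)) j = 0.
  have E := congr1 (fun B : 'M[R]_(1, 3) => B ord0 j) vA.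
  by rewrite mxE [RHS]mxE !big_ord_recl big_ord0 addr0 addrA in E.
have r1 := row ord0; have r2 := row (lift ord0 ord0); have r3 := row (lift ord0 (lift ord0 ord0)).
rewrite !mxE /= in r1 r2 r3.
pose N := x ^+ 2 + y ^+ 2 + z ^+ 2.
have N0 : 0 < N.
  rewrite lt_def !addr_ge0 ?sqr_ge0 // andbT; apply: contraNneq v0 => NE.
  have [x0 y0 z0] : [/\ x = 0, y = 0 & z = 0].
    have := @dot3_eq0 (x, y, z); rewrite /dot3 /= -!expr2 => /(_ NE) [-> -> ->]; split=> //.
  apply/eqP/matrixP => i j; rewrite (ord1 i) mxE.
  have [k ->|->] := unliftP ord0 j; last exact: x0.
  have [k' ->|->] := unliftP ord0 k; last exact: y0.
  by rewrite (ord1 k').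
pose t := Num.sqrt N; have t0 : 0 < t by rewrite sqrtr_gt0.
have tN : t ^+ 2 = N by rewrite sqr_sqrtr // ltW.
exists (x / t, y / t, z / t), l; split=> //.
  rewrite /dot3 /= (_ : _ + _ = N / t ^+ 2); first by rewrite tN divff // gt_eqF.
  by rewrite /N; field; rewrite gt_eqF.
rewrite /mat3_app /=; rewrite -/a -/b -/c -/d -/e -/f.
congr (_, _, _).
- rewrite (_ : _ + _ = (x * (a - l) + y * b + z * c) / t + l * (x / t)); last by ring.
  by rewrite r1 mul0r add0r.
- rewrite (_ : _ + _ = (x * b + y * (d - l) + z * e) / t + l * (y / t)); last by ring.
  by rewrite r2 mul0r add0r.
- rewrite (_ : _ + _ = (x * c + y * e + z * (f - l)) / t + l * (z / t)); last by ring.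
  by rewrite r3 mul0r add0r.
Qed.

Variables (s : R * R * R) (l : R).
Hypotheses (l_gt0 : 0 < l) (s1 : dot3 s s = 1) (sQ : Q s = (l * s.1.1, l * s.1.2, l * s.2)).

Let sQy y : dot3 s (Q y) = l * dot3 s y.
Proof. by rewrite form_mat_sym sQ /dot3 /=; ring. Qed.

Definition cross3 x y : R * R * R :=
  (x.1.2 * y.2 - x.2 * y.1.2, x.2 * y.1.1 - x.1.1 * y.2, x.1.1 * y.1.2 - x.1.2 * y.1.1).

Lemma cross3_sqr x y : dot3 (cross3 x y) (cross3 x y) = dot3 x x * dot3 y y - dot3 x y ^+ 2.
Proof. by rewrite /dot3 /cross3 /=; ring. Qed.

(** In the orthogonal basis [s], [y], [s x y] the Gram matrix of [Q] splits off the eigenvalue [l].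
    Its determinant is [det Q] times the square of the determinant [|y|^2] of the basis. *)
Let gram y z : dot3 s y = 0 -> z = cross3 s y ->
  l * (dot3 y (Q y) * dot3 z (Q z) - dot3 y (Q z) ^+ 2) = 2 * S (disc q) * dot3 y y ^+ 2.
Proof.
move=> sy zE; have sz : dot3 s z = 0 by rewrite zE /dot3 /cross3 /=; ring.
have zz : dot3 z z = dot3 y y by rewrite zE cross3_sqr s1 sy expr0n subr0 mul1r.
pose N := Mat3 s.1.1 y.1.1 z.1.1 s.1.2 y.1.2 z.1.2 s.2 y.2 z.2.
pose Nt := Mat3 s.1.1 s.1.2 s.2 y.1.1 y.1.2 y.2 z.1.1 z.1.2 z.2.
have dN : mat3_det N = dot3 y y by rewrite -zz {2}zE /mat3_det /dot3 /cross3 /=; ring.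
have dNt : mat3_det Nt = dot3 y y by rewrite -dN /mat3_det /=; ring.
have yz_sym : dot3 z (Q y) = dot3 y (Q z) by rewrite form_mat_sym /dot3; ring.
have ys : dot3 y (Q s) = 0 by rewrite form_mat_sym /dot3; have := sQy y; rewrite sy mulr0 /dot3 => <-; ring.
have zs : dot3 z (Q s) = 0 by rewrite form_mat_sym /dot3; have := sQy z; rewrite sz mulr0 /dot3 => <-; ring.
have QE u : Q u = (m11 form_mat * u.1.1 + m12 form_mat * u.1.2 + m13 form_mat * u.2,
   m21 form_mat * u.1.1 + m22 form_mat * u.1.2 + m23 form_mat * u.2,
   m31 form_mat * u.1.1 + m32 form_mat * u.1.2 + m33 form_mat * u.2) by case: u => [[]].
have GE : mat3_mul Nt (mat3_mul form_mat N) =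
    Mat3 (dot3 s (Q s)) (dot3 s (Q y)) (dot3 s (Q z)) (dot3 y (Q s)) (dot3 y (Q y)) (dot3 y (Q z))
      (dot3 z (Q s)) (dot3 z (Q y)) (dot3 z (Q z)).
  by rewrite !QE /mat3_mul /N /Nt /dot3 /=.
have := mat3_detM Nt (mat3_mul form_mat N).
rewrite (mat3_detM form_mat) dN dNt form_mat_det GE /mat3_det /= ys zs yz_sym !sQy s1 sy sz.
by move=> E; transitivity (dot3 y y * (2 * S (disc q) * dot3 y y)); [rewrite -E|]; ring.
Qed.

Lemma eigen_le : l <= F.
Proof.
have := form_mat_bound s; rewrite sQy s1 !mulr1 => /(le_trans (ler_norm _)).
by [].
Qed.

Let perp_bound y : dot3 s y = 0 -> 2 * S (disc q) * dot3 y y ^+ 2 <= l * `|dot3 y (Q y)| * (F * dot3 y y).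
Proof.
move=> sy; pose z := cross3 s y.
have zz : dot3 z z = dot3 y y by rewrite cross3_sqr s1 sy expr0n subr0 mul1r.
rewrite -(gram sy (erefl z)) -zz -mulrA ler_wpM2l ?(ltW l_gt0) //.
apply: (@le_trans _ _ (dot3 y (Q y) * dot3 z (Q z))); first by rewrite lerBlDr lerDl sqr_ge0.
apply: le_trans (ler_norm _) _; rewrite normrM ler_wpM2l //.
exact: form_mat_bound.
Qed.

(** Write [x = p s + y] with [y] orthogonal to [s]. Since [q x = 0], the form [Q] at [y] equals
    [- l p^2], and the Gram identity yields [2 disc q |y|^2 <= l^2 F p^2 <= F^3 p^2]. *)
Lemma cone_norm_bound x : qeval q x = 0 ->
  dot3 x x <= (1 + rho R q / 2) * dot3 s x ^+ 2.
Proof.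
move=> qx; set p := dot3 s x.
pose y := (x.1.1 - p * s.1.1, x.1.2 - p * s.1.2, x.2 - p * s.2).
have sy : dot3 s y = 0.
  have -> : dot3 s y = dot3 s x - p * dot3 s s by rewrite /dot3 /y /=; ring.
  by rewrite s1 mulr1 subrr.
have xx : dot3 x x = p ^+ 2 + dot3 y y.
  have -> : dot3 y y = dot3 x x - 2 * p * dot3 s x + p ^+ 2 * dot3 s s by rewrite /dot3 /y /=; ring.
  by rewrite s1 -/p; ring.
have yQy : dot3 y (Q y) = - (l * p ^+ 2).
  have -> : dot3 y (Q y) = dot3 x (Q x) - 2 * p * dot3 s (Q x) + p ^+ 2 * dot3 s (Q s).
    by rewrite /dot3 /y; case: (x) (s) => [[? ?] ?] [[? ?] ?] /=; ring.
  by rewrite -qeval_form_mat qx !sQy s1 -/p; ring.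
have := perp_bound sy; rewrite yQy normrN ger0_norm; last by rewrite mulr_ge0 ?sqr_ge0 // ltW.
have lF := eigen_le; have F0 := form_norm_ge0.
rewrite xx (_ : (1 + rho R q / 2) * p ^+ 2 = p ^+ 2 + rho R q / 2 * p ^+ 2); last by ring.
rewrite lerD2l /rho; set X := dot3 y y.
have X0 : 0 <= X by exact: dot3_ge0.
have d0 := D0; set d := S (disc q) in d0 *.
move=> H.
have [->|Xn] := eqVneq X 0; first by apply: mulr_ge0 (sqr_ge0 p); apply: divr_ge0 => //; apply: divr_ge0 (ltW d0); exact: exprn_ge0.
have Xpos : 0 < X by rewrite lt_def Xn.
have H2 : 2 * d * X <= l * (l * p ^+ 2) * F.
  rewrite -(ler_pM2r Xpos); rewrite -(mulrA (2 * d)) -expr2; apply: le_trans H _.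
  by rewrite le_eqVlt; apply/orP; left; apply/eqP; ring.
have H3 : l * (l * p ^+ 2) * F <= F ^+ 3 * p ^+ 2.
  rewrite (_ : l * (l * p ^+ 2) * F = (l * l) * (F * p ^+ 2)); last by ring.
  rewrite (_ : F ^+ 3 * p ^+ 2 = (F * F) * (F * p ^+ 2)); last by ring.
  apply: ler_wpM2r; first by rewrite mulr_ge0 ?sqr_ge0.
  by apply: ler_pM => //; exact: ltW.
rewrite (_ : F ^+ 3 / d / 2 * p ^+ 2 = F ^+ 3 * p ^+ 2 / (2 * d)); last by field; rewrite gt_eqF.
by rewrite ler_pdivlMr ?mulr_gt0 // mulrC (le_trans H2).
Qed.

(** [det Q] is [l] times the determinant of the restriction to the plane orthogonal to [s], which is
    at most [F^2]. *)
Lemma eigen_ge : 2 * S (disc q) <= l * F ^+ 2.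
Proof.
have [y [y0 sy]] : exists y, 0 < dot3 y y /\ dot3 s y = 0.
  (* [(- s2, s1, 0)] is orthogonal to [s]; if it vanishes, [s] lies on the third axis and
     [(1, 0, 0)] serves. *)
  have [E|E] := eqVneq (dot3 (- s.1.2, s.1.1, 0) (- s.1.2, s.1.1, 0)) 0.
    exists (1, 0, 0); split; first by rewrite /dot3 /= !mulr0 !addr0 mulr1.
    by move/dot3_eq0 : E => -[_ E2]; rewrite /dot3 /= E2 mul0r !mulr0 !addr0.
  exists (- s.1.2, s.1.1, 0); split; first by rewrite lt_def E dot3_ge0.
  by rewrite /dot3 /=; ring.
have := perp_bound sy; have := form_mat_bound y; set X := dot3 y y in y0 *.
set A := `|_| => h1 h2.
have h3 : 2 * S (disc q) * X ^+ 2 <= l * F ^+ 2 * X ^+ 2.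
  apply: le_trans h2 _; rewrite (_ : l * F ^+ 2 * X ^+ 2 = l * (F * X) * (F * X)); last by ring.
  by rewrite ler_wpM2r ?mulr_ge0 ?form_norm_ge0 ?(ltW y0) // ler_wpM2l // ltW.
by move: h3; rewrite ler_pM2r // exprn_gt0.
Qed.

Lemma rho_ge2 : 2 <= rho R q.
Proof.
rewrite /rho ler_pdivlMr //; apply: (le_trans eigen_ge).
rewrite (_ : F ^+ 3 = F * F ^+ 2); last by rewrite exprS.
by rewrite ler_wpM2r ?sqr_ge0 //; exact: eigen_le.
Qed.

End Eigendirection.

(** * The binary form on the parametrised cone *)

Section ConeForm.
Variable R : realType.

Lemma qeval_nf_cone (n : nat) (d e u v : R) : d * e = n%:R ->
  qeval (nf_form 1 0 0 (- n%:Z)) (cone_pt d e u v) = 0.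
Proof.
move=> de; rewrite /qeval /cone_pt /= !mulr0z mulr1z rmorphN /= -pmulrn -de.
by ring.
Qed.

Lemma zero_equiv_disc_eq q n M c : zero_equiv R q (nf_form 1 0 0 (- n%:Z)) M c ->
  c%:R ^+ 3 * n%:R = (`|mat3_det M|%N%:R) ^+ 2 * (disc q)%:~R :> R.
Proof.
move=> H; have := congr1 disc (ze_pull H).
rewrite disc_pull disc_scale disc_nf expr1n mul1r opprK.
move=> /(congr1 (fun t : int => t%:~R : R)) E0.
have E : (mat3_det M)%:~R ^+ 2 * (disc q)%:~R = c%:Z%:~R ^+ 3 * n%:Z%:~R :> R.
  by transitivity ((mat3_det M ^+ 2 * disc q)%:~R : R); [ring | rewrite E0; ring].
rewrite -[X in X ^+ 3 * _]/(c%:Z%:~R) -[X in _ * X = _]/(n%:Z%:~R) -E; congr (_ * _).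
have -> : `|mat3_det M|%N%:R = `|(mat3_det M)%:~R| :> R by rewrite -intr_norm -abszE.
by rewrite real_normK ?num_real.
Qed.

Lemma qeval_polar q (x y : R * R * R) :
  dot3 x (mat3_app (form_mat R q) y) =
  qeval q (x.1.1 + y.1.1, x.1.2 + y.1.2, x.2 + y.2) - qeval q x - qeval q y.
Proof. by case: x => [[? ?] ?]; case: y => [[? ?] ?]; rewrite /dot3 /qeval /=; ring. Qed.

(** [h] is the scalar product of the zero with the eigenvector [s], up to a sign fixed by [A > 0].
    Its discriminant [D = 4 n A C - B^2] is the same for all [d] and satisfies [l D = 2 n c]; the
    lower bound for [l], the relation between the discriminants of the two forms and [|det M| <= c]
    give [D <= F^2]. *)
Lemma cone_form q n M c : 0 < disc q -> (0 < n)%N ->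
  zero_equiv R q (nf_form 1 0 0 (- n%:Z)) M c ->
  exists A B C : R, [/\ 0 < A, 0 < 4 * n%:R * A * C - B ^+ 2,
    4 * n%:R * A * C - B ^+ 2 <= form_norm R q ^+ 2 &
    forall d e u v : R, d * e = n%:R ->
      let x := mat3_app (mat3_int R M) (cone_pt d e u v) in
      let h := d * A * u ^+ 2 + B * u * v + e * C * v ^+ 2 in
      `|h| <= norm2 x /\ norm2 x <= Num.sqrt (1 + rho R q / 2) * `|h|].
Proof.
move=> D0 n0 H; have [s [l [l0 s1 sQ]]] := eigenvector_exists R D0.
have lge := eigen_ge l0 s1 sQ.
set X := mat3_int R M.
have c0 : 0 < c%:R :> R by rewrite ltr0n (ze_c_gt0 H).
have qX (x : R * R * R) : qeval q (mat3_app X x) = c%:R * qeval (nf_form 1 0 0 (- n%:Z)) x.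
  by rewrite -qeval_pull (ze_pull H) qeval_scale -pmulrn.
have dX : mat3_det X != 0.
  by rewrite mat3_int_det intr_eq0 -absz_gt0; exact: ze_det_gt0 H.
have q0E (a b e : R) : qeval (nf_form 1 0 0 (- n%:Z)) (a, b, e) = a * b - n%:R * e ^+ 2.
  by rewrite /qeval /= !mulr0z mulr1z rmorphN /= -pmulrn; ring.
pose a := m11 X * s.1.1 + m21 X * s.1.2 + m31 X * s.2.
pose g := m12 X * s.1.1 + m22 X * s.1.2 + m32 X * s.2.
pose b := m13 X * s.1.1 + m23 X * s.1.2 + m33 X * s.2.
have sX (x : R * R * R) : dot3 s (mat3_app X x) = a * x.1.1 + g * x.1.2 + b * x.2.
  by case: x => [[? ?] ?]; rewrite /dot3 /a /g /b /=; ring.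
(* [t] is the preimage of [s]. As [s] is an eigenvector, [l] times the product of [s] with [M x] is
   the polar form of [q] at [M x] and [M t], that is, [c] times the polar form of the model at [x]
   and [t]. This expresses [a], [g], [b] through [t]. *)
pose t := let: (x, y, z) := mat3_app (mat3_adj X) s in (x / mat3_det X, y / mat3_det X, z / mat3_det X).
have tE : mat3_app X t = s.
  rewrite /t; case: (s) => [[x y] z] /=; rewrite /mat3_det in dX *.
  by congr (_, _, _); field.
have lX (x : R * R * R) : l * dot3 s (mat3_app X x) =
    c%:R * (x.1.1 * t.1.2 + x.1.2 * t.1.1 - 2 * n%:R * x.2 * t.2).
  have := qeval_polar q (mat3_app X x) s.
  rewrite sQ => E; transitivity (dot3 (mat3_app X x) (l * s.1.1, l * s.1.2, l * s.2)).
    by rewrite /dot3 /=; ring.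
  rewrite E -{1 2 3}tE.
  have -> : ((mat3_app X x).1.1 + (mat3_app X t).1.1, (mat3_app X x).1.2 + (mat3_app X t).1.2,
      (mat3_app X x).2 + (mat3_app X t).2) =
      mat3_app X (x.1.1 + t.1.1, x.1.2 + t.1.2, x.2 + t.2).
    by case: (x) => [[? ?] ?]; case: (t) => [[? ?] ?] /=; congr (_, _, _); ring.
  rewrite -tE !qX; case: (x) => [[? ?] ?]; case: (t) => [[? ?] ?].
  by rewrite !q0E /=; ring.
have la : l * a = c%:R * t.1.2 by have := lX (1, 0, 0); rewrite sX /= => E; move: E; rewrite !(mulr1, mulr0, addr0, mul1r, mul0r, subr0).
have lg : l * g = c%:R * t.1.1 by have := lX (0, 1, 0); rewrite sX /= => E; move: E; rewrite !(mulr1, mulr0, addr0, mul1r, mul0r, subr0, add0r).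
have lb : l * b = - (2 * c%:R * n%:R * t.2).
  have := lX (0, 0, 1); rewrite sX /= => E; transitivity (l * (a * 0 + g * 0 + b * 1)); first by ring.
  by rewrite E; ring.
have ls : l = 2 * c%:R * (t.1.1 * t.1.2 - n%:R * t.2 ^+ 2).
  have := qeval_form_mat q s; rewrite sQ -{1}tE qX.
  have -> : dot3 s (l * s.1.1, l * s.1.2, l * s.2) = l * dot3 s s by rewrite /dot3 /=; ring.
  by rewrite s1 mulr1 => <-; case: (t) => [[? ?] ?]; rewrite q0E /=; ring.
have DE : l * (4 * n%:R * a * g - b ^+ 2) = 2 * n%:R * c%:R.
  apply: (mulfI (lt0r_neq0 l0)).
  transitivity (4 * n%:R * (l * a) * (l * g) - (l * b) ^+ 2); first by ring.
  rewrite la lg lb [RHS](_ : _ = 2 * n%:R * c%:R * l); last by ring.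
  by rewrite [in RHS]ls; ring.
have nR : 0 < n%:R :> R by rewrite ltr0n.
have Dpos : 0 < 4 * n%:R * a * g - b ^+ 2.
  by rewrite -(pmulr_rgt0 _ l0) DE !mulr_gt0.
have Dle : 4 * n%:R * a * g - b ^+ 2 <= form_norm R q ^+ 2.
  have dR : 0 < (disc q)%:~R :> R by rewrite ltr0z.
  have mc : `|mat3_det M|%N%:R <= c%:R :> R.
    by rewrite ler_nat dvdn_leq ?(ze_c_gt0 H) ?(ze_det_dvd H).
  have cE := zero_equiv_disc_eq H.
  set m := `|mat3_det M|%N%:R in mc cE; set d := (disc q)%:~R in dR cE lge.
  have m0 : 0 <= m by rewrite /m ler0n.
  set D := 4 * _ * _ * _ - _ in DE Dpos *; set F2 := form_norm R q ^+ 2 in lge *.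
  have F20 : 0 <= F2 by rewrite sqr_ge0.
  have e1 : 2 * d * D <= 2 * n%:R * c%:R * F2.
    by rewrite -DE [leRHS]mulrAC ler_pM2r.
  have e2 : c%:R ^+ 2 * (d * D) <= c%:R ^+ 2 * (d * F2).
    apply: (@le_trans _ _ (c%:R ^+ 2 * (n%:R * c%:R * F2))).
      by rewrite ler_wpM2l ?sqr_ge0 //; lra.
    rewrite (_ : c%:R ^+ 2 * (n%:R * c%:R * F2) = c%:R ^+ 3 * n%:R * F2); last by ring.
    rewrite cE -mulrA; apply: ler_wpM2r; first by rewrite mulr_ge0 // ltW.
    by rewrite !expr2; apply: ler_pM.
  by move: e2; rewrite ler_pM2l ?exprn_gt0 // ler_pM2l.
have key (d e u v : R) : d * e = n%:R ->
    let x := mat3_app X (cone_pt d e u v) in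
    let h := d * a * u ^+ 2 + b * u * v + e * g * v ^+ 2 in
    `|h| <= norm2 x /\ norm2 x <= Num.sqrt (1 + rho R q / 2) * `|h|.
  move=> de x h; have hE : h = dot3 s x by rewrite sX /h /cone_pt /=; ring.
  have ns : norm2 s = 1.
    by apply/eqP; rewrite -(@eqrXn2 _ 2) ?sqrtr_ge0 // norm2_dot3 s1 expr1n.
  split; first by rewrite hE -[leRHS]mul1r -ns norm2_dot3_le.
  have r0 : 0 <= 1 + rho R q / 2.
    by rewrite addr_ge0 // divr_ge0 // (le_trans _ (rho_ge2 D0 l0 s1 sQ)).
  rewrite -(@ler_pXn2r _ 2) ?nnegrE ?mulr_ge0 ?sqrtr_ge0 //.
  rewrite norm2_dot3 exprMn sqr_sqrtr // real_normK ?num_real // hE.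
  by apply: (cone_norm_bound D0 l0 s1 sQ); rewrite qX qeval_nf_cone ?mulr0.
have [a0|a0] := ltP 0 a; first by exists a, b, g.
exists (- a), (- b), (- g); split.
- rewrite oppr_gt0 lt_neqAle a0 andbT; apply: contraTneq Dpos => ->.
  by rewrite mulr0 mul0r sub0r -leNgt oppr_le0 sqr_ge0.
- by rewrite mulrN mulrN mulNr opprK sqrrN.
- by rewrite mulrN mulrN mulNr opprK sqrrN.
move=> d e u v de x h; have := key d e u v de.
by rewrite (_ : h = - (d * a * u ^+ 2 + b * u * v + e * g * v ^+ 2)) ?normrN // /h; ring.
Qed.

End ConeForm.

(** * Lattice sums of weights along quadratic maps *)

Section OneDimensionalSums.
Variable R : realType.
Local Notation MR := (measurableTypeR R).
Local Notation leb := (@lebesgue_measure R).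

Definition zbox (N : nat) : seq int := [seq k%:Z - N%:Z | k <- iota 0 (N + N)].

Lemma zbox_uniq N : uniq (zbox N).
Proof. by rewrite map_inj_uniq ?iota_uniq // => i j /eqP; lia. Qed.

Lemma mem_zbox N (i : int) : (i \in zbox N) = (- N%:Z <= i < N%:Z).
Proof.
apply/mapP/idP => [[k + ->]|iN]; first by rewrite mem_iota; lia.
by exists (absz (i + N%:Z)); [rewrite mem_iota; lia | lia].
Qed.

Lemma mem_zbox_real N (i : int) : `|i%:~R| < N%:R :> R -> i \in zbox N.
Proof.
rewrite ltr_norml => iN; have : - N%:Z < i < N%:Z by rewrite -!(ltr_int R) rmorphN.
by rewrite mem_zbox => /andP[/ltW -> ->].
Qed.

Lemma zbox_sum N (f : int -> R) :
  \sum_(i <- zbox N) f i = \sum_(0 <= k < N + N) f (k%:Z - N%:Z).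
Proof. by rewrite big_map /index_iota subn0. Qed.

Lemma fsbig_zbox2 N (P : pred (int * int)) (F : int * int -> R) :
  (forall v, F v != 0 -> (v.1 \in zbox N) && (v.2 \in zbox N)) ->
  \sum_(v \in [set v | P v]) F v =
  \sum_(j <- zbox N) \sum_(i <- zbox N) (if P (i, j) then F (i, j) else 0).
Proof.
move=> FN; rewrite exchange_big /=.
have u2 : uniq [seq (i, j) | i <- zbox N, j <- zbox N].
  by apply: allpairs_uniq; rewrite ?zbox_uniq // => -[a b] [c d].
transitivity (\sum_(v <- [seq (i, j) | i <- zbox N, j <- zbox N]) if P v then F v else 0); last first.
  by rewrite big_allpairs_dep.
rewrite -big_mkcond /=.
apply/esym/(etrans (@bigfs _ _ _ _ _ P F u2 _)) => // -[i j] _; apply: contraNeq => /FN /= /andP[iN jN].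
exact: allpairs_f.
Qed.

(** Bounded variation in the shape that a cell-by-cell comparison uses: a monotone [V] dominates the
    increments, and the total variation is at most [2 A]. *)
Definition var_le (f : R -> R) (A : R) := exists V : R -> R,
  [/\ {homo V : x y / x <= y}, forall x, `|V x| <= A &
      forall x y, x <= y -> `|f x - f y| <= V y - V x].

Lemma integral_cell (f V : R -> R) (c : R) : measurable_fun [set: MR] (f : MR -> R) ->
  (forall x, 0 <= f x) -> {homo V : x y / x <= y} ->
  (forall x y, x <= y -> `|f x - f y| <= V y - V x) ->
  ((f c)%:E <= \int[leb]_(x in `[c, (c + 1)%R[%classic) (f x)%:E + (V (c + 1) - V c)%:E /\
   \int[leb]_(x in `[c, (c + 1)%R[%classic) (f x)%:E <= (f c)%:E + (V (c + 1) - V c)%:E)%E.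
Proof.
move=> mf f0 ndV fV; set D := `[c, (c + 1)%R[%classic; set dl := V (c + 1) - V c.
have dl0 : 0 <= dl by rewrite subr_ge0 ndV // lerDl.
have mD : measurable (D : set MR) by exact: measurable_itv.
have lD : leb D = 1%E.
  by rewrite /D lebesgue_measure_itv /= lte_fin ltrDl ltr01 -EFinD (addrC c) addrK.
have cs (k : R) : (\int[leb]_(x in D) (cst k%:E x) = k%:E)%E.
  transitivity (k%:E * leb D)%E; first exact: integral_cst.
  by rewrite lD mule1.
have near x : D x -> `|f c - f x| <= dl.
  rewrite /D /= in_itv /= => /andP[cx xc]; apply: (le_trans (fV _ _ cx)).
  by rewrite lerD2r ndV // ltW.
have mfD : measurable_fun (D : set MR) (fun x => (f x)%:E).
  by apply/measurable_EFinP; apply: measurable_funTS.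
split.
  rewrite -{1}(cs (f c)) -(cs dl) -ge0_integralD //; last by move=> x _; rewrite lee_fin.
  apply: ge0_le_integral => //.
  - by move=> x _; rewrite lee_fin.
  - by apply: emeasurable_funD.
  move=> x /near; rewrite /cst -EFinD lee_fin ler_norml => /andP[_].
  by rewrite lerBlDl.
rewrite -EFinD -(cs (f c + dl)); apply: ge0_le_integral => //.
  by move=> x _; rewrite lee_fin.
move=> x /near; rewrite /cst lee_fin ler_norml => /andP[+ _].
by rewrite lerNl opprB lerBlDl.
Qed.

(** On each unit cell the error is the increment of [V]; these telescope. *)
Lemma integral_cells (f V : R -> R) (c : R) m : measurable_fun [set: MR] (f : MR -> R) ->
  (forall x, 0 <= f x) -> {homo V : x y / x <= y} ->
  (forall x y, x <= y -> `|f x - f y| <= V y - V x) ->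
  ((\sum_(0 <= k < m) f (c + k%:R))%:E <=
     \int[leb]_(x in `[c, (c + m%:R)%R[%classic) (f x)%:E + (V (c + m%:R) - V c)%:E /\
   \int[leb]_(x in `[c, (c + m%:R)%R[%classic) (f x)%:E <=
     (\sum_(0 <= k < m) f (c + k%:R))%:E + (V (c + m%:R) - V c)%:E)%E.
Proof.
move=> mf f0 ndV fV; elim: m => [|m [IH1 IH2]].
  rewrite addr0 subrr adde0 big_geq // set_itvE /=.
  by rewrite integral_set0 adde0.
rewrite big_nat_recr //= EFinD.
have [h1 h2] := integral_cell (c + m%:R) mf f0 ndV fV.
have cm : (BLeft c <= BLeft (c + m%:R) <= BLeft (c + m%:R + 1))%O.
  by rewrite !bnd_simp lerDl ler0n lerDl ler01.
have iS : (\int[leb]_(x in `[c, (c + m.+1%:R)%R[%classic) (f x)%:E =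
  \int[leb]_(x in `[c, (c + m%:R)%R[%classic) (f x)%:E +
  \int[leb]_(x in `[(c + m%:R)%R, (c + m%:R + 1)%R[%classic) (f x)%:E)%E.
  have sE : `[c, (c + m.+1%:R)%R[%classic =
      `[c, (c + m%:R)%R[%classic `|` `[(c + m%:R)%R, (c + m%:R + 1)%R[%classic.
    by rewrite -natr1 addrA; case/andP: cm => a b; rewrite -(itv_bndbnd_setU a b).
  rewrite sE; apply: ge0_integral_setU => //.
  - by apply/measurable_EFinP; apply: measurable_funTS.
  - by move=> x _; rewrite lee_fin.
  - apply/disj_setPS => x [] /=.
    by rewrite !in_itv /= => /andP[_ a] /andP[b _]; have := lt_le_trans a b; rewrite ltxx.
rewrite iS.
have -> : (V (c + m.+1%:R) - V c)%:E =
  ((V (c + m%:R) - V c)%:E + (V (c + m%:R + 1) - V (c + m%:R))%:E)%E.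
  by rewrite -EFinD -natr1 addrA; congr (_%:E); ring.
split; rewrite [leRHS]addeACA; [exact: leeD IH1 h1|exact: leeD IH2 h2].
Qed.

Lemma zbox_sum_integral (f : R -> R) (A : R) (N : nat) : measurable_fun [set: MR] (f : MR -> R) ->
  (forall x, 0 <= f x) -> var_le f A -> (forall x, f x != 0 -> `|x| < N%:R) ->
  ((\sum_(i <- zbox N) f i%:~R)%:E <= \int[leb]_x (f x)%:E + (2 * A)%:E /\
   \int[leb]_x (f x)%:E <= (\sum_(i <- zbox N) f i%:~R)%:E + (2 * A)%:E)%E.
Proof.
move=> mf f0 [V [ndV VA fV]] fN.
have [h1 h2] := integral_cells (- N%:R) (N + N) mf f0 ndV fV.
have iE : (\int[leb]_x (f x)%:E = \int[leb]_(x in `[(- N%:R)%R, (- N%:R + (N + N)%:R)%R[%classic) (f x)%:E)%E.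
  rewrite [RHS]integral_mkcond; apply: eq_integral => x _.
  rewrite patchE; case: ifPn => //; rewrite notin_setE /= in_itv /= => /negP xN.
  congr (_%:E); apply/eqP; apply: contraNT xN => /fN; rewrite ltr_norml => /andP[a b].
  by rewrite natrD addrA addNr add0r b ltW.
have sE : \sum_(i <- zbox N) f i%:~R = \sum_(0 <= k < N + N) f (- N%:R + k%:R).
  by rewrite zbox_sum; apply: eq_bigr => k _; rewrite addrC rmorphD /= rmorphN.
have VE : V (- N%:R + (N + N)%:R) - V (- N%:R) <= 2 * A.
  have := VA (- N%:R + (N + N)%:R); have := VA (- N%:R).
  by rewrite !ler_norml => /andP[a b] /andP[d e]; lra.
by rewrite iE sE; split; [apply: (le_trans h1)|apply: (le_trans h2)]; rewrite leeD2l ?lee_fin.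
Qed.

Lemma var_le_box1 (r : R) : 0 <= r -> var_le (box1 r) 1.
Proof.
move=> r0; exists (fun x => (- r <= x)%R%:R + (r < x)%R%:R - 1); split.
- move=> x y xy; rewrite lerD2r; apply: lerD; rewrite ler_nat.
    by case: (leP (- r) x) => // h; rewrite (le_trans h xy).
  by case: (ltP r x) => // h; rewrite (lt_le_trans h xy).
- by move=> x; case: (leP (- r) x); case: (ltP r x) => _ _ /=; rewrite ler_norml /=; lra.
move=> x y xy; rewrite /box1 !ler_norml.
by case: (leP (- r) x); case: (leP (- r) y); case: (leP x r); case: (leP y r) => /= *; lra.
Qed.

Lemma zbox_count (r : R) N : 0 <= r -> r < N%:R ->
  \sum_(i <- zbox N) box1 r (i%:~R : R) <= 2 * r + 2.
Proof.
move=> r0 rN.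
have sb x : box1 r x != 0 -> `|x| < N%:R.
  by rewrite /box1; case: (leP `|x| r) => [xr _|_]; [apply: le_lt_trans rN|rewrite eqxx].
have [h _] := zbox_sum_integral (@measurable_box1 R r) (@box1_ge0 R r) (var_le_box1 r0) sb.
rewrite -lee_fin; apply: (le_trans h).
have := @integral_box1 R 1 r ler01 r0; under eq_integral do rewrite mul1r.
by move=> ->; rewrite -EFinD lee_fin mul1r mulr1.
Qed.

End OneDimensionalSums.

(** * Plane integrals over ellipses *)

Section PlaneSums.
Variable R : realType.
Local Notation MR := (measurableTypeR R).
Local Notation leb := (@lebesgue_measure R).

Definition plane_int (F : R -> R -> R) : \bar R := (\int[leb]_x \int[leb]_y (F x y)%:E)%E.

Definition qf (a b c x y : R) : R := a * x ^+ 2 + b * x * y + c * y ^+ 2.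

Lemma qf_square a b c x y : c != 0 ->
  qf a b c x y = c * (y + b / (2 * c) * x) ^+ 2 + (4 * a * c - b ^+ 2) / (4 * c) * x ^+ 2.
Proof. by move=> c0; rewrite /qf; field. Qed.

Lemma measurable_section2 (F : R -> R -> R) x :
  measurable_fun [set: MR * MR] (fun v : MR * MR => F v.1 v.2) ->
  measurable_fun [set: MR] (fun y : MR => F x y).
Proof. by move=> mF; apply: (measurable_fun_pair2 (f := fun v : MR * MR => F v.1 v.2) x mF). Qed.

Lemma measurable_inner (F : R -> R -> R) :
  measurable_fun [set: MR * MR] (fun v : MR * MR => F v.1 v.2) -> (forall x y, 0 <= F x y) ->
  measurable_fun [set: MR] (fun x : MR => (\int[leb]_y (F x y)%:E)%E).
Proof.
move=> mF F0; apply: (@measurable_fun_fubini_tonelli_F _ _ MR MR R leb (fun v => (F v.1 v.2)%:E)).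
  by apply/measurable_EFinP.
by move=> v; rewrite lee_fin.
Qed.

Lemma plane_int_swap (F : R -> R -> R) :
  measurable_fun [set: MR * MR] (fun v : MR * MR => F v.1 v.2) -> (forall x y, 0 <= F x y) ->
  plane_int F = plane_int (fun x y => F y x).
Proof.
move=> mF F0; apply: (ge0_fubini_leb (f := fun v : MR * MR => (F v.1 v.2)%:E)).
  by apply/measurable_EFinP.
by move=> v; rewrite lee_fin.
Qed.

Lemma measurable_linear2 (F : R -> R -> R) (p q r s : R) :
  measurable_fun [set: MR * MR] (fun v : MR * MR => F v.1 v.2) ->
  measurable_fun [set: MR * MR] (fun v : MR * MR => F (p * v.1 + q * v.2) (r * v.1 + s * v.2)).
Proof.
move=> mF; apply: (measurableT_comp (f := fun v : MR * MR => F v.1 v.2)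
  (g := fun v : MR * MR => (p * v.1 + q * v.2, r * v.1 + s * v.2))) => //.
have m1 : measurable_fun [set: MR * MR] (fun v : MR * MR => v.1) by exact: measurable_fst.
have m2 : measurable_fun [set: MR * MR] (fun v : MR * MR => v.2) by exact: measurable_snd.
by apply: measurable_fun_pair => /=;
  apply: measurable_realfun.measurable_funD; apply: measurable_funM.
Qed.

Lemma plane_int_scale (F : R -> R -> R) (p q : R) : p != 0 -> q != 0 ->
  measurable_fun [set: MR * MR] (fun v : MR * MR => F v.1 v.2) -> (forall x y, 0 <= F x y) ->
  plane_int (fun x y => F (p * x) (q * y)) = (`|p * q|^-1%:E * plane_int F)%E.
Proof.
move=> p0 q0 mF F0; rewrite /plane_int.
have i1 x : (\int[leb]_y (F (p * x)%R (q * y)%R)%:E = `|q|^-1%:E * \int[leb]_y (F (p * x)%R y)%:E)%E.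
  rewrite -(ge0_integral_affine 0 (f := fun y => (F (p * x) y)%:E)) //.
  - by apply: eq_integral => y _; rewrite addr0.
  - by apply/measurable_EFinP; exact: measurable_section2.
  - by move=> y; rewrite lee_fin.
under eq_integral do rewrite i1.
transitivity (\int[leb]_x (`|q|^-1%:E * \int[leb]_y (F (p * x + 0)%R y)%:E))%E.
  by apply: eq_integral => x _; rewrite addr0.
have mI := measurable_inner mF F0.
have I0 x : (0 <= \int[leb]_y (F x y)%:E)%E by apply: integral_ge0 => y _; rewrite lee_fin.
apply: (etrans (ge0_integral_affine 0 p0 (f := fun x => `|q|^-1%:E * \int[leb]_y (F x y)%:E)%E _ _)).
- by apply: measurable_funeM.
- by move=> x; rewrite mule_ge0 // lee_fin.
rewrite ge0_integralZl //.
by rewrite muleA -EFinM normrM invfM.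
Qed.

Lemma plane_int_shear (F : R -> R -> R) (t : R) :
  measurable_fun [set: MR * MR] (fun v : MR * MR => F v.1 v.2) -> (forall x y, 0 <= F x y) ->
  plane_int (fun x y => F x (y + t * x)) = plane_int F.
Proof.
move=> mF F0; apply: eq_integral => x _.
transitivity (\int[leb]_y (F x (1 * y + t * x)%R)%:E)%E.
  by apply: eq_integral => y _; rewrite mul1r.
apply: (etrans (ge0_integral_affine (t * x) (oner_neq0 R) (f := fun y => (F x y)%:E) _ _)).
- by apply/measurable_EFinP; exact: measurable_section2.
- by move=> y; rewrite lee_fin.
by rewrite normr1 invr1 mul1e.
Qed.

Lemma plane_int_strip (k x0 y0 t : R) : 0 <= k -> 0 <= x0 -> 0 <= y0 ->
  plane_int (fun x y => k * box1 x0 x * box1 y0 (y + t * x)) = (4 * k * x0 * y0)%:E.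
Proof.
move=> k0 x00 y00; rewrite /plane_int.
have i1 x : (\int[leb]_y (k * box1 x0 x * box1 y0 (y + t * x)%R)%:E = (k * (2 * y0) * box1 x0 x)%:E)%E.
  have kb : 0 <= k * box1 x0 x by rewrite mulr_ge0 ?box1_ge0.
  rewrite -[RHS]/((_ * _)%:E) mulrAC -(integral_box1 kb y00).
  transitivity (\int[leb]_y (k * box1 x0 x * box1 y0 (1 * y + t * x)%R)%:E)%E.
    by apply: eq_integral => y _; rewrite mul1r.
  apply: (etrans (ge0_integral_affine (t * x) (oner_neq0 R) (f := fun y => (k * box1 x0 x * box1 y0 y)%:E) _ _)).
  - by apply/measurable_EFinP/measurable_funM => //; exact: measurable_box1.
  - by move=> y; rewrite lee_fin mulr_ge0 ?box1_ge0.
  by rewrite normr1 invr1 mul1e.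
under eq_integral do rewrite i1.
rewrite integral_box1 //; last by rewrite !mulr_ge0.
by congr (_%:E); ring.
Qed.

Lemma le_plane_int (F G : R -> R -> R) :
  measurable_fun [set: MR * MR] (fun v : MR * MR => F v.1 v.2) ->
  measurable_fun [set: MR * MR] (fun v : MR * MR => G v.1 v.2) ->
  (forall x y, 0 <= F x y) -> (forall x y, F x y <= G x y) -> (plane_int F <= plane_int G)%E.
Proof.
move=> mF mG F0 FG; have G0 x y : 0 <= G x y by exact: le_trans (FG x y).
apply: ge0_le_integral => //.
- by move=> x _; apply: integral_ge0 => y _; rewrite lee_fin.
- exact: measurable_inner.
- exact: measurable_inner.
move=> x _; apply: ge0_le_integral => //.
- by move=> y _; rewrite lee_fin.
- by apply/measurable_EFinP; exact: measurable_section2.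
- by apply/measurable_EFinP; exact: measurable_section2.
by move=> y _; rewrite lee_fin.
Qed.

Lemma measurable_strip (k x0 y0 t : R) :
  measurable_fun [set: MR * MR] (fun v : MR * MR => k * box1 x0 v.1 * box1 y0 (v.2 + t * v.1)).
Proof.
have m1 : measurable_fun [set: MR * MR] (fun v : MR * MR => v.1) by exact: measurable_fst.
have m2 : measurable_fun [set: MR * MR] (fun v : MR * MR => v.2) by exact: measurable_snd.
apply: measurable_funM; first by apply: measurable_funM => //; apply: (measurableT_comp (@measurable_box1 R x0)).
apply: (measurableT_comp (@measurable_box1 R y0)) => //.
by apply: measurable_realfun.measurable_funD => //; apply: measurable_funM.
Qed.

Section Disc.
Variables (a b c : R).
Hypotheses (c0 : 0 < c) (D0 : 0 < 4 * a * c - b ^+ 2).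
Let D := 4 * a * c - b ^+ 2.

Let strip_area (s : R) : 0 <= s ->
  Num.sqrt (4 * c * s / D) * Num.sqrt (s / c) = 2 * s / Num.sqrt D.
Proof.
move=> s0; rewrite -sqrtrM ?mulr_ge0 ?invr_ge0 ?(ltW c0) ?(ltW D0) //.
have -> : 4 * c * s / D * (s / c) = (2 * s) ^+ 2 * D^-1.
  by field; rewrite !gt_eqF.
by rewrite sqrtrM ?sqr_ge0 // sqrtr_sqr ger0_norm ?mulr_ge0 // sqrtrV // ltW.
Qed.

Let qfE x y : qf a b c x y = c * (y + b / (2 * c) * x) ^+ 2 + D / (4 * c) * x ^+ 2.
Proof. by rewrite qf_square ?gt_eqF. Qed.

(** After completing the square, the ellipse lies in a parallelogram of area [8 / sqrt D]. *)
Lemma plane_int_le (F : R -> R -> R) (A : R) :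
  measurable_fun [set: MR * MR] (fun v : MR * MR => F v.1 v.2) -> (forall x y, 0 <= F x y <= A) ->
  (forall x y, F x y != 0 -> qf a b c x y <= 1) -> (plane_int F <= (8 * A / Num.sqrt D)%:E)%E.
Proof.
move=> mF FA Fq; have A0 : 0 <= A by case/andP: (FA 0 0) => u v; exact: le_trans v.
have := @plane_int_strip A (Num.sqrt (4 * c * 1 / D)) (Num.sqrt (1 / c)) (b / (2 * c)) A0
  (sqrtr_ge0 _) (sqrtr_ge0 _).
rewrite -[in X in _ = X]mulrA (strip_area ler01) (_ : 4 * A * _ = 8 * A / Num.sqrt D); last by ring.
move=> <-; apply: le_plane_int => //; first exact: measurable_strip.
  by move=> x y; case/andP: (FA x y).
move=> x y; have [F1|/Fq] := eqVneq (F x y) 0.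
  by rewrite F1 !mulr_ge0 ?box1_ge0.
rewrite qfE => h; have D4 : 0 < D / (4 * c) by rewrite divr_gt0 // mulr_gt0.
have h1 : 0 <= c * (y + b / (2 * c) * x) ^+ 2 by rewrite mulr_ge0 ?sqr_ge0 // ltW.
have h2 : 0 <= D / (4 * c) * x ^+ 2 by rewrite mulr_ge0 ?sqr_ge0 // ltW.
rewrite /box1 -!sqrtr_sqr !ler_sqrt ?divr_ge0 ?mulr_ge0 ?(ltW c0) ?(ltW D0) //.
rewrite !(ler_pdivlMr, ler_pdivrMr) //.
have -> : x ^+ 2 * D <= 4 * c * 1.
  have : D / (4 * c) * x ^+ 2 <= 1 by lra.
  by rewrite mulrAC ler_pdivrMr ?mulr_gt0 // mul1r mulr1 mulrC.
have -> : (y + b / (2 * c) * x) ^+ 2 * c <= 1 by rewrite mulrC; lra.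
by rewrite !mulr1; case/andP: (FA x y).
Qed.

(** The parallelogram on which both squares are at most [s / 2] lies in the ellipse and has area
    [4 s / sqrt D]. *)
Lemma plane_int_ge (F : R -> R -> R) (k s : R) :
  measurable_fun [set: MR * MR] (fun v : MR * MR => F v.1 v.2) -> (forall x y, 0 <= F x y) ->
  0 <= k -> 0 <= s ->
  (forall x y, qf a b c x y <= s -> k <= F x y) -> ((4 * k * s / Num.sqrt D)%:E <= plane_int F)%E.
Proof.
move=> mF F0 k0 s0 Fq; have s20 : 0 <= s / 2 by rewrite divr_ge0.
have := @plane_int_strip k (Num.sqrt (4 * c * (s / 2) / D)) (Num.sqrt (s / 2 / c)) (b / (2 * c)) k0
  (sqrtr_ge0 _) (sqrtr_ge0 _).
rewrite -[in X in _ = X]mulrA (strip_area s20) (_ : 4 * k * _ = 4 * k * s / Num.sqrt D); last first.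
  by rewrite !mulrA; congr (_ / _); field.
move=> <-; apply: le_plane_int => //; first exact: measurable_strip.
  by move=> x y; rewrite !mulr_ge0 ?box1_ge0.
move=> x y; rewrite /box1 -!sqrtr_sqr !ler_sqrt ?divr_ge0 ?mulr_ge0 ?(ltW c0) ?(ltW D0) //.
have [hx|_] := boolP (x ^+ 2 <= _); last by rewrite mulr0 mul0r.
have [hy|_] := boolP (_ <= s / 2 / c); last by rewrite mulr0.
rewrite !mulr1; apply: Fq; rewrite qfE.
move: hx hy; rewrite !ler_pdivlMr // => hx hy.
have : D / (4 * c) * x ^+ 2 <= s / 2.
  by rewrite mulrAC ler_pdivrMr ?mulr_gt0 //; lra.
by move: hy; rewrite [_ * c]mulrC; lra.
Qed.

End Disc.

End PlaneSums.

(** * Lattice points weighted in an ellipse *)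

Section LatticeSums.
Variable R : realType.
Local Notation MR := (measurableTypeR R).
Local Notation leb := (@lebesgue_measure R).

Definition lat_sum (P : pred (int * int)) (F : R -> R -> R) : R :=
  \sum_(v \in [set v | P v]) F v.1%:~R v.2%:~R.

(** [A] bounds both the values and the variation along every line; quantifying over all lines makes
    the class stable under the unimodular substitutions of Gauss reduction. *)
Definition quad_bump (F : R -> R -> R) (A a b c : R) :=
  [/\ measurable_fun [set: MR * MR] (fun v : MR * MR => F v.1 v.2),
      forall x y, 0 <= F x y <= A,
      forall x y, F x y != 0 -> qf a b c x y <= 1 &
      forall p q r s, var_le (fun t => F (p + q * t) (r + s * t)) A].

Lemma lat_sum_box N P (F : R -> R -> R) :
  (forall i j : int, F i%:~R j%:~R != 0 -> (i \in zbox N) && (j \in zbox N)) ->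
  lat_sum P F = \sum_(j <- zbox N) \sum_(i <- zbox N) (if P (i, j) then F i%:~R j%:~R else 0).
Proof.
move=> FN; rewrite /lat_sum (fsbig_zbox2 (N := N) P (F := fun v => F v.1%:~R v.2%:~R)) //.
by move=> [i j] /FN.
Qed.

Lemma lat_sum_le (P : pred (int * int)) (F : R -> R -> R) (A r1 r2 : R) : 0 <= A -> 0 <= r1 -> 0 <= r2 ->
  (exists r, forall x y, F x y != 0 -> `|x| <= r /\ `|y| <= r) ->
  (forall i j : int, P (i, j) -> F i%:~R j%:~R <= A * box1 r1 i%:~R * box1 r2 j%:~R) ->
  lat_sum P F <= A * (2 * r1 + 2) * (2 * r2 + 2).
Proof.
move=> A0 r10 r20 [r Fr] FA.
have [N rN] : exists N : nat, `|r| + r1 + r2 < N%:R.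
  by exists (Num.truncn (`|r| + r1 + r2)).+1; rewrite truncnS_gt // !addr_ge0.
have FN (i j : int) : F i%:~R j%:~R != 0 -> (i \in zbox N) && (j \in zbox N).
  move=> /Fr[h1 h2]; have rr := ler_norm r.
  by apply/andP; split; apply: (@mem_zbox_real R); apply: le_lt_trans rN; lra.
rewrite (lat_sum_box P FN).
apply: (@le_trans _ _ (\sum_(j <- zbox N) \sum_(i <- zbox N) A * box1 r1 i%:~R * box1 r2 j%:~R)).
  apply: ler_sum => j _; apply: ler_sum => i _; case: ifP => [/FA //|_].
  by rewrite !mulr_ge0 ?box1_ge0.
under eq_bigr do rewrite -mulr_suml -mulr_sumr.
rewrite -mulr_sumr -!mulrA; apply: ler_wpM2l => //.
have nr := normr_ge0 r.
by apply: ler_pM; rewrite ?sumr_ge0 //; try (by move=> *; rewrite box1_ge0);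
  apply: zbox_count => //; lra.
Qed.

Section Reduced.
Variables (F : R -> R -> R) (A a b c mu : R).
Hypotheses (c0 : 0 < c) (bc : `|b| <= c) (ac : c / 2 <= a) (HF : quad_bump F A a b c).
Hypotheses (mu0 : 0 < mu) (hmu : forall i j : int, (i, j) != 0 -> mu <= qf a b c i%:~R j%:~R).

Let D := 4 * a * c - b ^+ 2.

Let a0 : 0 < a. Proof. by apply: lt_le_trans ac; rewrite divr_gt0. Qed.

Let b2 : b ^+ 2 <= c ^+ 2.
Proof. by rewrite -(real_normK (num_real b)) lerXn2r ?nnegrE ?(ltW c0). Qed.

Let Dc : c ^+ 2 <= D.
Proof.
have h : 0 <= (2 * a - c) * c by rewrite mulr_ge0 ?(ltW c0) // subr_ge0; move: ac; rewrite ler_pdivrMr // mulrC.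
by move: b2 h; rewrite /D; lra.
Qed.

Let D0 : 0 < D. Proof. by apply: lt_le_trans Dc; rewrite exprn_gt0. Qed.

Let A0 : 0 <= A. Proof. by case: HF => _ /(_ 0 0) /andP[u v] _ _; apply: le_trans v. Qed.

Let qf_ge x y : a * x ^+ 2 + c * y ^+ 2 <= 4 * qf a b c x y.
Proof.
rewrite -subr_ge0 (_ : _ - _ = 3 * a * (x + 4 * b / (6 * a) * y) ^+ 2 +
  (9 * a * c - 4 * b ^+ 2) / (3 * a) * y ^+ 2); last first.
  by rewrite /qf; field; rewrite gt_eqF.
have h1 : 0 <= 3 * a by rewrite mulr_ge0 ?(ltW a0).
have h2 : 0 <= 9 * a * c - 4 * b ^+ 2 by have := sqr_ge0 b; move: b2 Dc; rewrite /D; lra.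
by apply: addr_ge0; (apply: mulr_ge0; last exact: sqr_ge0) => //; apply: divr_ge0.
Qed.

Let suppF x y : F x y != 0 -> a * x ^+ 2 <= 4 /\ c * y ^+ 2 <= 4.
Proof.
case: HF => _ _ Fq _ /Fq h; have := qf_ge x y.
have h1 : 0 <= a * x ^+ 2 by rewrite mulr_ge0 ?sqr_ge0 // ltW.
have h2 : 0 <= c * y ^+ 2 by rewrite mulr_ge0 ?sqr_ge0 // ltW.
by lra.
Qed.

Let abs_le (k x : R) : 0 < k -> k * x ^+ 2 <= 4 -> `|x| <= 2 / Num.sqrt k.
Proof.
move=> k0 h; have sk : 0 < Num.sqrt k by rewrite sqrtr_gt0.
rewrite ler_pdivlMr // -(@ler_pXn2r _ 2) ?nnegrE ?mulr_ge0 ?sqrtr_ge0 //.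
by rewrite exprMn sqr_sqrtr ?(ltW k0) // real_normK ?num_real // mulrC; lra.
Qed.

Let mua : mu <= a.
Proof. by have := @hmu 1 0 isT; rewrite /qf expr1n expr0n /= !mulr0 !addr0 mulr1. Qed.

Let muc : mu <= c.
Proof. by have := @hmu 0 1 isT; rewrite /qf expr1n expr0n /= !mulr0 !mul0r !add0r mulr1. Qed.

(** [mu <= c], and [|b| <= c <= 2 a] gives [D >= 2 c^2 - c^2 = c^2]. *)
Lemma reduced_hermite : mu <= Num.sqrt D.
Proof.
rewrite -(ger0_norm (ltW mu0)) -sqrtr_sqr ler_sqrt ?(ltW D0) //; apply: le_trans Dc.
by rewrite lerXn2r ?nnegrE ?(ltW mu0) ?(ltW c0).
Qed.

(** The four sides of a box of lattice points contribute area plus perimeter; coprimality removes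
    the perimeter term of a long thin ellipse, which is what allows [1 + 1 / sqrt D]. *)
Lemma reduced_coprime_sum :
  lat_sum (fun v => coprimez v.1 v.2) F <= 200 * A * (1 + (Num.sqrt D)^-1).
Proof.
have Fr : exists r, forall x y, F x y != 0 -> `|x| <= r /\ `|y| <= r.
  exists (2 / Num.sqrt a + 2 / Num.sqrt c) => x y /suppF[/(abs_le a0) h1 /(abs_le c0) h2].
  by split; [apply: (le_trans h1); rewrite lerDl|apply: (le_trans h2); rewrite lerDr];
    rewrite divr_ge0 ?sqrtr_ge0.
have FA (x y : R) : F x y <= A by case: HF => _ /(_ x y) /andP[].
have iD : 0 <= (Num.sqrt D)^-1 by rewrite invr_ge0 sqrtr_ge0.
have AD := mulr_ge0 A0 iD.
set t := (Num.sqrt D)^-1 in iD AD *.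
(* For [a > 4] the support, contained in [a x^2 <= 4], leaves [i = 0], and coprimality then forces
   [j] to be 1 or -1. Otherwise both sides of the box are bounded below and its area controls the
   count. *)
have [a4|a4] := ltP 4 a.
  apply: (le_trans (lat_sum_le (r1 := 0) (r2 := 1) A0 _ _ Fr _)) => //; last by move: A0 AD iD; lra.
  move=> i j /= cij; have [->|/suppF[h1 _]] := eqVneq (F i%:~R j%:~R) 0.
    by rewrite !mulr_ge0 ?box1_ge0.
  have i0 : i = 0.
    apply/eqP; apply: contraTT h1 => i0; rewrite -ltNge; apply: (lt_le_trans a4).
    rewrite -{1}(mulr1 a) ler_pM2l // -(rmorphXn (intr : int -> R)) /=.
    by rewrite -[1]/(1%:~R) ler_int -gtz0_ge1 exprn_even_gt0.
  have j1 : absz j = 1%N by move: cij; rewrite i0 /coprimez /gcdz absz0 gcd0n => /eqP[].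
  by rewrite i0 /box1 normr0 lexx mulr1 -intr_norm -natr_absz j1 lexx mulr1.
have c8 : c <= 8 by move: ac a4; rewrite ler_pdivrMr //; lra.
set r1 := 2 / Num.sqrt a; set r2 := 2 / Num.sqrt c.
have r1p : 1 <= r1.
  by rewrite /r1 ler_pdivlMr ?sqrtr_gt0 // mul1r -(ler_sqr) ?nnegrE ?sqrtr_ge0 // sqr_sqrtr ?(ltW a0) //; lra.
have r2p : 1 <= 2 * r2.
  rewrite /r2 mulrA ler_pdivlMr ?sqrtr_gt0 // mul1r -(ler_sqr) ?nnegrE ?sqrtr_ge0 ?mulr_ge0 //.
  by rewrite sqr_sqrtr ?(ltW c0) //; lra.
have r12 : r1 * r2 <= 8 / Num.sqrt D.
  have -> : r1 * r2 = 4 / Num.sqrt (a * c).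
    by rewrite /r1 /r2 sqrtrM ?(ltW a0) //; field; rewrite !gt_eqF ?sqrtr_gt0.
  rewrite ler_pdivrMr ?sqrtr_gt0 ?mulr_gt0 // mulrAC ler_pdivlMr ?sqrtr_gt0 //.
  rewrite -ler_sqr ?nnegrE ?mulr_ge0 ?sqrtr_ge0 // !exprMn !sqr_sqrtr ?mulr_ge0 ?(ltW a0) ?(ltW c0) ?(ltW D0) //.
  by rewrite /D; have := sqr_ge0 b; lra.
apply: (le_trans (lat_sum_le (r1 := r1) (r2 := r2) A0 _ _ Fr _)); try lra.
  move=> i j _; have [->|/suppF[/(abs_le a0) h1 /(abs_le c0) h2]] := eqVneq (F i%:~R j%:~R) 0.
    by rewrite !mulr_ge0 ?box1_ge0.
  by rewrite /box1 h1 h2 !mulr1.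
have h : (2 * r1 + 2) * (2 * r2 + 2) <= (4 * r1) * (6 * r2).
  by apply: ler_pM; lra.
rewrite -mulrA; apply: (@le_trans _ _ (A * (192 * t))); last by move: A0 AD iD; lra.
by apply: ler_wpM2l => //; move: h r12; rewrite -/t; lra.
Qed.

Let line_sum (f : R -> R) (r t : R) (N : nat) : measurable_fun [set: MR] (f : MR -> R) ->
  (forall x, 0 <= f x) -> var_le f A -> (forall x, f x != 0 -> `|x| <= r /\ `|t| <= r) -> r < N%:R ->
  ((\sum_(i <- zbox N) f i%:~R)%:E <= \int[leb]_x (f x)%:E + (2 * A * box1 r t)%:E /\
   \int[leb]_x (f x)%:E <= (\sum_(i <- zbox N) f i%:~R)%:E + (2 * A * box1 r t)%:E)%E.
Proof.
move=> mf f0 fV fr rN; rewrite /box1; case: (leP `|t| r) => tr /=.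
  rewrite mulr1; apply: zbox_sum_integral => // x /fr[xr _]; exact: le_lt_trans rN.
have fz x : f x = 0 by apply/eqP; apply: contraTT tr => /fr[_]; rewrite leNgt.
have -> : \sum_(i <- zbox N) f i%:~R = 0 by apply: big1 => i _; rewrite fz.
have -> : (\int[leb]_x (f x)%:E = 0)%E by apply: integral0_eq => x _; rewrite fz.
by rewrite mulr0 adde0.
Qed.

(** Sum and integral are compared in one variable at a time. The support has radius at most [r], so
    a loss of [2 A] per line adds up to a multiple of [A r], also after the additive constants are
    absorbed by [r >= 2]. *)
Let lattice_sum_small (I : R) : mu <= 1 -> plane_int F = I%:E ->
  `|lat_sum predT F - I| <= 29 * A / Num.sqrt mu.
Proof.
move=> mu1 FI; set r := 2 / Num.sqrt mu.
have smu : 0 < Num.sqrt mu by rewrite sqrtr_gt0.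
have r2 : 2 <= r.
  by rewrite ler_pdivlMr // ler_piMr // -sqrtr1 ler_sqrt.
have Fr x y : F x y != 0 -> `|x| <= r /\ `|y| <= r.
  move=> /suppF[h1 h2]; split; apply: abs_le => //.
    by apply: le_trans h1; rewrite ler_wpM2r ?sqr_ge0.
  by apply: le_trans h2; rewrite ler_wpM2r ?sqr_ge0.
have [mF FA _ FV] := HF.
have F0 x y : 0 <= F x y by case/andP: (FA x y).
pose N := (Num.truncn r).+1; have rN : r < N%:R by rewrite truncnS_gt.
have FN (i j : int) : F i%:~R j%:~R != 0 -> (i \in zbox N) && (j \in zbox N).
  by move=> /Fr[h1 h2]; apply/andP; split; apply: (@mem_zbox_real R); apply: le_lt_trans rN.
rewrite (lat_sum_box predT FN) /= exchange_big /=.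
have mS y : measurable_fun [set: MR] (fun x : MR => F x y).
  exact: (measurable_fun_pair1 (f := fun v : MR * MR => F v.1 v.2) y mF).
have V1 x : var_le (F x) A.
  have := FV x 0 0 1; rewrite (_ : (fun t => _) = F x) //; apply/funext => t.
  by rewrite mul0r addr0 add0r mul1r.
have V2 y : var_le (F ^~ y) A.
  have := FV 0 1 y 0; rewrite (_ : (fun t => _) = F ^~ y) //; apply/funext => t.
  by rewrite mul0r addr0 add0r mul1r.
have h1 x := line_sum (t := x) (measurable_section2 x mF) (F0 x) (V1 x)
  (fun y Fy => let: conj p q := Fr x y Fy in conj q p) rN.
have h2 y := line_sum (t := y) (mS y) (F0 ^~ y) (V2 y) (fun x => Fr x y) rN.
pose e := \sum_(i <- zbox N) (2 * A * box1 r (i%:~R : R)).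
have eB : e <= 2 * A * (2 * r + 2).
  rewrite /e -mulr_sumr ler_wpM2l ?mulr_ge0 // zbox_count //; lra.
(* [J] is summed in the first variable and integrated in the second; it lies between the double
   integral and the double sum. *)
pose J : \bar R := (\sum_(i <- zbox N) \int[leb]_y (F i%:~R y)%:E)%E.
have JE : J = (\int[leb]_y (\sum_(i <- zbox N) F i%:~R y)%:E)%E.
  rewrite /J -ge0_integral_sum //.
  - by apply: eq_integral => y _; rewrite sumEFin.
  - by move=> i; apply/measurable_EFinP; exact: measurable_section2.
  - by move=> i y _; rewrite lee_fin.
have mT : measurable_fun [set: MR] (fun y : MR => \sum_(i <- zbox N) F i%:~R y).
  by apply: measurable_sum => i; exact: measurable_section2.
have T0 y : 0 <= \sum_(i <- zbox N) F i%:~R y by apply: sumr_ge0.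
have Isw : I%:E = (\int[leb]_y \int[leb]_x (F x y)%:E)%E by rewrite -FI plane_int_swap.
have mI : measurable_fun [set: MR] (fun y : MR => (\int[leb]_x (F x y)%:E)%E).
  by apply: (measurable_inner (F := fun y x => F x y)) => //;
    have := measurable_linear2 0 1 1 0 mF; apply: eq_measurable_fun => v _; rewrite !mul0r !mul1r add0r addr0.
have I0 y : (0 <= \int[leb]_x (F x y)%:E)%E by apply: integral_ge0 => x _; rewrite lee_fin.
have b0 : 0 <= 2 * A by rewrite mulr_ge0.
have mb : measurable_fun [set: MR] (fun y : MR => (2 * A * box1 r y)%:E).
  by apply/measurable_EFinP; apply: measurable_funM => //; exact: measurable_box1.
have bb0 y : (0 <= (2 * A * box1 r y)%:E)%E by rewrite lee_fin mulr_ge0 ?box1_ge0.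
have r0 : 0 <= r by lra.
have J1 : (J <= I%:E + (2 * A * (2 * r))%:E)%E.
  rewrite JE Isw -(integral_box1 b0 r0) -ge0_integralD //.
  apply: ge0_le_integral => //.
  - by move=> y _; rewrite lee_fin.
  - by apply/measurable_EFinP.
  - by apply: emeasurable_funD.
  - by move=> y _; case: (h2 y).
have J2 : (I%:E <= J + (2 * A * (2 * r))%:E)%E.
  rewrite JE Isw -(integral_box1 b0 r0) -ge0_integralD //; last 2 first.
  - by move=> y _; rewrite lee_fin.
  - by apply/measurable_EFinP.
  apply: ge0_le_integral => //.
  - by apply: emeasurable_funD => //; apply/measurable_EFinP.
  - by move=> y _; case: (h2 y).
have S1 : ((\sum_(i <- zbox N) \sum_(j <- zbox N) F i%:~R j%:~R)%:E <= J + e%:E)%E.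
  rewrite /J /e -!sumEFin -big_split /=; apply: lee_sum => i _.
  by case: (h1 i%:~R).
have S2 : (J <= (\sum_(i <- zbox N) \sum_(j <- zbox N) F i%:~R j%:~R)%:E + e%:E)%E.
  rewrite /J /e -!sumEFin -big_split /=; apply: lee_sum => i _.
  by case: (h1 i%:~R).
have Jfin : J \is a fin_num.
  rewrite ge0_fin_numE; first by apply: (le_lt_trans J1); rewrite -EFinD ltry.
  by rewrite /J sume_ge0 // => i _; apply: integral_ge0 => y _; rewrite lee_fin.
move: J1 J2 S1 S2; rewrite -(fineK Jfin) -!EFinD !lee_fin.
set S := \sum_(i <- zbox N) _; set j := fine J => J1 J2 S1 S2.
have -> : 29 * A / Num.sqrt mu = 29 / 2 * (A * r) by rewrite /r; field; rewrite gt_eqF.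
have Ar : 2 * A <= A * r by rewrite mulrC ler_wpM2l.
by rewrite ler_norml; apply/andP; split; move: A0; lra.
Qed.

(** The value at the origin is taken out because the sieve cancels it, and without it the bound
    persists for large [mu]: for [mu > 1] the origin is the only lattice point in the support, and
    the area of the ellipse bounds [I]. *)
Lemma reduced_lattice_sum (I : R) : plane_int F = I%:E ->
  `|lat_sum predT F - F 0 0 - I| <= 30 * A / Num.sqrt mu.
Proof.
move=> FI; have [mF FA Fq FV] := HF.
have smu : 0 < Num.sqrt mu by rewrite sqrtr_gt0.
have [mu1|mu1] := leP mu 1.
  have h := lattice_sum_small mu1 FI.
  have : `|F 0 0| <= A / Num.sqrt mu.
    case/andP: (FA 0 0) => u v; rewrite ger0_norm // ler_pdivlMr //.
    rewrite -[leRHS]mulr1; apply: ler_pM => //.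
    by rewrite -sqrtr1 ler_sqrt.
  move: h; rewrite !ler_norml -!mulrA => /andP[h1 h2] /andP[h3 h4].
  by apply/andP; split; lra.
have -> : lat_sum predT F = F 0 0.
  transitivity (\sum_(v \in [set ((0, 0) : int * int)]) F v.1%:~R v.2%:~R); last by rewrite fsbig_set1.
  apply/esym/fsbig_widen => // -[i j] [_ /= ij]; apply/eqP; apply: contraT => /Fq h.
  have /hmu h' : (i, j) != 0 by apply/eqP => -[i0 j0]; apply: ij; rewrite i0 j0.
  by have := lt_le_trans mu1 (le_trans h' h); rewrite ltxx.
rewrite subrr sub0r normrN.
have I0 : 0 <= I.
  by rewrite -lee_fin -FI; apply: integral_ge0 => x _; apply: integral_ge0 => y _; rewrite lee_fin; case/andP: (FA x y).
have := plane_int_le c0 D0 mF FA Fq; rewrite FI lee_fin ger0_norm // => /le_trans; apply.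
rewrite -(mulrA 8) -(mulrA 30); apply: ler_pM => //; first by rewrite mulr_ge0 // invr_ge0 sqrtr_ge0.
  by lra.
have mD : mu <= D.
  apply: le_trans Dc; apply: (le_trans muc); rewrite expr2 ler_pMr //.
  by apply: le_trans muc; exact: ltW.
have sD : 0 < Num.sqrt D by rewrite sqrtr_gt0 D0.
by apply: ler_wpM2l A0 _ _ _; rewrite lef_pV2 ?posrE //; exact: ler_wsqrtr.
Qed.

End Reduced.

Lemma qf_shear (a b c k x y : R) :
  qf (a + b * k + c * k ^+ 2) (b + 2 * c * k) c x y = qf a b c x (y + k * x).
Proof. by rewrite /qf; ring. Qed.

Lemma quad_bump_shear (F : R -> R -> R) (A a b c k : R) : quad_bump F A a b c ->
  quad_bump (fun x y => F x (y + k * x)) A (a + b * k + c * k ^+ 2) (b + 2 * c * k) c.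
Proof.
case=> mF FA Fq FV; split=> //.
- have := measurable_linear2 1 0 k 1 mF; apply: eq_measurable_fun => v _.
  by rewrite !mul1r mul0r addr0 addrC.
- by move=> x y /Fq; rewrite qf_shear.
move=> p q r s; have := FV p q (r + k * p) (s + k * q).
rewrite (_ : (fun t => _) = (fun t : R => F (p + q * t) (r + s * t + k * (p + q * t)))) //.
by apply/funext => t; congr F; ring.
Qed.

Lemma quad_bump_swap (F : R -> R -> R) (A a b c : R) : quad_bump F A a b c ->
  quad_bump (fun x y => F y x) A c b a.
Proof.
case=> mF FA Fq FV; split=> //.
- have := measurable_linear2 0 1 1 0 mF; apply: eq_measurable_fun => v _.
  by rewrite !mul1r !mul0r addr0 add0r.
by move=> x y /Fq; rewrite /qf; lra.
Qed.

Lemma lat_sum_bij (P : pred (int * int)) (F G : R -> R -> R) (f g : int * int -> int * int) :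
  cancel f g -> cancel g f -> (forall v, P (f v) = P v) ->
  (forall v : int * int, F (f v).1%:~R (f v).2%:~R = G v.1%:~R v.2%:~R) -> lat_sum P G = lat_sum P F.
Proof.
move=> fK gK Pf FG; rewrite /lat_sum [RHS](reindex_fsbig f [set v | P v] [set v | P v]).
  by apply: eq_fsbigr => v _; exact/esym/FG.
split; first by move=> v /=; rewrite Pf.
  by move=> u v _ _; exact: can_inj fK u v.
by move=> v /= Pv; exists (g v) => //; rewrite -Pf gK.
Qed.

Lemma coprimez_shear (i j k : int) : coprimez i (j + k * i) = coprimez i j.
Proof. by rewrite /coprimez addrC gcdzMDl. Qed.

Lemma lat_sum_shear P (F : R -> R -> R) (k : int) :
  (forall i j, P (i, j + k * i) = P (i, j)) ->
  lat_sum P (fun x y => F x (y + k%:~R * x)) = lat_sum P F.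
Proof.
move=> Pk; apply: (lat_sum_bij (f := fun v => (v.1, v.2 + k * v.1)) (g := fun v => (v.1, v.2 - k * v.1))).
- by move=> [i j] /=; rewrite addrK.
- by move=> [i j] /=; rewrite subrK.
- by move=> [i j] /=.
by move=> [i j] /=; rewrite intrD intrM.
Qed.

Lemma lat_sum_swap P (F : R -> R -> R) : (forall i j, P (j, i) = P (i, j)) ->
  lat_sum P (fun x y => F y x) = lat_sum P F.
Proof. by move=> Ps; apply: (lat_sum_bij (f := fun v => (v.2, v.1)) (g := fun v => (v.2, v.1))) => -[]. Qed.

Definition lattice_estimates (F : R -> R -> R) (A D mu : R) :=
  [/\ mu <= Num.sqrt D,
      forall I : R, plane_int F = I%:E -> `|lat_sum predT F - F 0 0 - I| <= 30 * A / Num.sqrt mu &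
      lat_sum (fun v => coprimez v.1 v.2) F <= 200 * A * (1 + (Num.sqrt D)^-1)].

(* Gauss reduction: each round of shear and swap at least halves [c], which stays above [mu]. *)
Lemma quad_bump_estimates (F : R -> R -> R) (A a b c mu : R) :
  0 < c -> 0 < 4 * a * c - b ^+ 2 -> quad_bump F A a b c -> 0 < mu ->
  (forall i j : int, (i, j) != 0 -> mu <= qf a b c i%:~R j%:~R) ->
  lattice_estimates F A (4 * a * c - b ^+ 2) mu.
Proof.
move=> c0 D0 HF mu0 hmu; have [k ck] : exists k : nat, c < 2 ^+ k * mu.
  have [k kc] : exists k : nat, c / mu < k%:R by exists (Num.truncn (c / mu)).+1; rewrite truncnS_gt.
  exists k; rewrite -ltr_pdivrMr //; apply: (lt_trans kc).
  by rewrite -natrX ltr_nat ltn_expl.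
elim: k F a b c c0 D0 HF hmu ck => [|k IH] F a b c c0 D0 HF hmu ck.
  have := @hmu 0 1 isT; rewrite /qf expr1n expr0n /= !mulr0 !mul0r !add0r mulr1 => h.
  by have := le_lt_trans h ck; rewrite expr0 mul1r ltxx.
(* The integer nearest to [- b / (2 c)]; the shear by [m] brings the middle coefficient to at most
   [c] in absolute value. *)
pose m : int := Num.floor (2^-1 - b / (2 * c)).
have c20 : 0 < 2 * c by rewrite mulr_gt0.
have mc : `|b + 2 * c * m%:~R| <= c.
  have := floor_itv (2^-1 - b / (2 * c)); rewrite -/m intrD => /andP[m1 m2].
  have e : 2 * c * (2^-1 - b / (2 * c)) = c - b by field; rewrite gt_eqF.
  have m1' : 2 * c * m%:~R <= c - b by rewrite -e ler_pM2l.
  have m2' : c - b < 2 * c * (m%:~R + 1) by rewrite -e ltr_pM2l.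
  by rewrite ler_norml; apply/andP; split; lra.
have HF' := quad_bump_shear m%:~R HF.
set a' := a + _ + _ in HF'; set b' := b + _ in HF' mc; set F' := fun x => _ in HF'.
have DE : 4 * a * c - b ^+ 2 = 4 * a' * c - b' ^+ 2 by rewrite /a' /b'; ring.
have hmu' (i j : int) : (i, j) != 0 -> mu <= qf a' b' c i%:~R j%:~R.
  move=> ij; rewrite qf_shear -intrM -intrD; apply: hmu.
  apply: contraNneq ij => -[-> /eqP]; rewrite mulr0 addr0 => /eqP ->.
  by [].
suff h : lattice_estimates F' A (4 * a' * c - b' ^+ 2) mu.
  rewrite DE; case: h => h1 h2 h3; have [mF FA _ _] := HF; split=> //.
    move=> I FI; have := h2 I; rewrite /F' plane_int_shear //; last by move=> x y; case/andP: (FA x y).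
    rewrite (@lat_sum_shear predT) // mulr0 addr0 => h4; exact: h4.
  by rewrite -(@lat_sum_shear _ F m) // => i j; exact: coprimez_shear.
have [ac|ac] := leP (c / 2) a'.
  rewrite DE in D0; split; first exact: (reduced_hermite c0 mc ac mu0 hmu').
    exact: (reduced_lattice_sum c0 mc ac HF' mu0 hmu').
  exact: (reduced_coprime_sum c0 mc ac HF').
have [mF FA _ _] := HF'; have F0 x y : 0 <= F' x y by case/andP: (FA x y).
have DE' : 4 * a' * c - b' ^+ 2 = 4 * c * a' - b' ^+ 2 by ring.
rewrite DE'; have [|||||h1 h2 h3] := IH (fun x y => F' y x) c b' a'.
- by have := @hmu' 1 0 isT; rewrite /qf expr1n expr0n /= !mulr0 !addr0 mulr1; apply: lt_le_trans.
- by rewrite -DE' -DE.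
- exact: quad_bump_swap.
- move=> i j ij; have -> : qf c b' a' i%:~R j%:~R = qf a' b' c j%:~R i%:~R by rewrite /qf; ring.
  by apply: hmu'; apply: contraNneq ij => -[-> ->].
- by rewrite exprS in ck; apply: (lt_trans ac); rewrite ltr_pdivrMr // mulrC mulrA.
split=> //.
  move=> I FI; have := h2 I; rewrite -plane_int_swap // (@lat_sum_swap predT) // => h4; exact: h4.
by rewrite -(@lat_sum_swap _ F') // => i j /=; rewrite coprimez_sym.
Qed.

End LatticeSums.

(** * Variation of weights along quadratic curves *)

Section ConeWeights.
Variable R : realType.
Local Notation MR := (measurableTypeR R).
Local Notation leb := (@lebesgue_measure R).

(** Clipping the coordinates does not alter a weight that vanishes off the open unit ball, and it
    makes the variation of the coordinates independent of their size. *)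
Definition clamp (x : R) : R := Num.max (- 1) (Num.min x 1).

Lemma clamp_bound x : `|clamp x| <= 1.
Proof.
rewrite /clamp ler_norml le_max lexx /= ge_max ge_min lexx orbT andbT.
by lra.
Qed.

Lemma clamp_homo : {homo clamp : x y / x <= y}.
Proof.
move=> x y xy; rewrite /clamp ge_max !le_max lexx /=; apply/orP; right.
by rewrite le_min !ge_min xy lexx orbT.
Qed.

Lemma clampN x : clamp (- x) = - clamp x.
Proof.
rewrite /clamp; case: (leP x 1); case: (leP (- x) 1) => h1 h2.
- by rewrite !(max_idPr _) //; lra.
- by rewrite (max_idPr _) ?(max_idPl _) ?opprK //; lra.
- by rewrite (max_idPl _) ?(max_idPr _) //; lra.
- by lra.
Qed.

Lemma clamp_id x : `|x| <= 1 -> clamp x = x.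
Proof. by rewrite ler_norml => /andP[a b]; rewrite /clamp (min_idPl b) (max_idPr a). Qed.

Lemma clamp_norm x : 1 < `|x| -> `|clamp x| = 1.
Proof.
rewrite ltr_normr /clamp => /orP[x1|x1].
  by rewrite (min_idPr (ltW x1)) (max_idPr _) ?normr1 //; lra.
have x2 : x < -1 by lra.
by rewrite (min_idPl _) ?(max_idPl _) ?normrN1 //; lra.
Qed.

Lemma var_le_turn (g : R -> R) (t0 : R) : (forall x, `|g x| <= 1) ->
  (forall x y, x <= y -> y <= t0 -> g y <= g x) -> (forall x y, t0 <= x -> x <= y -> g x <= g y) ->
  var_le g 2.
Proof.
move=> g1 gd gi; exists (fun x => if x <= t0 then g t0 - g x else g x - g t0); split.
- move=> x y xy; case: (leP x t0) => xt; case: (leP y t0) => yt.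
  + by have := gd _ _ xy yt; lra.
  + by have := gd _ _ xt (lexx _); have := gi _ _ (lexx _) (ltW yt); lra.
  + by have := lt_le_trans xt (le_trans xy yt); rewrite ltxx.
  + by have := gi _ _ (ltW xt) xy; lra.
- move=> x; have := g1 x; have := g1 t0; rewrite !ler_norml => /andP[a b] /andP[c d].
  by case: ifP => _; apply/andP; split; lra.
move=> x y xy; case: (leP x t0) => xt; case: (leP y t0) => yt.
- by have h := gd _ _ xy yt; rewrite ger0_norm ?subr_ge0 //; lra.
- have := gd _ _ xt (lexx _); have := gi _ _ (lexx _) (ltW yt).
  by rewrite ler_norml => *; apply/andP; split; lra.
- by have := lt_le_trans xt (le_trans xy yt); rewrite ltxx.
- have h := gi _ _ (ltW xt) xy.
  by rewrite ler_norml; apply/andP; split; lra.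
Qed.

Lemma var_leN (g : R -> R) A : var_le (fun x => - g x) A -> var_le g A.
Proof.
by case=> V [h1 h2 h3]; exists V; split=> // x y /h3; rewrite -opprD normrN.
Qed.

(** A quadratic polynomial is monotone on either side of its vertex [t0]; clipped, it has a
    variation bound free of its coefficients. *)
Lemma var_le_clamp_quad (al be ga : R) : var_le (fun t => clamp (al * t ^+ 2 + be * t + ga)) 2.
Proof.
have pos (a b c : R) : 0 < a -> var_le (fun t => clamp (a * t ^+ 2 + b * t + c)) 2.
  move=> a0; pose t0 := - b / (2 * a).
  have t0E : 2 * a * t0 + b = 0 by rewrite /t0; field; rewrite gt_eqF.
  have dE x y : a * y ^+ 2 + b * y + c - (a * x ^+ 2 + b * x + c) =
      (y - x) * (a * ((x - t0) + (y - t0)) + (2 * a * t0 + b)) by ring.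
  apply: (@var_le_turn _ t0) => [x|x y xy yt|x y tx xy]; first exact: clamp_bound.
    apply: clamp_homo; rewrite -subr_le0 dE t0E addr0.
    by apply: mulr_ge0_le0; [lra|apply: mulr_ge0_le0; lra].
  apply: clamp_homo; rewrite -subr_ge0 dE t0E addr0.
  by apply: mulr_ge0; [lra|apply: mulr_ge0; lra].
have lin (b c : R) : 0 <= b -> var_le (fun t => clamp (0 * t ^+ 2 + b * t + c)) 2.
  move=> b0; have mono x y : x <= y -> clamp (0 * x ^+ 2 + b * x + c) <= clamp (0 * y ^+ 2 + b * y + c).
    by move=> xy; apply: clamp_homo; rewrite !mul0r !add0r lerD2r ler_wpM2l.
  exists (fun t => clamp (0 * t ^+ 2 + b * t + c)); split=> //.
    by move=> x; apply: (le_trans (clamp_bound _)); lra.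
  by move=> x y /mono h; rewrite distrC ger0_norm ?subr_ge0.
have neg : (fun t => - clamp (al * t ^+ 2 + be * t + ga)) =
    (fun t => clamp (- al * t ^+ 2 + - be * t + - ga)).
  by apply/funext => t; rewrite -clampN; congr clamp; ring.
have [al0|al0|al0] := ltgtP al 0; first by apply: var_leN; rewrite neg; apply: pos; lra.
  exact: pos.
have [be0|be0] := leP 0 be; first by rewrite al0; apply: lin.
by apply: var_leN; rewrite neg al0 oppr0; apply: lin; lra.
Qed.

(** Vanishing is demanded on the unit sphere as well, since clipping may send an exterior point onto
    it. *)
Definition lip_weight (w : R * R * R -> R) (A : R) :=
  [/\ forall x, 0 <= w x <= A,
      forall x y : R * R * R, `|w x - w y| <= A * (`|x.1.1 - y.1.1| + `|x.1.2 - y.1.2| + `|x.2 - y.2|) &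
      forall x, 1 <= norm2 x -> w x = 0].

Lemma abs_le_norm2 (x : R * R * R) : [/\ `|x.1.1| <= norm2 x, `|x.1.2| <= norm2 x & `|x.2| <= norm2 x].
Proof.
rewrite /norm2 -!sqrtr_sqr; have h1 := sqr_ge0 x.1.1; have h2 := sqr_ge0 x.1.2; have h3 := sqr_ge0 x.2.
by split; apply: ler_wsqrtr; lra.
Qed.

Lemma lip_weight_clamp w A x : lip_weight w A ->
  w x = w (clamp x.1.1, clamp x.1.2, clamp x.2).
Proof.
case=> _ _ w0; case: x => -[x y] z /=.
have [/andP[/andP[h1 h2] h3]|] := boolP ((`|x| <= 1) && (`|y| <= 1) && (`|z| <= 1)).
  by rewrite !clamp_id.
move=> h; rewrite !w0 //.
  have [/= h1 h2 h3] := abs_le_norm2 (clamp x, clamp y, clamp z).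
  by move: h; rewrite !negb_and -!ltNge => /orP[/orP[]|] /clamp_norm <-.
have [/= h1 h2 h3] := abs_le_norm2 (x, y, z).
by move: h; rewrite !negb_and -!ltNge => /orP[/orP[]|] h; apply: ltW; apply: (lt_le_trans h).
Qed.

(** The Lipschitz bound adds the majorants of the three coordinates, each at most 2, hence [6 A]. *)
Lemma lip_weight_var w A (f1 f2 f3 : R -> R) : 0 <= A -> lip_weight w A ->
  var_le (clamp \o f1) 2 -> var_le (clamp \o f2) 2 -> var_le (clamp \o f3) 2 ->
  var_le (fun t => w (f1 t, f2 t, f3 t)) (6 * A).
Proof.
move=> A0 Hw [V1 [n1 b1 v1]] [V2 [n2 b2 v2]] [V3 [n3 b3 v3]].
exists (fun t => A * (V1 t + V2 t + V3 t)); split.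
- by move=> x y xy; apply: ler_wpM2l => //; rewrite !lerD ?n1 ?n2 ?n3.
- move=> x; rewrite normrM ger0_norm // mulrC ler_wpM2r //.
  have h := ler_normD (V1 x + V2 x) (V3 x); have h' := ler_normD (V1 x) (V2 x).
  by have := b1 x; have := b2 x; have := b3 x; lra.
move=> x y xy; have e t := lip_weight_clamp (f1 t, f2 t, f3 t) Hw.
rewrite (e x) (e y) -mulrBr; case: Hw => _ wL _.
apply: (le_trans (wL _ _)); apply: ler_wpM2l => //=.
by have := v1 x y xy; have := v2 x y xy; have := v3 x y xy => /=; lra.
Qed.

Definition quad3 (f : R -> R -> R * R * R) := exists a b c a' b' c' a'' b'' c'' : R,
  f = fun x y => (qf a b c x y, qf a' b' c' x y, qf a'' b'' c'' x y).

Lemma continuous_lip_weight w A : 0 <= A -> lip_weight w A -> continuous w.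
Proof.
move=> A0 [_ wL _] x; apply/cvgrPdist_le => e e0.
have d0 : 0 < e / (3 * (A + 1)) by rewrite divr_gt0 // mulr_gt0 // ltr_wpDl.
near=> y; apply: (le_trans (wL _ _)).
have : `|x - y| < e / (3 * (A + 1)).
  by near: y; exact: (@cvgr_dist_lt _ _ _ _ _ id x cvg_id _ d0).
rewrite ltr_pdivlMr ?mulr_gt0 ?ltr_wpDl // => h.
have n0 := normr_ge0 (x - y).
have [h1 h2 h3] : [/\ `|x.1.1 - y.1.1| <= `|x - y|, `|x.1.2 - y.1.2| <= `|x - y| & `|x.2 - y.2| <= `|x - y|].
  by split; rewrite /Num.norm /= ?le_max ?lexx ?orbT.
apply: (@le_trans _ _ (A * (3 * `|x - y|))); first by apply: ler_wpM2l => //; lra.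
by apply: le_trans (ltW h); rewrite mulrCA [leRHS]mulrC -mulrA ler_wpM2l // mulrDl mulrC; lra.
Unshelve. all: by end_near. Qed.

Lemma quad_bump_cone w A (f : R -> R -> R * R * R) (a b c : R) : 0 <= A -> lip_weight w A -> quad3 f ->
  (forall x y, qf a b c x y <= norm2 (f x y)) ->
  quad_bump (fun x y => w (f x y)) (6 * A) a b c.
Proof.
move=> A0 Hw [p1 [p2 [p3 [q1 [q2 [q3 [r1 [r2 [r3 fE]]]]]]]]] fq.
have [wA _ w1] := Hw.
have m1 : measurable_fun [set: MR * MR] (fun v : MR * MR => v.1) by exact: measurable_fst.
have m2 : measurable_fun [set: MR * MR] (fun v : MR * MR => v.2) by exact: measurable_snd.
have mq (k l m : R) : measurable_fun [set: MR * MR] (fun v : MR * MR => qf k l m v.1 v.2).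
  by rewrite /qf; apply: measurable_realfun.measurable_funD; [apply: measurable_realfun.measurable_funD|];
    rewrite ?expr2; repeat (apply: measurable_funM => //); apply: measurable_funX.
split.
- rewrite fE; apply: (measurableT_comp (f := w : MR * MR * MR -> R)).
    exact: measurable_continuous3 (continuous_lip_weight A0 Hw).
  have m12 := measurable_fun_pair (mq p1 p2 p3) (mq q1 q2 q3).
  exact: (measurable_fun_pair m12 (mq r1 r2 r3)).
- by move=> x y; case/andP: (wA (f x y)) => -> h /=; apply: (le_trans h); lra.
- move=> x y /eqP h; apply: (le_trans (fq x y)); rewrite leNgt; apply/negP => /ltW /w1 /h.
  by [].
move=> p q r s; rewrite fE.
have qq (k l m : R) : var_le (clamp \o (fun t => qf k l m (p + q * t) (r + s * t))) 2.
  have := var_le_clamp_quad (k * q ^+ 2 + l * q * s + m * s ^+ 2)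
    (2 * k * p * q + l * (p * s + q * r) + 2 * m * r * s) (k * p ^+ 2 + l * p * r + m * r ^+ 2).
  congr (var_le _ 2); apply/funext => t /=; congr clamp; rewrite /qf; ring.
exact: lip_weight_var.
Qed.

End ConeWeights.

(** * Parametrization of the primitive zeros *)

Section ConeParametrization.

(** Take [u = gcd(X, Z)], [v = Z / u] and [d = X / u^2]. The two points with [Z = 0] are separate:
    [u = 0] forces [d = n] and [v = 1], while [v = 0] forces [d = 1] and [u = 1]. *)
Lemma square_factor (n X Y Z : nat) : (0 < n)%N -> (X * Y = n * Z ^ 2)%N -> gcdn (gcdn X Y) Z = 1%N ->
  exists d u v : nat, [/\ (d %| n)%N, (X = d * u ^ 2)%N, (Y = n %/ d * v ^ 2)%N & (Z = u * v)%N] /\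
    [/\ coprime u v, coprime u (n %/ d) & coprime v d].
Proof.
move=> n0 XY g1; pose u := gcdn X Z.
have uY : coprime u Y by rewrite /coprime /u -gcdnA (gcdnC Z) gcdnA g1.
have [u0|u0] := posnP u.
  have X0 : X = 0%N by apply/eqP; move: u0 => /eqP; rewrite /u; case: (X) => // X'; rewrite eqn0Ngt gcdn_gt0.
  have Z0 : Z = 0%N by apply/eqP; move: u0 => /eqP; rewrite /u; case: (Z) => // Z'; rewrite eqn0Ngt gcdn_gt0 orbT.
  have Y1 : Y = 1%N by move: g1; rewrite X0 Z0 gcd0n gcdn0.
  by exists n, 0%N, 1%N; rewrite X0 Y1 Z0 dvdnn divnn n0 /coprime gcd1n gcdn1 muln0.
have [X' XE] : exists X', X = (X' * u)%N by apply/dvdnP; rewrite dvdn_gcdl.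
have [v ZE] : exists v, Z = (v * u)%N by apply/dvdnP; rewrite dvdn_gcdr.
have Xv : coprime X' v.
  have : gcdn (X' * u) (v * u) = (1 * u)%N by rewrite -XE -ZE mul1n.
  by rewrite -muln_gcdl => /eqP; rewrite eqn_pmul2r.
have E1 : (X' * Y = n * u * v ^ 2)%N.
  by apply/eqP; rewrite -(eqn_pmul2r u0); apply/eqP; move: XY; rewrite XE ZE expnMn; nia.
have [Y' YE] : exists Y', Y = (Y' * v ^ 2)%N.
  apply/dvdnP; have : (v ^ 2 %| X' * Y)%N by rewrite E1 dvdn_mull.
  by rewrite Gauss_dvdr // coprimeXl // coprime_sym.
have uY' : coprime u Y' by move: uY; rewrite YE coprimeMr => /andP[].
have uv : coprime u v by move: uY; rewrite YE coprimeMr => /andP[_]; rewrite coprime_pexpr.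
have [v0|v0] := posnP v.
  have u1 : u = 1%N by move: uv; rewrite v0 /coprime gcdn0 => /eqP.
  have X1 : X' = 1%N by move: Xv; rewrite v0 /coprime gcdn0 => /eqP.
  have Y0 : Y = 0%N by move: E1; rewrite X1 v0 mul1n muln0.
  by exists 1%N, 1%N, 0%N; rewrite XE ZE X1 u1 v0 Y0 dvd1n divn1 /coprime !gcd1n gcdn1 exp0n // muln0.
have E2 : (X' * Y' = n * u)%N.
  have v20 : (0 < v ^ 2)%N by rewrite expn_gt0 v0.
  by apply/eqP; rewrite -(eqn_pmul2r v20) -mulnA -YE E1.
have [d dE] : exists d, X' = (d * u)%N.
  by apply/dvdnP; have : (u %| X' * Y')%N by [rewrite E2 dvdn_mull]; rewrite Gauss_dvdl.
have E3 : (d * Y' = n)%N.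
  by apply/eqP; rewrite -(eqn_pmul2r u0) -E2 dE mulnAC.
have d0 : (0 < d)%N by case: (d) E3 n0 => // <-.
have nd : (n %/ d = Y')%N by rewrite -E3 mulKn.
exists d, u, v; rewrite nd uv uY' YE ZE; split; split=> //.
- by rewrite -E3 dvdn_mulr.
- by rewrite XE dE expnS expn1 mulnA.
- exact: mulnC.
by move: Xv; rewrite dE coprimeMl coprime_sym => /andP[].
Qed.

(** The coprimality conditions recover [u] as [gcd(X, Z)] and [v] as [gcd(Y, Z)]. *)
Lemma square_factor_uniq (n d d' u v u' v' : nat) : (0 < n)%N -> (d %| n)%N -> (d' %| n)%N ->
  coprime u v -> coprime u (n %/ d) -> coprime v d ->
  coprime u' v' -> coprime u' (n %/ d') -> coprime v' d' ->
  (d * u ^ 2 = d' * u' ^ 2)%N -> (n %/ d * v ^ 2 = n %/ d' * v' ^ 2)%N -> (u * v = u' * v')%N ->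
  [/\ d = d', u = u' & v = v'].
Proof.
move=> n0 dn dn' h1 h2 h3 k1 k2 k3 e1 e2 e3.
have ug (a x y : nat) : coprime x y -> coprime y a -> gcdn (a * x ^ 2) (x * y) = x.
  move=> xy ya; rewrite expnS expn1 mulnA (mulnC x y) -muln_gcdl.
  by have /eqP -> : coprime (a * x) y; rewrite ?mul1n // coprimeMl xy coprime_sym ya.
have uE : u = u' by rewrite -(ug d u v) // e1 e3 ug.
have vE : v = v'.
  have := ug (n %/ d)%N v u; rewrite coprime_sym => /(_ h1 h2) <-.
  by rewrite e2 mulnC [(v * u)%N]mulnC e3 [(u' * v')%N]mulnC mulnC ug // coprime_sym.
split=> //; subst u' v'.
have [u0|u0] := posnP u; last first.
  by apply/eqP; rewrite -(eqn_pmul2r (_ : 0 < u ^ 2)%N) ?expn_gt0 ?u0 // e1.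
have v1 : v = 1%N by move: h1; rewrite u0 /coprime gcd0n => /eqP.
rewrite v1 in e2; have {}e2 : (n %/ d = n %/ d')%N by rewrite -(muln1 (n %/ d)%N) -[RHS]muln1.
have d0 := dvdn_gt0 n0 dn; have nd0 : (0 < n %/ d)%N by rewrite divn_gt0 // dvdn_leq.
by apply/eqP; rewrite -(eqn_pmul2l nd0) (divnK dn) e2 divnK.
Qed.

Definition cone_cond (d e : nat) (v : int * int) : bool :=
  [&& coprimez v.1 v.2, coprimez v.1 e%:Z & coprimez v.2 d%:Z].

(** Contains exactly one of any two opposite nonzero vectors. *)
Definition half_plane (v : int * int) : bool := (0 < v.1) || (v.1 == 0) && (0 < v.2).

(** The index consists of the divisor [d], a bit for the common sign of the zero, and the point
    [(u, v)]. *)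
Definition cone_vec (n : nat) (t : nat * bool * (int * int)) : int * int * int :=
  ((-1) ^+ t.1.2 * (t.1.1%:Z * t.2.1 ^+ 2), (-1) ^+ t.1.2 * ((n %/ t.1.1)%N%:Z * t.2.2 ^+ 2),
   (-1) ^+ t.1.2 * (t.2.1 * t.2.2)).

Definition cone_index (n : nat) (t : nat * bool * (int * int)) : bool :=
  (t.1.1 %| n)%N && cone_cond t.1.1 (n %/ t.1.1) t.2.

Lemma cone_condE d e v : cone_cond d e v =
  [&& coprime `|v.1| `|v.2|, coprime `|v.1| e & coprime `|v.2| d].
Proof. by rewrite /cone_cond /coprimez /gcdz !eqz_nat. Qed.

Lemma half_planeN (v : int * int) : v != 0 -> half_plane (- v.1, - v.2) = ~~ half_plane v.
Proof.
case: v => u v uv; have : (u != 0) || (v != 0).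
  by rewrite -negb_and; apply: contra uv => /andP[/eqP-> /eqP->].
by rewrite /half_plane /=; lia.
Qed.

Lemma cone_vec_abs n t (x := cone_vec n t) :
  [/\ `|x.1.1|%N = (t.1.1 * `|t.2.1| ^ 2)%N, `|x.1.2|%N = (n %/ t.1.1 * `|t.2.2| ^ 2)%N &
      `|x.2|%N = (`|t.2.1| * `|t.2.2|)%N].
Proof. by split; rewrite /x /cone_vec /= abszMsign abszM ?abszX. Qed.

Lemma absz_eq_or (x y : int) : `|x|%N = `|y|%N -> x = y \/ x = - y.
Proof. by lia. Qed.

Lemma half_plane_inj (u v u' v' : int) : `|u|%N = `|u'|%N -> `|v|%N = `|v'|%N ->
  u * v = u' * v' -> half_plane (u, v) = half_plane (u', v') -> u = u' /\ v = v'.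
Proof.
have zero (k l : int) : k * l = - (k * l) -> k = 0 \/ l = 0.
  move=> h; have /eqP : k * l = 0 by lia.
  by rewrite mulf_eq0 => /orP[]/eqP->; [left|right].
move=> /absz_eq_or[->|->] /absz_eq_or[->|->] //; rewrite ?mulrN ?mulNr ?opprK.
- by move=> /esym/zero[->|->]; rewrite /half_plane /=; lia.
- by move=> /esym/zero[->|->]; rewrite /half_plane /=; lia.
move=> _; have [[-> ->]|uv] := eqVneq (u', v') 0; first by rewrite oppr0.
by have := half_planeN uv => /= ->; case: half_plane.
Qed.

Lemma signed_absz (x y : int) : 0 <= x * y -> x = (-1) ^+ ((x < 0) || (y < 0)) * `|x|%N%:Z.
Proof.
have [x0|x0] := ltP x 0; first by move=> _; rewrite /= expr1; lia.
have [y0|y0] := ltP y 0 => /= h; last by rewrite expr0; lia.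
have -> : x = 0 by apply/eqP; rewrite eq_le x0 andbT; move: h; rewrite nmulr_lge0.
by rewrite mulr0.
Qed.

Lemma signed_factor (u v : nat) (z : int) : `|z|%N = (u * v)%N ->
  exists2 k : int, u%:Z * k = z & `|k|%N = v.
Proof.
move=> h; have [E|E] : z = (u * v)%N%:Z \/ z = - (u * v)%N%:Z by lia.
  by exists v%:Z => //; rewrite E PoszM.
by exists (- v%:Z); rewrite ?abszN // E PoszM mulrN.
Qed.

(* Every primitive zero comes from exactly two points [(u, v)], opposite to each other. *)
Lemma cone_vec_bij (n : nat) (b : bool) : (0 < n)%N ->
  set_bij [set t | cone_index n t && (half_plane t.2 == b)]
    [set x | primitive_vec x /\ qeval (nf_form 1 0 0 (- n%:Z)) x = 0] (cone_vec n).
Proof.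
move=> n0; split.
- move=> t ht; have /andP[/andP[dn cnd] _] : cone_index n t && _ := ht.
  suff: primitive_vec (cone_vec n t) /\ qeval (nf_form 1 0 0 (- n%:Z)) (cone_vec n t) = 0 by [].
  split.
    have [a1 a2 a3] := cone_vec_abs n t.
    apply/primitive_vecP => p pp; apply/negP; rewrite /pdvd3 !dvdzE a1 a2 a3 /= => /and3P[].
    move: cnd; rewrite cone_condE => /and3P[c1 c2 c3].
    have eX a : (p %| a ^ 2)%N = (p %| a)%N by rewrite Euclid_dvdX // andbT.
    rewrite (Euclid_dvdM t.1.1) // (Euclid_dvdM (n %/ _)) // (Euclid_dvdM `|t.2.1|) // !eX.
    have no a c : coprime a c -> (p %| a)%N -> (p %| c)%N -> False.
      by move=> ac pa pc; have := dvdn_gcd p a c; rewrite pa pc (eqP ac) dvdn1 => /eqP p1; rewrite p1 in pp.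
    by move=> /orP[pd|pu] /orP[pe|pv] /orP[pu'|pv'];
      solve [exact: (no _ _ c1) | exact: (no _ _ c2) | exact: (no _ _ c3)].
  case: t {ht cnd} dn => -[d s] [u v] dn; rewrite /cone_vec qeval_nf /=.
  have -> : n%:Z = (n %/ d)%N%:Z * d%:Z by rewrite -PoszM divnK.
  by case: s {dn} => /=; rewrite ?expr0 ?expr1; ring.
- move=> t t'; rewrite !inE => /andP[/andP[dn cn] /eqP hb] /andP[/andP[dn' cn'] /eqP hb'] E.
  have [a1 a2 a3] := cone_vec_abs n t; have [b1 b2 b3] := cone_vec_abs n t'.
  rewrite E in a1 a2 a3; rewrite b1 in a1; rewrite b2 in a2; rewrite b3 in a3.
  move: cn cn'; rewrite !cone_condE => /and3P[c1 c2 c3] /and3P[c1' c2' c3'].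
  have [e1 e2 e3] := square_factor_uniq n0 dn dn' c1 c2 c3 c1' c2' c3' (esym a1) (esym a2) (esym a3).
  have d0 : (0 < t.1.1)%N by exact: dvdn_gt0 dn.
  have nd0 : (0 < n %/ t.1.1)%N by rewrite divn_gt0 // dvdn_leq.
  case: t t' dn dn' c1 c2 c3 c1' c2' c3' hb hb' E e1 e2 e3 d0 nd0 {a1 a2 a3 b1 b2 b3} =>
    [[d s] [u v]] [[d' s'] [u' v']] /= dn _ c1 _ _ _ _ _ hb hb' [E1 E2 E3] e1 e2 e3 d0 nd0.
  subst d'.
  have uv : (u != 0) || (v != 0).
    by rewrite -negb_and; apply: contraTN c1 => /andP[/eqP-> /eqP->].
  have sq (x y : int) : `|x|%N = `|y|%N -> x ^+ 2 = y ^+ 2.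
    by move=> /absz_eq_or[->|->]; rewrite ?sqrrN.
  have nz (k : nat) : (0 < k)%N -> k%:Z != 0 by rewrite eqz_nat lt0n.
  have ss : s = s'.
    have inj (k : int) : k != 0 -> (-1) ^+ s * k = (-1) ^+ s' * k -> s = s'.
      by move=> k0 /(mulIf k0); case: (s) (s') => -[].
    case/orP: uv => h; [move: E1|move: E2].
      by rewrite -(sq _ _ e2); apply: inj; rewrite mulf_neq0 ?expf_neq0 ?nz.
    by rewrite -(sq _ _ e3); apply: inj; rewrite mulf_neq0 ?expf_neq0 ?nz.
  subst s'; have {}E3 : u * v = u' * v' by apply: (mulfI _ E3); rewrite signr_eq0.
  have hh : half_plane (u, v) = half_plane (u', v') by rewrite hb hb'.
  by have [-> ->] := half_plane_inj e2 e3 E3 hh.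
move=> [[x y] z] [px qx]; rewrite qeval_nf !mul1r !mul0r !addr0 in qx.
have xy : x * y = n%:Z * z ^+ 2 by apply/eqP; rewrite -subr_eq0; apply/eqP; rewrite -qx; ring.
have xyN : (`|x| * `|y| = n * `|z| ^ 2)%N.
  by have := congr1 absz xy; rewrite (abszM x) (abszM n) abszX.
have g1 : gcdn (gcdn `|x| `|y|) `|z| = 1%N by move: px => /= /eqP[].
have [d [u [v [[dn XE YE ZE] [c1 c2 c3]]]]] := square_factor n0 xyN g1.
(* A zero has [x y >= 0], so a negative coordinate reveals the common sign. *)
pose s := (x < 0) || (y < 0).
have xy0 : 0 <= x * y by rewrite xy mulr_ge0 // sqr_ge0.
have xs : x = (-1) ^+ s * `|x|%N%:Z by exact: signed_absz.
have ys : y = (-1) ^+ s * `|y|%N%:Z by rewrite /s orbC; apply: signed_absz; rewrite mulrC.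
have [k kz kv] : exists2 k : int, u%:Z * k = (-1) ^+ s * z & `|k|%N = v.
  by apply: signed_factor; rewrite abszMsign.
(* Of the two opposite points that give this zero, the one on the side [b]. *)
pose uv := if half_plane (u%:Z, k) == b then (u%:Z, k) else (- u%:Z, - k).
have k0 : ((u%:Z, k) : int * int) != 0.
  by apply/eqP => -[u0 k00]; move: c1; rewrite -kv k00 absz0 u0.
exists ((d, s), uv) => /=.
  rewrite /cone_index /= dn cone_condE /uv; case: ifP => /= [-> |h]; rewrite ?abszN ?absz_nat kv c1 c2 c3 //=.
  by have /= -> := half_planeN k0; move: h; case: (half_plane _); case: (b).
rewrite /cone_vec /=; have -> : uv.1 ^+ 2 = (u ^ 2)%N%:Z by rewrite /uv; case: ifP => _ /=; rewrite ?sqrrN expnS expn1 PoszM expr2.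
have -> : uv.2 ^+ 2 = (v ^ 2)%N%:Z.
  rewrite -kv -abszX gez0_abs; last by rewrite sqr_ge0.
  by rewrite /uv; case: ifP => _ /=; rewrite ?sqrrN.
have -> : uv.1 * uv.2 = u%:Z * k by rewrite /uv; case: ifP => _ //=; rewrite mulrNN.
by rewrite -!PoszM -XE -YE -xs -ys kz mulrA -signr_addb addbb mul1r.
Qed.

End ConeParametrization.

(** * The sieve *)

Section PrimeSieve.
Variable R : realType.

Definition zsum2 (G : int * int -> R) : R := \sum_(v \in [set v | predT v]) G v.

Definition box_supp (N : nat) (G : int * int -> R) :=
  forall v, G v != 0 -> (v.1 \in zbox N) && (v.2 \in zbox N).

Lemma zsum2_box N G : box_supp N G ->
  zsum2 G = \sum_(j <- zbox N) \sum_(i <- zbox N) G (i, j).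
Proof. by move=> GN; rewrite /zsum2 (fsbig_zbox2 predT GN). Qed.

Lemma zsum2_lin (I : Type) (s : seq I) (c : I -> R) (G : I -> int * int -> R) N :
  (forall i, box_supp N (G i)) ->
  zsum2 (fun v => \sum_(i <- s) c i * G i v) = \sum_(i <- s) c i * zsum2 (G i).
Proof.
move=> GN; rewrite (@zsum2_box N); last first.
  move=> v; apply: contraR => h; apply/eqP; apply: big1 => i _.
  have [->|/GN hv] := eqVneq (G i v) 0; first by rewrite mulr0.
  by rewrite hv in h.
under eq_bigr do rewrite exchange_big /=.
rewrite exchange_big /=; apply: eq_bigr => i _.
by rewrite (zsum2_box (GN i)) mulr_sumr; apply: eq_bigr => j _; rewrite mulr_sumr.
Qed.

Lemma zsum2_sublattice (a b : nat) G : (0 < a)%N -> (0 < b)%N ->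
  zsum2 (fun v => ((a%:Z %| v.1)%Z && (b%:Z %| v.2)%Z)%:R * G v) =
  zsum2 (fun v => G (a%:Z * v.1, b%:Z * v.2)).
Proof.
move=> a0 b0; have az : a%:Z != 0 by rewrite eqz_nat -lt0n.
have bz : b%:Z != 0 by rewrite eqz_nat -lt0n.
pose A := [set v : int * int | (a%:Z %| v.1)%Z && (b%:Z %| v.2)%Z].
transitivity (\sum_(v \in A) G v).
  transitivity (\sum_(v \in A) ((a%:Z %| v.1)%Z && (b%:Z %| v.2)%Z)%:R * G v).
    apply/esym/fsbig_widen => // v [_ vA]; apply/eqP; rewrite /= mulf_eq0.
    by apply/orP; left; move: vA; rewrite /A /=; case: (_ && _) => // /(_ isT).
  by apply: eq_fsbigr => v; rewrite inE => -> ; rewrite mul1r.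
apply: (@reindex_fsbig _ _ _ _ _ (fun v : int * int => (a%:Z * v.1, b%:Z * v.2))).
split; first by move=> v _; rewrite /A /= !dvdz_mulr.
  by move=> [u v] [u' v'] _ _ [/(mulfI az) -> /(mulfI bz) ->].
move=> [u v]; rewrite /A /= => /andP[/dvdzP[k ->] /dvdzP[l ->]]; exists (k, l) => //=.
by rewrite [k * _]mulrC [l * _]mulrC.
Qed.

(* [D] and [E] say whether the prime divides [d] and [n / d]; each option [(c, (i, j))] stands for
   [c] times the indicator of [p ^ i | u] and [p ^ j | v]. *)
Definition kind (D E : bool) : seq (R * (bool * bool)) :=
  if D && E then [:: (1, (false, false)); (-1, (true, false)); (-1, (false, true)); (1, (true, true))]
  else if E then [:: (1, (false, false)); (-1, (true, false))]
  else if D then [:: (1, (false, false)); (-1, (false, true))]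
  else [:: (1, (false, false)); (-1, (true, true))].

(** The part at [p] of the three coprimality conditions in [cone_cond]. *)
Definition loc (D E : bool) (p : nat) (v : int * int) : bool :=
  ~~ ((p%:Z %| v.1)%Z && ((p%:Z %| v.2)%Z || E)) && ~~ ((p%:Z %| v.2)%Z && D).

Lemma loc_expand D E p v : (loc D E p v)%:R =
  \sum_(o <- kind D E) o.1 * (((p ^ o.2.1)%N%:Z %| v.1)%Z && ((p ^ o.2.2)%N%:Z %| v.2)%Z)%:R.
Proof.
rewrite /loc /kind; case: D; case: E; rewrite !big_cons big_nil /= !expn0 !expn1 !dvd1z;
  by case: (_ %| v.1)%Z; case: (_ %| v.2)%Z => /=; lra.
Qed.

Variables (D E : nat -> bool).

(** The expanded product of the lists [kind]: an entry [(c, (a, b))] is the coefficient [c] of the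
    indicator of [a | u] and [b | v], in the manner of Moebius inversion. *)
Definition opts (ps : seq nat) : seq (R * (nat * nat)) :=
  foldr (fun p os => [seq (o.1 * o'.1, ((p ^ o.2.1 * o'.2.1)%N, (p ^ o.2.2 * o'.2.2)%N)) |
    o : R * (bool * bool) <- kind (D p) (E p), o' : R * (nat * nat) <- os]) [:: (1, (1%N, 1%N))] ps.

Lemma big_opts_cons p ps (f : R * (nat * nat) -> R) :
  \sum_(o <- opts (p :: ps)) f o = \sum_(o <- kind (D p) (E p)) \sum_(o' <- opts ps)
    f (o.1 * o'.1, ((p ^ o.2.1 * o'.2.1)%N, (p ^ o.2.2 * o'.2.2)%N)).
Proof. by rewrite /= big_allpairs_dep. Qed.

Lemma opts_gt0 ps o : all prime ps -> o \in opts ps -> (0 < o.2.1)%N /\ (0 < o.2.2)%N.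
Proof.
elim: ps o => [|p ps IH] o /=; first by rewrite inE => _ /eqP ->.
move=> /andP[pp pps] /allpairsP[oo [_ /(IH _ pps)[h1 h2] ->]] /=.
by rewrite !muln_gt0 !expn_gt0 prime_gt0.
Qed.

Definition sieved (ps : seq nat) (v : int * int) : bool := all (fun p => loc (D p) (E p) p v) ps.

Lemma dvdz_prime_mul (p q : nat) (i : bool) (x : int) : prime p -> prime q -> p != q ->
  (q%:Z %| (p ^ i)%N%:Z * x)%Z = (q%:Z %| x)%Z.
Proof.
move=> pp pq pnq; rewrite !dvdzE /= abszM Euclid_dvdM // absz_nat; case: i => /=.
  by rewrite expn1 dvdn_prime2 // eq_sym (negPf pnq).
by rewrite expn0 dvdn1 gtn_eqF ?prime_gt1.
Qed.

(** Induction on the primes: the indicator at [p] expands over sublattices, and rescaling by a power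
    of [p] does not affect the conditions at the other primes. *)
Lemma sieve_sum ps N G : uniq ps -> all prime ps -> box_supp N G ->
  zsum2 (fun v => (sieved ps v)%:R * G v) =
  \sum_(o <- opts ps) o.1 * zsum2 (fun v => G (o.2.1%:Z * v.1, o.2.2%:Z * v.2)).
Proof.
elim: ps G => [|p ps IH] G.
  move=> _ _ GN; rewrite big_cons big_nil addr0 mul1r /=.
  by apply: eq_fsbigr => -[u v] _ /=; rewrite !mul1r.
rewrite [uniq _]/= [all _ _]/= => /andP[pps ups] /andP[pp aps] GN.
have GNo (o : bool * bool) (H : int * int -> R) : box_supp N (fun v => H v * G v).
  by move=> v; rewrite mulf_eq0 negb_or => /andP[_ /GN].
transitivity (zsum2 (fun v => \sum_(o <- kind (D p) (E p)) o.1 *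
   ((((p ^ o.2.1)%N%:Z %| v.1)%Z && ((p ^ o.2.2)%N%:Z %| v.2)%Z)%:R * ((sieved ps v)%:R * G v)))).
  apply: eq_fsbigr => v _; rewrite [sieved _ _]/= -mulnb natrM -mulrA loc_expand mulr_suml.
  by apply: eq_bigr => o _; rewrite -!mulrA.
rewrite (@zsum2_lin _ _ _ _ N); last first.
  by move=> o v; rewrite !mulf_eq0 !negb_or => /and3P[_ _ /GN].
rewrite big_opts_cons; apply: eq_bigr => o _.
have p0 (i : bool) : (0 < p ^ i)%N by rewrite expn_gt0 prime_gt0.
rewrite zsum2_sublattice //.
transitivity (o.1 * zsum2 (fun v => (sieved ps v)%:R * G ((p ^ o.2.1)%N%:Z * v.1, (p ^ o.2.2)%N%:Z * v.2))).
  congr (_ * _); apply: eq_fsbigr => v _; congr (_%:R * _); congr nat_of_bool.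
  apply: eq_in_all => q qps; have pq : p != q by apply: contraNneq pps => ->.
  by rewrite /loc /= !dvdz_prime_mul // (allP aps).
rewrite (IH (fun v => G ((p ^ o.2.1)%N%:Z * v.1, (p ^ o.2.2)%N%:Z * v.2))) //; last first.
  move=> [u v] /GN /=; rewrite !mem_zbox.
  by have := p0 o.2.1; have := p0 o.2.2; move: (p ^ o.2.1)%N (p ^ o.2.2)%N => x y; nia.
rewrite mulr_sumr; apply: eq_bigr => o' _; rewrite mulrA; congr (_ * _).
by apply: eq_fsbigr => v _; rewrite /= !PoszM !mulrA.
Qed.

Lemma opts_mult ps (g : nat -> nat -> R) : (forall a b c d, g (a * c)%N (b * d)%N = g a b * g c d) ->
  g 1%N 1%N = 1 ->
  \sum_(o <- opts ps) o.1 * g o.2.1 o.2.2 =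
  \prod_(p <- ps) \sum_(o <- kind (D p) (E p)) o.1 * g (p ^ o.2.1)%N (p ^ o.2.2)%N.
Proof.
move=> gM g1; elim: ps => [|p ps IH]; first by rewrite big_cons !big_nil addr0 mul1r.
rewrite big_opts_cons [in RHS]big_cons -IH mulr_suml; apply: eq_bigr => o _.
by rewrite mulr_sumr; apply: eq_bigr => o' _; rewrite /= gM; ring.
Qed.

(** Each prime in [ps1], in the application a prime factor of [n], costs one bounded factor; the sum
    over the remaining primes stays to be evaluated. *)
Lemma opts_error ps1 ps2 (e : nat -> nat -> R) : all prime ps1 -> all prime ps2 ->
  (forall (p : nat) (i j : bool) a b, prime p -> (0 < a)%N -> (0 < b)%N ->
    e (p ^ i * a)%N (p ^ j * b)%N <= (p ^ (i && j))%N%:R^-1 * e a b) ->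
  \sum_(o <- opts (ps1 ++ ps2)) `|o.1| * e o.2.1 o.2.2 <=
  (\prod_(p <- ps1) \sum_(o <- kind (D p) (E p)) `|o.1| * (p ^ (o.2.1 && o.2.2))%N%:R^-1) *
  \sum_(o <- opts ps2) `|o.1| * e o.2.1 o.2.2.
Proof.
move=> + aps2 eM; elim: ps1 => [_|p ps IH]; first by rewrite big_nil mul1r.
rewrite [all _ _]/= => /andP[pp aps]; rewrite cat_cons big_opts_cons big_cons -mulrA mulr_suml; apply: ler_sum => o _.
have h := IH aps; have n0 : 0 <= `|o.1| * (p ^ (o.2.1 && o.2.2))%N%:R^-1 :> R.
  by rewrite mulr_ge0 // invr_ge0.
apply: le_trans (ler_wpM2l n0 h); rewrite mulr_sumr big_seq [leRHS]big_seq.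
apply: ler_sum => o' /opts_gt0; rewrite all_cat aps aps2 => /(_ isT)[a0 b0] /=.
by rewrite normrM mulrACA; apply: ler_wpM2l; rewrite ?mulr_ge0 // eM.
Qed.

End PrimeSieve.

(** * Summation of the sieve errors *)

Section SieveCost.
Variable R : realType.

(** At primes where [D] and [E] are false only the options [(1, 1)] and [(p, p)] occur, so the sum
    runs over distinct integers [l] through the sublattices of type [(l, l)]. *)
Lemma opts_coprime (D E : nat -> bool) (ps : seq nat) : uniq ps -> all prime ps ->
  {in ps, forall p, D p = false /\ E p = false} ->
  exists s : seq nat, [/\ uniq s, forall l, l \in s -> (0 < l)%N,
    forall l, l \in s -> forall p, prime p -> (p %| l)%N -> p \in ps &
    forall e : nat -> nat -> R, \sum_(o <- opts R D E ps) `|o.1| * e o.2.1 o.2.2 = \sum_(l <- s) e l l].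
Proof.
elim: ps => [|p ps IH] /=.
  move=> _ _ _; exists [:: 1%N]; split=> // [l|l|e]; rewrite ?inE ?big_cons ?big_nil /=.
  - by move=> /eqP->.
  - by move=> /eqP-> q pq; rewrite dvdn1 => /eqP q1; rewrite q1 in pq.
  by rewrite normr1 mul1r !addr0.
move=> /andP[pps ups] /andP[pp aps] DE.
have [|s [us s0 sp se]] := IH ups aps; first by move=> q qps; apply: DE; rewrite inE qps orbT.
have p0 := prime_gt0 pp.
exists (s ++ [seq (p * l)%N | l <- s]); split.
- rewrite cat_uniq us map_inj_uniq ?us ?andbT; last by move=> x y /eqP; rewrite eqn_pmul2l // => /eqP.
  by apply/hasPn => _ /mapP[l ls ->]; apply: contra pps => /sp; apply; rewrite // dvdn_mulr.
- by move=> l; rewrite mem_cat => /orP[/s0 //|/mapP[k /s0 k0 ->]]; rewrite muln_gt0 p0.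
- move=> l; rewrite mem_cat => /orP[/sp h|/mapP[k /sp h ->]] q pq.
    by move=> /(h q pq) qs; rewrite inE qs orbT.
  rewrite Euclid_dvdM // dvdn_prime2 // inE => /orP[->//|/(h q pq) ->].
  by rewrite orbT.
move=> e; rewrite -/(opts R D E (p :: ps)) big_opts_cons.
have [-> ->] : D p = false /\ E p = false by apply: DE; rewrite inE eqxx.
rewrite !big_cons big_nil addr0 big_cat big_map /= -se -(se (fun a b => e (p * a)%N (p * b)%N)).
congr (_ + _); apply: eq_bigr => o _; rewrite normrM ?normrN1 ?normr1 mul1r ?expn0 ?expn1 ?mul1n //.
Qed.

Lemma sum_uniq_le (s : seq nat) (f : nat -> R) (M : nat) : uniq s ->
  (forall l, l \in s -> (0 < l < M)%N) -> (forall l, 0 <= f l) ->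
  \sum_(l <- s) f l <= \sum_(1 <= l < M) f l.
Proof.
move=> us sM f0; have -> : \sum_(l <- s) f l = \sum_(1 <= l < M | l \in s) f l.
  rewrite -[RHS]big_filter; apply: perm_big; apply: uniq_perm => //.
    by rewrite filter_uniq // iota_uniq.
  by move=> l; rewrite mem_filter mem_index_iota; case: (boolP (l \in s)) => // /sM ->.
by rewrite big_mkcond; apply: ler_sum => l _; case: ifP.
Qed.

Variables (B E1 J : R).
Hypotheses (B2 : 2 <= B) (E10 : 0 <= E1) (J0 : 0 <= J) (JE : J <= E1 * Num.sqrt B).

(* Once [x ^ 2 > B] the sublattice contains no zero of norm at most [B], and the error is the main term. *)
Definition sieve_cost (x : R) : R := if x ^+ 2 <= B then E1 / x else J / x ^+ 2.

Let sB0 : 0 < Num.sqrt B. Proof. by rewrite sqrtr_gt0 (lt_le_trans _ B2). Qed.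

Let leB x : 0 <= x -> (x ^+ 2 <= B) = (x <= Num.sqrt B).
Proof.
move=> x0; rewrite -[in LHS](@sqr_sqrtr _ B) ?(le_trans _ B2) //.
by rewrite ler_pXn2r ?nnegrE ?sqrtr_ge0.
Qed.

Lemma sieve_cost_ge0 x : 0 <= x -> 0 <= sieve_cost x.
Proof. by move=> x0; rewrite /sieve_cost; case: ifP => _; rewrite divr_ge0 ?sqr_ge0. Qed.

(** The cost decays at least like [1 / x], also across the threshold, where [J <= E1 sqrt B] makes
    the second expression no larger than the first. *)
Lemma sieve_cost_mul (m g k : R) : 1 <= m -> 1 <= g -> m * g <= k ->
  sieve_cost k <= m^-1 * sieve_cost g.
Proof.
move=> m1 g1 mgk; have m0 : 0 < m by lra.
have g0 : 0 < g by lra.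
have mg0 : 0 < m * g by rewrite mulr_gt0.
have k0 : 0 < k by apply: lt_le_trans mgk.
have gk : g <= k by apply: le_trans mgk; rewrite ler_peMl // ltW.
rewrite /sieve_cost !leB ?(ltW k0) ?(ltW g0) //.
case: (leP g) => gB; case: (leP k) => kB.
- rewrite mulrCA -invfM; apply: ler_wpM2l => //.
  by rewrite lef_pV2 ?posrE.
- rewrite mulrCA -invfM ler_pdivrMr ?exprn_gt0 // -mulrA.
  apply: (le_trans JE); apply: ler_wpM2l => //.
  rewrite mulrC ler_pdivlMr //; rewrite expr2; apply: ler_pM => //; exact: ltW.
- by have := lt_le_trans gB (le_trans gk kB); rewrite ltxx.
rewrite mulrCA -invfM; apply: ler_wpM2l => //; rewrite lef_pV2 ?posrE ?exprn_gt0 ?mulr_gt0 ?exprn_gt0 //.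
apply: (@le_trans _ _ ((m * g) ^+ 2)).
  by rewrite exprMn ler_wpM2r ?sqr_ge0 // expr2 ler_peMl // ltW.
by rewrite ler_pXn2r ?nnegrE // ltW.
Qed.

Lemma sieve_cost_prime (p : nat) (i j : bool) (a b : nat) : prime p -> (0 < a)%N -> (0 < b)%N ->
  sieve_cost (gcdn (p ^ i * a) (p ^ j * b))%:R <= (p ^ (i && j))%N%:R^-1 * sieve_cost (gcdn a b)%:R.
Proof.
move=> pp a0 b0; have p0 := prime_gt0 pp; apply: sieve_cost_mul.
- by rewrite ler1n expn_gt0 p0.
- by rewrite ler1n gcdn_gt0 a0.
rewrite -natrM ler_nat dvdn_leq ?gcdn_gt0 ?muln_gt0 ?expn_gt0 ?p0 ?a0 //.
rewrite dvdn_gcd !dvdn_mul ?dvdn_gcdl ?dvdn_gcdr //; case: i; case: j => //=; exact: dvd1n.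
Qed.

Let lnB : 2^-1 <= ln B.
Proof.
have h : expR 2^-1 <= 2 :> R.
  have := expR_ge1Dx (- 2^-1 : R); rewrite expRN (_ : 1 + - 2^-1 = 2^-1); last by lra.
  by rewrite lef_pV2 ?posrE ?expR_gt0.
rewrite -(expRK 2^-1) ler_ln ?posrE ?expR_gt0 //; last exact: lt_le_trans B2.
exact: le_trans h B2.
Qed.

Let lnS (k : nat) : (0 < k)%N -> (k.+1%:R)^-1 <= ln k.+1%:R - ln k%:R :> R.
Proof.
move=> k0; have kp : 0 < k%:R :> R by rewrite ltr0n.
have := @le_ln1Dx R (- (k.+1%:R)^-1); rewrite (_ : 1 + - (k.+1%:R)^-1 = k%:R / k.+1%:R); last first.
  by rewrite -natr1; field; rewrite natr1 pnatr_eq0.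
rewrite ln_div ?posrE // => h; rewrite -[leRHS]opprB lerNr.
by apply: h; rewrite ltrN2 invf_lt1 // ltr1n.
Qed.

(** A harmonic sum up to [sqrt B] and a convergent tail; the constant 7 absorbs the additive terms
    by means of [ln B >= 1/2]. *)
Lemma sum_sieve_cost M : \sum_(1 <= l < M) sieve_cost l%:R <= 7 * E1 * ln B.
Proof.
pose s := Num.sqrt B.
(* Majorants fit for induction: logarithmic up to [s], then telescoping through
   [s / l^2 <= s / (l - 1) - s / l]. *)
have main k : \sum_(1 <= l < k.+2) sieve_cost l%:R <=
    E1 * (if (k.+1)%:R <= s then 1 + ln k.+1%:R else 3 + ln s - s / k.+1%:R).
  elim: k => [|k IH].
    rewrite big_nat1 /sieve_cost leB // -/s; case: ifP => h; first by rewrite ln1 addr0 divr1 mulr1.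
    have := lt_le_trans (lt_trans (_ : 1 < 2) (lt_le_trans _ B2)) (lexx B) => _.
    by move: h; rewrite -leB // expr1n (le_trans _ B2) // ler1n.
  rewrite big_nat_recr //=; apply: (le_trans (lerD IH (lexx _))).
  rewrite /sieve_cost leB // -/s; have k1 : 0 < k.+1%:R :> R by rewrite ltr0n.
  have k2 : 0 < k.+2%:R :> R by rewrite ltr0n.
  have kk : k.+1%:R <= k.+2%:R :> R by rewrite ler_nat.
  have [h2|h2] := leP k.+2%:R s.
    rewrite (le_trans kk h2) -mulrDr ler_wpM2l // -addrA lerD2l.
    by rewrite -lerBrDl; exact: lnS.
  have JE' : J / k.+2%:R ^+ 2 <= E1 * (s / k.+2%:R ^+ 2).
    by rewrite mulrA ler_wpM2r ?invr_ge0 ?sqr_ge0.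
  apply: (le_trans (lerD (lexx _) JE')); rewrite -mulrDr ler_wpM2l //.
  have s2 : s / k.+2%:R ^+ 2 <= s / k.+1%:R - s / k.+2%:R.
    rewrite -mulrBr ler_wpM2l ?(ltW sB0) // (_ : _^-1 - _^-1 = (k.+1%:R * k.+2%:R)^-1); last first.
      by rewrite -(natr1 k.+1); field; rewrite ?natr1 !gt_eqF.
    by rewrite lef_pV2 ?posrE ?mulr_gt0 ?exprn_gt0 // expr2 ler_wpM2r // ltW.
  have [h1|h1] := leP k.+1%:R s; last first.
    by move: s2; move: (s / k.+2%:R ^+ 2) (s / k.+1%:R) (s / k.+2%:R) (ln s) => x y z t; lra.
  have e1 : ln k.+1%:R <= ln s by rewrite ler_ln ?posrE.
  have e2 : s / k.+2%:R <= 1 by rewrite ler_pdivrMr // mul1r ltW.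
  have e3 : s / k.+2%:R ^+ 2 <= 1.
    rewrite expr2 invfM mulrA; apply: (@le_trans _ _ (1 * 1)); last by rewrite mulr1.
    by apply: ler_pM; rewrite ?divr_ge0 ?invr_ge0 ?(ltW sB0) // invf_le1 // ler1n.
  move: e1 e2 e3; move: (s / k.+2%:R ^+ 2) (s / k.+2%:R) (ln s) (ln k.+1%:R) => x y z t.
  by lra.
have ls : ln s = ln B / 2.
  have -> : ln B = ln s + ln s by rewrite -lnM ?posrE // -expr2 sqr_sqrtr // (le_trans _ B2).
  by lra.
case: M => [|[|k]]; try by rewrite big_geq // !mulr_ge0 // (le_trans _ lnB) // invr_ge0.
apply: (le_trans (main k)); rewrite -mulrA mulrCA ler_wpM2l //.
have k1 : 0 < k.+1%:R :> R by rewrite ltr0n.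
case: ifP => h; last first.
  have : 0 <= s / k.+1%:R by rewrite divr_ge0 // ltW.
  by move: lnB; rewrite ls; move: (s / _) => x; lra.
have : ln k.+1%:R <= ln s by rewrite ler_ln ?posrE.
by move: lnB; rewrite ls; move: (ln k.+1%:R) => x; lra.
Qed.

End SieveCost.

(** * Multiplicative sums over divisors *)

Section DivisorSums.
Variable R : realType.

Lemma perm_divisors_prime_power (p k m : nat) : prime p -> (0 < m)%N -> ~~ (p %| m)%N ->
  perm_eq (divisors (p ^ k * m)) [seq (p ^ j * d)%N | j <- iota 0 k.+1, d <- divisors m].
Proof.
move=> pp m0 pm; have p0 := prime_gt0 pp; have pk0 : (0 < p ^ k * m)%N by rewrite muln_gt0 expn_gt0 p0.
have lg j d : (d %| m)%N -> logn p (p ^ j * d) = j.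
  move=> dm; have d0 := dvdn_gt0 m0 dm; rewrite lognM ?expn_gt0 ?p0 // pfactorK //.
  by rewrite lognE pp d0 /= (negPf (contra (fun h => dvdn_trans h dm) pm)) addn0.
apply: uniq_perm; first exact: divisors_uniq.
  apply: allpairs_uniq; rewrite ?iota_uniq ?divisors_uniq // => -[j d] [j' d'].
  move=> /allpairsP[u [_ u2 [-> ->]]] /allpairsP[v [_ v2 [-> ->]]] /= e.
  have jj : u.1 = v.1 by rewrite -(lg u.1 u.2) ?dvdn_divisors // e lg // dvdn_divisors.
  by move/eqP: e; rewrite jj eqn_pmul2l ?expn_gt0 ?p0 // => /eqP ->.
move=> x; rewrite -dvdn_divisors //; apply/idP/allpairsP => [xd|[u [jk dm ->]]].
  have x0 := dvdn_gt0 pk0 xd; exists (logn p x, x`_p^')%N; split.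
  - by rewrite mem_iota /= ltnS (leq_trans (dvdn_leq_log p pk0 xd)) // lognM ?expn_gt0 ?p0 // pfactorK // lognE (negPf pm) !andbF addn0.
  - rewrite -dvdn_divisors // -(Gauss_dvdr _ (_ : coprime _ (p ^ k))).
      exact: dvdn_trans (dvdn_part _ _) xd.
    by rewrite coprime_sym coprimeXl // prime_coprime // -p'natE // part_pnat.
  by rewrite -p_part partnC.
apply: dvdn_mul; last by rewrite -dvdn_divisors in dm.
by apply: dvdn_exp2l; move: jk; rewrite mem_iota add0n ltnS.
Qed.

(** Split off one prime [p] with its full power [p^k]. The exponent of [p] in [d] is 0, or [k], or
    one of [k - 1] intermediate values, and the last are exactly those for which [p] divides both
    [d] and [n / d]. *)
Lemma sum_divisors_prod (n : nat) (g : nat -> bool -> bool -> R) : (0 < n)%N ->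
  \sum_(d <- divisors n) \prod_(p <- primes n) g p (p %| d)%N (p %| n %/ d)%N =
  \prod_(p <- primes n)
    (g p false true + (logn p n).-1%:R * g p true true + g p true false).
Proof.
have [N] := ubnP n; elim: N n => // N IH n nN n0.
have [n1|n1] := leqP n 1.
  by have -> : n = 1%N by [apply/eqP; rewrite eqn_leq n1]; rewrite big_seq1 !big_nil.
pose p := pdiv n; have pp : prime p by rewrite pdiv_prime.
set k := logn p n; set m := (n`_p^')%N.
have nE : n = (p ^ k * m)%N by rewrite -(partnC p n0) p_part.
have m0 : (0 < m)%N by rewrite part_gt0.
have p0 := prime_gt0 pp.
have pm : ~~ (p %| m)%N.
  by rewrite -p'natE // part_pnat.
have k0 : (0 < k)%N by rewrite logn_gt0 mem_primes pp n0 pdiv_dvd.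
have pr : perm_eq (primes n) (p :: primes m).
  apply: uniq_perm; rewrite /= ?primes_uniq ?andbT //; first by rewrite mem_primes (negPf pm) !andbF.
  by move=> q; rewrite nE primesM ?expn_gt0 ?p0 // primesX // primes_prime // !inE.
have mn : (m < N)%N.
  apply: (@leq_trans n); last by rewrite -ltnS.
  rewrite [X in (_ < X)%N]nE ltn_Pmull // -[1%N](exp1n k) ltn_exp2r ?prime_gt1 //.
rewrite [RHS](perm_big _ pr) big_cons.
transitivity (\sum_(d <- divisors n) g p (p %| d)%N (p %| n %/ d)%N *
   \prod_(q <- primes m) g q (q %| d)%N (q %| n %/ d)%N).
  by apply: eq_bigr => d _; rewrite (perm_big _ pr) big_cons.
rewrite [in LHS]nE (perm_big _ (perm_divisors_prime_power k pp m0 pm)) big_allpairs_dep.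
transitivity (\sum_(j <- iota 0 k.+1) g p (0 < j)%N (j < k)%N *
   \sum_(d <- divisors m) \prod_(q <- primes m) g q (q %| d)%N (q %| m %/ d)%N).
  rewrite big_seq [RHS]big_seq; apply: eq_bigr => j; rewrite mem_iota add0n ltnS => jk.
  rewrite mulr_sumr big_seq [RHS]big_seq; apply: eq_bigr => d; rewrite -dvdn_divisors // => dm.
  have d0 := dvdn_gt0 m0 dm; have md0 : (0 < m %/ d)%N by rewrite divn_gt0 // dvdn_leq.
  have pd : ~~ (p %| d)%N by apply: contra pm => h; exact: dvdn_trans dm.
  have pmd : ~~ (p %| m %/ d)%N by apply: contra pm => h; rewrite -(divnK dm) dvdn_mulr.
  have qE : (p ^ k * m %/ (p ^ j * d) = p ^ (k - j) * (m %/ d))%N.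
    by rewrite -{1}(subnKC jk) expnD -!mulnA divnMl ?expn_gt0 ?p0 // muln_divA.
  rewrite /= qE; congr (_ * _).
    by rewrite !Euclid_dvdM // (negPf pd) (negPf pmd) !orbF !Euclid_dvdX // dvdnn subn_gt0.
  rewrite big_seq [RHS]big_seq; apply: eq_bigr => q; rewrite mem_primes => /and3P[pq _ qm].
  have qp : (q == p) = false by apply: contraNF pm => /eqP <-.
  by rewrite !Euclid_dvdM // !Euclid_dvdX // dvdn_prime2 // qp.
rewrite -mulr_suml IH //; congr (_ * _); last first.
  rewrite [LHS]big_seq [RHS]big_seq; apply: eq_bigr => q; rewrite mem_primes => /and3P[pq _ qm].
  have qp : (q == p) = false by apply: contraNF pm => /eqP <-.
  by rewrite nE lognM ?expn_gt0 ?p0 // lognX (logn_prime q pp) qp muln0.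
rewrite -/k; case: (k) k0 => // j _; have -> : iota 0 j.+2 = 0%N :: iota 1 j ++ [:: j.+1].
  by rewrite -(addn1 j.+1) iotaD.
rewrite big_cons big_cat big_seq1 /= ltnn -addrA; congr (_ + (_ + _)).
transitivity (\sum_(i <- iota 1 j) g p true true).
  by rewrite big_seq [RHS]big_seq; apply: eq_bigr => i; rewrite mem_iota add1n => /andP[-> ->].
by rewrite big_const_seq count_predT size_iota iter_addr_0 mulr_natl.
by rewrite ltnn.
Qed.

End DivisorSums.

(** * The sieve estimate for one divisor *)

Section SieveEstimate.
Variable R : realType.

Lemma kind_dens (D E : bool) (p : nat) : (0 < p)%N ->
  \sum_(o <- kind R D E) o.1 * ((p ^ o.2.1 * p ^ o.2.2)%N%:R)^-1 =
  if D && E then (1 - p%:R^-1) ^+ 2 else if D || E then 1 - p%:R^-1 else 1 - p%:R^-1 ^+ 2 :> R.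
Proof.
move=> p0; have pn : p%:R != 0 :> R by rewrite pnatr_eq0 -lt0n.
by rewrite /kind; case: D; case: E; rewrite /= !big_cons big_nil /= ?expn0 ?expn1 ?mul1n ?muln1 ?natrM; field.
Qed.

Definition kind_weight (D E : bool) (p : nat) : R :=
  \sum_(o <- kind R D E) `|o.1| * (p ^ (o.2.1 && o.2.2))%N%:R^-1.

Lemma kind_weightE p : [/\ kind_weight false true p = 2, kind_weight true false p = 2 &
  kind_weight true true p = 3 + p%:R^-1].
Proof.
by split; rewrite /kind_weight /kind /= !big_cons big_nil /= ?normrN ?normr1 ?expn0 ?expn1 ?invr1; lra.
Qed.

Lemma kind_weight_ge0 D E p : 0 <= kind_weight D E p.
Proof. by apply: sumr_ge0 => o _; rewrite mulr_ge0 // invr_ge0. Qed.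

Lemma kind_sum0 (D E : bool) : \sum_(o <- kind R D E) o.1 = 0.
Proof. by rewrite /kind; case: D; case: E; rewrite /= !big_cons big_nil /=; lra. Qed.

Variables (n N : nat).
Hypotheses (n0 : (0 < n)%N) (nN : (n < N)%N) (N2 : (2 < N)%N).

Definition free_primes : seq nat := [seq p <- iota 0 N | prime p && ~~ (p %| n)%N].

Lemma free_primes_prime : all prime free_primes.
Proof. by apply/allP => p; rewrite mem_filter => /andP[/andP[]]. Qed.

Lemma primes_prime_all : all prime (primes n).
Proof. by apply/allP => p; rewrite mem_primes => /andP[]. Qed.

Lemma sieve_primes_uniq : uniq (primes n ++ free_primes).
Proof.
rewrite cat_uniq primes_uniq filter_uniq ?iota_uniq // andbT.
by apply/hasPn => p; rewrite mem_filter mem_primes => /andP[/andP[_ h] _]; rewrite (negPf h) !andbF.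
Qed.

Lemma mem_sieve_primes p : prime p -> (p < N)%N || (p %| n)%N -> p \in primes n ++ free_primes.
Proof.
move=> pp; rewrite mem_cat mem_primes mem_filter mem_iota pp n0 /=.
by case: (p %| n)%N => //=; rewrite orbF.
Qed.

Lemma dens_prod_split : dens_prod R n N =
  (\prod_(p <- primes n) local_dens R n p) * \prod_(p <- free_primes) (1 - p%:R^-1 ^+ 2).
Proof.
transitivity (\prod_(p <- primes n ++ free_primes) local_dens R n p).
  rewrite /dens_prod -big_filter; apply: perm_big; apply: uniq_perm.
  - by rewrite filter_uniq // iota_uniq.
  - exact: sieve_primes_uniq.
  move=> p; rewrite mem_filter mem_index_iota /= mem_cat mem_primes mem_filter mem_iota n0 /=.
  case: (boolP (prime p)) => //= pp; case: (boolP (p %| n)%N) => //= pn.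
  by rewrite (leq_ltn_trans (dvdn_leq n0 pn) nN).
rewrite big_cat; congr (_ * _); rewrite /= big_seq [RHS]big_seq; apply: eq_bigr => p.
by rewrite mem_filter => /andP[/andP[_ pn] _]; rewrite /local_dens (negPf pn).
Qed.

Section OneDivisor.
Variable d : nat.
Hypothesis dn : (d %| n)%N.
Let Db (p : nat) := (p %| d)%N.
Let Eb (p : nat) := (p %| n %/ d)%N.

Let d0 : (0 < d)%N. Proof. exact: dvdn_gt0 dn. Qed.
Let nd0 : (0 < n %/ d)%N. Proof. by rewrite divn_gt0 // dvdn_leq. Qed.

(** Inside the box a common prime factor is below [N] unless the point is the origin, and the origin
    is already removed by the prime 2. *)
Lemma sieved_cond v : (`|v.1| < N)%N -> (`|v.2| < N)%N ->
  sieved Db Eb (primes n ++ free_primes) v = cone_cond d (n %/ d) v.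
Proof.
move=> v1 v2; rewrite cone_condE; apply/idP/idP => [/allP sv|/and3P[c1 c2 c3]]; last first.
  have no p a c : prime p -> coprime a c -> (p %| a)%N -> (p %| c)%N -> False.
    by move=> pp ac pa pc; have := dvdn_gcd p a c; rewrite pa pc (eqP ac) dvdn1 => /eqP p1; rewrite p1 in pp.
  apply/allP => p; rewrite mem_cat => ps.
  have pp : prime p by case/orP: ps => [/(allP primes_prime_all)|/(allP free_primes_prime)].
  rewrite /loc !dvdzE /= /Db /Eb; apply/andP; split; apply/negP => /andP[h1].
    by case/orP => [h2|h2]; [exact: no c1 h1 h2|exact: no c2 h1 h2].
  by move=> h2; exact: no c3 h1 h2.
have bad (a c : nat) : (0 < gcdn a c)%N -> (forall p, prime p -> (p %| a)%N -> (p %| c)%N -> False) -> coprime a c.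
  move=> g0 h; rewrite /coprime eqn_leq g0 andbT leqNgt; apply/negP => g1.
  have pd := pdiv_dvd (gcdn a c); rewrite dvdn_gcd in pd; case/andP: pd => pa pc.
  exact: h (pdiv_prime g1) pa pc.
have svp p : prime p -> (p < N)%N || (p %| n)%N -> loc (Db p) (Eb p) p v.
  by move=> pp h; apply: sv; exact: mem_sieve_primes.
apply/and3P; split.
- apply: bad => [|p pp p1 p2].
    rewrite gcdn_gt0 !lt0n -negb_and; apply/negP => /andP[/eqP z1 /eqP z2].
    have := svp 2 isT; rewrite N2 => /(_ isT).
    by rewrite /loc !dvdzE z1 z2 !dvdn0.
  have pN : (p < N)%N.
    have [z1|z1] := posnP `|v.1|%N; last exact: leq_ltn_trans (dvdn_leq z1 p1) v1.
    have [z2|z2] := posnP `|v.2|%N; last exact: leq_ltn_trans (dvdn_leq z2 p2) v2.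
    have := svp 2 isT; rewrite N2 => /(_ isT).
    by rewrite /loc !dvdzE z1 z2 !dvdn0.
  by have := svp p pp; rewrite pN => /(_ isT); rewrite /loc !dvdzE /= p1 p2.
- apply: bad => [|p pp p1 p2]; first by rewrite gcdn_gt0 nd0 orbT.
  have pn : (p %| n)%N by rewrite -(divnK dn) dvdn_mulr.
  by have := svp p pp; rewrite pn orbT => /(_ isT); rewrite /loc !dvdzE /= p1 /Eb p2 orbT.
apply: bad => [|p pp p1 p2]; first by rewrite gcdn_gt0 d0 orbT.
have pn : (p %| n)%N by apply: dvdn_trans dn.
by have := svp p pp; rewrite pn orbT => /(_ isT); rewrite /loc !dvdzE /= p1 /Db p2 andbF.
Qed.

Definition div_dens : R := \prod_(p <- primes n)
  \sum_(o <- kind R (Db p) (Eb p)) o.1 * ((p ^ o.2.1 * p ^ o.2.2)%N%:R)^-1.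
Definition div_weight : R := \prod_(p <- primes n) kind_weight (Db p) (Eb p) p.

Variables (G : int * int -> R) (B E1 J : R).
Hypotheses (B2 : 2 <= B) (E10 : 0 <= E1) (J0 : 0 <= J) (JE : J <= E1 * Num.sqrt B).
Hypothesis GN : forall v, G v != 0 -> (`|v.1| < N)%N && (`|v.2| < N)%N.
Hypothesis GL : forall a b : nat, (0 < a)%N -> (0 < b)%N ->
  `|zsum2 (fun v => G (a%:Z * v.1, b%:Z * v.2)) - G (0, 0) - J / (a * b)%N%:R| <=
  sieve_cost B E1 J (gcdn a b)%:R.

(** The coefficients [o.1] add up to zero, so the values at the origin cancel; weighted by
    [1 / (a b)] they give the Euler product of the main term. The errors factor over the primes
    dividing [n], and the remaining ones sum to the logarithm. *)
Lemma sieve_estimate :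
  `|zsum2 (fun v => (cone_cond d (n %/ d) v)%:R * G v) -
    J * (div_dens * \prod_(p <- free_primes) (1 - p%:R^-1 ^+ 2))| <= div_weight * (7 * E1 * ln B).
Proof.
pose ps := primes n ++ free_primes.
have aps : all prime ps by rewrite all_cat primes_prime_all free_primes_prime.
have GNb : box_supp N G by move=> v /GN; rewrite !mem_zbox; lia.
have -> : zsum2 (fun v => (cone_cond d (n %/ d) v)%:R * G v) = zsum2 (fun v => (sieved Db Eb ps v)%:R * G v).
  apply: eq_fsbigr => v _; have [->|/GN /andP[v1 v2]] := eqVneq (G v) 0; first by rewrite !mulr0.
  by rewrite sieved_cond.
rewrite (sieve_sum Db Eb sieve_primes_uniq aps GNb).
have c0 : \sum_(o <- opts R Db Eb ps) o.1 = 0.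
  have p2 : 2%N \in ps by apply: mem_sieve_primes => //; rewrite N2.
  transitivity (\sum_(o <- opts R Db Eb ps) o.1 * 1); first by apply: eq_bigr => o _; rewrite mulr1.
  rewrite (opts_mult (R := R) Db Eb ps (g := fun _ _ => 1)) // => [|? ? ? ?]; last by rewrite mulr1.
  by rewrite (big_rem _ p2) /= -mulr_suml kind_sum0 !mul0r.
have cd : \sum_(o <- opts R Db Eb ps) o.1 * ((o.2.1 * o.2.2)%N%:R)^-1 =
    div_dens * \prod_(p <- free_primes) (1 - p%:R^-1 ^+ 2).
  rewrite (opts_mult (R := R) Db Eb ps (g := fun a b => ((a * b)%N%:R)^-1)); first last.
  - by rewrite mul1n invr1.
  - by move=> a b x y; rewrite mulnACA natrM invfM.
  rewrite big_cat; congr (_ * _); rewrite /= big_seq [RHS]big_seq; apply: eq_bigr => p.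
  rewrite mem_filter => /andP[/andP[pp pn] _]; rewrite kind_dens ?prime_gt0 //.
  have -> : Db p = false by apply: contraNF pn => h; exact: dvdn_trans dn.
  by have -> : Eb p = false by apply: contraNF pn => h; rewrite -(divnK dn) dvdn_mulr.
have -> : \sum_(o <- opts R Db Eb ps) o.1 * zsum2 (fun v => G (o.2.1%:Z * v.1, o.2.2%:Z * v.2)) -
    J * (div_dens * \prod_(p <- free_primes) (1 - p%:R^-1 ^+ 2)) =
  \sum_(o <- opts R Db Eb ps) o.1 * (zsum2 (fun v => G (o.2.1%:Z * v.1, o.2.2%:Z * v.2)) - G (0, 0) -
    J / (o.2.1 * o.2.2)%N%:R).
  have e0 : \sum_(o <- opts R Db Eb ps) o.1 * G (0, 0) = 0 by rewrite -mulr_suml c0 mul0r.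
  under [RHS]eq_bigr do rewrite !mulrBr.
  rewrite !sumrB e0 subr0 -cd mulr_sumr; congr (_ - _).
  by apply: eq_bigr => o _; rewrite mulrCA.
pose e (a b : nat) := sieve_cost B E1 J (gcdn a b)%:R.
apply: (le_trans (ler_norm_sum _ _ _)).
apply: (@le_trans _ _ (\sum_(o <- opts R Db Eb ps) `|o.1| * e o.2.1 o.2.2)).
  rewrite big_seq [leRHS]big_seq; apply: ler_sum => o /(opts_gt0 aps)[a0 b0].
  by rewrite normrM ler_wpM2l // GL.
have eM (p : nat) (i j : bool) (a b : nat) : prime p -> (0 < a)%N -> (0 < b)%N ->
    e (p ^ i * a)%N (p ^ j * b)%N <= (p ^ (i && j))%N%:R^-1 * e a b.
  by move=> pp a0 b0; apply: sieve_cost_prime.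
apply: (le_trans (opts_error Db Eb primes_prime_all free_primes_prime eM)).
apply: ler_wpM2l; first by apply: prodr_ge0 => p _; exact: kind_weight_ge0.
have uf : uniq free_primes by rewrite filter_uniq // iota_uniq.
have [|s [us s0 _ ->]] := @opts_coprime R Db Eb free_primes uf free_primes_prime.
  move=> p; rewrite mem_filter => /andP[/andP[pp pn] _]; split; apply: contraNF pn => h.
    exact: dvdn_trans dn.
  by rewrite -(divnK dn) dvdn_mulr.
pose M := (\max_(l <- s) l).+1.
have ee l : e l l = sieve_cost B E1 J l%:R by rewrite /e gcdnn.
under eq_bigr do rewrite ee.
apply: (le_trans (sum_uniq_le (M := M) us _ _)).
- by move=> l ls; rewrite s0 //= ltnS; apply: (leq_bigmax_seq _ ls).
- by move=> l; apply: sieve_cost_ge0.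
exact: sum_sieve_cost.
Qed.

End OneDivisor.

Lemma sum_div_dens : \sum_(d <- divisors n) div_dens d = \prod_(p <- primes n) local_dens R n p.
Proof.
rewrite /div_dens (sum_divisors_prod (fun p D E => \sum_(o <- kind R D E) o.1 * ((p ^ o.2.1 * p ^ o.2.2)%N%:R)^-1)) //.
rewrite big_seq [RHS]big_seq; apply: eq_bigr => p; rewrite mem_primes => /and3P[pp _ pn].
by rewrite !kind_dens ?prime_gt0 //= /local_dens pn; ring.
Qed.

Lemma sum_div_weight : \sum_(d <- divisors n) div_weight d =
  \prod_(p <- primes n) (4 + (logn p n).-1%:R * (3 + p%:R^-1)).
Proof.
rewrite /div_weight (sum_divisors_prod (fun p D E => kind_weight D E p)) //.
by apply: eq_bigr => p _; have [-> -> ->] := kind_weightE p; ring.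
Qed.

End SieveEstimate.

(** * Lattice sums on the cone of [q] *)

Section ConeSums.
Variable R : realType.
Local Notation MR := (measurableTypeR R).
Local Notation leb := (@lebesgue_measure R).

Lemma norm2Z (t : R) x : norm2 (t *: x) = `|t| * norm2 x.
Proof.
rewrite /norm2 /= !exprMn -!mulrDr sqrtrM ?sqr_ge0 // sqrtr_sqr.
by [].
Qed.

Lemma norm2_ge0 (x : R * R * R) : 0 <= norm2 x. Proof. exact: sqrtr_ge0. Qed.

Lemma norm2_int_ge1 (x : int * int * int) : x != 0 -> 1 <= norm2 (vec3R R x).
Proof.
case: x => -[x y] z x0.
suff h : 1 <= (x ^+ 2 + y ^+ 2 + z ^+ 2)%:~R :> R.
  rewrite /norm2 -sqrtr1; apply: ler_wsqrtr; apply: (le_trans h).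
  by rewrite le_eqVlt; apply/orP; left; apply/eqP; rewrite /vec3R /=; ring.
rewrite -[1]/(1%:~R) ler_int -gtz0_ge1.
have [h1 h2 h3] : [/\ 0 <= x ^+ 2, 0 <= y ^+ 2 & 0 <= z ^+ 2] by rewrite !sqr_ge0.
rewrite lt_neqAle !addr_ge0 // andbT eq_sym; apply: contra x0.
by rewrite !paddr_eq0 ?addr_ge0 // !sqrf_eq0 => /andP[/andP[/eqP -> /eqP ->] /eqP ->].
Qed.

Lemma mat3_appZ (M : mat3 R) (t : R) (x : R * R * R) : mat3_app M (t *: x) = t *: mat3_app M x.
Proof.
case: x => -[x y] z; rewrite /mat3_app /=.
by congr (_, _, _); rewrite /GRing.scale /=; ring.
Qed.

Lemma cone_ptZ (d e t u v : R) : cone_pt d e (t * u) (t * v) = (t ^+ 2) *: cone_pt d e u v.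
Proof. by congr (_, _, _); rewrite /GRing.scale /=; ring. Qed.

Variables (q : ternary_form) (n c : nat) (M : mat3 int) (z0 : int * int * int) (B : R).
Hypotheses (q0 : 0 < disc q) (n0 : (0 < n)%N).
Hypothesis H : zero_equiv R q (nf_form 1 0 0 (- n%:Z)) M c.
Hypothesis mz : minimal_zero R q z0.
Hypothesis B2 : 2 <= B.
Let MR3 := mat3_int R M.
Let z := norm2 (vec3R R z0).
Let B0 : 0 < B. Proof. exact: lt_le_trans B2. Qed.

Lemma minimal_norm_ge1 : 1 <= z.
Proof. by case: mz => z0n _ _; exact: norm2_int_ge1. Qed.

(** The image is [g^2] times a nonzero integral zero of [q], whose norm is at least that of [z0]. *)
Lemma cone_norm_ge (d g : nat) (i j : int) : (d %| n)%N -> (i, j) != 0 ->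
  g%:R ^+ 2 * z <= norm2 (mat3_app MR3 (cone_pt d%:R (n %/ d)%N%:R (g%:R * i%:~R) (g%:R * j%:~R))).
Proof.
move=> dn ij; rewrite cone_ptZ mat3_appZ norm2Z ger0_norm ?sqr_ge0 // ler_wpM2l ?sqr_ge0 //.
pose y : int * int * int := (d%:Z * i ^+ 2, (n %/ d)%N%:Z * j ^+ 2, i * j).
have yE : vec3R R y = cone_pt d%:R (n %/ d)%N%:R i%:~R j%:~R.
  by rewrite /vec3R /y /cone_pt /=; congr (_, _, _); rewrite intrM ?(rmorphXn (intr : int -> R)).
have d0 : (0 < d)%N by exact: dvdn_gt0 dn.
have nd0 : (0 < n %/ d)%N by rewrite divn_gt0 // dvdn_leq.
have y0 : y != 0.
  apply: contra ij => /eqP[/eqP + /eqP + _]; rewrite !mulf_eq0 !eqz_nat !eqn0Ngt d0 nd0 /= ?orbb ?sqrf_eq0.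
  by move=> /eqP -> /eqP ->.
rewrite -yE -vec3R_app; case: mz => _ _; apply; last first.
  have := congr1 (fun f => qeval f y : int) (ze_pull H); rewrite qeval_int_pull => ->.
  have nE : n%:Z = (n %/ d)%N%:Z * d%:Z by rewrite -PoszM divnK.
  suff yq : qeval (nf_form 1 0 0 (- n%:Z)) y = 0 :> int by rewrite qeval_scale yq mulr0.
  by rewrite /y qeval_nf nE; ring.
apply: contra y0 => /eqP My; case: (y) My => -[y1 y2] y3 My.
have := mat3_app_adj M y1 y2 y3; rewrite My.
have D0 : mat3_det M != 0 by have := ze_det_gt0 H; rewrite absz_gt0.
rewrite /mat3_app /= !mulr0 !addr0 => -[/esym/eqP + /esym/eqP + /esym/eqP].
by rewrite !mulf_eq0 !(negPf D0) /= => /eqP -> /eqP -> /eqP ->.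
Qed.

Variables (hA hB hC : R).
Hypotheses (hA0 : 0 < hA) (hD0 : 0 < 4 * n%:R * hA * hC - hB ^+ 2).
Let D := 4 * n%:R * hA * hC - hB ^+ 2.
Let K := Num.sqrt (1 + rho R q / 2).
Hypothesis K0 : 0 < K.
Hypothesis hE : forall d e u v : R, d * e = n%:R ->
  let x := mat3_app MR3 (cone_pt d e u v) in
  let h := d * hA * u ^+ 2 + hB * u * v + e * hC * v ^+ 2 in
  `|h| <= norm2 x /\ norm2 x <= K * `|h|.

Let nR0 : 0 < n%:R :> R. Proof. by rewrite ltr0n. Qed.

Lemma hC_gt0 : 0 < hC.
Proof.
have : 0 < 4 * n%:R * hA * hC by have := sqr_ge0 hB; move: hD0; lra.
by rewrite pmulr_rgt0 // !mulr_gt0.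
Qed.

Variables (w : R * R * R -> R) (A : R).
Hypotheses (A0 : 0 <= A) (Hw : lip_weight w A).

(** [k] and [l] are the indices of the sublattice in the sieve. *)
Definition cone_fun (d : nat) (k l x y : R) : R :=
  w (B^-1 *: mat3_app MR3 (cone_pt d%:R (n %/ d)%N%:R (k * x) (l * y))).

Section OneDivisor.
Variable d : nat.
Hypothesis dn : (d %| n)%N.
Let e := (n %/ d)%N.
Let d0 : 0 < d%:R :> R. Proof. by rewrite ltr0n (dvdn_gt0 n0). Qed.
Let e0 : 0 < e%:R :> R. Proof. by rewrite ltr0n divn_gt0 ?(dvdn_gt0 n0) // dvdn_leq. Qed.
Let de : d%:R * e%:R = n%:R :> R. Proof. by rewrite -natrM mulnC divnK. Qed.

Let c_gt0 : 0 < e%:R * hC. Proof. by rewrite mulr_gt0 // hC_gt0. Qed.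
Let DE : 4 * (d%:R * hA) * (e%:R * hC) - hB ^+ 2 = D.
Proof. by rewrite /D -de; ring. Qed.

Let h_ge0 u v : 0 <= d%:R * hA * u ^+ 2 + hB * u * v + e%:R * hC * v ^+ 2.
Proof.
have := qf_square (d%:R * hA) hB u v (lt0r_neq0 c_gt0); rewrite /qf => ->.
apply: addr_ge0; apply: mulr_ge0; rewrite ?sqr_ge0 ?(ltW c_gt0) //.
by apply: divr_ge0; [rewrite DE ltW|rewrite mulr_ge0 // ltW].
Qed.

Let hK u v : d%:R * hA * u ^+ 2 + hB * u * v + e%:R * hC * v ^+ 2 <=
    norm2 (mat3_app MR3 (cone_pt d%:R e%:R u v)) /\
  norm2 (mat3_app MR3 (cone_pt d%:R e%:R u v)) <=
    K * (d%:R * hA * u ^+ 2 + hB * u * v + e%:R * hC * v ^+ 2).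
Proof. by have := hE u v de => /=; rewrite (ger0_norm (h_ge0 u v)). Qed.

Let quad_bump_ab (a b : nat) :
  quad_bump (cone_fun d a%:R b%:R) (6 * A) (d%:R * hA * a%:R ^+ 2 / B) (hB * a%:R * b%:R / B)
    (e%:R * hC * b%:R ^+ 2 / B).
Proof.
apply: quad_bump_cone => // [|x y].
  exists (B^-1 * (m11 MR3 * d%:R * a%:R ^+ 2)), (B^-1 * (m13 MR3 * a%:R * b%:R)),
    (B^-1 * (m12 MR3 * e%:R * b%:R ^+ 2)),
    (B^-1 * (m21 MR3 * d%:R * a%:R ^+ 2)), (B^-1 * (m23 MR3 * a%:R * b%:R)),
    (B^-1 * (m22 MR3 * e%:R * b%:R ^+ 2)),
    (B^-1 * (m31 MR3 * d%:R * a%:R ^+ 2)), (B^-1 * (m33 MR3 * a%:R * b%:R)),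
    (B^-1 * (m32 MR3 * e%:R * b%:R ^+ 2)).
  apply/funext => x; apply/funext => y; rewrite /cone_pt /mat3_app /qf -/e.
  by congr (_, _, _); rewrite /GRing.scale /=; ring.
rewrite norm2Z ger0_norm ?invr_ge0 ?(ltW B0) //.
have [h _] := hK (a%:R * x) (b%:R * y).
rewrite (_ : qf _ _ _ x y = B^-1 * (d%:R * hA * (a%:R * x) ^+ 2 + hB * (a%:R * x) * (b%:R * y) +
  e%:R * hC * (b%:R * y) ^+ 2)); last by rewrite /qf; ring.
by rewrite ler_wpM2l // invr_ge0 ltW.
Qed.

(** On the sublattice with indices [a] and [b], the gcd factors out of both coordinates; so the
    minimum of the form grows with the square of the gcd. *)
Let mu_ab (a b : nat) (i j : int) : (0 < a)%N -> (0 < b)%N -> (i, j) != 0 ->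
  (gcdn a b)%:R ^+ 2 * (z / K) / B <=
    qf (d%:R * hA * a%:R ^+ 2 / B) (hB * a%:R * b%:R / B) (e%:R * hC * b%:R ^+ 2 / B) i%:~R j%:~R /\
  (gcdn a b)%:R ^+ 2 * z <= norm2 (mat3_app MR3 (cone_pt d%:R e%:R (a%:R * i%:~R) (b%:R * j%:~R))).
Proof.
move=> a0 b0 ij; set g := gcdn a b.
have g0 : (0 < g)%N by rewrite gcdn_gt0 a0.
have aE : a%:R = g%:R * (a %/ g)%N%:R :> R by rewrite -natrM mulnC divnK ?dvdn_gcdl.
have bE : b%:R = g%:R * (b %/ g)%N%:R :> R by rewrite -natrM mulnC divnK ?dvdn_gcdr.
have ij' : ((a %/ g)%N%:Z * i, (b %/ g)%N%:Z * j) != 0.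
  have ag : (a %/ g != 0)%N by rewrite -lt0n divn_gt0 // dvdn_leq ?dvdn_gcdl.
  have bg : (b %/ g != 0)%N by rewrite -lt0n divn_gt0 // dvdn_leq ?dvdn_gcdr.
  apply: contra ij => /eqP[/eqP + /eqP]; rewrite !mulf_eq0 !eqz_nat (negPf ag) (negPf bg) /=.
  by move=> /eqP -> /eqP ->.
have key := cone_norm_ge g dn ij'; rewrite !intrM !mulrA in key.
rewrite aE bE; split; last exact: key.
have [_ h] := hK (g%:R * (a %/ g)%N%:R * i%:~R) (g%:R * (b %/ g)%N%:R * j%:~R).
rewrite (_ : qf _ _ _ _ _ = (d%:R * hA * (g%:R * (a %/ g)%N%:R * i%:~R) ^+ 2 +
   hB * (g%:R * (a %/ g)%N%:R * i%:~R) * (g%:R * (b %/ g)%N%:R * j%:~R) +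
   e%:R * hC * (g%:R * (b %/ g)%N%:R * j%:~R) ^+ 2) / B); last by rewrite /qf; ring.
rewrite ler_wpM2r ?invr_ge0 ?(ltW B0) // mulrA ler_pdivrMr // mulrC [leRHS]mulrC.
by rewrite [z * _]mulrC; exact: le_trans key h.
Qed.

Variable J : R.
Hypothesis JE : plane_int (fun x y => w (mat3_app MR3 (cone_pt d%:R e%:R x y))) = J%:E.

Let mF1 : measurable_fun [set: MR * MR] (fun v : MR * MR => w (mat3_app MR3 (cone_pt d%:R e%:R v.1 v.2))).
Proof.
have cw : continuous (fun x => w (mat3_app MR3 x)).
  by move=> x; apply: continuous_comp; [exact: mat3_app_continuous|exact: (continuous_lip_weight A0 Hw)].
by have /measurable_EFinP := measurable_cone d%:R e%:R cw.
Qed.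

Let w_ge0 x : 0 <= w x. Proof. by case: Hw => /(_ x) /andP[]. Qed.

Lemma cone_int_J_ge0 : 0 <= J.
Proof. by rewrite -lee_fin -JE; apply: integral_ge0 => x _; apply: integral_ge0 => y _; rewrite lee_fin. Qed.

Lemma cone_int_J_le : J <= 48 * A / Num.sqrt D.
Proof.
have h : 0 < 4 * (d%:R * hA) * (e%:R * hC) - hB ^+ 2 by rewrite DE.
rewrite -lee_fin -JE; have := plane_int_le (F := fun x y => w (mat3_app MR3 (cone_pt d%:R e%:R x y))) (A := A) c_gt0 h mF1.
rewrite DE => h1; apply: (le_trans (h1 _ _)).
- by move=> x y; case: Hw => /(_ (mat3_app MR3 (cone_pt d%:R e%:R x y))).
- move=> x y wn; rewrite /qf; have [h2 _] := hK x y; apply: (le_trans h2); rewrite leNgt.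
  by apply/negP => /ltW h3; case: Hw wn => _ _ -> //; rewrite eqxx.
rewrite lee_fin -!mulrA; have : 0 <= A / Num.sqrt D by rewrite divr_ge0 ?sqrtr_ge0.
by move: (A / _) => t t0; lra.
Qed.

Let plane_ab (a b : nat) : (0 < a)%N -> (0 < b)%N ->
  plane_int (cone_fun d a%:R b%:R) = (B * J / (a * b)%N%:R)%:E.
Proof.
move=> a0 b0; have sB : 0 < Num.sqrt B by rewrite sqrtr_gt0.
have a1 : a%:R / Num.sqrt B != 0 by rewrite mulf_neq0 ?invr_eq0 ?gt_eqF // ltr0n.
have b1 : b%:R / Num.sqrt B != 0 by rewrite mulf_neq0 ?invr_eq0 ?gt_eqF // ltr0n.
pose F0 x y := w (mat3_app MR3 (cone_pt d%:R e%:R x y)).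
have -> : cone_fun d a%:R b%:R = (fun x y => F0
    (a%:R / Num.sqrt B * x) (b%:R / Num.sqrt B * y)).
  apply/funext => x; apply/funext => y; rewrite /cone_fun /F0 -mat3_appZ; congr (w (mat3_app _ _)).
  rewrite -[B in B^-1](@sqr_sqrtr _ B) ?(ltW B0) // -exprVn -cone_ptZ.
  by congr cone_pt; ring.
transitivity (`|a%:R / Num.sqrt B * (b%:R / Num.sqrt B)|^-1%:E * J%:E)%E.
  by rewrite -JE; exact: (plane_int_scale (F := F0) a1 b1 mF1 (fun x y => w_ge0 _)).
rewrite -EFinM; congr (_%:E).
have -> : a%:R / Num.sqrt B * (b%:R / Num.sqrt B) = (a * b)%N%:R / B.
  by rewrite natrM -[B in RHS](@sqr_sqrtr _ B) ?(ltW B0) //; field; rewrite gt_eqF.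
by rewrite ger0_norm ?divr_ge0 ?(ltW B0) // invfM invrK; ring.
Qed.

Let c_ab (a b : nat) : (0 < b)%N -> 0 < e%:R * hC * b%:R ^+ 2 / B.
Proof. by move=> b0; apply: divr_gt0 => //; apply: mulr_gt0 => //; rewrite exprn_gt0 // ltr0n. Qed.

Let DEab (a b : nat) : 4 * (d%:R * hA * a%:R ^+ 2 / B) * (e%:R * hC * b%:R ^+ 2 / B) -
  (hB * a%:R * b%:R / B) ^+ 2 = D * ((a * b)%N%:R / B) ^+ 2.
Proof. by rewrite -DE natrM; ring. Qed.

Let estimates (a b : nat) : (0 < a)%N -> (0 < b)%N ->
  lattice_estimates (cone_fun d a%:R b%:R) (6 * A) (D * ((a * b)%N%:R / B) ^+ 2)
    ((gcdn a b)%:R ^+ 2 * (z / K) / B).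
Proof.
move=> a0 b0; rewrite -DEab; apply: quad_bump_estimates.
- exact: c_ab.
- rewrite DEab; apply: mulr_gt0 => //; apply: exprn_gt0; apply: divr_gt0 => //.
  by rewrite ltr0n muln_gt0 a0.
- exact: quad_bump_ab.
- apply: divr_gt0 => //; apply: mulr_gt0; first by rewrite exprn_gt0 // ltr0n gcdn_gt0 a0.
  by apply: divr_gt0 => //; exact: lt_le_trans minimal_norm_ge1.
by move=> i j ij; have [] := mu_ab a0 b0 ij.
Qed.

(** The constant is 30 from the lattice estimate times the [6 A] of the weight. The second term
    secures [B J <= lattice_cost sqrt B], which the summation of sieve errors demands. *)
Definition lattice_cost : R := 180 * A * Num.sqrt (B * K / z) + J * Num.sqrt B.

Lemma cone_lattice_sum (a b : nat) : (0 < a)%N -> (0 < b)%N ->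
  `|lat_sum predT (cone_fun d a%:R b%:R) - cone_fun d a%:R b%:R 0 0 - B * J / (a * b)%N%:R| <=
  sieve_cost B lattice_cost (B * J) (gcdn a b)%:R.
Proof.
move=> a0 b0; have z1 := minimal_norm_ge1; have zp : 0 < z by exact: lt_le_trans z1.
set g := gcdn a b; have g0 : (0 < g)%N by rewrite gcdn_gt0 a0.
have gR : 0 < g%:R :> R by rewrite ltr0n.
rewrite /sieve_cost; case: (leP (g%:R ^+ 2) B) => gB.
  have [_ /(_ _ (plane_ab a0 b0)) h _] := estimates a0 b0; apply: (le_trans h).
  rewrite (_ : (gcdn a b)%:R ^+ 2 * (z / K) / B = g%:R ^+ 2 * (B * K / z)^-1); last first.
    by rewrite -/g; field; rewrite !gt_eqF.
  rewrite sqrtrM ?sqr_ge0 // sqrtr_sqr ger0_norm // sqrtrV; last first.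
    by rewrite divr_ge0 ?mulr_ge0 ?ltW.
  have sp : 0 < Num.sqrt (B * K / z) by rewrite sqrtr_gt0 divr_gt0 // mulr_gt0.
  apply: (@le_trans _ _ (180 * A * Num.sqrt (B * K / z) / g%:R)).
    rewrite le_eqVlt; apply/orP; left; apply/eqP; field.
    by rewrite !gt_eqF.
  rewrite ler_pM2r ?invr_gt0 // /lattice_cost lerDl.
  by rewrite mulr_ge0 ?cone_int_J_ge0 ?sqrtr_ge0.
(* Here [g^2 > B] and [z >= 1], so the rescaled weight vanishes at every nonzero lattice point. *)
have -> : lat_sum predT (cone_fun d a%:R b%:R) = cone_fun d a%:R b%:R 0 0.
  transitivity (\sum_(v \in [set ((0, 0) : int * int)]) cone_fun d a%:R b%:R v.1%:~R v.2%:~R);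
    last by rewrite fsbig_set1.
  apply/esym/fsbig_widen => // -[i j] [_ /= ij].
  have ijn : (i, j) != 0 by apply/eqP => -[i0 j0]; apply: ij; rewrite i0 j0.
  have [_ h] := mu_ab a0 b0 ijn; rewrite /cone_fun; case: Hw => _ _; apply.
  rewrite norm2Z ger0_norm ?invr_ge0 ?(ltW B0) // ler_pdivlMl // mulr1.
  apply: le_trans h; rewrite -/g; apply: (le_trans (ltW gB)).
  by rewrite ler_peMr ?sqr_ge0.
rewrite subrr sub0r normrN ger0_norm; last by rewrite !mulr_ge0 ?invr_ge0 ?cone_int_J_ge0 // ltW.
apply: ler_wpM2l; first by rewrite mulr_ge0 ?cone_int_J_ge0 // ltW.
rewrite lef_pV2 ?posrE ?exprn_gt0 // ?ltr0n ?muln_gt0 ?a0 // -natrX ler_nat expnS expn1.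
by apply: leq_mul; rewrite dvdn_leq ?dvdn_gcdl ?dvdn_gcdr.
Qed.

Lemma cone_coprime_sum :
  lat_sum (fun v => coprimez v.1 v.2) (cone_fun d 1 1) <= 1200 * A * (1 + B / Num.sqrt D).
Proof.
have [_ _ h] := estimates (isT : (0 < 1)%N) (isT : (0 < 1)%N); apply: (le_trans h).
rewrite muln1 div1r sqrtrM ?(ltW hD0) // sqrtr_sqr ger0_norm ?invr_ge0 ?(ltW B0) //.
by rewrite invfM invrK [_ * B]mulrC (_ : 200 * (6 * A) = 1200 * A) //; ring.
Qed.

(** The case [a = b = 1]. It ties the least zero to the discriminant and later keeps the fourth-root
    factor from being too small. *)
Lemma cone_hermite : z / K <= Num.sqrt D.
Proof.
have [h _ _] := estimates (isT : (0 < 1)%N) (isT : (0 < 1)%N); move: h.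
rewrite muln1 div1r sqrtrM ?(ltW hD0) // sqrtr_sqr ger0_norm ?invr_ge0 ?(ltW B0) //.
by rewrite gcdn1 expr1n mul1r ler_pM2r ?invr_gt0.
Qed.

(** One box for all divisors, obtained by bounding [d] and [n / d] by [n]; a single sieving range
    then serves the whole sum. *)
Lemma cone_supp (k : nat) (x y : R) : 4 * n%:R * (hA + hC) * B / D < k%:R ^+ 2 ->
  cone_fun d 1 1 x y != 0 -> `|x| < k%:R /\ `|y| < k%:R.
Proof.
move=> kB wn; have [h _] := hK (1 * x) (1 * y); rewrite !mul1r in h.
have hB1 : d%:R * hA * x ^+ 2 + hB * x * y + e%:R * hC * y ^+ 2 <= B.
  apply: (le_trans h); rewrite leNgt; apply/negP => hb; move: wn; rewrite /cone_fun !mul1r.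
  case: Hw => _ _ ->; rewrite ?eqxx // norm2Z ger0_norm ?invr_ge0 ?(ltW B0) // ler_pdivlMl // mulr1.
  exact: ltW.
have a_gt0 : 0 < d%:R * hA by rewrite mulr_gt0.
have dN : d%:R <= n%:R :> R by rewrite ler_nat dvdn_leq.
have eN : e%:R <= n%:R :> R by rewrite ler_nat leq_div.
have hC0 := hC_gt0.
have fin (t s : R) : 0 < s -> s <= n%:R * (hA + hC) -> D / (4 * s) * t ^+ 2 <= B -> `|t| < k%:R.
  move=> s0 sn; rewrite mulrAC ler_pdivrMr ?mulr_gt0 // => ht.
  rewrite -(@ltr_pXn2r _ 2) ?nnegrE // real_normK ?num_real //; apply: le_lt_trans kB.
  rewrite ler_pdivlMr // mulrC; apply: (le_trans ht); rewrite mulrC ler_pM2r //.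
  by rewrite -[leRHS]mulrA ler_pM2l.
have s1 := qf_square (d%:R * hA) hB x y (lt0r_neq0 c_gt0).
have s2 := qf_square (e%:R * hC) hB y x (lt0r_neq0 a_gt0).
rewrite DE /qf in s1; rewrite (_ : 4 * (e%:R * hC) * (d%:R * hA) - hB ^+ 2 = D) /qf in s2; last by rewrite -DE; ring.
split; [apply: (fin x _ c_gt0)|apply: (fin y _ a_gt0)].
- by rewrite mulrDr; apply: ler_wpDl; [rewrite mulr_ge0 ?ltW|rewrite ler_pM2r].
- have t0 : 0 <= e%:R * hC * (y + hB / (2 * (e%:R * hC)) * x) ^+ 2 by apply: mulr_ge0; rewrite ?sqr_ge0 // ltW.
  by move: hB1; rewrite s1; lra.
- by rewrite mulrDr; apply: ler_wpDr; [rewrite mulr_ge0 ?ltW|rewrite ler_pM2r].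
have t0 : 0 <= d%:R * hA * (x + hB / (2 * (d%:R * hA)) * y) ^+ 2 by apply: mulr_ge0; rewrite ?sqr_ge0 // ltW.
by move: hB1 s2; lra.
Qed.

End OneDivisor.

End ConeSums.

(** * Zeros counted by lattice points *)

Section ZeroCount.
Variable R : realType.
Variables (q : ternary_form) (n c : nat) (M : mat3 int) (B : R) (w : R * R * R -> R) (N : nat).
Hypothesis n0 : (0 < n)%N.
Hypothesis H : zero_equiv R q (nf_form 1 0 0 (- n%:Z)) M c.

Let W (d : nat) (v : int * int) : R * R * R :=
  B^-1 *: mat3_app (mat3_int R M) (cone_pt d%:R (n %/ d)%N%:R v.1%:~R v.2%:~R).

Hypothesis WN : forall (d : nat) v, (d %| n)%N -> (w (W d v) != 0) || (w (- W d v) != 0) ->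
  (`|v.1| < N)%N && (`|v.2| < N)%N.

Let F (t : nat * bool * (int * int)) : R := w (B^-1 *: vec3R R (mat3_app M (cone_vec n t))).

Let FE d s v : F (d, s, v) = if s then w (- W d v) else w (W d v).
Proof.
rewrite /F vec3R_app /W.
have -> : vec3R R (cone_vec n (d, s, v)) = (-1) ^+ s *: cone_pt d%:R (n %/ d)%N%:R v.1%:~R v.2%:~R.
  rewrite /vec3R /cone_vec /cone_pt; congr (_, _, _); rewrite /GRing.scale /=;
    by case: s; rewrite ?expr1 ?expr0 ?mulN1r ?mul1r ?mulrNz ?intrM ?(rmorphXn (intr : int -> R)).
by rewrite mat3_appZ; case: s; rewrite ?expr1 ?expr0 ?scaleN1r ?scale1r ?scalerN.
Qed.

Let zero_count_index (b : bool) :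
  zero_count B w q = \sum_(t \in [set t | cone_index n t && (half_plane t.2 == b)]) F t.
Proof.
have D0 : mat3_det M != 0 by have := ze_det_gt0 H; rewrite absz_gt0.
rewrite /zero_count; apply: (etrans (@reindex_fsbig _ _ _ _ _ (fun x => mat3_app M x)
  [set x | primitive_vec x /\ qeval (nf_form 1 0 0 (- n%:Z)) x = 0] _ _ _)).
  split.
  - move=> x [px qx]; split; first exact: (ze_into H).
    by rewrite -qeval_int_pull (ze_pull H) qeval_scale qx mulr0.
  - move=> [[x y] z] [[x' y'] z'] _ _ E.
    have := mat3_app_adj M x y z; rewrite E mat3_app_adj => -[].
    by move=> /(mulfI D0) -> /(mulfI D0) -> /(mulfI D0) ->.
  by move=> v [pv qv]; have [u pu ->] := ze_onto H pv qv; exists u.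
exact: (@reindex_fsbig _ _ _ _ _ (cone_vec n) _ _ (fun y => w (B^-1 *: vec3R R (mat3_app M y))) (cone_vec_bij b n0)).
Qed.

(** Adding the bijections for the two half-planes removes the half-plane condition and counts every
    zero twice. *)
Lemma zero_count_cone : 2 * zero_count B w q =
  \sum_(d <- divisors n) zsum2 (fun v => (cone_cond d (n %/ d) v)%:R * (w (W d v) + w (- W d v))).
Proof.
pose ds := [seq (d, s) | d <- divisors n, s <- [:: false; true]].
pose vs := [seq (i, j) | i <- zbox N, j <- zbox N].
pose r := [seq (t, v) | t <- ds, v <- vs].
have uvs : uniq vs by apply: allpairs_uniq; rewrite ?zbox_uniq // => -[? ?] [? ?].
have ur : uniq r.
  apply: allpairs_uniq => //; last by move=> [? ?] [? ?].
  by apply: allpairs_uniq; rewrite ?divisors_uniq // => -[? ?] [? ?].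
have zb (x : int) : (`|x| < N)%N -> x \in zbox N by rewrite mem_zbox; lia.
have rP (P : pred (nat * bool * (int * int))) : (forall t, P t -> cone_index n t) ->
    \sum_(t <- r | P t) F t = \sum_(t \in [set t | P t]) F t.
  move=> PI; apply: bigfs => // -[[d s] v] /PI /andP[/= dn _]; apply: contraNeq => Fn.
  have /andP[v1 v2] : (`|v.1| < N)%N && (`|v.2| < N)%N.
    by apply: (WN dn); move: Fn; rewrite FE; case: s => ->; rewrite ?orbT.
  apply: allpairs_f; first by apply: allpairs_f; rewrite -?dvdn_divisors //; case: (s).
  by rewrite [v]surjective_pairing; apply: allpairs_f; exact: zb.
have -> : 2 * zero_count B w q = \sum_(t <- r | cone_index n t) F t.
  rewrite (bigID (fun t => half_plane t.2)) /= !rP; try by move=> t /andP[].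
  rewrite mulrDl mul1r {1}(zero_count_index true) (zero_count_index false); congr (_ + _);
    apply: eq_fsbigl; apply/seteqP; split=> t /=; by case: half_plane; rewrite ?andbT ?andbF.
rewrite big_mkcond big_allpairs_dep big_allpairs_dep /=.
rewrite big_seq [RHS]big_seq; apply: eq_bigr => d; rewrite -dvdn_divisors // => dn.
rewrite !big_cons big_nil addr0 -big_split /=.
pose G v := (cone_cond d (n %/ d) v)%:R * (w (W d v) + w (- W d v)).
transitivity (\sum_(v <- vs) G v).
  apply: eq_bigr => v _; rewrite /G /cone_index /= dn !FE.
  by case: cone_cond; rewrite ?mul1r ?mul0r ?addr0.
apply: (etrans (@bigfs _ _ _ _ _ predT G uvs _)) => // v _; apply: contraNeq => Gn.
have /andP[v1 v2] : (`|v.1| < N)%N && (`|v.2| < N)%N.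
  apply: (WN dn); apply: contraR Gn; rewrite negb_or !negbK => /andP[/eqP a /eqP b].
  by rewrite /G a b addr0 mulr0.
by rewrite [v]surjective_pairing; apply: allpairs_f; exact: zb.
Qed.

End ZeroCount.

(** * The error term *)

Section WeightBounds.
Variable R : realType.

(** Bounded below by the product over all integers from 2 on, which telescopes to
    [(k + 2) / (2 (k + 1))]. *)
Lemma prod_one_minus_sqr_ge (s : seq nat) : uniq s -> (forall p, p \in s -> (1 < p)%N) ->
  2^-1 <= \prod_(p <- s) (1 - p%:R^-1 ^+ 2) :> R.
Proof.
move=> us s1; pose M := (\max_(l <- s) l).+2.
have sM : forall p, p \in s -> (1 < p < M)%N.
  by move=> p ps; rewrite s1 //= ltnS leqW //; apply: (leq_bigmax_seq _ ps).
have tel k : \prod_(2 <= m < k.+2) (1 - m%:R^-1 ^+ 2) = k.+2%:R / (2 * k.+1%:R) :> R.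
  elim: k => [|k IH]; first by rewrite big_geq // mulr1 divff.
  rewrite big_nat_recr //= IH -(natr1 k.+2) -(natr1 k.+1).
  have k1 : k.+1%:R != 0 :> R by rewrite pnatr_eq0.
  have k2 : k.+1%:R + 1 != 0 :> R by rewrite natr1 pnatr_eq0.
  by move: k1 k2; move: (k.+1%:R) => a k1 k2; field; rewrite ?k1 ?k2.
have -> : \prod_(p <- s) (1 - p%:R^-1 ^+ 2) = \prod_(2 <= p < M | p \in s) (1 - p%:R^-1 ^+ 2) :> R.
  rewrite -[RHS]big_filter; apply: perm_big; apply: uniq_perm => //.
    by rewrite filter_uniq // iota_uniq.
  by move=> l; rewrite mem_filter mem_index_iota; case: (boolP (l \in s)) => // /sM ->.
apply: (@le_trans _ _ (\prod_(2 <= m < M) (1 - m%:R^-1 ^+ 2))).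
  by rewrite /M tel ler_pdivlMr ?mulr_gt0 ?ltr0n // mulrA mulVf // mul1r ler_nat.
rewrite big_mkcond [leRHS]big_mkcond big_seq [leRHS]big_seq; apply: ler_prod => m.
rewrite mem_index_iota => /andP[m2 _]; have m0 : 0 < m%:R :> R by rewrite ltr0n ltnW.
have h : 0 <= (1 - m%:R^-1 ^+ 2 : R) <= 1.
  by rewrite gerBl sqr_ge0 andbT subr_ge0 exprn_ile1 ?invr_ge0 ?(ltW m0) // invf_le1 // ler1n ltnW.
by case: ifP => _; case/andP: h => h1 h2; rewrite h1 ?h2 ?lexx.
Qed.

(* 11 is the first prime [p] with [3 + 1 / p <= 4 (1 - 1 / p) ^ 2]. *)
Lemma local_weight_le (n p : nat) : prime p -> (p %| n)%N ->
  4 + (logn p n).-1%:R * (3 + p%:R^-1) <=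
  (if (p < 11)%N then 4 else 1) * (4 * local_dens R n p).
Proof.
move=> pp pn; rewrite /local_dens pn; move: (logn p n).-1 => k.
have k0 : 0 <= k%:R :> R by [].
have p0 : 0 < p%:R :> R by rewrite ltr0n prime_gt0.
set x := p%:R^-1; have x0 : 0 < x by rewrite invr_gt0.
case: ltnP => p11.
  have x2 : x <= 2^-1 by rewrite lef_pV2 ?posrE // ler_nat prime_gt1.
  have : 3 + x <= 16 * (1 - x) ^+ 2 by nra.
  by move: (k%:R) k0 => t t0 h; have := ler_wpM2l t0 h; nra.
have x11 : x <= 11^-1 by rewrite lef_pV2 ?posrE // ler_nat.
have : 3 + x <= 4 * (1 - x) ^+ 2 by nra.
by move: (k%:R) k0 => t t0 h; have := ler_wpM2l t0 h; nra.
Qed.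

(** [4^11] bounds crudely the loss at the primes below 11, one factor 4 comes from the tail of the
    density product, and one is slack. The remaining 4 per prime is [4^omega]. *)
Lemma sum_div_weight_le (n N : nat) : (0 < n)%N -> (n < N)%N -> (1 < N)%N ->
  \sum_(d <- divisors n) div_weight R n d <= 4 ^+ 13 * 4 ^+ omega n * dens_series R n.
Proof.
move=> n0 nN N1; rewrite sum_div_weight //.
have h1 : \prod_(p <- primes n) (4 + (logn p n).-1%:R * (3 + p%:R^-1)) <=
    \prod_(p <- primes n) ((if (p < 11)%N then 4 else 1) * (4 * local_dens R n p)) :> R.
  rewrite big_seq [leRHS]big_seq; apply: ler_prod => p; rewrite mem_primes => /and3P[pp _ pn].
  by rewrite local_weight_le // andbT addr_ge0 // mulr_ge0 // addr_ge0 // invr_ge0.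
apply: (le_trans h1); rewrite !big_split /=.
have h2 : \prod_(p <- primes n) (if (p < 11)%N then 4 else 1) <= 4 ^+ 11 :> R.
  rewrite -big_mkcond /= big_const_seq iter_mulr_1 ler_eXn2l //; last by rewrite ltr1n.
  rewrite -size_filter (leq_trans (uniq_leq_size (s2 := iota 0 11) _ _)) ?size_iota //.
    by rewrite filter_uniq // primes_uniq.
  by move=> p; rewrite mem_filter mem_iota add0n => /andP[].
have h3 : \prod_(p <- primes n) (4 : R) = 4 ^+ omega n.
  by rewrite big_const_seq count_predT iter_mulr_1.
have h4 : 0 <= \prod_(p <- primes n) local_dens R n p.
  by rewrite big_seq prodr_ge0 // => p; rewrite mem_primes => /and3P[pp _ _]; rewrite ltW // local_dens_gt0.
have h5 : \prod_(p <- primes n) local_dens R n p <= 4 * dens_series R n.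
  have /andP[+ _] := dens_series_bounds R n0 nN N1; rewrite dens_prod_split //.
  have : 2^-1 <= \prod_(p <- free_primes n N) (1 - p%:R^-1 ^+ 2) :> R.
    apply: prod_one_minus_sqr_ge; first by rewrite filter_uniq // iota_uniq.
    by move=> p /(allP (free_primes_prime n N)) /prime_gt1.
  by move=> a b; have := ler_wpM2l h4 a; lra.
rewrite h3 (_ : 4 ^+ 13 * 4 ^+ omega n * dens_series R n = 4 ^+ 11 * (4 ^+ omega n * (4 * dens_series R n)) * 4); last by ring.
have h6 : 4 ^+ omega n * \prod_(p <- primes n) local_dens R n p <= 4 ^+ omega n * (4 * dens_series R n).
  by rewrite ler_wpM2l // exprn_ge0.
have h7 : 0 <= 4 ^+ omega n * \prod_(p <- primes n) local_dens R n p by rewrite mulr_ge0 // exprn_ge0.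
have h8 : 0 <= \prod_(p <- primes n) (if (p < 11)%N then 4 else 1) :> R.
  by apply: prodr_ge0 => p _; case: ifP.
apply: (le_trans (ler_pM h8 h7 h2 h6)); rewrite ler_peMr //; last by rewrite ler1n.
by rewrite mulr_ge0 ?exprn_ge0 // (le_trans h7).
Qed.

Lemma div_weight_ge1 (n d : nat) : 1 <= div_weight R n d.
Proof.
rewrite /div_weight -[leLHS](big1_eq (primes n) predT (idx := 1) (op := *%R)).
apply: ler_prod => p _; rewrite ler01 /= /kind_weight.
have nn (o : R * (bool * bool)) : 0 <= `|o.1| * (p ^ (o.2.1 && o.2.2))%N%:R^-1 by rewrite mulr_ge0 // invr_ge0.
by rewrite /kind; case: (p %| d)%N; case: (p %| n %/ d)%N; rewrite /= !big_cons big_nil /= ?normrN !normr1 ?expn0 ?expn1 ?invr1;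
  rewrite !mul1r lerDl ?addr_ge0 ?invr_ge0.
Qed.

Lemma tau_le_weight (n : nat) : (tau n)%:R <= \sum_(d <- divisors n) div_weight R n d.
Proof.
rewrite /tau -sum1_size natr_sum; apply: ler_sum => d _.
by rewrite div_weight_ge1.
Qed.

(** Both errors are multiples of [r B Y / (K sqrt D)]. For the first, [D <= F^2] reduces the claim
    to [K^3 Y^4 <= r^2 Y^2]. For the second, [z <= K F] gives the lower bound [Y^4 >= 1 / (K^2 B)],
    so that [B Y] outweighs [sqrt B]. The constant is [456 = 360 + 96]. *)
Lemma error_compare (A B z F r K D Y : R) : 0 <= A -> 2 <= B -> 1 <= z -> 2 <= r ->
  K ^+ 2 = 1 + r / 2 -> 0 < K -> 0 < D -> D <= F ^+ 2 -> 0 <= F -> z / K <= Num.sqrt D ->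
  0 < Y -> Y ^+ 4 = F ^+ 2 / (z * B) -> Y <= 1 ->
  180 * (2 * A) * Num.sqrt (B * K / z) + 96 * A / Num.sqrt D * Num.sqrt B <=
    456 * A * (r * B * Y / (K * Num.sqrt D)).
Proof.
move=> A0 B2 z1 r2 KE K0 D0 DF F0 zK Y0 YE Y1.
have B0 : 0 < B by lra.
have z0 : 0 < z by lra.
have K1 : 1 <= K by rewrite -(@ler_pXn2r _ 2) ?nnegrE ?(ltW K0) // expr1n KE; lra.
have K2r : K ^+ 2 <= r by rewrite KE; lra.
have sD : 0 < Num.sqrt D by rewrite sqrtr_gt0.
have sB : 0 < Num.sqrt B by rewrite sqrtr_gt0.
have sDF : Num.sqrt D <= F by rewrite -(ger0_norm F0) -sqrtr_sqr ler_wsqrtr.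
have F1 : 0 < F by apply: lt_le_trans sDF.
have h1 : Num.sqrt (B * K / z) <= r * B * Y / (K * Num.sqrt D).
  rewrite ler_pdivlMr ?mulr_gt0 //; apply: (@le_trans _ _ (Num.sqrt (B * K / z) * (K * F))).
    by rewrite ler_wpM2l ?sqrtr_ge0 // ler_wpM2l // ltW.
  have YY : Y ^+ 4 <= Y ^+ 2 by rewrite -[leRHS]mulr1 (exprD Y 2 2) ler_wpM2l ?sqr_ge0 // expr_le1 // ltW.
  rewrite -(@ler_pXn2r _ 2) ?nnegrE ?mulr_ge0 ?sqrtr_ge0 ?(ltW K0) ?(ltW Y0) ?(ltW B0) //; last by lra.
  rewrite exprMn sqr_sqrtr ?divr_ge0 ?mulr_ge0 ?(ltW K0) ?(ltW B0) ?(ltW z0) //.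
  rewrite (_ : B * K / z * (K * F) ^+ 2 = B ^+ 2 * (K ^+ 3 * Y ^+ 4)); last by rewrite YE; field; rewrite !gt_eqF.
  rewrite (_ : (r * B * Y) ^+ 2 = B ^+ 2 * (r ^+ 2 * Y ^+ 2)); last by ring.
  rewrite ler_wpM2l ?sqr_ge0 //; apply: ler_pM; rewrite ?exprn_ge0 ?(ltW K0) ?(ltW Y0) //.
  apply: (@le_trans _ _ ((K ^+ 2) ^+ 2)); first by rewrite -exprM ler_weXn2l.
  by rewrite ler_pXn2r ?nnegrE ?exprn_ge0 ?(ltW K0) //; lra.
have h2 : Num.sqrt B / Num.sqrt D <= r * B * Y / (K * Num.sqrt D).
  rewrite ler_pdivlMr ?mulr_gt0 // (_ : Num.sqrt B / Num.sqrt D * (K * Num.sqrt D) = Num.sqrt B * K); last first.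
    by field; rewrite gt_eqF.
  rewrite -[B in leRHS](@sqr_sqrtr _ B) ?(ltW B0) // (_ : r * _ * Y = Num.sqrt B * (r * Num.sqrt B * Y)); last by ring.
  rewrite ler_wpM2l ?sqrtr_ge0 //.
  rewrite -(@ler_pXn2r _ 4) ?nnegrE ?mulr_ge0 ?sqrtr_ge0 ?(ltW K0) ?(ltW Y0) //; last by lra.
  have zKF : z <= K * F by move: (le_trans zK sDF); rewrite ler_pdivrMr // mulrC.
  have y4 : (K ^+ 2 * B)^-1 <= Y ^+ 4.
    rewrite YE ler_pdivlMr ?mulr_gt0 //.
    rewrite (_ : (K ^+ 2 * B)^-1 * (z * B) = z / K ^+ 2); last by field; rewrite !gt_eqF.
    rewrite ler_pdivrMr ?exprn_gt0 //; apply: (@le_trans _ _ (z ^+ 2)); first by rewrite expr2 ler_peMr // ltW.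
    by rewrite -exprMn mulrC ler_pXn2r ?nnegrE ?mulr_ge0 ?(ltW z0) ?(ltW K0).
  have b4 : Num.sqrt B ^+ 4 = B ^+ 2 by rewrite (exprM _ 2 2) sqr_sqrtr // ltW.
  rewrite !exprMn b4; apply: (@le_trans _ _ (r ^+ 4 * B ^+ 2 * (K ^+ 2 * B)^-1)); last first.
    by apply: ler_wpM2l => //; rewrite mulr_ge0 ?exprn_ge0 ?sqr_ge0 //; lra.
  rewrite ler_pdivlMr ?mulr_gt0 ?exprn_gt0 // mulrA -exprD [B ^+ 2]expr2 mulrA ler_wpM2r ?(ltW B0) //.
  have r0 : 0 < r by lra.
  apply: (@le_trans _ _ (r ^+ 4 * 1)); last by rewrite ler_wpM2l ?exprn_ge0 ?(ltW r0) //; lra.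
  rewrite mulr1 (exprM K 2 3); apply: (@le_trans _ _ (r ^+ 3)).
    by rewrite ler_pXn2r ?nnegrE ?exprn_ge0 ?(ltW K0) ?(ltW r0).
  by rewrite ler_weXn2l //; lra.
rewrite (_ : 96 * A / Num.sqrt D * Num.sqrt B = 96 * (A * (Num.sqrt B / Num.sqrt D))); last by ring.
have := ler_wpM2l A0 h1; have := ler_wpM2l A0 h2.
by move: (Num.sqrt B / _) (Num.sqrt (B * K / z)) (r * B * Y / _) => x y t; lra.
Qed.

End WeightBounds.

(** * The mass of a weight on the cone of [q] *)

Section CountEstimate.
Variable R : realType.
Local Notation MR := (measurableTypeR R).
Local Notation leb := (@lebesgue_measure R).

(** The adjugate bounds the support of the composed weight; the added 1 makes the radius visibly
    positive. *)
Lemma bump_like_app (w : R * R * R -> R) (C r : R) (M : mat3 int) : mat3_det M != 0 ->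
  bump_like w C r -> exists r',
    bump_like (fun x => w (mat3_app (mat3_int R M) x)) C r' /\
    bump_like (fun x => w (mat3_app (mat3_int R M) (- x))) C r'.
Proof.
move=> D0 [cw w0 wC r0 ws]; set N := mat3_int R M.
have det0 : mat3_det N != 0 by rewrite mat3_int_det intr_eq0.
pose P := mat3_adj N.
pose S := `|m11 P| + `|m12 P| + `|m13 P| + `|m21 P| + `|m22 P| + `|m23 P| + `|m31 P| + `|m32 P| + `|m33 P|.
pose r' := S * r / `|mat3_det N| + 1.
have d0 : 0 < `|mat3_det N| by rewrite normr_gt0.
have S0 : 0 <= S by rewrite !addr_ge0.
have bnd x y z : w (mat3_app N (x, y, z)) != 0 -> [/\ `|x| <= r', `|y| <= r' & `|z| <= r'].
  have := mat3_app_adj N x y z; case: (mat3_app N (x, y, z)) => -[a b] c.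
  rewrite {1}/mat3_app -/P => -[e1 e2 e3] /ws[h1 h2 h3].
  have key (k l m t : R) : k * a + l * b + m * c = mat3_det N * t -> `|k| + `|l| + `|m| <= S -> `|t| <= r'.
    move=> e klm; apply: (@le_trans _ _ (S * r / `|mat3_det N|)); last by rewrite lerDl.
    rewrite ler_pdivlMr // mulrC -normrM -e.
    have t1 := ler_normD (k * a + l * b) (m * c); have t2 := ler_normD (k * a) (l * b).
    rewrite !normrM in t1 t2; apply: (le_trans t1); apply: (le_trans (lerD t2 (lexx _))).
    apply: (@le_trans _ _ (`|k| * r + `|l| * r + `|m| * r)); first by rewrite !lerD // ler_wpM2l.
    by rewrite -!mulrDl ler_wpM2r // ltW.
  have n0 (t : R) := normr_ge0 t.
  split; [apply: key e1 _|apply: key e2 _|apply: key e3 _]; rewrite /S;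
    have := n0 (m11 P); have := n0 (m12 P); have := n0 (m13 P); have := n0 (m21 P); have := n0 (m22 P);
    have := n0 (m23 P); have := n0 (m31 P); have := n0 (m32 P); have := n0 (m33 P); lra.
have r'0 : 0 < r' by rewrite ltr_wpDl // divr_ge0 ?mulr_ge0 // ltW.
exists r'; split; split=> //.
- by move=> x; apply: continuous_comp; [exact: mat3_app_continuous|exact: cw].
- move=> x; apply: (@continuous_comp _ _ _ (fun x : R * R * R => - x) (fun x => w (mat3_app N x))).
    exact: opp_continuous.
  by apply: continuous_comp; [exact: mat3_app_continuous|exact: cw].
by move=> x y z /bnd[]; rewrite !normrN.
Qed.

Variables (q : ternary_form) (n c : nat) (M : mat3 int).
Hypotheses (q0 : 0 < disc q) (n0 : (0 < n)%N).
Hypothesis H : zero_equiv R q (nf_form 1 0 0 (- n%:Z)) M c.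

(** The density at infinity of [q] freed from its factor [|det M| / c]. *)
Definition zero_mass (w : R * R * R -> R) : R :=
  fine (tot_int (fun x => w (mat3_app (mat3_int R M) x)) n%:R).

Let D0 : mat3_det M != 0. Proof. by have := ze_det_gt0 H; rewrite absz_gt0. Qed.

Lemma sigma_infty_zero_mass w C r : bump_like w C r ->
  (\int[@lebesgue3 R]_y (w y * kernelK T (qeval q y))) @[T --> +oo] -->
  `|mat3_det M|%N%:R / c%:R * zero_mass w.
Proof. by move=> Hw; have [r' [HW _]] := bump_like_app D0 Hw; exact: (sigma_infty_cvg n0 H Hw HW). Qed.

Lemma lip_weight_bump (w : R * R * R -> R) A : 0 <= A -> lip_weight w A -> bump_like w A 1.
Proof.
move=> A0 Hw; have [wA _ w1] := Hw; split=> //.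
- exact: continuous_lip_weight A0 Hw.
- by move=> x; case/andP: (wA x).
- by move=> x; case/andP: (wA x).
move=> x y z wn; have h : norm2 (x, y, z) <= 1.
  by rewrite leNgt; apply/negP => /ltW /w1 e; rewrite e eqxx in wn.
by have [h1 h2 h3] := abs_le_norm2 (x, y, z); split; apply: le_trans h.
Qed.

Lemma zero_mass_plane w C r d : bump_like w C r -> (d %| n)%N ->
  plane_int (fun x y => w (mat3_app (mat3_int R M) (cone_pt d%:R (n %/ d)%N%:R x y)) +
                        w (- mat3_app (mat3_int R M) (cone_pt d%:R (n %/ d)%N%:R x y))) =
  (zero_mass w)%:E.
Proof.
move=> Hw dn; have [r' [HW HWN]] := bump_like_app D0 Hw.
set W := (fun x => _) in HW; set WN := (fun x => _) in HWN.
have d0 : 0 < d%:R :> R by rewrite ltr0n (dvdn_gt0 n0).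
have [cW W0 WC r0 WS] := HW; have [cWN WN0 _ _ _] := HWN.
rewrite /zero_mass fineK; last by apply: (tot_int_fin cW W0 WC r0 WS); rewrite ler1n.
have nE : n%:R = d%:R * (n %/ d)%N%:R :> R by rewrite -natrM mulnC divnK.
rewrite [in RHS]nE (tot_int_cone _ HW HWN d0) /cone_int /plane_int -/W.
have m1 := measurable_cone d%:R (n %/ d)%N%:R cW; have m2 := measurable_cone d%:R (n %/ d)%N%:R cWN.
have s1 x := measurable_fun_pair2 (f := fun t : MR * MR => (W (cone_pt d%:R (n %/ d)%N%:R t.1 t.2))%:E) x m1.
have s2 x := measurable_fun_pair2 (f := fun t : MR * MR => (WN (cone_pt d%:R (n %/ d)%N%:R t.1 t.2))%:E) x m2.
have i1 := measurable_inner (F := fun x y => W (cone_pt d%:R (n %/ d)%N%:R x y)) (proj1 (measurable_EFinP _ _) m1) (fun x y => W0 _).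
have i2 := measurable_inner (F := fun x y => WN (cone_pt d%:R (n %/ d)%N%:R x y)) (proj1 (measurable_EFinP _ _) m2) (fun x y => WN0 _).
rewrite -ge0_integralD //; last 2 first.
- by move=> x _; apply: integral_ge0 => y _; rewrite lee_fin W0.
- by move=> x _; apply: integral_ge0 => y _; rewrite lee_fin WN0.
apply: eq_integral => x _; rewrite -ge0_integralD //; try by move=> y _; rewrite lee_fin ?W0 ?WN0.
have eN u : mat3_app (mat3_int R M) (- u) = - mat3_app (mat3_int R M) u.
  by rewrite -scaleN1r mat3_appZ scaleN1r.
- by apply: eq_integral => y _; rewrite -EFinD /W /WN eN.
- exact: (s1 x).
- exact: (s2 x).
Qed.

(** On the ellipse [h <= 1 / (2 K)] the zeros have norm at most 1/2, where the weight is at least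
    [k0]. Its area has order [1 / (K sqrt D)], the scale in which the error is measured. *)
Lemma zero_mass_ge w C r (hA hB hC K k0 : R) : 0 < hA -> 0 < 4 * n%:R * hA * hC - hB ^+ 2 -> 0 < K ->
  (forall d e u v : R, d * e = n%:R ->
    let x := mat3_app (mat3_int R M) (cone_pt d e u v) in
    let h := d * hA * u ^+ 2 + hB * u * v + e * hC * v ^+ 2 in
    `|h| <= norm2 x /\ norm2 x <= K * `|h|) ->
  bump_like w C r -> 0 <= k0 -> (forall x, norm2 x <= 2^-1 -> k0 <= w x) ->
  2 * k0 / (K * Num.sqrt (4 * n%:R * hA * hC - hB ^+ 2)) <= zero_mass w.
Proof.
move=> hA0 hD0 K0 hE Hw k00 wk; have [cw w0 _ _ _] := Hw.
have hC0 : 0 < n%:R * hC.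
  have : 0 < 4 * n%:R * hA * hC by have := sqr_ge0 hB; move: hD0; lra.
  by rewrite -!mulrA pmulr_rgt0 // mulrCA pmulr_rgt0.
have DE : 4 * hA * (n%:R * hC) - hB ^+ 2 = 4 * n%:R * hA * hC - hB ^+ 2 by ring.
have D1 : 0 < 4 * hA * (n%:R * hC) - hB ^+ 2 by rewrite DE.
rewrite -lee_fin -(zero_mass_plane Hw (dvd1n n)) divn1.
set F := fun x y : R => _.
have cW : continuous (fun x => w (mat3_app (mat3_int R M) x) + w (- mat3_app (mat3_int R M) x)).
  move=> x; apply: cvgD; first by apply: continuous_comp; [exact: mat3_app_continuous|exact: cw].
  apply: (@continuous_comp _ _ _ (mat3_app (mat3_int R M)) (fun y => w (- y))); first exact: mat3_app_continuous.
  by apply: (@continuous_comp _ _ _ (fun x : R * R * R => - x) w); [exact: opp_continuous|exact: cw].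
have mF : measurable_fun [set: MR * MR] (fun v : MR * MR => F v.1 v.2).
  by have /measurable_EFinP := measurable_cone 1%:R n%:R cW.
have F0 x y : 0 <= F x y by rewrite addr_ge0.
have s0 : 0 <= (2 * K)^-1 by rewrite invr_ge0 mulr_ge0 // ltW.
have := @plane_int_ge R hA hB (n%:R * hC) hC0 D1 F k0 (2 * K)^-1 mF F0 k00 s0.
rewrite DE (_ : 4 * k0 * _ / _ = 2 * k0 / (K * Num.sqrt (4 * n%:R * hA * hC - hB ^+ 2))); last first.
  by field; rewrite !gt_eqF ?sqrtr_gt0.
apply=> x y hq; apply: (@le_trans _ _ (w (mat3_app (mat3_int R M) (cone_pt 1%:R n%:R x y)))); last by rewrite lerDl.
apply: wk; have := hE 1 n%:R x y (mul1r _) => /= -[_ h]; apply: (le_trans h).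
rewrite ger0_norm.
  rewrite !mul1r; apply: (@le_trans _ _ (K * (2 * K)^-1)); first by rewrite ler_wpM2l // ltW.
  by rewrite invfM mulrCA divff ?gt_eqF // mulr1.
rewrite !mul1r; have := qf_square hA hB x y (lt0r_neq0 hC0); rewrite /qf => ->.
apply: addr_ge0; apply: mulr_ge0; rewrite ?sqr_ge0 ?(ltW hC0) //.
by apply: divr_ge0; [exact: ltW|rewrite mulr_ge0 // ltW].
Qed.

End CountEstimate.

(** * The estimate for nonnegative weights *)

Section MainEstimate.
Variable R : realType.

Lemma mem_zbox_absz (x : int) k : (`|x| < k)%N -> x \in zbox k.
Proof. by rewrite mem_zbox; lia. Qed.

Lemma lip_weight_sym (w : R * R * R -> R) (A : R) : lip_weight w A ->
  lip_weight (fun x => w x + w (- x)) (2 * A).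
Proof.
case=> wA wL w1; split.
- move=> x; have /andP[a b] := wA x; have /andP[a' b'] := wA (- x).
  by rewrite addr_ge0 //=; lra.
- move=> x y; have h1 := wL x y; have := wL (- x) (- y).
  rewrite [(- x).1.1]/= [(- x).1.2]/= [(- x).2]/= [(- y).1.1]/= [(- y).1.2]/= [(- y).2]/=.
  rewrite -!opprD !normrN => h2.
  have h3 := ler_normD (w x - w y) (w (- x) - w (- y)).
  rewrite (_ : w x + w (- x) - (w y + w (- y)) = w x - w y + (w (- x) - w (- y))); last by ring.
  by apply: (le_trans h3); rewrite -mulrA mulr_natl mulr2n lerD.
move=> x x1; rewrite !w1 ?addr0 //.
by rewrite /norm2 /= !sqrrN.
Qed.

Variables (q : ternary_form) (n c : nat) (M : mat3 int) (z0 : int * int * int) (B : R).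
Hypotheses (q0 : 0 < disc q) (n0 : (0 < n)%N).
Hypothesis H : zero_equiv R q (nf_form 1 0 0 (- n%:Z)) M c.
Hypothesis mz : minimal_zero R q z0.
Hypothesis B2 : 2 <= B.
Variables (hA hB hC : R).
Let z := norm2 (vec3R R z0).
Let D := 4 * n%:R * hA * hC - hB ^+ 2.
Let r := rho R q.
Let K := Num.sqrt (1 + r / 2).
Let F := form_norm R q.
Hypotheses (hA0 : 0 < hA) (hD0 : 0 < 4 * n%:R * hA * hC - hB ^+ 2) (DF : 4 * n%:R * hA * hC - hB ^+ 2 <= F ^+ 2).
Hypothesis hE : forall d e u v : R, d * e = n%:R ->
  let x := mat3_app (mat3_int R M) (cone_pt d e u v) in
  let h := d * hA * u ^+ 2 + hB * u * v + e * hC * v ^+ 2 in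
  `|h| <= norm2 x /\ norm2 x <= K * `|h|.
Hypothesis r2 : 2 <= r.
Variables (w : R * R * R -> R) (A : R).
Hypotheses (A0 : 0 <= A) (Hw : lip_weight w A).

Let ws x := w x + w (- x).
Let Hws : lip_weight ws (2 * A). Proof. exact: lip_weight_sym. Qed.
Let A20 : 0 <= 2 * A. Proof. by rewrite mulr_ge0. Qed.
Let B0 : 0 < B. Proof. exact: lt_le_trans B2. Qed.
Let K2E : K ^+ 2 = 1 + r / 2.
Proof. by rewrite sqr_sqrtr // addr_ge0 // divr_ge0 // (le_trans _ r2). Qed.
Let K0 : 0 < K. Proof. by rewrite sqrtr_gt0 ltr_wpDr // divr_ge0 // (le_trans _ r2). Qed.
Let J := zero_mass n M w.
Let S := dens_series R n.

Let JE d (dn : (d %| n)%N) :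
  plane_int (fun x y => ws (mat3_app (mat3_int R M) (cone_pt d%:R (n %/ d)%N%:R x y))) = J%:E.
Proof. exact: (zero_mass_plane n0 H (lip_weight_bump A0 Hw) dn). Qed.

Let J0 : 0 <= J. Proof. exact: (cone_int_J_ge0 Hws (JE (dvd1n n))). Qed.

Let JD : J <= 96 * A / Num.sqrt D.
Proof.
have := cone_int_J_le n0 hA0 hD0 hE A20 Hws (dvd1n n) (JE (dvd1n n)).
by rewrite (_ : 48 * (2 * A) = 96 * A) //; ring.
Qed.

Let G d (v : int * int) : R := ws (B^-1 *: mat3_app (mat3_int R M) (cone_pt d%:R (n %/ d)%N%:R v.1%:~R v.2%:~R)).

Let G_fun d v : G d v = cone_fun n M B ws d 1 1 v.1%:~R v.2%:~R.
Proof. by rewrite /cone_fun !mul1r. Qed.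

(** The support fits into one box whatever [d] is, and any larger box may be used, so the sieving
    range can tend to infinity. *)
Let bound : exists k0 : nat, forall k, (k0 <= k)%N -> [/\ (n < k)%N, (2 < k)%N &
  forall d v, (d %| n)%N -> G d v != 0 -> (`|v.1| < k)%N && (`|v.2| < k)%N].
Proof.
pose T := 4 * n%:R * (hA + hC) * B / D.
have T0 : 0 <= T.
  have hC0 := hC_gt0 n0 hA0 hD0.
  by rewrite divr_ge0 ?(ltW hD0) // !mulr_ge0 ?(ltW B0) // addr_ge0 // ltW.
exists (maxn (maxn n.+1 3) (Num.truncn T).+1) => k; rewrite !geq_max => /andP[/andP[kn k3] kT].
split=> // d v dn; rewrite G_fun => Gn.
have Tk : T < k%:R ^+ 2.
  apply: (@lt_le_trans _ _ k%:R); last by rewrite expr2 ler_peMr // ler1n (leq_trans _ k3).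
  by apply: (@lt_le_trans _ _ (Num.truncn T).+1%:R); rewrite ?ler_nat // truncnS_gt.
have [h1 h2] := cone_supp n0 B2 hA0 hD0 hE Hws dn Tk Gn.
by rewrite -!intr_norm -!natr_absz !ltr_nat in h1 h2; rewrite h1 h2.
Qed.

Let count_sum : 2 * zero_count B w q =
  \sum_(d <- divisors n) zsum2 (fun v => (cone_cond d (n %/ d) v)%:R * G d v).
Proof.
have [k /(_ k (leqnn k)) [_ _ kG]] := bound.
apply: (zero_count_cone (N := k) n0 H) => d v dn wn; apply: (kG d v dn).
have [wA _ _] := Hw; rewrite /G /ws; apply: contraL wn => /eqP e.
by move: e => /eqP; rewrite paddr_eq0; [|by case/andP: (wA (B^-1 *: mat3_app (mat3_int R M) (cone_pt d%:R (n %/ d)%N%:R v.1%:~R v.2%:~R)))|by case/andP: (wA (- (B^-1 *: mat3_app (mat3_int R M) (cone_pt d%:R (n %/ d)%N%:R v.1%:~R v.2%:~R))))];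
  move=> /andP[/eqP -> /eqP ->]; rewrite eqxx.
Qed.

Let E1 := 180 * (2 * A) * Num.sqrt (B * K / z) + J * Num.sqrt B.

Let E10 : 0 <= E1. Proof. by rewrite addr_ge0 ?mulr_ge0 ?sqrtr_ge0. Qed.

(** For each large sieving range the main term carries the finite product [dens_prod], with an error
    independent of the range; the limit gives the full series. *)
Let sum_estimate : `|2 * zero_count B w q - B * J * S| <=
  (\sum_(d <- divisors n) div_weight R n d) * (7 * E1 * ln B).
Proof.
have [k0 kH] := bound.
have BJE : B * J <= E1 * Num.sqrt B.
  rewrite /E1 mulrDl -(mulrA J) -expr2 sqr_sqrtr ?(ltW B0) // (mulrC J) lerDr.
  by rewrite !mulr_ge0 ?sqrtr_ge0.
have step k : (k0 <= k)%N -> `|2 * zero_count B w q - B * J * dens_prod R n k| <=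
    (\sum_(d <- divisors n) div_weight R n d) * (7 * E1 * ln B).
  move=> /kH[nk k2 kG]; have -> : dens_prod R n k = \sum_(d <- divisors n) div_dens R n d * \prod_(p <- free_primes n k) (1 - p%:R^-1 ^+ 2).
    by rewrite dens_prod_split // -mulr_suml sum_div_dens.
  rewrite count_sum mulr_sumr -sumrB.
  apply: (le_trans (ler_norm_sum _ _ _)); rewrite mulr_suml big_seq [leRHS]big_seq.
  apply: ler_sum => d; rewrite -dvdn_divisors // => dn.
  apply: (sieve_estimate n0 nk k2 dn B2 E10 (mulr_ge0 (ltW B0) J0) BJE) => [v|a b a0 b0]; first exact: kG.
  have := cone_lattice_sum n0 H mz B2 hA0 hD0 K0 hE A20 Hws dn (JE dn) a0 b0.
  rewrite /cone_fun !mulr0 /lat_sum /zsum2 /G /=.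
  rewrite (_ : \sum_(v \in [set v | true]) _ = \sum_(v \in [set v : int * int | true])
     ws (B^-1 *: mat3_app (mat3_int R M) (cone_pt d%:R (n %/ d)%N%:R (a%:Z * v.1)%:~R (b%:Z * v.2)%:~R))) //.
  by apply: eq_fsbigr => v _; rewrite !intrM.
have cv : (fun k => `|2 * zero_count B w q - B * J * dens_prod R n k|) @ \oo --> `|2 * zero_count B w q - B * J * S|.
  apply: cvg_norm; apply: cvgB; first exact: cvg_cst.
  by apply: cvgMl_tmp; exact: is_cvg_dens_prod.
rewrite -(cvg_lim (@Rhausdorff R) cv); apply: limr_le; first by apply/cvg_ex; eexists; exact: cv.
by exists k0 => // k /step.
Qed.

Let coprime_bound : 2 * zero_count B w q <= (tau n)%:R * (2400 * A * (1 + B / Num.sqrt D)).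
Proof.
rewrite count_sum /tau -sum1_size natr_sum mulr_suml big_seq [leRHS]big_seq.
apply: ler_sum => d; rewrite -dvdn_divisors // => dn; rewrite mul1r.
have := cone_coprime_sum n0 H mz B2 hA0 hD0 K0 hE A20 Hws dn.
rewrite (_ : 1200 * (2 * A) = 2400 * A); last by ring.
apply: le_trans; have [k /(_ k (leqnn k)) [_ _ kG]] := bound.
have zb (x : int) := @mem_zbox_absz x k.
rewrite (@lat_sum_box R k) => [|i j]; last first.
  by rewrite -(G_fun d (i, j)) => /(kG _ _ dn) /andP[/zb -> /zb ->].
rewrite (@zsum2_box R k) => [|v]; last first.
  by rewrite mulf_eq0 negb_or => /andP[_ /(kG _ _ dn) /andP[/zb -> /zb ->]].
apply: ler_sum => j _; apply: ler_sum => i _; rewrite -(G_fun d (i, j)).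
have G0 : 0 <= G d (i, j) by case: Hws => /(_ (B^-1 *: mat3_app (mat3_int R M) (cone_pt d%:R (n %/ d)%N%:R i%:~R j%:~R))) /andP[].
rewrite /cone_cond /=; case: (coprimez i j) => /=; last by rewrite mul0r.
by case: (_ && _); rewrite ?mul1r ?mul0r.
Qed.

(** For [Y <= 1] the sieve applies, and [error_compare] rewrites its error. For [Y > 1] one has
    [B / sqrt D <= t], so the coprime count and the main term are each within the claimed error; the
    number of divisors is bounded by the total sieve weight. *)
Lemma main_estimate (Y : R) : 0 < Y -> Y ^+ 4 = F ^+ 2 / (z * B) ->
  `|2 * zero_count B w q - B * J * S| <=
  6000 * 4 ^+ 13 * A * (4 ^+ omega n * S * ln B * (r * B * Y / (K * Num.sqrt D)) + (tau n)%:R).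
Proof.
move=> Y0 YE; have S0 : 0 < S by exact: dens_series_gt0.
have lB : 2^-1 <= ln B.
  have h : expR 2^-1 <= 2 :> R.
    have := expR_ge1Dx (- 2^-1 : R); rewrite expRN (_ : 1 + - 2^-1 = 2^-1); last by lra.
    by rewrite lef_pV2 ?posrE ?expR_gt0.
  by rewrite -(expRK 2^-1) ler_ln ?posrE ?expR_gt0 //; exact: le_trans h B2.
have z1 : 1 <= z := minimal_norm_ge1 mz.
have sD : 0 < Num.sqrt D by rewrite sqrtr_gt0.
have r0 : 0 < r by move: r2; lra.
set t := r * B * Y / _; have t0 : 0 < t.
  apply: divr_gt0; last by apply: mulr_gt0 => //; exact: K0.
  by apply: mulr_gt0 => //; apply: mulr_gt0 => //; exact: B0.
have o0 : 1 <= 4 ^+ omega n :> R by rewrite exprn_ege1 // ler1n.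
have Wt := @sum_div_weight_le R n n.+2 n0 (leqnSn _) isT; rewrite -/S in Wt.
set P := 4 ^+ 13 : R in Wt *; have P1 : 1 <= P by rewrite exprn_ege1 // ler1n.
set o := 4 ^+ omega n in Wt o0 *.
have oS : 0 < o * S by rewrite mulr_gt0 //; apply: lt_le_trans o0.
have tau0 : 0 <= (tau n)%:R :> R by [].
have AT : 0 <= A * (tau n)%:R by rewrite mulr_ge0.
have F0 : 0 <= F := sqrtr_ge0 _.
set l := ln B in lB *.
have l0 : 0 <= l by lra.
have oSlt : 0 <= A * (o * S * l * t).
  by apply: mulr_ge0 => //; apply: mulr_ge0; [apply: mulr_ge0 => //; exact: ltW|exact: ltW].
have PAT := mulr_ge0 (le_trans ler01 P1) AT.
have PX := mulr_ge0 (le_trans ler01 P1) oSlt.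
have [Y1|Y1] := leP Y 1.
  (* The constant [3192 = 7 * 456] stays below 6000. *)
  apply: (le_trans sum_estimate); apply: (@le_trans _ _ (P * o * S * (7 * (456 * A * t) * l))); last first.
    rewrite (_ : P * o * S * (7 * (456 * A * t) * l) = 3192 * (P * (A * (o * S * l * t)))); last by ring.
    rewrite (_ : 6000 * P * A * _ = 6000 * (P * (A * (o * S * l * t))) + 6000 * (P * (A * (tau n)%:R))); last by ring.
    by move: (P * (A * (o * S * l * t))) (P * (A * (tau n)%:R)) PX PAT => x y x0 y0; lra.
  apply: ler_pM => //; first by apply: sumr_ge0 => d _; exact: le_trans (div_weight_ge1 R n d).
    by rewrite !mulr_ge0.
  rewrite ler_wpM2r // ler_wpM2l //.
  apply: le_trans (error_compare A0 B2 z1 r2 K2E K0 hD0 DF F0 (cone_hermite n0 H mz B2 hA0 hD0 K0 hE A20 Hws (dvd1n n)) Y0 YE Y1).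
  by rewrite lerD2l ler_wpM2r ?sqrtr_ge0.
have Kr : K <= r.
  by rewrite -(@ler_pXn2r _ 2) ?nnegrE ?(ltW K0) ?(le_trans _ r2) // K2E; move: r2; nra.
have Bt : B / Num.sqrt D <= t.
  rewrite /t ler_pdivrMr // (_ : r * B * Y / (K * Num.sqrt D) * Num.sqrt D = B * (r * Y / K)); last first.
    by field; rewrite !gt_eqF.
  rewrite ler_peMr ?(ltW B0) // ler_pdivlMr // mul1r; apply: (le_trans Kr).
  by rewrite ler_peMr ?(ltW Y1) // ltW.
apply: (le_trans (ler_normB _ _)).
rewrite (ger0_norm (_ : 0 <= 2 * zero_count B w q)); last first.
  rewrite count_sum sumr_ge0 // => d _; rewrite /zsum2 big_seq.
  apply: sumr_ge0 => v _; rewrite mulr_ge0 //.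
  by case: Hws => /(_ (B^-1 *: mat3_app (mat3_int R M) (cone_pt d%:R (n %/ d)%N%:R v.1%:~R v.2%:~R))) /andP[].
rewrite ger0_norm; last by rewrite !mulr_ge0 ?(ltW B0) ?(ltW S0).
have tW := le_trans (tau_le_weight R n) Wt.
have b1 : (tau n)%:R * (B / Num.sqrt D) <= P * o * S * t.
  by apply: ler_pM => //; rewrite divr_ge0 ?(ltW B0) ?sqrtr_ge0.
have b2 : B * J * S <= 96 * A * t * S.
  rewrite ler_pM2r //; apply: (@le_trans _ _ (B * (96 * A / Num.sqrt D))); first by rewrite ler_pM2l.
  rewrite (_ : B * (96 * A / Num.sqrt D) = 96 * A * (B / Num.sqrt D)); last by ring.
  by rewrite ler_wpM2l // mulr_ge0.
apply: (le_trans (lerD coprime_bound b2)).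
have b3 := ler_wpM2l A0 b1.
have b4 : A * (o * S * t) <= 2 * (A * (o * S * l * t)).
  have x0 : 0 <= A * (o * S * t) by apply: mulr_ge0 => //; apply: mulr_ge0; exact: ltW.
  rewrite (_ : 2 * _ = (2 * l) * (A * (o * S * t))); last by ring.
  by rewrite ler_peMl //; lra.
have b5 : A * t * S <= A * (o * S * t).
  rewrite (_ : A * (o * S * t) = o * (A * t * S)); last by ring.
  by rewrite ler_peMl //; apply: mulr_ge0; [apply: mulr_ge0 => //; exact: ltW|exact: ltW].
have b6 : P * (A * (o * S * t)) <= P * (2 * (A * (o * S * l * t))) by rewrite ler_wpM2l // (le_trans _ P1).
have b7 : A * (tau n)%:R <= P * (A * (tau n)%:R) by rewrite ler_peMl.
have b8 : A * (o * S * l * t) <= P * (A * (o * S * l * t)) by rewrite ler_peMl.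
rewrite (_ : (tau n)%:R * (2400 * A * (1 + B / Num.sqrt D)) =
  2400 * (A * (tau n)%:R) + 2400 * (A * ((tau n)%:R * (B / Num.sqrt D)))); last by ring.
rewrite (_ : 96 * A * t * S = 96 * (A * t * S)); last by ring.
rewrite (_ : 6000 * P * A * _ = 6000 * (P * (A * (o * S * l * t))) + 6000 * (P * (A * (tau n)%:R))); last by ring.
have b3' : A * ((tau n)%:R * (B / Num.sqrt D)) <= P * (A * (o * S * t)).
  by apply: (le_trans b3); rewrite le_eqVlt; apply/orP; left; apply/eqP; ring.
move: b3' b4 b5 b6 b7 b8 PX PAT AT oSlt.
move: (A * ((tau n)%:R * _)) (P * (A * (o * S * t))) (A * (o * S * t)) (A * t * S) (A * (tau n)%:R) (A * (o * S * l * t)).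
move=> x1 x2 x3 x4 x5 x6.
rewrite (_ : P * (2 * x6) = 2 * (P * x6)); last by ring.
by move: (P * x5) (P * x6) => x7 x8; lra.
Qed.

End MainEstimate.

(** * Smooth weights *)

Section SmoothWeights.
Variable R : realType.
Local Notation MR := (measurableTypeR R).
Local Notation leb := (@lebesgue_measure R).

Lemma continuous_supp_bounded (f : R * R * R -> R) : continuous f ->
  (forall x, 1 < norm2 x -> f x = 0) -> exists2 A, 0 <= A & forall x, `|f x| <= A.
Proof.
move=> cf f0; pose I : set R := `[(-1)%R, 1%R]%classic.
have cI : compact I by exact: segment_compact.
have cK : compact ((I `*` I) `*` I : set (R * R * R)) by apply: compact_setX => //; exact: compact_setX.
have := continuous_compact (continuous_subspaceT cf) cK => /compact_bounded [A [_ hA]].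
have A1 : A < `|A| + 1 by rewrite (le_lt_trans (ler_norm A)) // ltrDl.
exists (`|A| + 1); first by rewrite addr_ge0.
move=> x; have [x1|/f0 ->] := leP (norm2 x) 1; last by rewrite normr0 addr_ge0.
apply: (hA _ A1); exists x => //; have [h1 h2 h3] := abs_le_norm2 x.
have key (t : R) : `|t| <= norm2 x -> I t.
  by move=> h; rewrite /I /= in_itv /= -ler_norml (le_trans h).
by split; [split; exact: key|exact: key].
Qed.

(** The mean value theorem for [f] restricted to the line through [u] in direction [v]. *)
Lemma line_lipschitz (f : R * R * R -> R) (u v : R * R * R) (A a b : R) :
  (forall x, derivable f x v) -> (forall x, `|'D_v f x| <= A) ->
  `|f (a *: v + u) - f (b *: v + u)| <= A * `|a - b|.
Proof.
move=> df Df; pose g (t : R) := f (t *: v + u).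
have gE (t : R) : (fun h : R => h^-1 *: ((g \o shift t) (h *: 1) - g t)) =
    (fun h : R => h^-1 *: ((f \o shift (t *: v + u)) (h *: v) - f (t *: v + u))).
  apply/funext => h /=; congr (_ *: (f _ - _)).
  by rewrite /shift /= [h *: 1]mulr1 scalerDl addrA.
have dg (t : R) : is_derive t 1 g ('D_v f (t *: v + u)).
  apply: DeriveDef; first by rewrite /derivable gE; exact: df.
  by rewrite /derive gE.
have main (x y : R) : x <= y -> `|g y - g x| <= A * `|y - x|.
  move=> xy; have [|z _ ->] := @MVT_segment R g (fun t => 'D_v f (t *: v + u)) x y xy (fun t _ => dg t).
    apply: derivable_within_continuous => t _; exact: ex_derive.
  by rewrite normrM ler_wpM2r.
have [ba|/ltW ab] := leP b a; first exact: main.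
by rewrite distrC (distrC a); exact: main.
Qed.

(** Two derivatives make the directional derivatives continuous; they are compactly supported, hence
    bounded, and the increment is taken along the three axes in turn. *)
Lemma smooth_lipschitz (w : R * R * R -> R) : smooth w -> (forall x, 1 < norm2 x -> w x = 0) ->
  exists A, [/\ 0 <= A, continuous w, forall x, `|w x| <= A,
    forall x y, `|w x - w y| <= A * (`|x.1.1 - y.1.1| + `|x.1.2 - y.1.2| + `|x.2 - y.2|) &
    forall x, 1 <= norm2 x -> w x = 0].
Proof.
move=> sw w0; have [dw dw2] := sw 2%N.
have cw : continuous w by move=> x; exact: differentiable_continuous.
have nc : continuous (@norm2 R).
  move=> x; apply: (@continuous_comp _ _ _ (fun x : R * R * R => x.1.1 ^+ 2 + x.1.2 ^+ 2 + x.2 ^+ 2) Num.sqrt); last exact: sqrt_continuous.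
  have c1 : {for x, continuous (fun x : R * R * R => x.1.1)} by apply: continuous_comp; exact: cvg_fst.
  have c2 : {for x, continuous (fun x : R * R * R => x.1.2)} by apply: continuous_comp; [exact: cvg_fst|exact: cvg_snd].
  have c3 : {for x, continuous (fun x : R * R * R => x.2)} by exact: cvg_snd.
  by apply: cvgD; [apply: cvgD|]; rewrite ?expr2; apply: cvgM.
have Dsupp (v x : R * R * R) : 1 < norm2 x -> 'D_v w x = 0.
  move=> x1; have nx : \forall y \near x, w y = cst 0 y.
    near=> y; rewrite w0 //; near: y; exact: (@cvgr_gt _ _ _ _ (@norm2 R) (norm2 x) (nc x)).
  by rewrite (near_eq_derive v nx) derive_cst.
have Dbound (v : R * R * R) : exists2 A, 0 <= A & forall x, `|'D_v w x| <= A.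
  apply: continuous_supp_bounded => [x|x]; last exact: Dsupp.
  by have [h _] := dw2 v; exact: differentiable_continuous.
have [A0 A00 hA0] := continuous_supp_bounded cw w0.
have [A1 A10 hA1] := Dbound (1, 0, 0); have [A2 A20 hA2] := Dbound (0, 1, 0).
have [A3 A30 hA3] := Dbound (0, 0, 1).
have dv v x : derivable w x v by apply: diff_derivable.
exists (A0 + A1 + A2 + A3); split=> //; first by rewrite !addr_ge0.
- by move=> x; apply: (le_trans (hA0 x)); lra.
- move=> [[x1 x2] x3] [[y1 y2] y3] /=.
  have h1 := @line_lipschitz w (0, x2, x3) (1, 0, 0) A1 x1 y1 (dv _) hA1.
  have h2 := @line_lipschitz w (y1, 0, x3) (0, 1, 0) A2 x2 y2 (dv _) hA2.
  have h3 := @line_lipschitz w (y1, y2, 0) (0, 0, 1) A3 x3 y3 (dv _) hA3.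
  have e1 (t : R) : t *: ((1, 0, 0) : R * R * R) + (0, x2, x3) = (t, x2, x3).
    by congr (_, _, _); rewrite /= /GRing.scale /= ?mulr1 ?mulr0 ?addr0 ?add0r.
  have e2 (t : R) : t *: ((0, 1, 0) : R * R * R) + (y1, 0, x3) = (y1, t, x3).
    by congr (_, _, _); rewrite /= /GRing.scale /= ?mulr1 ?mulr0 ?addr0 ?add0r.
  have e3 (t : R) : t *: ((0, 0, 1) : R * R * R) + (y1, y2, 0) = (y1, y2, t).
    by congr (_, _, _); rewrite /= /GRing.scale /= ?mulr1 ?mulr0 ?addr0 ?add0r.
  rewrite !e1 in h1; rewrite !e2 in h2; rewrite !e3 in h3.
  have t1 := ler_normD (w (x1, x2, x3) - w (y1, x2, x3)) (w (y1, x2, x3) - w (y1, y2, y3)).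
  have t2 := ler_normD (w (y1, x2, x3) - w (y1, y2, x3)) (w (y1, y2, x3) - w (y1, y2, y3)).
  rewrite addrA subrK in t1; rewrite addrA subrK in t2.
  have n1 := normr_ge0 (x1 - y1); have n2 := normr_ge0 (x2 - y2); have n3 := normr_ge0 (x3 - y3).
  have p1 : A1 * `|x1 - y1| <= (A0 + A1 + A2 + A3) * `|x1 - y1| by rewrite ler_wpM2r //; lra.
  have p2 : A2 * `|x2 - y2| <= (A0 + A1 + A2 + A3) * `|x2 - y2| by rewrite ler_wpM2r //; lra.
  have p3 : A3 * `|x3 - y3| <= (A0 + A1 + A2 + A3) * `|x3 - y3| by rewrite ler_wpM2r //; lra.
  by rewrite !mulrDr; lra.
(* On the unit sphere the value is the limit of [w ((1 + t) x)] as [t] decreases to 0, and these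
   values vanish. *)
move=> x; rewrite le_eqVlt => /orP[/eqP x1|/w0 //].
have L0 := hA1 0; apply/eqP; apply: contraT => wx.
have cx : (fun t : R => w ((1 + t) *: x)) @ 0^'+ --> w x.
  have -> : w x = w ((1 + 0) *: x) by rewrite addr0 scale1r.
  apply: cvg_at_right_filter; apply: continuous_comp; last exact: cw.
  by apply: cvgZr_tmp; apply: cvgD; [exact: cvg_cst|exact: cvg_id].
have c0 : (fun t : R => w ((1 + t) *: x)) @ 0^'+ --> (0 : R).
  apply: cvg_near_cst; near=> t; apply/w0.
  have t0 : 0 < t by near: t; exact: nbhs_right_gt.
  by rewrite norm2Z -x1 mulr1 gtr0_norm ?ltrDl // addr_gt0.
by rewrite (cvg_unique _ cx c0) ?eqxx in wx.
Unshelve. all: by end_near. Qed.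

Lemma w0_bump : bump_like (@w0 R) 1 1.
Proof.
pose E (s : R) := if 0 < s then expR (- s^-1) else 0.
have E1 s : 0 <= E s <= 1.
  rewrite /E; case: ltP => s0; rewrite ?lexx ?ler01 // expR_ge0 /= -expR0 ler_expR.
  by rewrite oppr_le0 invr_ge0 ltW.
(* This comparison with [|s|] gives continuity at 0, where the two branches meet. *)
have Es s : E s <= `|s|.
  rewrite /E; case: ltP => s0 //; rewrite gtr0_norm // expRN -[leRHS]invrK lef_pV2 ?posrE ?expR_gt0 ?invr_gt0 //.
  by apply: le_trans (expR_ge1Dx _); rewrite lerDr.
have cE : continuous E.
  move=> s; have [s0|s0|s0] := ltgtP s 0.
  - have h : {near nbhs s, (cst 0 : R -> R) =1 E}.
      near=> t; rewrite /E ifF //; apply/negbTE; rewrite -leNgt ltW //; near: t; exact: lt_nbhsl.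
    rewrite /continuous_at {2}/E ifF ?(ltNge, ltW s0) //.
    by apply: cvg_trans (near_eq_cvg h) _; exact: cvg_cst.
  - have h : {near nbhs s, (fun t => expR (- t^-1)) =1 E}.
      near=> t; rewrite /E ifT //; near: t; exact: lt_nbhsr.
    rewrite /continuous_at {2}/E ifT //.
    apply: cvg_trans (near_eq_cvg h) _; apply: (@continuous_comp _ _ _ (fun t : R => - t^-1) expR); last exact: continuous_expR.
    by apply: cvgN; apply: cvgV; [rewrite gt_eqF|exact: cvg_id].
  rewrite s0; apply/cvgrPdist_le => e e0.
  have h : \forall t \near (0 : R), `|t| <= e.
    by exists e => //= t /=; rewrite sub0r normrN => /ltW.
  rewrite /E ltxx -/(E _); near=> t.
  rewrite sub0r normrN ger0_norm; last by case/andP: (E1 t).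
  by apply: (le_trans (Es t)); near: t.
pose P (x : R * R * R) := 1 - (x.1.1 ^+ 2 + x.1.2 ^+ 2 + x.2 ^+ 2).
have PE x : P x = 1 - norm2 x ^+ 2 by rewrite /P /norm2 sqr_sqrtr // !addr_ge0 ?sqr_ge0.
have wE x : w0 x = E (P x).
  by rewrite /w0 /E PE subr_gt0 -{3}(expr1n R 2) ltr_pXn2r ?nnegrE ?norm2_ge0.
split=> //.
- have -> : @w0 R = E \o P by apply/funext => x; rewrite wE.
  move=> x; apply: continuous_comp; last exact: cE.
  have c1 : {for x, continuous (fun x : R * R * R => x.1.1)} by apply: continuous_comp; exact: cvg_fst.
  have c2 : {for x, continuous (fun x : R * R * R => x.1.2)} by apply: continuous_comp; [exact: cvg_fst|exact: cvg_snd].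
  have c3 : {for x, continuous (fun x : R * R * R => x.2)} by exact: cvg_snd.
  apply: cvgB; first exact: cvg_cst.
  by apply: cvgD; [apply: cvgD|]; rewrite ?expr2; apply: cvgM.
- by move=> x; rewrite wE; case/andP: (E1 (P x)).
- by move=> x; rewrite wE; case/andP: (E1 (P x)).
move=> x y z; rewrite /w0; case: ifP => [h _|_]; last by rewrite eqxx.
by have [h1 h2 h3] := abs_le_norm2 (x, y, z); split; apply: le_trans (ltW h).
Unshelve. all: by end_near. Qed.

(** For norm at most 1/2 the exponent is at least [- 4/3], rounded to -2. *)
Lemma w0_ge (x : R * R * R) : norm2 x <= 2^-1 -> expR (-2) <= w0 x.
Proof.
move=> h; have n0 := norm2_ge0 x; rewrite /w0 ifT; last by lra.
rewrite ler_expR lerN2; have : norm2 x ^+ 2 <= 4^-1.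
  rewrite (_ : 4^-1 = 2^-1 ^+ 2); last by field.
  by rewrite ler_pXn2r ?nnegrE.
by move=> h2; rewrite -[leRHS]invrK lef_pV2 ?posrE; lra.
Qed.

(** Finiteness at each [T] allows the integrals of the positive and negative parts to be
    subtracted. *)
Lemma bump_core_fin (q : ternary_form) (w : R * R * R -> R) C T : 0 < T -> bump_like w C 1 ->
  (\int[@lebesgue3 R]_y (w y * kernelK T (qeval q y))%:E)%E \is a fin_num.
Proof.
move=> T0 [cw w0 wC _ ws]; have C0 : 0 <= C by exact: le_trans (w0 0) (wC 0).
have k0 : 0 <= C * T by rewrite mulr_ge0 // ltW.
have core0 y : 0 <= w y * kernelK T (qeval q y) by rewrite mulr_ge0 ?kernelK_ge0.
have m11 : measurable_fun [set: MR * MR * MR] (fun v : MR * MR * MR => v.1.1) by apply: measurableT_comp.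
have m12 : measurable_fun [set: MR * MR * MR] (fun v : MR * MR * MR => v.1.2) by apply: measurableT_comp.
have m2 : measurable_fun [set: MR * MR * MR] (fun v : MR * MR * MR => v.2) by exact: measurable_snd.
pose g (v : MR * MR * MR) : \bar R := (C * T * box1 1 v.1.1 * box1 1 v.1.2 * box1 1 v.2)%:E.
have mg : measurable_fun [set: MR * MR * MR] g.
  apply/measurable_EFinP; apply: measurable_funM; last exact: (measurableT_comp (@measurable_box1 R 1) m2).
  apply: measurable_funM; last exact: (measurableT_comp (@measurable_box1 R 1) m12).
  by apply: measurable_funM => //; exact: (measurableT_comp (@measurable_box1 R 1) m11).
have g0 v : (0 <= g v)%E by rewrite lee_fin !mulr_ge0 ?box1_ge0 // ltW.
have gI : (\int[@lebesgue3 R]_v g v < +oo)%E.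
  rewrite (ge0_integral_lebesgue3 mg g0).
  have i3 x y : (\int[leb]_z g (x, y, z) = (C * T * box1 1 x * (2 * 1) * box1 1 y)%:E)%E.
    rewrite /g /= integral_box1 ?mulr_ge0 ?box1_ge0 ?(ltW T0) //.
    by congr (_%:E); ring.
  under eq_integral do under eq_integral do rewrite i3.
  have i2 x : (\int[leb]_y (C * T * box1 1 x * (2 * 1) * box1 1 y)%:E = (C * T * (2 * 1) * (2 * 1) * box1 1 x)%:E)%E.
    rewrite integral_box1 ?mulr_ge0 ?box1_ge0 ?(ltW T0) //.
    by congr (_%:E); ring.
  under eq_integral do rewrite i2.
  by rewrite integral_box1 ?ltry // !mulr_ge0 // ltW.
rewrite ge0_fin_numE; last by apply: integral_ge0 => y _; rewrite lee_fin.
apply: le_lt_trans gI; apply: ge0_le_integral => //.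
- by move=> y _; rewrite lee_fin.
- apply/measurable_EFinP; apply: measurable_funM; first exact: measurable_W.
  exact: measurable_kernelK_qeval.
move=> -[[x y] z] _; rewrite lee_fin /=.
have [->|/ws[h1 h2 h3]] := eqVneq (w (x, y, z)) 0; first by rewrite mul0r !mulr_ge0 ?box1_ge0 // ltW.
rewrite /box1 h1 h2 h3 !mulr1; apply: ler_pM => //; first exact: kernelK_ge0.
rewrite kernelK_tent // ler_piMr ?(ltW T0) //; apply: (le_trans (tent_le _)).
by rewrite /box1 lern1 leq_b1.
Qed.

Lemma sigma_infty_signed (q : ternary_form) (w w1 w2 : R * R * R -> R) (C l1 l2 : R) :
  (forall x, w1 x = Num.max (w x) 0) -> (forall x, w2 x = Num.max (- w x) 0) ->
  bump_like w1 C 1 -> bump_like w2 C 1 ->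
  (\int[@lebesgue3 R]_y (w1 y * kernelK T (qeval q y))) @[T --> +oo] --> l1 ->
  (\int[@lebesgue3 R]_y (w2 y * kernelK T (qeval q y))) @[T --> +oo] --> l2 ->
  sigma_infty q w = l1 - l2.
Proof.
move=> e1 e2 b1 b2 c1 c2; apply: cvg_lim => //.
apply: cvg_trans (cvgB c1 c2); apply: near_eq_cvg; near=> T.
have T0 : 0 < T by near: T; exact: nbhs_pinfty_gt.
have f1 := bump_core_fin q T0 b1; have f2 := bump_core_fin q T0 b2.
have K0 y : 0 <= kernelK T (qeval q y) by exact: kernelK_ge0.
suff E : \int[@lebesgue3 R]_y (w y * kernelK T (qeval q y)) =
    \int[@lebesgue3 R]_y (w1 y * kernelK T (qeval q y)) - \int[@lebesgue3 R]_y (w2 y * kernelK T (qeval q y)).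
  exact: esym E.
rewrite /Rintegral -fineB // [in LHS]integralE; congr (fine (_ - _)).
  apply: eq_integral => y _; rewrite funeposE -EFin_max e1; congr (_%:E).
  by rewrite maxr_pMl // mul0r.
apply: eq_integral => y _; rewrite funenegE -EFinN -EFin_max e2; congr (_%:E).
by rewrite maxr_pMl // mul0r mulNr.
Unshelve. all: by end_near. Qed.

End SmoothWeights.

(** * Assembly for signed weights *)

Section Reassembly.
Variable R : realType.

Lemma lip_weight_pos (w : R * R * R -> R) (A : R) : 0 <= A -> (forall x, `|w x| <= A) ->
  (forall x y : R * R * R, `|w x - w y| <= A * (`|x.1.1 - y.1.1| + `|x.1.2 - y.1.2| + `|x.2 - y.2|)) ->
  (forall x, 1 <= norm2 x -> w x = 0) -> lip_weight (fun x => Num.max (w x) 0) A.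
Proof.
move=> A0 wA wL w0; split.
- move=> x; rewrite le_max lexx orbT ge_max A0 andbT.
  by have := wA x; rewrite ler_norml => /andP[].
- move=> x y; apply: le_trans (wL x y).
  by case: (leP (w x) 0) => h1; case: (leP (w y) 0) => h2;
    rewrite ?subrr ?normr0 // ler_norml; have := ler_norm (w x - w y);
    have := ler_norm (w y - w x); rewrite (distrC (w y)) => *; apply/andP; split; lra.
by move=> x /w0 ->; rewrite maxxx.
Qed.

Lemma zero_countB (q : ternary_form) (B : R) (w w1 w2 : R * R * R -> R) : 0 < B ->
  (forall x, w x = w1 x - w2 x) -> (forall x, 1 <= norm2 x -> w1 x = 0) ->
  (forall x, 1 <= norm2 x -> w2 x = 0) ->
  zero_count B w q = zero_count B w1 q - zero_count B w2 q.
Proof.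
move=> B0 we h1 h2; pose P (x : int * int * int) := primitive_vec x && (qeval q x == 0).
pose N := (Num.truncn B).+1; have BN : B < N%:R by rewrite truncnS_gt.
pose r := [seq (u, k) | u <- [seq (i, j) | i <- zbox N, j <- zbox N], k <- zbox N].
have ur : uniq r.
  by apply: allpairs_uniq; rewrite ?zbox_uniq //; [apply: allpairs_uniq; rewrite ?zbox_uniq //|];
    move=> [? ?] [? ?].
have zE (f : R * R * R -> R) : (forall x, 1 <= norm2 x -> f x = 0) ->
    zero_count B f q = \sum_(x <- r | P x) f (B^-1 *: vec3R R x).
  move=> f0; rewrite (@bigfs _ _ _ _ r P (fun x => f (B^-1 *: vec3R R x)) ur).
    apply: eq_fsbigl; apply/seteqP; split=> x; first by move=> [px qx]; apply/andP; split=> //; apply/eqP.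
    by move=> /andP[px /eqP qx].
  move=> [[i j] k] _; apply: contraNeq => fx.
  have n1 : norm2 (vec3R R (i, j, k)) < B.
    rewrite ltNge; apply: contra fx => h; apply/eqP/f0.
    by rewrite norm2Z ger0_norm ?invr_ge0 ?(ltW B0) // ler_pdivlMl // mulr1.
  have [/= a1 a2 a3] := abs_le_norm2 (vec3R R (i, j, k)).
  have zb (t : int) : `|t%:~R| <= norm2 (vec3R R (i, j, k)) :> R -> t \in zbox N.
    by move=> h; apply: (@mem_zbox_real R); apply: (le_lt_trans h); exact: lt_trans BN.
  by apply: allpairs_f; [apply: allpairs_f|]; apply: zb.
have h0 x : 1 <= norm2 x -> w x = 0 by move=> hx; rewrite we h1 // h2 // subrr.
by rewrite !zE // -sumrB; apply: eq_bigr => x _; rewrite we.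
Qed.

(** When nonzero, the density of [w] cancels against the denominator in [psi], so the conventional
    value is the general one and no case distinction remains. *)
Lemma sigma_psiE (q : ternary_form) (w : R * R * R -> R) (B : R) :
  sigma_psi q w B = 4 ^+ omega `|disc q|%N * rho R q * sigma_infty q (@w0 R) * ln B.
Proof.
rewrite /sigma_psi /psi; case: eqP => // /eqP.
by move: (sigma_infty q w) (sigma_infty q _) (rho R q) (ln B) (4 ^+ _) => a b r l o a0; field.
Qed.

(** With [c = a m] and [m = |det M|], the relation [c^3 n = m^2 disc q] becomes [m a^3 n = disc q].
    It replaces [tau n] and [omega n] by the values at the discriminant. *)
Lemma zero_equiv_dvd_disc (q : ternary_form) (n c : nat) (M : mat3 int) : 0 < disc q ->
  zero_equiv R q (nf_form 1 0 0 (- n%:Z)) M c -> (n %| `|disc q|)%N.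
Proof.
move=> q0 H; have [a cE] : exists a, c = (a * `|mat3_det M|)%N by apply/dvdnP; exact: ze_det_dvd H.
have m0 := ze_det_gt0 H; set m := `|mat3_det M|%N in cE m0.
have := zero_equiv_disc_eq H; rewrite -/m.
have -> : (disc q)%:~R = `|disc q|%N%:R :> R by rewrite natr_absz ger0_norm // ltW.
move=> E; have {}E : (c ^ 3 * n = m ^ 2 * `|disc q|)%N.
  by apply/eqP; rewrite -(eqr_nat R) [(c ^ 3 * n)%:R]natrM [(m ^ 2 * _)%:R]natrM !natrX E.
apply/dvdnP; exists (m * a ^ 3)%N; apply/eqP.
have m20 : (0 < m ^ 2)%N by rewrite expn_gt0 m0.
by rewrite -(eqn_pmul2l m20) -E cE expnMn; apply/eqP; rewrite (expnS m 2); ring.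
Qed.

Lemma tau_dvd_le n m : (0 < m)%N -> (n %| m)%N -> (tau n <= tau m)%N.
Proof.
move=> m0 nm; apply: uniq_leq_size; first exact: divisors_uniq.
by move=> d; rewrite -!dvdn_divisors ?(dvdn_gt0 m0) // => h; exact: dvdn_trans nm.
Qed.

Lemma omega_dvd_le n m : (0 < m)%N -> (n %| m)%N -> (omega n <= omega m)%N.
Proof.
move=> m0 nm; apply: uniq_leq_size; first exact: primes_uniq.
move=> p; rewrite !mem_primes m0 => /and3P[-> _ pn]; exact: dvdn_trans nm.
Qed.

Lemma fourth_root (a : R) : 0 < a -> 0 < a `^ (4^-1) /\ (a `^ (4^-1)) ^+ 4 = a.
Proof.
move=> a0; split; first exact: powR_gt0.
by rewrite -powR_mulrn ?powR_ge0 // -powRrM mulVf // powRr1 // ltW.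
Qed.

(** A single relative error [E / T] is distributed to both terms, which remains possible when [a] is
    zero. *)
Lemma split_error (L k a b E : R) : 0 <= L -> 0 < k -> k <= 1 -> 0 <= a -> 0 < b ->
  `|E| <= L * (a / (2 * k) + b) ->
  exists t1 t2, [/\ `|t1| <= L / k, `|t2| <= L / k & E = 2^-1 * (t1 * a) + t2 * b].
Proof.
move=> L0 k0 k1 a0 b0 EL; set T := a / (2 * k) + b in EL.
have T0 : 0 < T by rewrite ltr_wpDl // divr_ge0 // mulr_ge0 // ltW.
have tL : `|E / T| <= L by rewrite normrM normfV (gtr0_norm T0) ler_pdivrMr.
exists (E / T / k), (E / T); split.
- by rewrite normrM normfV (gtr0_norm k0) ler_pM2r ?invr_gt0.
- by apply: (le_trans tL); rewrite ler_pdivlMr // ler_piMr.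
rewrite -[LHS](divfK (lt0r_neq0 T0)) {2}/T; field.
by rewrite !gt_eqF.
Qed.

End Reassembly.

Theorem theorem6 (R : realType) (w : R * R * R -> R)
    (w_smooth : smooth w)
    (w_supp : forall x : R * R * R, 1 < norm2 x -> w x = 0) :
  exists C : R,
  forall (q : ternary_form) (z0 : int * int * int) (B : R),
    primitive_form q -> isotropic q -> 0 < disc q ->
    minimal_zero R q z0 -> 2 <= B ->
    exists theta1 theta2 : R,
      [/\ `|theta1| <= C, `|theta2| <= C &
        zero_count B w q =
          2^-1 * (sigma_infty q w
                  + theta1 * sigma_psi q w B
                    * (form_norm R q ^+ 2 / (norm2 (vec3R R z0) * B)) `^ (4^-1))
               * singular_series R q * B
          + theta2 * (tau `|disc q|%N)%:R].
Proof.
have [A [A0 cw wA wL wz]] := smooth_lipschitz w_smooth w_supp.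
(* The cone estimates are for nonnegative weights; counts and densities are linear, and both parts
   keep the Lipschitz constant. *)
pose w1 x := Num.max (w x) 0; pose w2 x := Num.max (- w x) 0.
have l1 : lip_weight w1 A by exact: lip_weight_pos.
have l2 : lip_weight w2 A.
  apply: lip_weight_pos => //; first by move=> x; rewrite normrN.
    by move=> x y; rewrite -opprD normrN.
  by move=> x /wz ->; rewrite oppr0.
have wE x : w x = w1 x - w2 x.
  by rewrite /w1 /w2; case: (leP (w x) 0) => h; case: (leP (- w x) 0) => h'; lra.
pose k0 : R := expR (-2); have k0p : 0 < k0 by exact: expR_gt0.
have k01 : k0 <= 1 by rewrite /k0 -[leRHS]expR0 ler_expR; lra.
have [L [L0 LE]] : exists L : R, 0 <= L /\ L = 6000 * 4 ^+ 13 * A.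
  exists (6000 * 4 ^+ 13 * A); split; last exact: erefl.
  apply: mulr_ge0; last exact: A0.
  by apply: mulr_ge0; [exact: ler0n|apply: exprn_ge0; exact: ler0n].
(* Division by [k0] accounts for the lower bound of [w0] on the half ball. *)
exists (L / k0) => q z0 B pq iq D0 mz B2.
have B0 : 0 < B by exact: lt_le_trans B2.
have [n [M [c [n0 H]]]] := isotropic_reducible R pq iq D0.
have [hA [hB [hC [hA0 hD0 DF hE]]]] := cone_form D0 n0 H.
have r2 : 2 <= rho R q by have [s [l [l0 s1 sQ]]] := eigenvector_exists R D0; exact: rho_ge2 sQ.
have K0 : 0 < Num.sqrt (1 + rho R q / 2).
  by rewrite sqrtr_gt0 ltr_wpDr // divr_ge0 // (le_trans _ r2).
have z1 := minimal_norm_ge1 mz.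
have F0 : 0 < form_norm R q.
  by rewrite lt_neqAle sqrtr_ge0 andbT eq_sym; apply: contraTneq DF => ->; rewrite expr0n /= -ltNge.
have X0 : 0 < form_norm R q ^+ 2 / (norm2 (vec3R R z0) * B).
  by apply: divr_gt0; [exact: exprn_gt0|apply: mulr_gt0 => //; exact: lt_le_trans z1].
have [Y0 YE] := fourth_root X0; set Y := _ `^ _ in Y0 YE *.
have m1 := main_estimate n0 H mz B2 hA0 hD0 DF hE r2 A0 l1 Y0 YE; rewrite -LE in m1.
have m2 := main_estimate n0 H mz B2 hA0 hD0 DF hE r2 A0 l2 Y0 YE; rewrite -LE in m2.
have zm := zero_mass_ge n0 H hA0 hD0 K0 hE (@w0_bump R) (ltW k0p) (@w0_ge R).
have b1 := lip_weight_bump A0 l1; have b2 := lip_weight_bump A0 l2.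
have sw := sigma_infty_signed (fun x => erefl) (fun x => erefl) b1 b2
  (sigma_infty_zero_mass n0 H b1) (sigma_infty_zero_mass n0 H b2).
have s0 : sigma_infty q (@w0 R) = _ := cvg_lim (@Rhausdorff R) (sigma_infty_zero_mass n0 H (@w0_bump R)).
have sg := singular_series_zero_equiv n0 H.
have zc := zero_countB q B0 wE (let: And3 _ _ h := l1 in h) (let: And3 _ _ h := l2 in h).
have nD := zero_equiv_dvd_disc D0 H.
have aD : (0 < `|disc q|)%N by rewrite absz_gt0 gt_eqF.
have tD : (tau n)%:R <= (tau `|disc q|%N)%:R :> R by rewrite ler_nat tau_dvd_le.
have oD : 4 ^+ omega n <= 4 ^+ omega `|disc q|%N :> R.
  by rewrite ler_weXn2l ?ler1n // omega_dvd_le.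
have t1 : 0 < (tau `|disc q|%N)%:R :> R.
  by rewrite ltr0n /tau; case: (divisors _) (dvdn_divisors 1 aD) => //; rewrite dvd1n.
have c0 : 0 < c%:R :> R by rewrite ltr0n (ze_c_gt0 H).
have d0 : 0 < `|mat3_det M|%N%:R :> R by rewrite ltr0n (ze_det_gt0 H).
have S0 := dens_series_gt0 R n0.
have lB : 0 <= ln B by rewrite ln_ge0 // (le_trans _ B2) // ler1n.
set K := Num.sqrt (1 + _) in K0 m1 m2 zm; set sD := Num.sqrt (4 * n%:R * hA * hC - hB ^+ 2) in m1 m2 zm.
have sD0 : 0 < sD by rewrite sqrtr_gt0.
set S := dens_series R n in sg m1 m2 S0; set Z := zero_mass n M (@w0 R) in s0 zm.
set Z1 := zero_mass n M _ in sw m1; set Z2 := zero_mass n M _ in sw m2.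
set o := 4 ^+ omega n in oD m1 m2; set O := 4 ^+ omega `|disc q|%N in oD.
have O0 : 0 <= O by rewrite exprn_ge0.
(* Twice the first error term of the theorem, without its coefficient. *)
pose Q := sigma_psi q w B * Y * singular_series R q * B.
have QE : Q = O * (S * ln B * (rho R q * B * Y * Z)).
  rewrite /Q sigma_psiE s0 sg -/O; move: (lt0r_neq0 c0) (lt0r_neq0 d0).
  move: (c%:R) (`|mat3_det M|%N%:R) (rho R q) (ln B) (O) (S) (Z) (Y) => c' d' r' l' o' s' z' y' c'0 d'0.
  by field; rewrite c'0 d'0.
have rBY : 0 <= rho R q * B * Y.
  by apply: mulr_ge0; [apply: mulr_ge0; [exact: le_trans r2|exact: ltW]|exact: ltW].
have SL : 0 <= S * ln B by rewrite mulr_ge0 // ltW.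
have Z0 : 0 <= Z.
  apply: le_trans zm; apply: divr_ge0; first by rewrite mulr_ge0 // ltW.
  by rewrite mulr_ge0 // ltW.
have Q0 : 0 <= Q by rewrite QE mulr_ge0 // mulr_ge0 // mulr_ge0.
have o0 : 0 <= o by rewrite exprn_ge0.
(* The mass [Z] of [w0] is at least [2 k0 / (K sD)]; this converts the geometric error into the
   density of [w0]. *)
have key : o * S * ln B * (rho R q * B * Y / (K * sD)) <= Q / (2 * k0).
  rewrite ler_pdivlMr ?mulr_gt0 // QE.
  apply: (@le_trans _ _ (o * (S * ln B * (rho R q * B * Y * Z)))); last first.
    by rewrite ler_wpM2r // mulr_ge0 // mulr_ge0.
  have -> : o * S * ln B * (rho R q * B * Y / (K * sD)) * (2 * k0) =
      o * (S * ln B * (rho R q * B * Y * (2 * k0 / (K * sD)))).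
    by move: (rho R q) (ln B) (o) (S) (Y) ((K * sD)^-1) (k0) => r' l' o' s' y' d' k'; ring.
  by do 3 apply: ler_wpM2l => //.
pose E := zero_count B w q - 2^-1 * sigma_infty q w * singular_series R q * B.
have EL : `|E| <= L * (Q / (2 * k0) + (tau `|disc q|%N)%:R).
  have -> : E = 2^-1 * ((2 * zero_count B w1 q - B * Z1 * S) - (2 * zero_count B w2 q - B * Z2 * S)).
    rewrite /E zc sw sg; move: (lt0r_neq0 c0) (lt0r_neq0 d0).
    move: (c%:R) (`|mat3_det M|%N%:R) (S) (Z1) (Z2) (zero_count B w1 q) (zero_count B w2 q) => c' d' s' x1 x2 x3 x4 c'0 d'0.
    by field; rewrite c'0 d'0.
  rewrite normrM ger0_norm ?invr_ge0 //; have h := ler_normB (2 * zero_count B w1 q - B * Z1 * S) (2 * zero_count B w2 q - B * Z2 * S).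
  have hL : L * (o * S * ln B * (rho R q * B * Y / (K * sD)) + (tau n)%:R) <=
      L * (Q / (2 * k0) + (tau `|disc q|%N)%:R) by rewrite ler_wpM2l // lerD.
  move: m1 m2 hL h; move: (L * (o * _ * _ * _ + _)) (L * (Q / _ + _)) => x1 x2.
  move: (`|2 * zero_count B w1 q - B * Z1 * S|) (`|2 * zero_count B w2 q - B * Z2 * S|) (`|_ - _|) => x3 x4 x5.
  by lra.
have [th1 [th2 [h1 h2 h3]]] := split_error L0 k0p k01 Q0 t1 EL.
exists th1, th2; split=> //; rewrite -/Y.
have -> : zero_count B w q = E + 2^-1 * sigma_infty q w * singular_series R q * B by rewrite /E subrK.
rewrite h3 /Q; move: (sigma_psi q w B) (sigma_infty q w) (singular_series R q) (Y) (_%:R) => x1 x2 x3 x4 x5.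
by ring.
Qed.
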